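(* Let $U=(-\infty,-1)\cup(1,\infty)$ and let $H\in\mathcal R(U)$. Then $H\in\mathcal D$ if and only if $F(i;H)=i$.
   Context: $\mathbb C^{\pm}$ are the open upper and lower half planes, $\mathbb C_\infty$ is the Riemann sphere, $\overline{\mathbb C^+}=\mathbb C^+\cup\mathbb R\cup\{\infty\}\subseteq\mathbb C_\infty$. Canonical systems: $\mathcal C(\mathbb R)$ is the collection of canonical systems $Ju'(x)=-zH(x)u(x)$, $x\in\mathbb R$, $J=\begin{pmatrix}0&-1\\1&0\end{pmatrix}$, with $H(x)\in\mathbb R^{2\times2}$ locally integrable, $H(x)\ge0$ (symmetric), $\operatorname{tr}H(x)=1$; functions equal almost everywhere are identified. Other normalizations are allowed: a change of variable replaces $H$ by $\phi'(x)H(\phi(x))$, with $\phi$ an increasing bijection of $\mathbb R$, $\phi(0)=0$, $\phi,\phi^{-1}$ locally absolutely continuous. This does not change the $m$ functions, and differently normalized coefficient functions with the same $m$ functions are viewed as the same element of $\mathcal C(\mathbb R)$. For $z\in\mathbb C^+$ let $f_+$ ($f_-$) be the, up to a constant factor unique, nontrivial solution with $\int_0^\infty f_+^*Hf_+<\infty$ ($\int_{-\infty}^0 f_-^*Hf_-<\infty$). The $m$ functions are $m_\pm(z)=\pm f_\pm(0,z)$, where a vector $(f_1,f_2)^t\ne0$ is identified with $f_1/f_2\in\mathbb C_\infty$; they are holomorphic maps $\mathbb C^+\to\overline{\mathbb C^+}$. $H$ is reflectionless on a Borel set $A\subseteq\mathbb R$ if $m_+(t)=-\overline{m_-(t)}$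 for Lebesgue almost every $t\in A$, where $m_\pm(t)=\lim_{y\to0+}m_\pm(t+iy)$. $\mathcal R(A)=\{H\in\mathcal C(\mathbb R): H\text{ is reflectionless on }A\}$. $F$ function: for $H\in\mathcal R(U)$, the function $M(z)=m_+(z)$ ($z\in\mathbb C^+$), $M(z)=-\overline{m_-(\overline z)}$ ($z\in\mathbb C^-$) has a holomorphic continuation $M:\Omega\to\overline{\mathbb C^+}$ to $\Omega=\mathbb C_\infty\setminus[-1,1]$. The map $\varphi(\lambda)=\frac{2\lambda}{\lambda^2+1}$ is a conformal map $\varphi:\mathbb C^+\to\Omega$ with $\varphi(i)=\infty$. The $F$ function of $H$ is $F(\lambda;H)=M(\varphi(\lambda))$, $\lambda\in\mathbb C^+$. Dirac canonical systems: $\mathcal D=\{H\in\mathcal C(\mathbb R): H\in AC(\mathbb R),\ H(0)=1,\ \det H(x)=1\}$. Here $1$ in $H(0)=1$ is the identity matrix, $AC$ means locally absolutely continuous, and the determinant normalization is used, i.e. an element of $\mathcal C(\mathbb R)$ belongs to $\mathcal D$ if it has a version with these properties. *)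

(* Defs.v *)
From HB Require Import structures.
From mathcomp Require Import all_boot all_order all_algebra.
From mathcomp Require Import all_classical all_reals all_analysis.
From mathcomp Require Import complex.

Set Implicit Arguments.
Unset Strict Implicit.
Unset Printing Implicit Defensive.

Import Order.TTheory GRing.Theory Num.Theory.
Import numFieldNormedType.Exports.

Local Open Scope classical_set_scope.
Local Open Scope ring_scope.
Local Open Scope complex_scope.

(** Riemann sphere.  [None] is the point at infinity; the [^o] selects the
    structure of [R[i]] as a normed module over itself. *)

Notation sphere R := (one_point_compactification (R[i]^o)).
Notation infty := (@None _).

Definition sdiv (R : realType) (a b : R[i]) : sphere R :=
  if b == 0 then infty else Some (a / b).

Definition sopp (R : realType) (w : sphere R) : sphere R :=
  if w is Some z then Some (- z) else infty.

Definition sconj (R : realType) (w : sphere R) : sphere R :=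
  if w is Some z then Some (conjc z) else infty.

Definition sinv (R : realType) (w : sphere R) : sphere R :=
  if w is Some z then sdiv 1 z else Some 0.

Definition closed_upper (R : realType) : set (sphere R) :=
  [set w | if w is Some z then 0 <= complex.Im z else True].

(* Affine coordinate; the value at infinity is a dummy. *)
Definition affine (R : realType) (w : sphere R) : R[i]^o :=
  if w is Some z then z else 0.

(* The target is covered by the two charts w and 1/w. *)
Definition sdifferentiable (R : realType) (g : R[i]^o -> sphere R)
    (z : R[i]^o) : Prop :=
  ((\forall w \near z, g w <> infty) /\
    derivable (fun w => affine (g w)) z 1) \/
  ((\forall w \near z, sinv (g w) <> infty) /\
    derivable (fun w => affine (sinv (g w))) z 1).

(* Meaningful for open D; at infinity the local coordinate is 1/z. *)
Definition sholomorphic (R : realType) (D : set (sphere R))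
    (M : sphere R -> sphere R) : Prop :=
  forall p, D p ->
    if p is Some z then sdifferentiable (fun w => M (Some w)) z
    else sdifferentiable (fun w => M (sinv (Some w))) 0.

(** Absolute continuity. *)

Definition abs_cont (R : realType) (a b : R) (f : R -> R) : Prop :=
  forall e : R, 0 < e -> exists2 d : R, 0 < d &
    forall (n : nat) (l r : 'I_n -> R),
      (forall i, [&& a <= l i, l i < r i & r i <= b]) ->
      (forall i j, i != j -> r i <= l j \/ r j <= l i) ->
      \sum_(i < n) (r i - l i) < d ->
      \sum_(i < n) `|f (r i) - f (l i)| < e.

Definition loc_abs_cont (R : realType) (f : R -> R) : Prop :=
  forall a b : R, a < b -> abs_cont a b f.

(** Canonical systems. *)

Definition canonical_system (R : realType) : set (R -> 'M[R]_2) :=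
  [set H : R -> 'M[R]_2 | (forall i j, locally_integrable setT (fun x => H x i j)) /\
    {ae lebesgue_measure, forall x : R,
      [/\ (H x)^T = H x,
          forall v : 'cV[R]_2, 0 <= (v^T *m H x *m v) 0 0 &
          \tr (H x) = 1]}].

(* J = [0, -1; 1, 0] *)
Definition Jmx (C : pzRingType) : 'M[C]_2 :=
  \matrix_(i < 2, j < 2) ((j < i)%N%:R - (i < j)%N%:R).

Definition cmx (R : realType) (A : 'M[R]_2) : 'M[R[i]]_2 :=
  map_mx (fun t => t%:C) A.

Definition has_cderiv (R : realType) (f : R -> R[i]) (x : R) (v : R[i]) : Prop :=
  is_derive x (1 : R) (fun t => complex.Re (f t)) (complex.Re v) /\
  is_derive x (1 : R) (fun t => complex.Im (f t)) (complex.Im v).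

Definition cs_solution (R : realType) (H : R -> 'M[R]_2) (z : R[i])
    (u : R -> 'cV[R[i]]_2) : Prop :=
  (forall i, loc_abs_cont (fun t => complex.Re (u t i 0)) /\
             loc_abs_cont (fun t => complex.Im (u t i 0))) /\
  {ae lebesgue_measure, forall x : R, exists v : 'cV[R[i]]_2,
     (forall i, has_cderiv (fun t => u t i 0) x (v i 0)) /\
     Jmx _ *m v = - z *: (cmx (H x) *m u x)}.

(* u^* H u; it is real because H is real symmetric. *)
Definition energy (R : realType) (H : R -> 'M[R]_2) (u : R -> 'cV[R[i]]_2)
    (x : R) : R :=
  complex.Re (((map_mx conjc (u x))^T *m cmx (H x) *m u x) 0 0).

Definition weyl_solution (R : realType) (I : set R) (H : R -> 'M[R]_2)
    (z : R[i]) (u : R -> 'cV[R[i]]_2) : Prop :=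
  [/\ cs_solution H z u, exists x, u x != 0 &
      (\int[lebesgue_measure]_(x in I) (energy H u x)%:E < +oo)%E].

Definition ratio (R : realType) (f : 'cV[R[i]]_2) : sphere R :=
  sdiv (f 0 0) (f 1 0).

(* f_+ and f_- exist and are unique up to a factor for z in the upper half
   plane, so there the sets below are singletons and the default is unused. *)
Definition m_plus (R : realType) (H : R -> 'M[R]_2) (z : R[i]) : sphere R :=
  xget (Some 0) [set w | exists2 f, weyl_solution `[0, +oo[ H z f &
                                    w = ratio (f 0)].

Definition m_minus (R : realType) (H : R -> 'M[R]_2) (z : R[i]) : sphere R :=
  xget (Some 0) [set w | exists2 f, weyl_solution `]-oo, 0] H z f &
                                    w = sopp (ratio (f 0))].

Definition reflectionless (R : realType) (A : set R) (H : R -> 'M[R]_2) : Prop :=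
  {ae lebesgue_measure, forall t : R, A t -> exists wp wm : sphere R,
    [/\ m_plus H (t +i* y) @[y --> (0 : R)^'+] --> wp,
        m_minus H (t +i* y) @[y --> (0 : R)^'+] --> wm &
        wp = sopp (sconj wm)]}.

Definition Rclass (R : realType) (A : set R) : set (R -> 'M[R]_2) :=
  [set H : R -> 'M[R]_2 | canonical_system H /\ reflectionless A H].

(** The F function. *)

Definition Uset (R : realType) : set R := `]-oo, (-1)[ `|` `]1, +oo[.

Definition Omega (R : realType) : set (sphere R) :=
  ~` [set Some (t%:C) | t in (`[(-1), 1] : set R)].

Definition is_M_function (R : realType) (H : R -> 'M[R]_2)
    (M : sphere R -> sphere R) : Prop :=
  [/\ sholomorphic (@Omega R) M,
      forall p, Omega p -> closed_upper (M p),
      forall z : R[i], 0 < complex.Im z -> M (Some z) = m_plus H z &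
      forall z : R[i], complex.Im z < 0 ->
        M (Some z) = sopp (sconj (m_minus H (conjc z)))].

(* On Omega, M is determined by H; its values on [-1, 1] are arbitrary. If no
   continuation existed, M would be the constant 0. *)
Definition Mfun (R : realType) (H : R -> 'M[R]_2) : sphere R -> sphere R :=
  xget (fun=> Some 0) [set M | is_M_function H M].

Definition phi (R : realType) (lambda : R[i]) : sphere R :=
  sdiv (2 * lambda) (lambda ^+ 2 + 1).

Definition Ffun (R : realType) (lambda : R[i]) (H : R -> 'M[R]_2) : sphere R :=
  Mfun H (phi lambda).

(** Dirac canonical systems. *)

Definition change_of_variable (R : realType) (p : R -> R) : Prop :=
  [/\ {homo p : x y / x < y}, p 0 = 0, loc_abs_cont p &
      exists q : R -> R, [/\ cancel p q, cancel q p & loc_abs_cont q]].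

(* G represents the same canonical system as H, in another normalization. *)
Definition version (R : realType) (H G : R -> 'M[R]_2) : Prop :=
  exists2 p : R -> R, change_of_variable p &
    {ae lebesgue_measure, forall x : R, exists2 p' : R,
      is_derive x (1 : R) p p' & G x = p' *: H (p x)}.

Definition Dirac (R : realType) : set (R -> 'M[R]_2) :=
  [set H : R -> 'M[R]_2 | canonical_system H /\
    exists G : R -> 'M[R]_2,
      [/\ version H G, forall i j, loc_abs_cont (fun x => G x i j),
          G 0 = 1%:M & forall x, \det (G x) = 1]].

(* Main.v *)
(** In the coordinate [s = (m - i) / (m + i)] the m function of the half line
    starting at [x] becomes a Schur function [S x z], and as a function of [x]
    it solves [S' = i z (conj k S^2 - S + k)], where [k = (c - a) / 2 + i b]
    for [H = [[a, b], [b, c]]], [a + c = 1]. Being reflectionless on [U] means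
    that [S x] continues analytically across [U] and through infinity, for every
    [x] and with bounds independent of [x]. Let [sigma x] be its value at
    infinity; then [F(i) = i] says that [sigma 0 = 0]. Letting [z = i m] tend to
    infinity in the equation gives [conj k sigma^2 - sigma + k = 0] almost
    everywhere, and Schwarz's lemma improves [S - sigma = O(1/m)] to
    [O(rho/m)], [rho = 1 - |sigma|^2], so that [1/rho] is Lipschitz.

    If [sigma 0 = 0], then [rho > 0] everywhere, [k = sigma / (1 + |sigma|^2)]
    is Lipschitz and [sqrt (det H) = rho / (2 (1 + |sigma|^2))] is bounded below
    by a multiple of [1 / (1 + |x|)], so its primitive is the change of variable
    that normalizes the determinant. Conversely, for a Dirac system [k] tends to
    [0] along almost every [x] tending to [0], and the quadratic equation forces
    [sigma 0 = 0]. *)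
Require Import Defs.
From HB Require Import structures.
From mathcomp Require Import all_boot all_order all_algebra.
From mathcomp Require Import all_classical all_reals all_analysis.
From mathcomp Require Import measurable_realfun complex.
From mathcomp Require Import ring lra.
Set Implicit Arguments.
Unset Strict Implicit.
Unset Printing Implicit Defensive.
Import Order.TTheory GRing.Theory Num.Theory.
Import numFieldNormedType.Exports.
Local Open Scope classical_set_scope.
Local Open Scope ring_scope.
Local Open Scope complex_scope.

(** The hypothesis gives equality of boundary values only almost everywhere on [U] and in the
    topology of the sphere. In the coordinate [s] every value is bounded by [1] and the point
    infinity is not special. Two averages along horizontal segments turn the equality almost
    everywhere into a holomorphic gluing, also at infinity, about which nothing is assumed; Cauchy's
    estimates then bound the result by a constant that knows only the bound [1] and a radius. Every
    [S x] is again bounded by [1], and this is the source of the uniformity in [x]. As [H] is merely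
    measurable, the quadratic equation is first obtained in integrated form.

    The danger, when [sigma 0 = 0], is that [rho] reaches [0] at a finite [x]. The estimate [O(1/m)]
    would only make [rho] Lipschitz, which permits such a zero. With [O(rho/m)] the derivative of a
    comparison function is of size [rho^2]: one factor [rho] comes from Schwarz's lemma, the other
    from the derivative of the quadratic polynomial at its root [sigma]. *)

Notation Re := complex.Re.
Notation Im := complex.Im.

(** * Absolute continuity and null sets *)

Section cabs.
Variable R : realType.
Implicit Types (z w : R[i]) (x : R).

(** [|z|] takes values in [R[i]]; a modulus with values in [R] keeps the estimates in an ordered
    field where [lra] applies. *)
Definition cabs z : R := Num.sqrt (Re z ^+ 2 + Im z ^+ 2).

Lemma cabsE z : `|z| = (cabs z)%:C.
Proof. exact: normc_def. Qed.

Lemma cabs_ge0 z : 0 <= cabs z. Proof. exact: sqrtr_ge0. Qed.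

Lemma cabsM z w : cabs (z * w) = cabs z * cabs w.
Proof.
apply: complexI; rewrite -cabsE normrM !cabsE.
by rewrite -rmorphM.
Qed.

Lemma cabsD z w : cabs (z + w) <= cabs z + cabs w.
Proof.
by rewrite -lecR rmorphD /= -!cabsE ler_normD.
Qed.

Lemma cabsN z : cabs (- z) = cabs z.
Proof. by apply: complexI; rewrite -!cabsE normrN. Qed.

Lemma cabsB z w : cabs (z - w) <= cabs z + cabs w.
Proof. by rewrite -(cabsN w); exact: cabsD. Qed.

Lemma cabs_distC z w : cabs (z - w) = cabs (w - z).
Proof. by rewrite -cabsN opprB. Qed.

Lemma cabs0 : cabs 0 = 0. Proof. by apply: complexI; rewrite -cabsE normr0. Qed.
Lemma cabs1 : cabs 1 = 1. Proof. by apply: complexI; rewrite -cabsE normr1. Qed.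

Lemma cabs0_eq0 z : (cabs z == 0) = (z == 0).
Proof. by rewrite -(inj_eq (@complexI _)) -cabsE normr_eq0. Qed.

Lemma cabs_gt0 z : (0 < cabs z) = (z != 0).
Proof. by rewrite lt_def cabs_ge0 andbT cabs0_eq0. Qed.

Lemma cabsV z : cabs z^-1 = (cabs z)^-1.
Proof.
have [->|z0] := eqVneq z 0; first by rewrite invr0 cabs0 invr0.
apply: (@mulfI _ (cabs z)); first by rewrite cabs0_eq0.
by rewrite -cabsM !divff ?cabs1// cabs0_eq0.
Qed.

Lemma cabsX z n : cabs (z ^+ n) = cabs z ^+ n.
Proof.
elim: n => [|n IH]; first by rewrite !expr0 cabs1.
by rewrite !exprS cabsM IH.
Qed.

Lemma cabs_conj z : cabs (conjc z) = cabs z.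
Proof. by case: z => a b; rewrite /cabs /= sqrrN. Qed.

Lemma cabs_real x : cabs x%:C = `|x|.
Proof. by rewrite /cabs /= expr0n /= addr0 sqrtr_sqr. Qed.

Lemma cabs_i : cabs 'i = 1.
Proof. by rewrite /cabs /= expr0n expr1n /= add0r sqrtr1. Qed.

Lemma cabs_sqr z : cabs z ^+ 2 = Re z ^+ 2 + Im z ^+ 2.
Proof. by rewrite /cabs sqr_sqrtr// addr_ge0// sqr_ge0. Qed.

Lemma cabs_Re z : `|Re z| <= cabs z.
Proof. by rewrite -sqrtr_sqr ler_wsqrtr// lerDl sqr_ge0. Qed.

Lemma cabs_Im z : `|Im z| <= cabs z.
Proof. by rewrite -sqrtr_sqr ler_wsqrtr// lerDr sqr_ge0. Qed.

Lemma cabs_le z : cabs z <= `|Re z| + `|Im z|.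
Proof.
rewrite -(ler_pXn2r (n := 2)) ?nnegrE ?cabs_ge0 ?addr_ge0//.
rewrite cabs_sqr sqrrD !real_normK ?num_real// -addrA lerD2l addrC lerDl.
by rewrite mulrn_wge0// mulr_ge0.
Qed.

Lemma cabs_le_sqr z x : 0 <= x -> (cabs z <= x) = (Re z ^+ 2 + Im z ^+ 2 <= x ^+ 2).
Proof.
move=> x0; rewrite -cabs_sqr ler_pXn2r ?nnegrE ?cabs_ge0//.
Qed.

Lemma ReD z w : Re (z + w) = Re z + Re w. Proof. by case: z w => [? ?] [? ?]. Qed.
Lemma ImD z w : Im (z + w) = Im z + Im w. Proof. by case: z w => [? ?] [? ?]. Qed.
Lemma ReN z : Re (- z) = - Re z. Proof. by case: z. Qed.
Lemma ImN z : Im (- z) = - Im z. Proof. by case: z. Qed.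
Lemma ReB z w : Re (z - w) = Re z - Re w. Proof. by rewrite ReD ReN. Qed.
Lemma ImB z w : Im (z - w) = Im z - Im w. Proof. by rewrite ImD ImN. Qed.
Lemma ReM z w : Re (z * w) = Re z * Re w - Im z * Im w.
Proof. by case: z w => [? ?] [? ?]. Qed.
Lemma ImM z w : Im (z * w) = Re z * Im w + Im z * Re w.
Proof. by case: z w => [? ?] [? ?]. Qed.
Lemma Re_conj z : Re (conjc z) = Re z. Proof. by case: z. Qed.
Lemma Im_conj z : Im (conjc z) = - Im z. Proof. by case: z. Qed.
Definition cplxE := (ReB, ImB, ReD, ImD, ReN, ImN, ReM, ImM, Re_conj, Im_conj).

Lemma complex_eq z w : Re z = Re w -> Im z = Im w -> z = w.
Proof. by case: z w => [? ?] [? ?] /= -> ->. Qed.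

Lemma conj_mul z : z * conjc z = (cabs z ^+ 2)%:C.
Proof.
apply: complex_eq; rewrite !cplxE /= ?cabs_sqr; ring.
Qed.
End cabs.

Section derive_eps.
Variable R : realType.
Implicit Types (f g : R -> R).

(** Remainder form of the derivative. The non-strict bound includes [y = x], which spares its users
    a case split. *)
Lemma is_derive_eps f (x v : R) :
  is_derive x (1 : R) f v <->
  (forall e, 0 < e -> exists2 d, 0 < d &
     forall y, `|y - x| < d -> `|f y - f x - v * (y - x)| <= e * `|y - x|).
Proof.
split.
- move=> [df <-] e e0.
  have := df; rewrite /derivable => /cvg_ex[l fl].
  have -> : 'D_1 f x = l by apply/cvg_lim.
  move/cvgrPdist_le : fl => /(_ e e0).
  rewrite -nbhs_nearE => /nbhs_ballP[d /= d0 H].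
  exists d => // y yd.
  have [->|yx] := eqVneq y x; first by rewrite !subrr mulr0 subr0 normr0 mulr0.
  have yx0 : y - x != 0 by rewrite subr_eq0.
  have := H (y - x); rewrite /ball /= sub0r normrN => /(_ yd yx0).
  rewrite -[(y - x)%:A]/((y - x) * 1) mulr1 subrK.
  rewrite -[X in `|_ - X|]/((y - x)^-1 * (f y - f x)) => {}H.
  have -> : f y - f x - l * (y - x) =
            - ((l - (y - x)^-1 * (f y - f x)) * (y - x)) by field.
  by rewrite normrN normrM ler_wpM2r.
- move=> H.
  have fl : h^-1 *: (f (h *: (1 : R) + x) - f x) @[h --> 0^'] --> v.
    apply/cvgrPdist_le => e e0.
    have [d d0 dH] := H e e0.
    rewrite -nbhs_nearE; apply/nbhs_ballP; exists d => //= h.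
    rewrite /ball /= sub0r normrN => hd h0.
    have := dH (h + x); rewrite addrK => /(_ hd).
    rewrite -[h%:A]/(h * 1) mulr1 -[X in _ -> `|_ - X| <= _]/(h^-1 * (f (h + x) - f x)).
    have -> : f (h + x) - f x - v * h =
            - ((v - h^-1 * (f (h + x) - f x)) * h) by field.
    by rewrite normrN normrM ler_pM2r// normr_gt0.
  split; last exact/cvg_lim.
  by apply/cvg_ex; exists v.
Qed.

Lemma is_derive1_continuous f (x v : R) : is_derive x (1 : R) f v ->
  forall e, 0 < e -> exists2 d, 0 < d & forall y, `|y - x| < d -> `|f y - f x| < e.
Proof.
move=> /is_derive_eps /(_ _ ltr01)[d d0 H] e e0.
have vp : 0 < 1 + `|v| by rewrite ltr_pwDl.
exists (Num.min d (e / (1 + `|v|))); first by rewrite lt_min d0 divr_gt0.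
move=> y; rewrite lt_min => /andP[/H yd]; rewrite ltr_pdivlMr// => ye.
apply: le_lt_trans ye.
rewrite -[X in `|X|](subrK (v * (y - x))) (le_trans (ler_normD _ _))// normrM.
by move: yd; lra.
Qed.
End derive_eps.

Section real_induction.
Variable R : realType.

(** Replaces compactness of [[a, b]]: the supremum of the points up to which [P] holds is reached by
    the last hypothesis and, if below [b], passed by the one before it. *)
Lemma real_induction (a b : R) (P : R -> Prop) : a <= b -> P a ->
  (forall x, a <= x < b -> P x -> exists2 d, 0 < d & forall y, x < y < x + d -> y <= b -> P y) ->
  (forall x, a < x <= b -> (forall y, a <= y < x -> P y) -> P x) ->
  P b.
Proof.
move=> ab Pa Pr Pl.
pose A := [set x | a <= x <= b /\ forall y, a <= y <= x -> P y].
have Aa : A a.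
  by split; [rewrite lexx|move=> y /andP[ay ya]; rewrite (_ : y = a)//; apply/le_anti/andP].
have supA : has_sup A.
  by split; [exists a|exists b => x [/andP[]]].
set s := sup A.
have as_ : a <= s by apply: ub_le_sup => //; case: supA.
have sb : s <= b by apply: ge_sup => [|x [/andP[]]]//; exists a.
have Plt y : a <= y < s -> P y.
  move=> /andP[ay ys]; have [|t At yt] := @sup_gt _ A y _ ys; first by exists a.
  by case: At => _; apply; rewrite ay ltW.
have Ps : P s.
  move: as_; rewrite le_eqVlt => /predU1P[<-//|as_].
  by apply: Pl => //; rewrite as_.
move: sb; rewrite le_eqVlt => /predU1P[<-//|sb].
have [|d d0 H] := Pr s _ Ps; first by rewrite as_.
pose t := Num.min b (s + d / 2).
have st : s < t by rewrite lt_min sb ltrDl divr_gt0.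
have : t <= s.
  apply: ub_le_sup; first by case: supA.
  split=> [|y /andP[ay yt]]; first by rewrite ge_min lexx andbT (le_trans as_)// ltW.
  have [sy|] := ltP s y; last first.
    rewrite le_eqVlt => /predU1P[->//|ys]; first by apply: Plt; rewrite ay.
  have yb : y <= b by rewrite (le_trans yt)// ge_min lexx.
  apply: H => //; rewrite sy/= (le_lt_trans yt)// gt_min; apply/orP; right.
  by rewrite ltrD2l ltr_pdivrMr// mulr_natr mulr2n ltrDl.
by rewrite leNgt st.
Qed.

(** The radius [d] may depend on [x], and the constant survives unchanged. With [L] arbitrarily
    small this also shows that a function with increments of second order is constant. *)
Lemma local_lipschitz_le (f : R -> R[i]) (a b L : R) : a <= b ->
  (forall x, a <= x <= b -> exists2 d, 0 < d & forall y, a <= y <= b ->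
     `|y - x| < d -> cabs (f y - f x) <= L * `|y - x|) ->
  cabs (f b - f a) <= L * (b - a).
Proof.
move=> ab H; apply: (@real_induction a b (fun x => cabs (f x - f a) <= L * (x - a))) => //.
- by rewrite !subrr cabs0 mulr0.
- move=> x /andP[ax xb] Px; have [|d d0 xd] := H x; first by rewrite ax ltW.
  exists d => // y /andP[xy yd] yb.
  have -> : f y - f a = (f y - f x) + (f x - f a) by rewrite addrA subrK.
  have -> : y - a = (y - x) + (x - a) by rewrite addrA subrK.
  rewrite (le_trans (cabsD _ _))// mulrDr lerD//.
  have -> : y - x = `|y - x| by rewrite gtr0_norm// subr_gt0.
  apply: xd.
    by rewrite yb andbT (le_trans ax)// ltW.
  by rewrite gtr0_norm ?subr_gt0// ltrBlDl.
- move=> x /andP[ax xb] Py; have [|d d0 xd] := H x; first by rewrite xb ltW.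
  pose y := Num.max a (x - d / 2).
  have yx : y < x by rewrite gt_max ax ltrBlDr ltrDl divr_gt0.
  have ay : a <= y by rewrite le_max lexx.
  have -> : f x - f a = (f x - f y) + (f y - f a) by rewrite addrA subrK.
  have -> : x - a = (x - y) + (y - a) by rewrite addrA subrK.
  rewrite (le_trans (cabsD _ _))// mulrDr lerD//; last by apply: Py; rewrite ay.
  have -> : x - y = `|y - x| by rewrite distrC gtr0_norm// subr_gt0.
  rewrite cabs_distC; apply: xd.
    by rewrite ay/= (le_trans _ xb)// ltW.
  rewrite ltr0_norm ?subr_lt0// opprB ltrBlDr -ltrBlDl lt_max; apply/orP; right.
  by rewrite ltrD2l ltrN2 ltr_pdivrMr// mulr_natr mulr2n ltrDl.
Qed.
End real_induction.

Section ac_monotone.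
Variable R : realType.
Local Notation mu := (@lebesgue_measure R).

(** The exceptional null set is covered by an open [U] shorter than the [d] of absolute continuity.
    Real induction walks from [a] to [b]: short steps at good points lose at most [e] times their
    length, and steps inside [U] are recorded, so that absolute continuity bounds their total
    variation by [e]. *)
Lemma abs_cont_nondecreasing (f : R -> R) (a b : R) : a < b -> abs_cont a b f ->
  {ae mu, forall x, a <= x <= b -> exists2 v, 0 <= v & is_derive x (1 : R) f v} ->
  f a <= f b.
Proof.
move=> ab acf [N [mN N0 Nsub]].
apply/ler_addgt0Pr => e0 e00.
(* [e] is spent as a slope over the length [b - a] and once more on the recorded intervals. *)
pose e := e0 / (1 + (b - a)).
have ba : 0 < 1 + (b - a) by rewrite ltr_pwDl// subr_ge0 ltW.
have e_gt0 : 0 < e by rewrite divr_gt0.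
have [d d0 acd] := acf e e_gt0.
have [U [oU NU Ud]] : exists U, [/\ open U, N `<=` U & (mu U < d%:E)%E].
  have [|U [oU NU UN]] := @lebesgue_regularity_outer R N d mN _ d0; first by rewrite [X in (X < _)%E]N0.
  exists U; split => //.
  rewrite -(setDUK NU) measureU//; last 2 first.
  - by apply: measurableD => //; exact: open_measurable.
  - by rewrite setDIK.
  by rewrite [X in (X + _ < _)%E]N0 add0e.
(* State of the walk at [x]: the disjoint recorded intervals are no longer in total than [U] within
   [[a, x]], and apart from the variation over them [f] has fallen by at most [e * (x - a)]. *)
pose P x := exists n (l r : nat -> R),
  [/\ forall i, (i < n)%N -> [/\ a <= l i, l i < r i & r i <= x],
      forall i j, (i < j < n)%N -> r i <= l j,
      ((\sum_(i < n) (r i - l i))%:E <= mu (U `&` `[a, x]))%E &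
      - e * (x - a) - \sum_(i < n) `|f (r i) - f (l i)| <= f x - f a].
have Pstep x y : a <= x -> x < y -> P x ->
    (- e * (y - x) <= f y - f x \/ `[x, y] `<=` U) -> P y.
  move=> ax xy [n [l [r [lr disj sum_le fx]]]] [fxy|xyU].
    exists n, l, r; split => //.
    - by move=> i /lr[? ? ?]; split => //; rewrite (le_trans _ (ltW xy)).
    - rewrite (le_trans sum_le)// le_measure ?inE//.
      + by apply: measurableI => //; exact: open_measurable.
      + by apply: measurableI => //; exact: open_measurable.
      + apply: setIS => z /=; rewrite !in_itv/= => /andP[-> /le_trans]; apply.
        exact: ltW.
    - by move: fx fxy; lra.
  exists n.+1, (fun i => if (i == n)%N then x else l i),
     (fun i => if (i == n)%N then y else r i); split.
  - move=> i; rewrite ltnS leq_eqVlt => /orP[/eqP ->|ni].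
      by rewrite eqxx; split => //.
    rewrite ltn_eqF//; have [? ? ?] := lr _ ni; split => //.
    by rewrite (le_trans _ (ltW xy)).
  - move=> i j /andP[ij]; rewrite ltnS leq_eqVlt => /orP[/eqP jn|jn].
      by rewrite jn eqxx ltn_eqF -?jn//; rewrite jn in ij; have [] := lr _ ij.
    by rewrite !ltn_eqF ?(ltn_trans ij)//; apply: disj; rewrite ij.
  - rewrite big_ord_recr/= eqxx EFinD.
    rewrite (eq_bigr (fun i : 'I_n => r i - l i)); last by move=> i _; rewrite ltn_eqF.
    apply: (@le_trans _ _ (mu (U `&` `[a, x]) + mu `]x, y])%E).
      by rewrite leeD// lebesgue_measure_itv/= lte_fin xy.
    rewrite -measureU//; last 2 first.
    + by apply: measurableI => //; exact: open_measurable.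
    + rewrite -subset0 => z/= [[_]]; rewrite !in_itv/= => /andP[_ zx] /andP[xz _].
      by move: xz; rewrite ltNge zx.
    apply: le_measure; rewrite ?inE//.
    + by apply: measurableU => //; apply: measurableI => //; exact: open_measurable.
    + by apply: measurableI => //; exact: open_measurable.
    + move=> z [[Uz]|] /=; rewrite !in_itv/= => /andP[z1 z2]; split => //.
      * by rewrite z1 (le_trans z2)// ltW.
      * by apply: xyU; rewrite /= in_itv/= z2 ltW.
      * by rewrite z2 andbT (le_trans ax)// ltW.
  - rewrite big_ord_recr/= eqxx.
    rewrite (eq_bigr (fun i : 'I_n => `|f (r i) - f (l i)|)); last by move=> i _; rewrite ltn_eqF.
    have := ler_norm (f x - f y); rewrite distrC.
    by have := mulr_gt0 e_gt0 (_ : 0 < y - x); rewrite subr_gt0 => /(_ xy); move: fx; lra.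
have gauge x : a <= x <= b -> exists2 dx, 0 < dx & forall y z, x - dx < y -> y <= x ->
    x <= z -> z < x + dx ->
    (- e * (x - y) <= f x - f y \/ `[y, x] `<=` U) /\ (- e * (z - x) <= f z - f x \/ `[x, z] `<=` U).
  move=> xab; have [Nx|Nx] := pselect (N x).
    have := oU; rewrite openE => /(_ x (NU _ Nx)) /nbhs_ballP[dx /= dx0 xU].
    exists dx => // y z xy yx xz zx; split; right => t/=; rewrite in_itv/= => /andP[t1 t2];
      apply: xU; rewrite /ball/= ltr_norml; lra.
  have [v v0 /is_derive_eps/(_ _ e_gt0)[dx dx0 xv]] :
      exists2 v, 0 <= v & is_derive x (1 : R) f v.
    by move: Nx; apply: contra_notP => nx; apply: Nsub => /(_ xab).
  exists dx => // y z xy yx xz zx; split; left.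
    have := xv y; rewrite ler0_norm ?subr_le0// => /(_ ltac:(lra)).
    rewrite ler_norml => /andP[_]; have : 0 <= v * (x - y) by rewrite mulr_ge0// subr_ge0.
    by lra.
  have := xv z; rewrite ger0_norm ?subr_ge0// => /(_ ltac:(lra)).
  rewrite ler_norml => /andP[+ _]; have : 0 <= v * (z - x) by rewrite mulr_ge0// subr_ge0.
  by lra.
have [n [l [r [lr disj sum_le fb]]]] : P b.
  apply: (@real_induction _ a b P); first exact: ltW.
  - exists 0%N, (fun=> 0), (fun=> 0); split => //.
    + by rewrite big_ord0.
    + by rewrite big_ord0 !subrr mulr0 subr0.
  - move=> x /andP[ax xb] Px; have [|dx dx0 H] := gauge x; first by rewrite ax ltW.
    exists dx => // y /andP[xy yx] yb; apply: (Pstep x) => //.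
    by have [] := H x y; rewrite ?lexx ?ltrBlDr ?ltrDl//; exact: ltW.
  - move=> x /andP[ax xb] Py; have [|dx dx0 H] := gauge x; first by rewrite xb ltW.
    pose y := Num.max a (x - dx / 2).
    have yx : y < x by rewrite gt_max ax ltrBlDr ltrDl divr_gt0.
    have ay : a <= y by rewrite le_max lexx.
    apply: (Pstep y) => //; first by apply: Py; rewrite ay.
    have [] := H y x; rewrite ?lexx ?ltrDl//; last exact: ltW.
    by rewrite lt_max; apply/orP; right; lra.
have : \sum_(i < n) `|f (r i) - f (l i)| < e.
  apply: (acd n (fun i => l i) (fun i => r i)).
  - by move=> i; have [? ? ?] := lr i (ltn_ord i); apply/and3P.
  - move=> i j; rewrite -val_eqE neq_ltn => /orP[ij|ji].
      by left; apply: disj; rewrite ij ltn_ord.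
    by right; apply: disj; rewrite ji ltn_ord.
  - rewrite -lte_fin (le_lt_trans sum_le)// (le_lt_trans _ Ud)// le_measure ?inE//.
    + by apply: measurableI => //; exact: open_measurable.
    + exact: open_measurable.
have : e * (1 + (b - a)) = e0 by rewrite /e divfK// gt_eqF.
by move: fb; lra.
Qed.
End ac_monotone.

Section ae.
Variable R : realType.
Local Notation mu := (@lebesgue_measure R).

Lemma ae_imp (P Q : R -> Prop) : (forall x, P x -> Q x) ->
  {ae mu, forall x, P x} -> {ae mu, forall x, Q x}.
Proof. by move=> PQ; apply: (@filterS _ _ (ae_filter_ringOfSetsType mu)) => x; exact: PQ. Qed.

Lemma ae_imp2 (P Q S : R -> Prop) : (forall x, P x -> Q x -> S x) ->
  {ae mu, forall x, P x} -> {ae mu, forall x, Q x} -> {ae mu, forall x, S x}.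
Proof. by move=> PQ; apply: (@filterS2 _ _ (ae_filter_ringOfSetsType mu)) => x; exact: PQ. Qed.

Lemma ae_imp3 (P Q S T : R -> Prop) : (forall x, P x -> Q x -> S x -> T x) ->
  {ae mu, forall x, P x} -> {ae mu, forall x, Q x} -> {ae mu, forall x, S x} ->
  {ae mu, forall x, T x}.
Proof. by move=> PQ; apply: (@filterS3 _ _ (ae_filter_ringOfSetsType mu)) => x; exact: PQ. Qed.

Lemma ae_all (P : R -> Prop) : (forall x, P x) -> {ae mu, forall x, P x}.
Proof. by move=> H; apply: (@filterE _ _ (ae_filter_ringOfSetsType mu)) => x; exact: H. Qed.
End ae.

Section lac.
Variable R : realType.
Local Notation mu := (@lebesgue_measure R).
Implicit Types (f g h : R -> R).

Lemma lac_continuous f : loc_abs_cont f ->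
  forall x e, 0 < e -> exists2 d, 0 < d & forall y, `|y - x| < d -> `|f y - f x| < e.
Proof.
move=> acf x e e0.
have [|d d0 H] := acf (x - 1) (x + 1) _ e e0; first by lra.
have H1 u v : x - 1 <= u -> u < v -> v <= x + 1 -> v - u < d -> `|f v - f u| < e.
  move=> ? ? ? uvd.
  have := H 1%N (fun=> u) (fun=> v); rewrite !big_ord1; apply => //.
  - by move=> _; apply/and3P.
  - by move=> i j; rewrite !ord1.
exists (Num.min d 1); first by rewrite lt_min d0 ltr01.
move=> y; rewrite lt_min => /andP[yd]; rewrite ltr_norml => /andP[y1 y2].
have [xy|yx|<-] := ltgtP x y.
- by apply: H1; [lra..|]; rewrite -(gtr0_norm (_ : 0 < y - x))// subr_gt0.
- rewrite distrC; apply: H1; [lra..|].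
  by rewrite -(gtr0_norm (_ : 0 < x - y)) ?subr_gt0// distrC.
- by rewrite subrr normr0.
Qed.

Lemma continuous_epsP f : continuous f <->
  (forall x e, 0 < e -> exists2 d, 0 < d & forall y, `|y - x| < d -> `|f y - f x| < e).
Proof.
split=> [cf x e e0|H x].
- have /cvgrPdist_lt/(_ e e0) := cf x.
  rewrite -nbhs_nearE => /nbhs_ballP[d /= d0 xd]; exists d => // y.
  by rewrite distrC => /xd; rewrite distrC.
- apply/cvgrPdist_lt => e /(H x)[d d0 xd]; rewrite -nbhs_nearE; apply/nbhs_ballP.
  by exists d => // y; rewrite /ball/= distrC => /xd; rewrite distrC.
Qed.

Lemma lac_cts f : loc_abs_cont f -> continuous f.
Proof. by move=> /lac_continuous/continuous_epsP. Qed.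

Lemma continuous_bounded f (a b : R) : continuous f ->
  exists B, forall x, a <= x <= b -> `|f x| <= B.
Proof.
move=> cf; have [ab|ba] := leP a b; last first.
  by exists 0 => x /andP[/le_trans/[apply]]; rewrite leNgt ba.
have [|c _ H] := @EVT_max R (fun x => `|f x|) a b ab.
  by apply: continuous_subspaceT => x; apply: (cvg_comp _ _ (cf x)); exact: norm_continuous.
by exists `|f c|.
Qed.

Lemma loc_lipschitz_lac f :
  (forall r, exists K, forall x y, `|x| <= r -> `|y| <= r -> `|f y - f x| <= K * `|y - x|) ->
  loc_abs_cont f.
Proof.
move=> H a b ab e e0; have [K fK] := H (Num.max `|a| `|b|).
have K0 : 0 < 1 + `|K| by rewrite ltr_pwDl.
exists (e / (1 + `|K|)); first by rewrite divr_gt0.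
move=> n l r lr _; rewrite ltr_pdivlMr// => /le_lt_trans; apply.
rewrite mulr_suml; apply: ler_sum => i _; have /and3P[al li rb] := lr i.
have B x : a <= x -> x <= b -> `|x| <= Num.max `|a| `|b|.
  move=> ax xb; rewrite le_max; have [x0|x0] := leP 0 x.
    by apply/orP; right; rewrite !ger0_norm// (le_trans x0).
  by apply/orP; left; rewrite !ltr0_norm// ?lerN2// (le_lt_trans ax).
apply: le_trans (fK _ _ (B _ _ _) (B _ _ _)) _ => //; try lra.
rewrite gtr0_norm ?subr_gt0// mulrC ler_wpM2l ?subr_ge0 ?(ltW li)//.
by rewrite (le_trans (ler_norm K))// lerDr.
Qed.

Lemma lacD f g : loc_abs_cont f -> loc_abs_cont g -> loc_abs_cont (fun x => f x + g x).
Proof.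
move=> cf cg a b ab e e0; have e2 : 0 < e / 2 by rewrite divr_gt0.
have [d d0 H] := cf a b ab _ e2; have [d' d'0 H'] := cg a b ab _ e2.
exists (Num.min d d'); first by rewrite lt_min d0.
move=> n l r lr dis; rewrite lt_min => /andP[/(H _ _ _ lr dis) s1 /(H' _ _ _ lr dis) s2].
rewrite [ltRHS]splitr (le_lt_trans _ (ltrD s1 s2))// -big_split/=.
apply: ler_sum => i _; rewrite (_ : _ - _ = (f (r i) - f (l i)) + (g (r i) - g (l i))) ?ler_normD//.
by ring.
Qed.

Lemma lacM f g : loc_abs_cont f -> loc_abs_cont g -> loc_abs_cont (fun x => f x * g x).
Proof.
move=> cf cg a b ab e e0.
have [B fB] := continuous_bounded a b (lac_cts cf).
have [B' gB] := continuous_bounded a b (lac_cts cg).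
pose M := 1 + `|B| + `|B'|.
have M0 : 0 < M by rewrite /M; have := normr_ge0 B; have := normr_ge0 B'; lra.
have e2 : 0 < e / 2 / M by rewrite !divr_gt0.
have [d d0 H] := cf a b ab _ e2; have [d' d'0 H'] := cg a b ab _ e2.
exists (Num.min d d'); first by rewrite lt_min d0.
move=> n l r lr dis; rewrite lt_min => /andP[/(H _ _ _ lr dis) s1 /(H' _ _ _ lr dis) s2].
move: s1; rewrite ltr_pdivlMr// => s1; move: s2; rewrite ltr_pdivlMr// => s2.
rewrite [ltRHS]splitr (le_lt_trans _ (ltrD s1 s2))// !mulr_suml -big_split/=.
apply: ler_sum => i _; have /and3P[al li rb] := lr i.
have -> : f (r i) * g (r i) - f (l i) * g (l i) =
  (f (r i) - f (l i)) * g (r i) + (g (r i) - g (l i)) * f (l i) by ring.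
rewrite (le_trans (ler_normD _ _))// !normrM lerD// ler_wpM2l//.
- rewrite (le_trans (gB _ _)) ?rb ?(le_trans al (ltW li))//.
  by rewrite (le_trans (ler_norm B'))// /M; have := normr_ge0 B; lra.
- rewrite (le_trans (fB _ _)) ?al ?(le_trans (ltW li) rb)//.
  by rewrite (le_trans (ler_norm B))// /M; have := normr_ge0 B'; lra.
Qed.

Lemma lac_cst (c : R) : loc_abs_cont (fun=> c).
Proof. by apply: loc_lipschitz_lac => r; exists 0 => x y; rewrite subrr normr0 mul0r. Qed.

Lemma lac_id : loc_abs_cont (@idfun R).
Proof. by apply: loc_lipschitz_lac => r; exists 1 => x y; rewrite mul1r. Qed.

Lemma lacN f : loc_abs_cont f -> loc_abs_cont (fun x => - f x).
Proof.
move=> /(lacM (lac_cst (-1))); congr loc_abs_cont.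
by apply/funext => x; rewrite mulN1r.
Qed.

Lemma lacB f g : loc_abs_cont f -> loc_abs_cont g -> loc_abs_cont (fun x => f x - g x).
Proof. by move=> cf /lacN; exact: lacD. Qed.

Lemma lip_comp_lac f g (K : R) : loc_abs_cont f ->
  (forall a b, a < b -> exists K, forall x y, a <= x <= b -> a <= y <= b ->
     `|g (f y) - g (f x)| <= K * `|f y - f x|) -> loc_abs_cont (fun x => g (f x)).
Proof.
move=> cf gK a b ab e e0; have [L HL] := gK a b ab.
have K0 : 0 < 1 + `|L| by rewrite ltr_pwDl.
have [|d d0 H] := cf a b ab (e / (1 + `|L|)); first by rewrite divr_gt0.
exists d => // n l r lr dis /(H _ _ _ lr dis); rewrite ltr_pdivlMr// => /le_lt_trans; apply.
rewrite mulr_suml; apply: ler_sum => i _; have /and3P[al li rb] := lr i.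
apply: le_trans (HL _ _ _ _) _.
- by rewrite al (le_trans (ltW li)).
- by rewrite rb andbT (le_trans al)// ltW.
- by rewrite mulrC ler_wpM2l// (le_trans (ler_norm L))// lerDr.
Qed.

Lemma lac_inv f : loc_abs_cont f -> (forall x, 0 < f x) -> loc_abs_cont (fun x => (f x)^-1).
Proof.
move=> cf f0; apply: (lip_comp_lac 0 cf) => a b ab.
have [|c _ H] := @EVT_min R f a b (ltW ab).
  by apply: continuous_subspaceT; exact: lac_cts.
exists (f c ^- 2) => x y xab yab.
have -> : (f y)^-1 - (f x)^-1 = - (f y - f x) / (f x * f y).
  by field; rewrite !gt_eqF ?f0.
rewrite normrM normrN mulrC ler_wpM2r// gtr0_norm ?invr_gt0 ?mulr_gt0//.
rewrite lef_pV2 ?posrE ?exprn_gt0 ?mulr_gt0// expr2 ler_pM ?(ltW (f0 _))// H//.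
Qed.

Lemma lac_nondecreasing f (a b : R) : loc_abs_cont f -> a <= b ->
  {ae mu, forall x, a <= x <= b -> exists2 v, 0 <= v & is_derive x (1 : R) f v} -> f a <= f b.
Proof.
move=> cf; rewrite le_eqVlt => /predU1P[->//|ab]; apply: abs_cont_nondecreasing => //.
exact: cf.
Qed.

(** Monotonicity of [L * x + f x] and of [L * x - f x]. *)
Lemma lac_lipschitz f (a b L : R) : loc_abs_cont f -> a <= b ->
  {ae mu, forall x, a <= x <= b -> exists2 v, `|v| <= L & is_derive x (1 : R) f v} ->
  `|f b - f a| <= L * (b - a).
Proof.
move=> cf ab fL; rewrite ler_norml.
have cL : loc_abs_cont (fun x => L * x) by apply: lacM (lac_cst _) lac_id.
have dL x : is_derive x (1 : R) (fun x => L * x) L.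
  by apply/is_derive_eps => e e0; exists 1 => // y _; rewrite -mulrBr subrr normr0 mulr_ge0// ltW.
apply/andP; split.
- have := lac_nondecreasing (lacD cf cL) ab; rewrite -lerBlDr; move=> H.
  suff : f a + L * a <= f b + L * b by lra.
  rewrite -lerBlDr; apply: H; apply: (ae_imp _ fL) => x H /H[v vL dv].
  exists (v + L); first by move: vL; rewrite ler_norml; lra.
  exact: is_deriveD.
- suff : L * a - f a <= L * b - f b by lra.
  apply: lac_nondecreasing (lacB cL cf) ab _; apply: (ae_imp _ fL) => x H /H[v vL dv].
  exists (L - v); first by move: vL; rewrite ler_norml; lra.
  exact: is_deriveB.
Qed.
End lac.

Section cac.
Variable R : realType.
Local Notation mu := (@lebesgue_measure R).
Implicit Types (f g h : R -> R[i]).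

Definition cac f := loc_abs_cont (fun t => Re (f t)) /\ loc_abs_cont (fun t => Im (f t)).

Lemma cacD f g : cac f -> cac g -> cac (fun x => f x + g x).
Proof.
move=> [f1 f2] [g1 g2]; split.
- rewrite (funext (fun t => ReD (f t) (g t))); exact: lacD.
- rewrite (funext (fun t => ImD (f t) (g t))); exact: lacD.
Qed.

Lemma cacM f g : cac f -> cac g -> cac (fun x => f x * g x).
Proof.
move=> [f1 f2] [g1 g2]; split.
- by rewrite (funext (fun t => ReM (f t) (g t))); apply: lacB; exact: lacM.
- by rewrite (funext (fun t => ImM (f t) (g t))); apply: lacD; exact: lacM.
Qed.

Lemma cac_cst (c : R[i]) : cac (fun=> c). Proof. by split; exact: lac_cst. Qed.

Lemma cac_real (f : R -> R) : loc_abs_cont f -> cac (fun x => (f x)%:C).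
Proof. by split => //=; exact: lac_cst. Qed.

Lemma cacN f : cac f -> cac (fun x => - f x).
Proof.
move=> [f1 f2]; split.
- rewrite (funext (fun t => ReN (f t))); exact: lacN.
- rewrite (funext (fun t => ImN (f t))); exact: lacN.
Qed.

Lemma cacB f g : cac f -> cac g -> cac (fun x => f x - g x).
Proof. by move=> cf /cacN; exact: cacD. Qed.

Lemma cac_conj f : cac f -> cac (fun x => conjc (f x)).
Proof.
move=> [f1 f2]; split.
- by rewrite (funext (fun t => Re_conj (f t))).
- rewrite (funext (fun t => Im_conj (f t))); exact: lacN.
Qed.

Lemma has_cderivD f g x u v : has_cderiv f x u -> has_cderiv g x v ->
  has_cderiv (fun x => f x + g x) x (u + v).
Proof.
move=> [f1 f2] [g1 g2]; split.
- rewrite (funext (fun t => ReD (f t) (g t))); rewrite ReD; exact: is_deriveD.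
- rewrite (funext (fun t => ImD (f t) (g t))); rewrite ImD; exact: is_deriveD.
Qed.

Lemma has_cderivM f g x u v : has_cderiv f x u -> has_cderiv g x v ->
  has_cderiv (fun x => f x * g x) x (u * g x + f x * v).
Proof.
move=> [f1 f2] [g1 g2]; split.
- rewrite (funext (fun t => ReM (f t) (g t))).
  have H := is_deriveB (is_deriveM f1 g1) (is_deriveM f2 g2).
  apply: (is_derive_eq H); rewrite !cplxE -![_ *: _]/(_ * _); ring.
- rewrite (funext (fun t => ImM (f t) (g t))).
  have H := is_deriveD (is_deriveM f1 g2) (is_deriveM f2 g1).
  apply: (is_derive_eq H); rewrite !cplxE -![_ *: _]/(_ * _); ring.
Qed.

Lemma has_cderiv_cst c x : has_cderiv (fun=> c : R[i]) x 0.
Proof. by split; exact: is_derive_cst. Qed.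

Lemma has_cderivN f x u : has_cderiv f x u -> has_cderiv (fun x => - f x) x (- u).
Proof.
move=> [f1 f2]; split.
- rewrite (funext (fun t => ReN (f t))); rewrite ReN; exact: is_deriveN.
- rewrite (funext (fun t => ImN (f t))); rewrite ImN; exact: is_deriveN.
Qed.

Lemma has_cderivB f g x u v : has_cderiv f x u -> has_cderiv g x v ->
  has_cderiv (fun x => f x - g x) x (u - v).
Proof. by move=> fu /has_cderivN; exact: has_cderivD. Qed.

Lemma has_cderiv_conj f x u : has_cderiv f x u -> has_cderiv (fun x => conjc (f x)) x (conjc u).
Proof.
move=> [f1 f2]; split.
- by rewrite (funext (fun t => Re_conj (f t))); rewrite Re_conj.
- rewrite (funext (fun t => Im_conj (f t))); rewrite Im_conj; exact: is_deriveN.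
Qed.

Lemma has_cderiv_real (f : R -> R) x u : is_derive x (1 : R) f u -> has_cderiv (fun x => (f x)%:C) x u%:C.
Proof. by split => //=; exact: is_derive_cst. Qed.

(** The factor [2] comes from treating real and imaginary parts separately; only the order of
    magnitude matters later. *)
Lemma cac_lipschitz f (a b L : R) : cac f -> a <= b ->
  {ae mu, forall x, a <= x <= b -> exists2 v, cabs v <= L & has_cderiv f x v} ->
  cabs (f b - f a) <= 2 * L * (b - a).
Proof.
move=> [f1 f2] ab H; rewrite (le_trans (cabs_le _))// !cplxE -mulrA mulr_natl mulr2n lerD//.
- apply: lac_lipschitz f1 ab _; apply: (ae_imp _ H) => x {}H /H[v vL [dv _]].
  by exists (Re v) => //; rewrite (le_trans (cabs_Re _)).
- apply: lac_lipschitz f2 ab _; apply: (ae_imp _ H) => x {}H /H[v vL [_ dv]].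
  by exists (Im v) => //; rewrite (le_trans (cabs_Im _)).
Qed.

Lemma cac_const f : cac f -> {ae mu, forall x, has_cderiv f x 0} -> forall x y, f x = f y.
Proof.
move=> cf df; suff H a b : a <= b -> f b = f a.
  by move=> x y; have [/H|/ltW/H] := leP x y.
move=> ab; apply/eqP; rewrite -subr_eq0 -cabs0_eq0 eq_le cabs_ge0 andbT.
have := @cac_lipschitz f a b 0 cf ab; rewrite mulr0 mul0r; apply.
by apply: (ae_imp _ df) => x dx _; exists 0; rewrite ?cabs0.
Qed.
End cac.

(** * Primitives of locally bounded measurable functions *)

Section primitive.
Variable R : realType.
Local Notation mu := (@lebesgue_measure R).
Implicit Types (h : R -> R).

Lemma lebesgue_measure_oc_lty (a b : R) : (mu `]a, b] < +oo)%E.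
Proof. by rewrite lebesgue_measure_itv/=; case: ifP => _; rewrite ?ltry//= -EFinD ltry. Qed.

Definition loc_bounded_meas h := measurable_fun setT h /\
  forall r : R, exists B, forall x, `|x| <= r -> `|h x| <= B.

Lemma loc_bounded_integrable h (a b : R) : loc_bounded_meas h ->
  mu.-integrable `]a, b] (EFin \o h).
Proof.
move=> [mh hB]; apply: measurable_bounded_integrable => //.
- exact: lebesgue_measure_oc_lty.
- exact: measurable_funTS.
- have [B hBB] := hB (`|a| + `|b|).
  exists B; split; first exact: num_real.
  move=> M BM x /=; rewrite in_itv/= => /andP[ax xb].
  rewrite (le_trans (hBB _ _)) ?(ltW BM)//.
  have := ler_norm b; have := ler_norm (- a); rewrite normrN ler_norml => ? ?.
  by have := normr_ge0 a; have := normr_ge0 b; lra.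
Qed.

Lemma loc_bounded_locally_integrable h : loc_bounded_meas h -> locally_integrable setT h.
Proof.
move=> mhB; split; [by case: mhB|exact: openT|move=> K _ cK].
have [M [_ KM]] := compact_bounded cK.
have KI : K `<=` `]- (1 + `|M|) - 1, 1 + `|M| ].
  move=> x Kx /=; rewrite in_itv/=.
  have M1 : M < 1 + `|M| by rewrite (le_lt_trans (ler_norm M))// ltrDr.
  have : `|x| <= 1 + `|M| by exact: KM M1 x Kx.
  by rewrite ler_norml; lra.
have := @integrableS _ _ _ mu _ K (EFin \o h) _ _ KI (loc_bounded_integrable _ _ mhB).
by case/(_ _ _)/integrableP => //; exact: compact_measurable.
Qed.

Definition prim h (x : R) : R :=
  if 0 <= x then \int[mu]_(t in `]0, x]) h t else - \int[mu]_(t in `]x, 0]) h t.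

Lemma prim0 h : prim h 0 = 0.
Proof. by rewrite /prim lexx set_itvoc0 Rintegral_set0. Qed.

(** A base point to the left of both [0] and [x] removes the sign split in [prim]; additivity and
    the derivative are then those of an integral over []A, x]]. *)
Lemma primE h (A x : R) : loc_bounded_meas h -> A <= x -> A <= 0 ->
  prim h x = \int[mu]_(t in `]A, x]) h t - \int[mu]_(t in `]A, 0]) h t.
Proof.
move=> hb Ax A0; rewrite /prim; case: ifPn => [x0|]; last rewrite -ltNge => x0.
- rewrite (@Rintegral_itvB _ h (BRight A) (BRight x) 0)//.
  exact: loc_bounded_integrable.
- rewrite -(@Rintegral_itvB _ h (BRight A) (BRight 0) x) ?opprB//.
  + exact: loc_bounded_integrable.
  + by rewrite bnd_simp ltW.
Qed.

Lemma primB h (x y : R) : loc_bounded_meas h -> x <= y ->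
  prim h y - prim h x = \int[mu]_(t in `]x, y]) h t.
Proof.
move=> hb xy; pose A := Num.min 0 x.
rewrite (@primE h A x)// ?ge_min ?lexx ?orbT// (@primE h A y)//; last 2 first.
- by rewrite /A; have : Num.min 0 x <= x; [rewrite ge_min lexx orbT|lra].
- by rewrite ge_min lexx.
rewrite -(@Rintegral_itvB _ h (BRight A) (BRight y) x)//; first by ring.
- exact: loc_bounded_integrable.
- by rewrite bnd_simp ge_min lexx orbT.
Qed.

Lemma prim_lip h (x y r B : R) : loc_bounded_meas h ->
  (forall t, `|t| <= r -> `|h t| <= B) -> `|x| <= r -> `|y| <= r ->
  `|prim h y - prim h x| <= B * `|y - x|.
Proof.
move=> hb hB xr yr; wlog xy : x y xr yr / x <= y.
  move=> W; have [xy|/ltW yx] := leP x y; first exact: W.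
  by rewrite distrC (distrC y); exact: W.
have iI := loc_bounded_integrable x y hb.
rewrite primB// (le_trans (le_normr_Rintegral _ iI))//.
have -> : `|y - x| = fine (mu `]x, y]).
  rewrite lebesgue_measure_itv/= lte_fin.
  move: xy; rewrite le_eqVlt => /predU1P[->|xy]; first by rewrite ltxx subrr normr0.
  by rewrite xy/= gtr0_norm ?subr_gt0.
rewrite -Rintegral_cst//; apply: le_Rintegral => //.
- exact: integrable_abse iI.
- apply: loc_bounded_integrable; split; first exact: measurable_cst.
  by move=> ?; exists `|B|.
- move=> t /=; rewrite in_itv/= => /andP[xt ty]; apply: hB.
  by move: xr yr; rewrite !ler_norml; lra.
Qed.

Lemma prim_lac h : loc_bounded_meas h -> loc_abs_cont (prim h).
Proof.
move=> hb; apply: loc_lipschitz_lac => r; have [B hB] := hb.2 r.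
by exists B => x y xr yr; exact: (prim_lip hb hB).
Qed.

Lemma prim_derive h : loc_bounded_meas h ->
  {ae mu, forall x, is_derive x (1 : R) (prim h) (h x)}.
Proof.
move=> hb; have := lebesgue_differentiation (loc_bounded_locally_integrable hb).
apply: ae_imp => x lx.
pose A := Num.min 0 x - 1.
have Ax : A < x by rewrite /A; have : Num.min 0 x <= x; [rewrite ge_min lexx orbT|lra].
have A0 : A <= 0 by rewrite /A; have : Num.min 0 x <= 0; [rewrite ge_min lexx|lra].
have x1 : x < x + 1 by rewrite ltrDl.
have := FTC1_lebesgue_pt x1 (loc_bounded_integrable A (x + 1) hb) _ lx.
move=> /(_ Ax)[dF eF].
have : is_derive x (1 : R) (fun y : R => \int[mu]_(t in `]A, y]) h t) (h x).
  by apply: (DeriveDef dF); rewrite -derive1E.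
move=> /is_derive_eps H; apply/is_derive_eps => e /H[d d0 xd].
exists (Num.min d (x - A)); first by rewrite lt_min d0 subr_gt0.
move=> y; rewrite lt_min => /andP[/xd yd]; rewrite ltr_norml => /andP[yA _].
rewrite (@primE h A y)//; last by lra.
rewrite (@primE h A x)// ?(ltW Ax)//.
by rewrite (_ : forall a b c : R, a - c - (b - c) = a - b)// => a b c; ring.
Qed.
End primitive.

Section null_sets.
Variable R : realType.
Local Notation mu := (@lebesgue_measure R).

Lemma ae_opp (P : R -> Prop) : {ae mu, forall x, P x} -> {ae mu, forall x, P (- x)}.
Proof.
move=> [N [mN N0 NP]]; exists (-%R @^-1` N); split.
- have cN : continuous (-%R : R -> R) by move=> x; exact: opp_continuous.
  have := continuous_measurable_fun cN measurableT mN.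
  by rewrite setTI.
- by have := lebesgue_measureN mN; rewrite /pushforward => ->.
- by move=> x /= nP; apply: NP.
Qed.

(* For a compact [K] inside [p @^-1` N], the distribution function of [K] composed with the inverse [q] of [p] is absolutely continuous and locally constant off the null set [N], hence constant. *)
Lemma ae_preimage (p q : R -> R) (P : R -> Prop) : {homo p : x y / x < y} ->
  cancel p q -> cancel q p -> loc_abs_cont p -> loc_abs_cont q ->
  {ae mu, forall x, P x} -> {ae mu, forall x, P (p x)}.
Proof.
move=> pinc pq qp acp acq [N [mN N0 NP]].
have mpN : measurable (p @^-1` N).
  have := continuous_measurable_fun (lac_cts acp) measurableT mN.
  by rewrite setTI.
suff pN_n n : mu (p @^-1` N `&` `]- n%:R, n%:R]) = 0%E.
  have : mu.-negligible (\bigcup_n (p @^-1` N `&` `](- n%:R), n%:R])).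
    apply: negligible_bigcup => n; exists (p @^-1` N `&` `](- n%:R), n%:R]).
    split; [by apply: measurableI|exact: pN_n|by []].
  apply: negligibleS => x /= nP.
  exists (Num.truncn `|x|).+1 => //; split => /=; first exact: NP.
  have := truncnS_gt `|x|; rewrite in_itv/= => H.
  by rewrite -ltrN2 opprK; move: (H); rewrite ltr_norml => /andP[? /ltW ->]; lra.
set D := _ `&` _; have mD : measurable D by apply: measurableI.
have Dfin : (mu D < +oo)%E.
  apply: (@le_lt_trans _ _ (mu `](- n%:R : R), n%:R])).
    by apply: le_measure; rewrite ?inE//; exact: subIsetr.
  exact: lebesgue_measure_oc_lty.
apply/eqP; rewrite eq_le measure_ge0 andbT leNgt; apply/negP => D0.
have DE : mu D = (fine (mu D))%:E by rewrite fineK// ge0_fin_numE.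
have fD0 : 0 < fine (mu D) by rewrite -lte_fin -DE.
have [K [cK KD KmD]] := lebesgue_regularity_inner mD Dfin fD0.
have mK : measurable K by exact: compact_measurable.
have Kb : loc_bounded_meas (\1_K : R -> R).
  split; first by exact: measurable_indic.
  by move=> ?; exists 1 => x _; rewrite indicE; case: (x \in K); rewrite ?normr1// normr0.
pose k := prim (\1_K : R -> R).
have acK : loc_abs_cont (fun y => k (q y)).
  apply: (lip_comp_lac 0 acq) => a b ab.
  exists 1 => x y _ _.
  apply: (@prim_lip R _ (q x) (q y) (`|q x| + `|q y|) 1) => //.
  + by move=> t _; rewrite indicE; case: (t \in K); rewrite ?normr1// normr0.
  + by rewrite lerDl.
  + by rewrite lerDr.
have k_cst a b : a <= b -> (forall t, a <= t <= b -> ~ K t) -> k b = k a.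
  move=> ab nK; apply/eqP; rewrite -subr_eq0 /k primB//.
  rewrite (_ : \int[mu]_(t in `]a, b]) _ = \int[mu]_(t in `]a, b]) 0).
    by rewrite Rintegral_cst// mul0r.
  apply: eq_Rintegral => t; rewrite inE/= in_itv/= => /andP[/ltW at_ tb].
  by rewrite indicE memNset//; apply: nK; rewrite at_.
have dK : {ae mu, forall y, is_derive y (1 : R) (fun y => k (q y)) 0}.
  exists N; split => // y /= ndy.
  have [//|nNy] := pselect (N y); exfalso; apply: ndy.
  have nK : ~ K (q y) by move=> /KD[/=]; rewrite qp.
  have /nbhs_ballP[d /= d0 dK] : nbhs (q y) (~` K).
    apply: open_nbhs_nbhs; split => //; apply: closed_openC.
    exact: compact_closed.
  have [d' d'0 d'q] := lac_continuous acq y d0.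
  apply/is_derive_eps => e e0; exists d' => // z /d'q zd.
  suff -> : k (q z) = k (q y) by rewrite subrr mul0r subr0 normr0 mulr_ge0// ltW.
  move: zd; rewrite ltr_norml => /andP[z1 z2].
  have nKt t : `|t - q y| < d -> ~ K t.
    by move=> td; apply: dK; rewrite /ball/= distrC.
  have [qyz|/ltW qzy] := leP (q y) (q z).
    by apply: k_cst => // t /andP[? ?]; apply: nKt; rewrite ltr_norml; lra.
  by apply/esym/k_cst => // t /andP[? ?]; apply: nKt; rewrite ltr_norml; lra.
have kc a b : a <= b -> k (q b) = k (q a).
  move=> ab; apply/eqP; rewrite -subr_eq0 -normr_le0.
  have := @lac_lipschitz R _ a b 0 acK ab; rewrite mul0r; apply.
  by apply: (ae_imp _ dK) => x dx _; exists 0; rewrite ?normr0.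
have n0 : (- n%:R : R) <= n%:R by rewrite lerNl (le_trans _ (ler0n _ n))// oppr_le0.
have pn : p (- n%:R) <= p n%:R.
  by move: n0; rewrite le_eqVlt => /predU1P[->//|/pinc/ltW].
have K0 : mu K = 0%E.
  have := kc _ _ pn; rewrite !pq => /eqP; rewrite -subr_eq0 /k primB// => /eqP.
  rewrite /Rintegral integral_indic//.
  have -> : K `&` `](- n%:R : R), n%:R] = K by apply/setIidPl => x /KD[].
  have Kfin : mu K \is a fin_num by rewrite ge0_fin_numE// compact_finite_measure.
  by move=> K0; rewrite -(fineK Kfin) K0.
have : (mu D <= mu K + mu (D `\` K))%E.
  rewrite -measureU//; last by rewrite setDIK.
  - by rewrite setDUK.
  - exact: measurableD.
by rewrite K0 add0e leNgt DE KmD.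
Qed.
End null_sets.

(** * Complex differentiability and Cauchy estimates *)

Section ultralimit.
Variable R : realType.

(* Limits along a fixed free ultrafilter exist for every bounded sequence, which replaces all compactness arguments. *)
Definition free_ultrafilter : set_system nat :=
  projT1 (cid (ultraFilterLemma eventually_filter)).

Lemma free_ultrafilter_ultra : UltraFilter free_ultrafilter.
Proof. by rewrite /free_ultrafilter; case: cid => G []. Qed.

Lemma free_ultrafilter_eventually (A : set nat) n0 :
  (forall n, (n0 <= n)%N -> A n) -> free_ultrafilter A.
Proof.
rewrite /free_ultrafilter; case: cid => G [/= _ H] HA; apply: H.
by exists n0.
Qed.

Local Instance free_ultrafilter_filter : ProperFilter free_ultrafilter.
Proof. by case: free_ultrafilter_ultra. Qed.

Definition ulim (u : nat -> R) : R := lim (u n @[n --> free_ultrafilter]).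

Lemma ulim_cvg (u : nat -> R) B n0 : (forall n, (n0 <= n)%N -> `|u n| <= B) ->
  u n @[n --> free_ultrafilter] --> ulim u.
Proof.
move=> uB; suff [l ul] : exists l : R, u n @[n --> free_ultrafilter] --> l.
  by rewrite /ulim (cvg_lim (@Rhausdorff R) ul).
have [|l [_ cl]] := @segment_compact R (- B) B (u n @[n --> free_ultrafilter])
    (fmap_proper_filter _ free_ultrafilter_filter).
  by apply: (@free_ultrafilter_eventually _ n0) => n n0n; rewrite /= in_itv/= -ler_norml; exact: uB.
exists l => V lV; have [//|nV] := in_ultra_setVsetC (u @^-1` V) free_ultrafilter_ultra.
by have [x [/= nVx Vx]] := cl (~` V) V nV lV.
Qed.

Definition cbounded (u : nat -> R[i]) := exists B n0, forall n, (n0 <= n)%N -> cabs (u n) <= B.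

Definition culim (u : nat -> R[i]) : R[i] :=
  (ulim (fun n => Re (u n))) +i* (ulim (fun n => Im (u n))).

Lemma culim_cvgP (u : nat -> R[i]) : cbounded u ->
  Re (u n) @[n --> free_ultrafilter] --> Re (culim u) /\
  Im (u n) @[n --> free_ultrafilter] --> Im (culim u).
Proof.
move=> [B [n0 uB]]; split; apply: (@ulim_cvg _ B n0) => n n0n.
  exact: le_trans (cabs_Re _) (uB n n0n).
exact: le_trans (cabs_Im _) (uB n n0n).
Qed.

Lemma culim_unique (u : nat -> R[i]) (l : R[i]) :
  Re (u n) @[n --> free_ultrafilter] --> Re l ->
  Im (u n) @[n --> free_ultrafilter] --> Im l -> culim u = l.
Proof. by move=> ? ?; apply: complex_eq; exact: (cvg_lim (@Rhausdorff R)). Qed.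

Lemma culim_eq (u : nat -> R[i]) (l : R[i]) :
  (forall e, 0 < e -> exists n0, forall n, (n0 <= n)%N -> cabs (u n - l) <= e) -> culim u = l.
Proof.
move=> H; apply: culim_unique; apply/cvgrPdist_le => e /H[n0 n0P];
  apply: (@free_ultrafilter_eventually _ n0) => n /n0P; rewrite distrC => /(le_trans _); apply.
- by rewrite -ReB cabs_Re.
- by rewrite -ImB cabs_Im.
Qed.

Lemma culim_cst c : culim (fun=> c) = c.
Proof. by apply: culim_eq => e e0; exists 0%N => n _; rewrite subrr cabs0 ltW. Qed.

Lemma culimD u v : cbounded u -> cbounded v ->
  culim (fun n => u n + v n) = culim u + culim v.
Proof.
move=> /culim_cvgP[u1 u2] /culim_cvgP[v1 v2]; apply: culim_unique.
- under eq_cvg do rewrite ReD; rewrite ReD; exact: cvgD.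
- under eq_cvg do rewrite ImD; rewrite ImD; exact: cvgD.
Qed.

Lemma culimM u v : cbounded u -> cbounded v ->
  culim (fun n => u n * v n) = culim u * culim v.
Proof.
move=> /culim_cvgP[u1 u2] /culim_cvgP[v1 v2]; apply: culim_unique.
- under eq_cvg do rewrite ReM; rewrite ReM; apply: cvgB; exact: cvgM.
- under eq_cvg do rewrite ImM; rewrite ImM; apply: cvgD; exact: cvgM.
Qed.

Lemma cbounded_cst c : cbounded (fun=> c). Proof. by exists (cabs c), 0%N. Qed.

Lemma cboundedD u v : cbounded u -> cbounded v -> cbounded (fun n => u n + v n).
Proof.
move=> [B [n0 uB]] [B' [n1 vB]]; exists (B + B'), (maxn n0 n1) => n.
by rewrite geq_max => /andP[/uB ? /vB ?]; rewrite (le_trans (cabsD _ _))// lerD.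
Qed.

Lemma cboundedM u v : cbounded u -> cbounded v -> cbounded (fun n => u n * v n).
Proof.
move=> [B [n0 uB]] [B' [n1 vB]]; exists (B * B'), (maxn n0 n1) => n.
by rewrite geq_max => /andP[/uB ? /vB ?]; rewrite cabsM ler_pM ?cabs_ge0.
Qed.

Lemma cboundedN u : cbounded u -> cbounded (fun n => - u n).
Proof. by move=> [B [n0 uB]]; exists B, n0 => n; rewrite cabsN; exact: uB. Qed.

Lemma cbounded_conj u : cbounded u -> cbounded (fun n => conjc (u n)).
Proof. by move=> [B [n0 uB]]; exists B, n0 => n; rewrite cabs_conj; exact: uB. Qed.

Lemma culimZ c u : cbounded u -> culim (fun n => c * u n) = c * culim u.
Proof. by move=> ub; rewrite culimM ?culim_cst//; exact: cbounded_cst. Qed.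

Lemma culimN u : cbounded u -> culim (fun n => - u n) = - culim u.
Proof.
by move=> ub; rewrite -mulN1r -culimZ//; congr culim; apply/funext => n; rewrite mulN1r.
Qed.

Lemma culimB u v : cbounded u -> cbounded v ->
  culim (fun n => u n - v n) = culim u - culim v.
Proof. by move=> ub vb; rewrite culimD ?culimN//; exact: cboundedN. Qed.

Lemma culim_conj u : cbounded u -> culim (fun n => conjc (u n)) = conjc (culim u).
Proof.
move=> /culim_cvgP[u1 u2]; apply: culim_unique.
- by under eq_cvg do rewrite Re_conj; rewrite Re_conj.
- by under eq_cvg do rewrite Im_conj; rewrite Im_conj; exact: cvgN.
Qed.

Lemma culim_Re_ge u (K : R) n0 : cbounded u -> (forall n, (n0 <= n)%N -> K <= Re (u n)) ->
  K <= Re (culim u).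
Proof.
move=> /culim_cvgP[u1 u2] H.
rewrite -(cvg_lim (@Rhausdorff R) u1); apply: limr_ge; first by apply/cvg_ex; exists (Re (culim u)).
exact: (@free_ultrafilter_eventually _ n0).
Qed.

(** The bound passes to the limit through the real part of [u * conjc u]. Treating [Re] and [Im]
    separately would lose a factor, and the sharp bound [1] for Schur functions must survive. *)
Lemma culim_le u (K : R) n0 : cbounded u -> (forall n, (n0 <= n)%N -> cabs (u n) <= K) ->
  cabs (culim u) <= K.
Proof.
move=> ub H; have K0 : 0 <= K by rewrite (le_trans _ (H _ (leqnn n0)))// cabs_ge0.
rewrite cabs_le_sqr// -cabs_sqr.
have -> : cabs (culim u) ^+ 2 = - Re (culim (fun n => - (u n * conjc (u n)))).
  have cb := cbounded_conj ub; have mb := cboundedM ub cb.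
  by rewrite culimN// culimM// culim_conj// conj_mul /= opprK.
rewrite lerNl; apply: (@culim_Re_ge _ _ n0).
  by apply/cboundedN/cboundedM => //; exact: cbounded_conj.
by move=> n /H; rewrite cabs_le_sqr// conj_mul /= lerN2 cabs_sqr.
Qed.

End ultralimit.

(** * Calculus of functions with a uniform second-order remainder *)

Section C11.
Variable R : realType.
Implicit Types (D E : R[i] -> Prop) (f g : R[i] -> R[i]).

(* On the real segment [D] this is a statement about paths, on open [D] about holomorphic functions. *)
Definition C11 D (B : R) f f' := forall z, D z ->
  [/\ cabs (f z) <= B, cabs (f' z) <= B &
      forall w, D w -> cabs (f w - f z - f' z * (w - z)) <= B * cabs (w - z) ^+ 2].

Definition hol D f f' := exists B, C11 D B f f'.

Lemma C11_sub D E B f f' : (forall z, E z -> D z) -> C11 D B f f' -> C11 E B f f'.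
Proof. by move=> ED H z /ED/H[? ? H']; split => // w /ED/H'. Qed.

Lemma hol_sub D E f f' : (forall z, E z -> D z) -> hol D f f' -> hol E f f'.
Proof. by move=> ED [B]; exists B; exact: C11_sub ED _. Qed.

Lemma C11_ge0 D B f f' z : C11 D B f f' -> D z -> 0 <= B.
Proof. by move=> H /H[+ _ _]; apply: le_trans; exact: cabs_ge0. Qed.

(** Up to distance [1] the quadratic remainder is at most linear; beyond it the bound [2 * B] on the
    difference suffices, so [D] may have any shape. *)
Lemma C11_lip D B f f' z w : C11 D B f f' -> D z -> D w ->
  cabs (f w - f z) <= 2 * B * cabs (w - z).
Proof.
move=> H Dz Dw; have [fz f'z /(_ w Dw) r] := H z Dz; have [fw _ _] := H w Dw.
have B0 := C11_ge0 H Dz; have [h1|/ltW h1] := leP (cabs (w - z)) 1.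
- rewrite -[f w - f z](subrK (f' z * (w - z))) (le_trans (cabsD _ _))//.
  rewrite -mulrA mulr_natl mulr2n lerD//.
    by rewrite (le_trans r)// ler_wpM2l// expr2 -[leRHS]mulr1 ler_wpM2l// cabs_ge0.
  by rewrite cabsM ler_wpM2r// cabs_ge0.
- rewrite (le_trans (cabsB _ _))//.
  have : B * 1 <= B * cabs (w - z) by rewrite ler_wpM2l.
  by move: fz fw; lra.
Qed.

(** Adding the expansions at [z] and at [w] cancels the values of [f] and leaves
    [(f' w - f' z) * (w - z)]. *)
Lemma C11_deriv_lip D B f f' z w : C11 D B f f' -> D z -> D w ->
  cabs (f' w - f' z) <= 2 * B * cabs (w - z).
Proof.
move=> H Dz Dw; have [->|wz] := eqVneq w z; first by rewrite !subrr cabs0 mulr0.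
have [_ _ /(_ w Dw) r1] := H z Dz; have [_ _ /(_ z Dz) r2] := H w Dw.
have wz0 : 0 < cabs (w - z) by rewrite cabs_gt0 subr_eq0.
rewrite -(ler_pM2r wz0) -cabsM.
have -> : (f' w - f' z) * (w - z) =
  (f w - f z - f' z * (w - z)) + (f z - f w - f' w * (z - w)) by ring.
rewrite (le_trans (cabsD _ _))//.
by move: r1 r2; rewrite (cabs_distC z w); lra.
Qed.

Lemma hol_cst D c : hol D (fun=> c) (fun=> 0).
Proof.
exists (cabs c) => z _; split; rewrite ?cabs0 ?cabs_ge0// => w _.
by rewrite !subrr mul0r subr0 cabs0 mulr_ge0 ?cabs_ge0 ?sqr_ge0.
Qed.

Lemma hol_id D (M : R) : (forall z, D z -> cabs z <= M) -> hol D (fun z => z) (fun=> 1).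
Proof.
move=> H; exists (Num.max M 1) => z /H zM; split.
- by rewrite le_max zM.
- by rewrite cabs1 le_max lexx orbT.
- move=> w _; rewrite mul1r subrr cabs0 mulr_ge0 ?sqr_ge0//.
  by rewrite le_max ler01 orbT.
Qed.

Lemma C11D D B B' f f' g g' : C11 D B f f' -> C11 D B' g g' ->
  C11 D (B + B') (fun z => f z + g z) (fun z => f' z + g' z).
Proof.
move=> F G z Dz; have [f1 f2 f3] := F z Dz; have [g1 g2 g3] := G z Dz; split.
- by rewrite (le_trans (cabsD _ _))// lerD.
- by rewrite (le_trans (cabsD _ _))// lerD.
- move=> w Dw; rewrite [X in cabs X](_ : _ = (f w - f z - f' z * (w - z)) +
     (g w - g z - g' z * (w - z))); last by ring.
  by rewrite (le_trans (cabsD _ _))// mulrDl lerD ?f3 ?g3.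
Qed.

Lemma holD D f f' g g' : hol D f f' -> hol D g g' ->
  hol D (fun z => f z + g z) (fun z => f' z + g' z).
Proof. by move=> [B F] [B' G]; exists (B + B'); exact: C11D. Qed.

Lemma holM D f f' g g' : hol D f f' -> hol D g g' ->
  hol D (fun z => f z * g z) (fun z => f' z * g z + f z * g' z).
Proof.
move=> [B F] [B' G]; exists (8 * (B * B')) => z Dz.
have [f1 f2 f3] := F z Dz; have [g1 g2 g3] := G z Dz.
have B0 := C11_ge0 F Dz; have B'0 := C11_ge0 G Dz; have BB : 0 <= B * B' by rewrite mulr_ge0.
split.
- have : cabs (f z) * cabs (g z) <= B * B' by rewrite ler_pM ?cabs_ge0.
  by rewrite cabsM; lra.
- rewrite (le_trans (cabsD _ _))// !cabsM.
  have : cabs (f z) * cabs (g' z) <= B * B' by rewrite ler_pM ?cabs_ge0.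
  have : cabs (f' z) * cabs (g z) <= B * B' by rewrite ler_pM ?cabs_ge0.
  by lra.
- move=> w Dw; rewrite [X in cabs X](_ : _ = ((f w - f z - f' z * (w - z)) * g z +
     f z * (g w - g z - g' z * (w - z))) + (f w - f z) * (g w - g z)); last by ring.
  have r1 := f3 w Dw; have r2 := g3 w Dw.
  have l1 := C11_lip F Dz Dw; have l2 := C11_lip G Dz Dw.
  rewrite (le_trans (cabsD _ _))// (le_trans (lerD (cabsD _ _) (lexx _)))// !cabsM.
  have e1 : cabs (f w - f z - f' z * (w - z)) * cabs (g z) <= B * cabs (w - z) ^+ 2 * B'.
    by rewrite ler_pM ?cabs_ge0.
  have e2 : cabs (f z) * cabs (g w - g z - g' z * (w - z)) <= B * (B' * cabs (w - z) ^+ 2).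
    by rewrite ler_pM ?cabs_ge0.
  have e3 : cabs (f w - f z) * cabs (g w - g z) <= (2 * B * cabs (w - z)) * (2 * B' * cabs (w - z)).
    by rewrite ler_pM ?cabs_ge0.
  have : 0 <= B * B' * cabs (w - z) ^+ 2 by rewrite mulr_ge0 ?sqr_ge0.
  by move: e1 e2 e3; lra.
Qed.

Lemma hol_ext D f f' g g' : (forall z, D z -> f z = g z) -> (forall z, D z -> f' z = g' z) ->
  hol D f f' -> hol D g g'.
Proof.
move=> fg fg' [B F]; exists B => z Dz; have [f1 f2 f3] := F z Dz.
by rewrite -fg -?fg'//; split => // w Dw; rewrite -fg//; exact: f3.
Qed.

Lemma holZ D c f f' : hol D f f' -> hol D (fun z => c * f z) (fun z => c * f' z).
Proof.
move=> /(holM (hol_cst D c)); apply: hol_ext => z _ //.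
by rewrite mul0r add0r.
Qed.

Lemma holN D f f' : hol D f f' -> hol D (fun z => - f z) (fun z => - f' z).
Proof. by move=> /(holZ (-1)); apply: hol_ext => z _; rewrite mulN1r. Qed.

Lemma holB D f f' g g' : hol D f f' -> hol D g g' ->
  hol D (fun z => f z - g z) (fun z => f' z - g' z).
Proof. by move=> F /holN; exact: holD. Qed.

Lemma holV D f f' (m : R) : 0 < m -> (forall z, D z -> m <= cabs (f z)) ->
  hol D f f' -> hol D (fun z => (f z)^-1) (fun z => - f' z / (f z) ^+ 2).
Proof.
move=> m0 fm [B F]; exists (m^-1 + B / m ^+ 2 + 4 * B ^+ 2 / m ^+ 3) => z Dz.
have [f1 f2 f3] := F z Dz; have B0 := C11_ge0 F Dz.
have fm' w : D w -> cabs (f w)^-1 <= m^-1.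
  by move=> Dw; rewrite cabsV lef_pV2 ?posrE ?fm// (lt_le_trans m0)// fm.
have f0 w : D w -> f w != 0.
  by move=> Dw; rewrite -cabs_gt0 (lt_le_trans m0)// fm.
have im : 0 < m^-1 by rewrite invr_gt0.
have p1 : 0 <= m^-1 by exact: ltW.
have p2 : 0 <= B / m ^+ 2 by rewrite divr_ge0// exprn_ge0// ltW.
have p3 : 0 <= 4 * B ^+ 2 / m ^+ 3.
  by rewrite divr_ge0 ?mulr_ge0 ?sqr_ge0 ?exprn_ge0 ?(ltW m0).
split.
- by rewrite (le_trans (fm' z Dz))//; lra.
- rewrite -exprVn cabsM cabsN cabsX; apply: (@le_trans _ _ (B * m^-1 ^+ 2)).
    by rewrite ler_pM ?cabs_ge0 ?exprn_ge0 ?cabs_ge0// lerXn2r ?nnegrE ?cabs_ge0 ?fm'.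
  by rewrite exprVn; lra.
- move=> w Dw; have r := f3 w Dw; have l := C11_lip F Dz Dw.
  have -> : (f w)^-1 - (f z)^-1 - - f' z / f z ^+ 2 * (w - z) =
     (f w - f z) ^+ 2 * ((f w)^-1 * (f z)^-1 ^+ 2) - (f w - f z - f' z * (w - z)) * (f z)^-1 ^+ 2.
    by field; rewrite !f0.
  have E1 (a b c : R[i]) : cabs (a ^+ 2 * (b * c ^+ 2)) = cabs a ^+ 2 * (cabs b * cabs c ^+ 2).
    by rewrite cabsM cabsX cabsM cabsX.
  have E2 (a b : R[i]) : cabs (a * b ^+ 2) = cabs a * cabs b ^+ 2 by rewrite cabsM cabsX.
  rewrite (le_trans (cabsB _ _))// E1 E2.
  have e1 : cabs (f w - f z) ^+ 2 <= (2 * B * cabs (w - z)) ^+ 2.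
    by rewrite lerXn2r ?nnegrE ?cabs_ge0// (le_trans _ l)// cabs_ge0.
  have e2 : cabs (f z)^-1 ^+ 2 <= m^-1 ^+ 2 by rewrite lerXn2r ?nnegrE ?cabs_ge0 ?fm'// ltW.
  have e3 : cabs (f w - f z) ^+ 2 * (cabs (f w)^-1 * cabs (f z)^-1 ^+ 2) <=
      (2 * B * cabs (w - z)) ^+ 2 * (m^-1 * m^-1 ^+ 2).
    rewrite ler_pM ?exprn_ge0 ?mulr_ge0 ?exprn_ge0 ?cabs_ge0//.
    by rewrite ler_pM ?exprn_ge0 ?cabs_ge0 ?fm'.
  have e4 : cabs (f w - f z - f' z * (w - z)) * cabs (f z)^-1 ^+ 2 <=
      B * cabs (w - z) ^+ 2 * m^-1 ^+ 2.
    by rewrite ler_pM ?exprn_ge0 ?cabs_ge0.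
  rewrite (le_trans (lerD e3 e4))//.
  have -> : (2 * B * cabs (w - z)) ^+ 2 * (m^-1 * m^-1 ^+ 2) + B * cabs (w - z) ^+ 2 * m^-1 ^+ 2 =
     (B / m ^+ 2 + 4 * B ^+ 2 / m ^+ 3) * cabs (w - z) ^+ 2 by field; rewrite gt_eqF.
  by rewrite ler_wpM2r ?sqr_ge0//; lra.
Qed.

Lemma hol_div D f f' g g' (m : R) : 0 < m -> (forall z, D z -> m <= cabs (g z)) ->
  hol D f f' -> hol D g g' ->
  hol D (fun z => f z / g z) (fun z => f' z / g z + f z * (- g' z / (g z) ^+ 2)).
Proof. by move=> m0 gm F G; apply: holM F _; exact: holV gm G. Qed.

Lemma hol_comp D E f f' g g' : (forall z, D z -> E (g z)) -> hol E f f' -> hol D g g' ->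
  hol D (fun z => f (g z)) (fun z => f' (g z) * g' z).
Proof.
move=> DE [B F] [B' G]; exists (B + B * B' + 4 * B * B' ^+ 2) => z Dz.
have [f1 f2 f3] := F _ (DE z Dz); have [g1 g2 g3] := G z Dz.
have B0 := C11_ge0 F (DE z Dz); have B'0 := C11_ge0 G Dz.
have p1 : 0 <= B * B' by rewrite mulr_ge0.
have p2 : 0 <= 4 * B * B' ^+ 2 by rewrite !mulr_ge0 ?sqr_ge0.
split; first by lra.
- rewrite cabsM; have : cabs (f' (g z)) * cabs (g' z) <= B * B' by rewrite ler_pM ?cabs_ge0.
  by lra.
- move=> w Dw; have r1 := f3 _ (DE w Dw); have r2 := g3 w Dw; have l := C11_lip G Dz Dw.
  rewrite [X in cabs X](_ : _ = (f (g w) - f (g z) - f' (g z) * (g w - g z)) +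
     f' (g z) * (g w - g z - g' z * (w - z))); last by ring.
  rewrite (le_trans (cabsD _ _))// cabsM.
  have e1 : cabs (f' (g z)) * cabs (g w - g z - g' z * (w - z)) <= B * (B' * cabs (w - z) ^+ 2).
    by rewrite ler_pM ?cabs_ge0.
  have e2 : cabs (g w - g z) ^+ 2 <= (2 * B' * cabs (w - z)) ^+ 2.
    by rewrite lerXn2r ?nnegrE ?cabs_ge0// (le_trans _ l)// cabs_ge0.
  have e3 : B * cabs (g w - g z) ^+ 2 <= B * (2 * B' * cabs (w - z)) ^+ 2 by rewrite ler_wpM2l.
  have : 0 <= B * cabs (w - z) ^+ 2 by rewrite mulr_ge0 ?sqr_ge0.
  by move: r1 e1 e3; lra.
Qed.
End C11.

(** * Integrals of Lipschitz functions over intervals *)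

Section real_integral.
Variable R : realType.
Local Notation mu := (@lebesgue_measure R).
Implicit Types (h F : R -> R).

Definition rint (a b : R) h := \int[mu]_(t in `]a, b]) h t.

Definition rlip (a b K : R) h := forall s t, a <= s <= b -> a <= t <= b -> `|h t - h s| <= K * `|t - s|.

(** Composition with [clamp] extends a function constantly beyond [[a, b]], so that a function known
    to be Lipschitz only there becomes continuous and bounded on the line. *)
Definition clamp (a b t : R) : R := Num.max a (Num.min b t).

Lemma clamp_id a b t : a <= t <= b -> clamp a b t = t.
Proof. by move=> /andP[at_ tb]; rewrite /clamp min_r// max_r. Qed.

Lemma clamp_bound a b t : a <= b -> a <= clamp a b t <= b.
Proof. by move=> ab; rewrite /clamp le_max lexx/= ge_max ab ge_min lexx. Qed.

Lemma clamp_lip a b s t : `|clamp a b t - clamp a b s| <= `|t - s|.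
Proof.
wlog st : s t / s <= t.
  by move=> W; have [/W//|/ltW/W] := leP s t; rewrite distrC (distrC s).
have h : clamp a b s <= clamp a b t.
  by rewrite /clamp ge_max !le_max lexx/= !le_min !ge_min lexx st /= !orbT.
have mx (u v : R) : u <= v -> Num.max a v - Num.max a u <= v - u.
  by move=> uv; case: (leP a v) => ?; case: (leP a u) => ?; lra.
have mn (u v : R) : u <= v -> Num.min b v - Num.min b u <= v - u.
  by move=> uv; case: (leP b v) => ?; case: (leP b u) => ?; lra.
rewrite !ger0_norm ?subr_ge0//; apply: le_trans (mn _ _ st).
by apply: mx; rewrite le_min !ge_min lexx st !orbT.
Qed.

Lemma rlip_clamp a b K h : a <= b -> rlip a b K h -> loc_bounded_meas (fun t => h (clamp a b t)).
Proof.
move=> ab hK; split.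
  apply: continuous_measurable_fun; apply/continuous_epsP => x e e0.
  have K0 : 0 < 1 + `|K| by rewrite ltr_pwDl.
  exists (e / (1 + `|K|)); first by rewrite divr_gt0.
  move=> y; rewrite ltr_pdivlMr// => /le_lt_trans; apply.
  rewrite (le_trans (hK _ _ (clamp_bound _ ab) (clamp_bound _ ab)))// mulrC.
  have := clamp_lip a b x y; have := ler_norm K; have := normr_ge0 K.
  move=> p1 p2 p3; apply: (@le_trans _ _ (`|y - x| * `|K|)).
    apply: (@le_trans _ _ (`|clamp a b y - clamp a b x| * `|K|)).
      by rewrite ler_wpM2l.
    by rewrite ler_wpM2r.
  by rewrite ler_wpM2l// lerDr.
move=> r; exists (`|h a| + `|K| * (b - a)) => x _.
rewrite -[h _](subrK (h a)) addrC (le_trans (ler_normD _ _))// lerD2l.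
have aab : a <= a <= b by rewrite lexx.
rewrite (le_trans (hK _ _ aab (clamp_bound x ab)))//.
have /andP[c1 c2] := clamp_bound x ab.
rewrite ger0_norm ?subr_ge0//; apply: (@le_trans _ _ (`|K| * (clamp a b x - a))).
  by rewrite ler_wpM2r ?subr_ge0// ler_norm.
by rewrite ler_wpM2l// lerD2r.
Qed.

Lemma rlip_integrable a b K h : a <= b -> rlip a b K h -> mu.-integrable `]a, b] (EFin \o h).
Proof.
move=> ab hK.
have := loc_bounded_integrable a b (rlip_clamp ab hK).
apply: eq_integrable => // t; rewrite inE/= in_itv/= => /andP[at_ tb].
by rewrite clamp_id// tb ltW.
Qed.

Lemma rlipS a b c d K h : a <= c -> d <= b -> rlip a b K h -> rlip c d K h.
Proof.
move=> ac db hK s t /andP[s1 s2] /andP[t1 t2].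
by apply: hK; [rewrite (le_trans ac)//= (le_trans s2)|rewrite (le_trans ac)//= (le_trans t2)].
Qed.

Lemma rlip_cst a b c : rlip a b 0 (fun=> c).
Proof. by move=> s t _ _; rewrite subrr normr0 mul0r. Qed.

Lemma rint_cst a b c : a <= b -> rint a b (fun=> c) = c * (b - a).
Proof.
move=> ab; rewrite /rint Rintegral_cst//; congr (_ * _).
suff : fine (mu `]a, b]) = b - a by [].
rewrite lebesgue_measure_itv/= lte_fin.
by move: ab; rewrite le_eqVlt => /predU1P[->|ab]; rewrite ?ltxx ?subrr// ab.
Qed.

Lemma rint_le a b K h M : a <= b -> rlip a b K h ->
  (forall t, a <= t <= b -> `|h t| <= M) -> `|rint a b h| <= M * (b - a).
Proof.
move=> ab hK hM; rewrite -rint_cst// (le_trans (le_normr_Rintegral _ _))//.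
  exact: rlip_integrable hK.
apply: le_Rintegral => //.
- exact: integrable_abse (rlip_integrable ab hK).
- exact: (rlip_integrable ab (@rlip_cst a b M)).
- by move=> t /=; rewrite in_itv/= => /andP[at_ tb]; rewrite hM// tb ltW.
Qed.

Lemma rintB a b K K' h g : a <= b -> rlip a b K h -> rlip a b K' g ->
  rint a b (fun t => h t - g t) = rint a b h - rint a b g.
Proof.
by move=> ab hK gK; rewrite /rint RintegralB//; [exact: rlip_integrable hK|exact: rlip_integrable gK].
Qed.

Lemma rintD a b K K' h g : a <= b -> rlip a b K h -> rlip a b K' g ->
  rint a b (fun t => h t + g t) = rint a b h + rint a b g.
Proof.
by move=> ab hK gK; rewrite /rint RintegralD//; [exact: rlip_integrable hK|exact: rlip_integrable gK].
Qed.

Lemma rintZ a b K c h : a <= b -> rlip a b K h ->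
  rint a b (fun t => c * h t) = c * rint a b h.
Proof. by move=> ab hK; rewrite /rint RintegralZl//; exact: rlip_integrable hK. Qed.

Lemma rint_split a b c K h : a <= c -> c <= b -> rlip a b K h ->
  rint a b h - rint a c h = rint c b h.
Proof.
move=> ac cb hK; rewrite /rint (@Rintegral_itvB _ h (BRight a) (BRight b) c)//.
by apply: rlip_integrable hK; exact: le_trans cb.
Qed.

(** The difference between the integral and [F] has increments of second order, hence is constant by
    [local_lipschitz_le] with an arbitrarily small slope. *)
Lemma rint_ftc a b K K' h F : a <= b -> rlip a b K h ->
  (forall s t, a <= s <= b -> a <= t <= b -> `|F t - F s - h s * (t - s)| <= K' * (t - s) ^+ 2) ->
  rint a b h = F b - F a.
Proof.
move=> ab hK FK.
pose P (x : R) : R[i] := (rint a x h - F x)%:C.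
have M0 : 0 < 1 + `|K| + `|K'| by rewrite -addrA ltr_pwDl// addr_ge0.
have PM s t : a <= s -> s <= t -> t <= b ->
    `|(rint a t h - F t) - (rint a s h - F s)| <= (1 + `|K| + `|K'|) * (t - s) ^+ 2.
  move=> as_ st tb.
  have sI : a <= s <= b by rewrite as_ (le_trans st).
  have tI : a <= t <= b by rewrite tb (le_trans as_).
  have -> : (rint a t h - F t) - (rint a s h - F s) =
    (rint s t (fun u => h u - h s)) - (F t - F s - h s * (t - s)).
    rewrite (@rintB _ _ K 0)//; last 2 first.
    - exact: rlipS hK.
    - exact: rlip_cst.
    rewrite rint_cst// -(@rint_split a t s K h)//; last exact: rlipS hK.
    by ring.
  rewrite (le_trans (ler_normB _ _))//.
  have : `|rint s t (fun u => h u - h s)| <= (`|K| * (t - s)) * (t - s).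
    apply: (@rint_le _ _ K) => //.
    - move=> u v uI vI; rewrite (_ : _ - _ = h v - h u); last by ring.
      exact: (rlipS as_ tb hK).
    - move=> u /andP[su ut]; rewrite (le_trans (hK _ _ sI _))//.
        by rewrite (le_trans as_)//= (le_trans ut).
      rewrite ger0_norm ?subr_ge0//; apply: (@le_trans _ _ (`|K| * (u - s))).
        by rewrite ler_wpM2r ?subr_ge0// ler_norm.
      by rewrite ler_wpM2l// lerD2r.
  have := FK s t sI tI; have : K' * (t - s) ^+ 2 <= `|K'| * (t - s) ^+ 2.
    by rewrite ler_wpM2r ?sqr_ge0// ler_norm.
  by have := sqr_ge0 (t - s); lra.
have PM2 s t : a <= s <= b -> a <= t <= b -> cabs (P t - P s) <= (1 + `|K| + `|K'|) * (t - s) ^+ 2.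
  move=> /andP[s1 s2] /andP[t1 t2]; rewrite /P -(rmorphB (real_complex R)) cabs_real.
  have [st|/ltW ts] := leP s t; first exact: PM.
  rewrite distrC (_ : (t - s) ^+ 2 = (s - t) ^+ 2); last by ring.
  exact: PM.
have : cabs (P b - P a) <= 0.
  apply/ler_addgt0Pr => e e0; rewrite add0r.
  have ba : 0 < 1 + (b - a) by rewrite ltr_pwDl// subr_ge0.
  have e1 : 0 < e / (1 + (b - a)) by rewrite divr_gt0.
  apply: (@le_trans _ _ (e / (1 + (b - a)) * (b - a))); last first.
    by rewrite -mulrA ler_piMr ?(ltW e0)// ler_pdivrMl// mulr1 lerDr.
  apply: local_lipschitz_le => // x xI.
  exists (e / (1 + (b - a)) / (1 + `|K| + `|K'|)); first by rewrite divr_gt0.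
  move=> y yI; rewrite ltr_pdivlMr// => /ltW yx; rewrite (le_trans (PM2 _ _ xI yI))//.
  rewrite -real_normK ?num_real// expr2 mulrA ler_wpM2r// mulrC.
  by [].
rewrite -(rmorphB (real_complex R)) cabs_real normr_le0 => /eqP.
rewrite /rint set_itvoc0 Rintegral_set0 => H.
by apply/eqP; rewrite -subr_eq0; apply/eqP; rewrite -H; ring.
Qed.
End real_integral.

Section complex_integral.
Variable R : realType.
Local Notation mu := (@lebesgue_measure R).
Implicit Types (g h : R -> R[i]).

Definition cint (a b : R) g : R[i] := rint a b (fun t => Re (g t)) +i* rint a b (fun t => Im (g t)).

Definition clip (a b : R) g := exists K, forall s t, a <= s <= b -> a <= t <= b ->
  cabs (g t - g s) <= K * `|t - s|.

Lemma clip_rlip a b g : clip a b g ->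
  exists K, rlip a b K (fun t => Re (g t)) /\ rlip a b K (fun t => Im (g t)).
Proof.
move=> [K gK]; exists K; split=> s t sI tI; rewrite (le_trans _ (gK _ _ sI tI))//.
  by rewrite -ReB cabs_Re.
by rewrite -ImB cabs_Im.
Qed.

Lemma cintB a b g h : a <= b -> clip a b g -> clip a b h ->
  cint a b (fun t => g t - h t) = cint a b g - cint a b h.
Proof.
move=> ab /clip_rlip[K [g1 g2]] /clip_rlip[L [h1 h2]]; apply: complex_eq; rewrite ?cplxE/=.
- by rewrite (funext (fun t => ReB (g t) (h t))); exact: rintB g1 h1.
- by rewrite (funext (fun t => ImB (g t) (h t))); exact: rintB g2 h2.
Qed.

Lemma rlipZ a b c K (h : R -> R) : rlip a b K h -> rlip a b (`|c| * K) (fun t => c * h t).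
Proof.
by move=> hK s t sI tI; rewrite -mulrBr normrM -mulrA ler_wpM2l//; exact: hK.
Qed.

Lemma cintZ a b c g : a <= b -> clip a b g -> cint a b (fun t => c * g t) = c * cint a b g.
Proof.
move=> ab /clip_rlip[K [g1 g2]]; apply: complex_eq; rewrite ?cplxE/=.
- rewrite (funext (fun t => ReM c (g t))) (@rintB _ a b (`|Re c| * K) (`|Im c| * K))//.
  + by rewrite (rintZ _ ab g1) (rintZ _ ab g2).
  + exact: rlipZ.
  + exact: rlipZ.
- rewrite (funext (fun t => ImM c (g t))) (@rintD _ a b (`|Re c| * K) (`|Im c| * K))//.
  + by rewrite (rintZ _ ab g1) (rintZ _ ab g2).
  + exact: rlipZ.
  + exact: rlipZ.
Qed.

Lemma cint_cst a b c : a <= b -> cint a b (fun=> c) = c * (b - a)%:C.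
Proof. by move=> ab; apply: complex_eq; rewrite ?cplxE/= rint_cst//; ring. Qed.

Lemma cint_le a b g M : a <= b -> clip a b g -> (forall t, a <= t <= b -> cabs (g t) <= M) ->
  cabs (cint a b g) <= 2 * M * (b - a).
Proof.
move=> ab /clip_rlip[K [g1 g2]] gM; rewrite (le_trans (cabs_le _))//= -mulrA mulr_natl mulr2n.
rewrite lerD// ?(rint_le ab g1) ?(rint_le ab g2)//.
- by move=> t /gM; apply: le_trans; exact: cabs_Re.
- by move=> t /gM; apply: le_trans; exact: cabs_Im.
Qed.

Definition seg (a b : R) (z : R[i]) := Im z = 0 /\ a <= Re z <= b.

Lemma seg_real (a b t : R) : a <= t <= b -> seg a b t%:C. Proof. by []. Qed.

Lemma C11_clip a b B (G g : R[i] -> R[i]) : C11 (seg a b) B G g -> clip a b (fun t => G t%:C).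
Proof.
move=> GB; exists (2 * B) => s t sI tI.
by rewrite (le_trans (C11_lip GB (seg_real sI) (seg_real tI)))// -(rmorphB (real_complex R)) cabs_real.
Qed.

Lemma C11_deriv_clip a b B (G g : R[i] -> R[i]) : C11 (seg a b) B G g -> clip a b (fun t => g t%:C).
Proof.
move=> GB; exists (2 * B) => s t sI tI.
by rewrite (le_trans (C11_deriv_lip GB (seg_real sI) (seg_real tI)))// -(rmorphB (real_complex R)) cabs_real.
Qed.

Lemma cint_ftc a b B (G g : R[i] -> R[i]) : a <= b -> C11 (seg a b) B G g ->
  cint a b (fun t => g t%:C) = G b%:C - G a%:C.
Proof.
move=> ab GB; have /clip_rlip[K [g1 g2]] := C11_deriv_clip GB.
have H s t : a <= s <= b -> a <= t <= b ->
    cabs (G t%:C - G s%:C - g s%:C * (t - s)%:C) <= B * (t - s) ^+ 2.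
  move=> sI tI; have [_ _ /(_ _ (seg_real tI))] := GB _ (seg_real sI).
  by rewrite -(rmorphB (real_complex R)) cabs_real real_normK ?num_real.
apply: complex_eq; rewrite ?cplxE/=.
- rewrite (rint_ftc (F := fun t => Re (G t%:C)) (K' := B) ab g1)// => s t sI tI.
  apply: le_trans (H _ _ sI tI); apply: le_trans _ (cabs_Re _).
  by rewrite !cplxE /= mulr0 subr0.
- rewrite (rint_ftc (F := fun t => Im (G t%:C)) (K' := B) ab g2)// => s t sI tI.
  apply: le_trans (H _ _ sI tI); apply: le_trans _ (cabs_Im _).
  by rewrite !cplxE /= mulr0 add0r.
Qed.
End complex_integral.

Section circle_path.
Variable R : realType.
Local Notation T := (pi *+ 2 : R).

Definition cis (t : R) : R[i] := cos t +i* sin t.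

Lemma cabs_cis t : cabs (cis t) = 1.
Proof. by rewrite /cabs /= cos2Dsin2 sqrtr1. Qed.

Lemma cis_conj t : cis t * conjc (cis t) = 1.
Proof. by rewrite conj_mul cabs_cis expr1n. Qed.

Lemma cis_local (x e : R) : 0 < e -> exists2 d, 0 < d & forall y, `|y - x| < d ->
  cabs (cis y - cis x - 'i * cis x * (y - x)%:C) <= e * `|y - x|.
Proof.
move=> e0; have e2 : 0 < e / 2 by rewrite divr_gt0.
have /is_derive_eps/(_ _ e2)[d d0 H] := is_derive_cos x.
have /is_derive_eps/(_ _ e2)[d' d'0 H'] := is_derive_sin x.
exists (Num.min d d'); first by rewrite lt_min d0.
move=> y; rewrite lt_min => /andP[/H h /H' h'].
rewrite (le_trans (cabs_le _))// {1}[e]splitr mulrDl lerD//.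
- apply: le_trans h; rewrite le_eqVlt; apply/orP; left; apply/eqP; congr (`|_|).
  by rewrite !cplxE /=; ring.
- apply: le_trans h'; rewrite le_eqVlt; apply/orP; left; apply/eqP; congr (`|_|).
  by rewrite !cplxE /=; ring.
Qed.

Lemma cabs_iM (z : R[i]) : cabs ('i * z) = cabs z.
Proof. by rewrite cabsM cabs_i mul1r. Qed.

Lemma cis_lip (a b : R) : a <= b -> cabs (cis b - cis a) <= 2 * (b - a).
Proof.
move=> ab; apply: local_lipschitz_le => // x _.
have [d d0 H] := cis_local x ltr01; exists d => // y _ /H h.
rewrite -[cis y - cis x](subrK ('i * cis x * (y - x)%:C)) (le_trans (cabsD _ _))//.
by move: h; rewrite cabsM cabs_iM cabs_cis cabs_real; lra.
Qed.

(** The function [cis x - 'i * cis s * x] has derivative ['i * (cis x - cis s)], which [cis_lip]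
    bounds by twice the length of the interval. *)
Lemma cis_taylor (s t : R) : cabs (cis t - cis s - 'i * cis s * (t - s)%:C) <= 4 * (t - s) ^+ 2.
Proof.
have H a b c : a < b -> a <= c <= b ->
    cabs ((cis b - 'i * cis c * b%:C) - (cis a - 'i * cis c * a%:C)) <= 4 * (b - a) * (b - a).
  move=> ab /andP[ac cb].
  apply: (@local_lipschitz_le _ (fun x => cis x - 'i * cis c * x%:C)); first exact: ltW.
  move=> x /andP[ax xb]; have ba : 0 < b - a by rewrite subr_gt0.
  have [d d0 H] := cis_local x ba; exists d => // y _ /H h.
  have -> : cis y - 'i * cis c * y%:C - (cis x - 'i * cis c * x%:C) =
    (cis y - cis x - 'i * cis x * (y - x)%:C) + 'i * (cis x - cis c) * (y - x)%:C.
    by rewrite (rmorphB (real_complex R)); ring.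
  rewrite (le_trans (cabsD _ _))// cabsM cabs_iM cabs_real.
  have : cabs (cis x - cis c) <= 2 * (b - a).
    have [cx|/ltW xc] := leP c x; first by rewrite (le_trans (cis_lip cx))//; lra.
    by rewrite cabs_distC (le_trans (cis_lip xc))//; lra.
  move=> l; have : cabs (cis x - cis c) * `|y - x| <= 2 * (b - a) * `|y - x| by rewrite ler_wpM2r.
  have : 0 <= (b - a) * `|y - x| by rewrite mulr_ge0// ltW.
  by move: h; lra.
have [st|ts|<-] := ltgtP s t.
- have := H s t s st; rewrite lexx ltW// => /(_ isT).
  rewrite (_ : 4 * (t - s) * (t - s) = 4 * (t - s) ^+ 2); last by ring.
  congr (cabs _ <= _).
  by rewrite (rmorphB (real_complex R)); ring.
- have := H t s s ts; rewrite lexx ltW// => /(_ isT).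
  rewrite (_ : 4 * (s - t) * (s - t) = 4 * (t - s) ^+ 2); last by ring.
  rewrite -cabsN; congr (cabs _ <= _).
  by rewrite (rmorphB (real_complex R)); ring.
- by rewrite !subrr mulr0 subr0 cabs0 expr0n mulr0.
Qed.

Definition cispath (w : R[i]) := cis (Re w).

Lemma cispathE t : cispath t%:C = cis t. Proof. by []. Qed.

Lemma hol_cispath a b : hol (seg a b) cispath (fun w => 'i * cispath w).
Proof.
exists 4 => z [z0 _]; split; rewrite ?cabs_iM ?cabs_cis ?ler1n//.
move=> w [w0 _]; have -> : w - z = (Re w - Re z)%:C.
  by apply: complex_eq; rewrite !cplxE /= ?w0 ?z0 ?subrr.
by rewrite cabs_real real_normK ?num_real//; exact: cis_taylor.
Qed.

Lemma hol_conj_seg a b f f' : hol (seg a b) f f' ->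
  hol (seg a b) (fun w : R[i] => conjc (f w)) (fun w => conjc (f' w)).
Proof.
move=> [B F]; exists B => z sz; have [f1 f2 f3] := F z sz; split; rewrite ?cabs_conj//.
move=> w sw; apply: le_trans (f3 w sw).
rewrite -[leRHS]cabs_conj !(rmorphB (@conjc R)) /= (rmorphM (@conjc R)) /=.
have -> : conjc (w - z) = w - z.
  by case: sz sw => [z0 _] [w0 _]; apply: complex_eq; rewrite !cplxE /= ?w0 ?z0 ?subrr ?oppr0.
by [].
Qed.

Lemma cis2pi : cis T = cis 0.
Proof. by rewrite /cis cos2pi sin2pi cos0 sin0. Qed.
End circle_path.

(** * Cauchy's estimate for the first derivative *)

Section cauchy.
Variable R : realType.
Local Notation T := (pi *+ 2 : R).

Definition disc (z0 : R[i]) (r : R) (z : R[i]) := cabs (z - z0) < r.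

Let T0 : 0 <= T. Proof. by rewrite mulrn_wge0// pi_ge0. Qed.

Section circle_integral.
Variables (z0 : R[i]) (R0 K : R) (f f' : R[i] -> R[i]).
Hypothesis fC : C11 (disc z0 R0) K f f'.

Let gam (r : R) (w : R[i]) := z0 + r%:C * cispath w.
Let F (r : R) (w : R[i]) := f (gam r w) * conjc (cispath w).
Let F' (r : R) (w : R[i]) := f' (gam r w) * (0 + r%:C * ('i * cispath w)) * conjc (cispath w)
  + f (gam r w) * conjc ('i * cispath w).
(** Up to the factor ['i], [I r / r] is the contour integral of [f z / (z - z0)^2] over the circle
    of radius [r]. It does not depend on [r] and tends to [T * f' z0] as [r] tends to [0]. *)
Let I r := cint 0 T (fun t => F r t%:C).

Let gam_disc r w : 0 < r < R0 -> disc z0 R0 (gam r w).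
Proof.
move=> /andP[r0 rR]; rewrite /disc /gam addrC addKr cabsM cabs_cis cabs_real mulr1.
by rewrite gtr0_norm.
Qed.

Let F_hol r : 0 < r < R0 -> hol (seg 0 T) (F r) (F' r).
Proof.
move=> rR; apply: holM; last exact/hol_conj_seg/hol_cispath.
apply: (@hol_comp _ _ (disc z0 R0)) => //.
- by move=> z _; exact: gam_disc.
- by exists K.
- by apply: holD; [exact: hol_cst|apply: holZ; exact: hol_cispath].
Qed.

Let F'_int r : 0 < r < R0 -> cint 0 T (fun t => F' r t%:C) = 0.
Proof.
move=> rR; have [B FB] := F_hol rR.
by rewrite (cint_ftc T0 FB) /F /gam !cispathE cis2pi subrr.
Qed.

(** The integral of the angular derivative [F'] vanishes by periodicity, and by the chain rule this
    makes the radial derivative of [I] equal to [I r / r]. *)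
Let I_step r k : 0 < r < R0 -> 0 < r + k < R0 ->
  cabs (I (r + k) - (1 + k / r)%:C * I r) <= 2 * (K * k ^+ 2) * T.
Proof.
move=> rR rkR; have r0 : r != 0 by rewrite gt_eqF//; case/andP: rR.
have [B FB] := F_hol rR; have [B' FB'] := F_hol rkR.
have cF := C11_clip FB; have cF' := C11_deriv_clip FB; have cFk := C11_clip FB'.
have cZ c g : clip 0 T g -> clip 0 T (fun t => c * g t).
  move=> [L gL]; exists (cabs c * L) => s t sI tI.
  by rewrite -mulrBr cabsM -mulrA ler_wpM2l ?cabs_ge0// gL.
have cB g h : clip 0 T g -> clip 0 T h -> clip 0 T (fun t => g t - h t).
  move=> [L gL] [M hM]; exists (L + M) => s t sI tI.
  rewrite (_ : _ - _ = (g t - g s) - (h t - h s)); last by ring.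
  by rewrite (le_trans (cabsB _ _))// mulrDl lerD ?gL ?hM.
(* This multiple of [F'], of integral [0], cancels the first-order terms and leaves the Taylor
   remainder of [f] times the conjugate of [cis t]. *)
pose c : R[i] := - ((k / r)%:C * 'i).
have c1 := cZ ((1 + k / r)%:C) _ cF; have c2 := cZ c _ cF'; have c3 := cB _ _ cFk c1.
have -> : I (r + k) - (1 + k / r)%:C * I r =
    cint 0 T (fun t => F (r + k) t%:C - (1 + k / r)%:C * F r t%:C - c * F' r t%:C).
  rewrite (cintB T0 c3 c2) (cintB T0 cFk c1) (cintZ _ T0 cF) (cintZ _ T0 cF').
  by rewrite F'_int// mulr0 subr0.
rewrite -[T in leRHS]subr0; apply: (cint_le T0 (cB _ _ c3 c2)).
move=> t _; have [_ _ H] := fC (gam_disc t%:C rR).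
have := H _ (gam_disc t%:C rkR).
have -> : gam (r + k) t%:C - gam r t%:C = k%:C * cis t.
  by rewrite /gam /cispath /= (rmorphD (real_complex R)); ring.
rewrite cabsM cabs_cis mulr1 cabs_real real_normK ?num_real// => {}H.
apply: le_trans H; rewrite -[leRHS]mulr1 -[X in _ <= _ * X](cabs_cis t) -[cabs (cis t)]cabs_conj -cabsM.
rewrite le_eqVlt; apply/orP; left; apply/eqP; congr cabs.
have e1 : cispath t%:C * conjc (cispath t%:C) = 1 by exact: cis_conj.
have mulii : ('i : R[i]) * 'i = -1 by rewrite -expr2 sqr_i.
have kq : k%:C = (k / r)%:C * r%:C :> R[i].
  by rewrite -(rmorphM (real_complex R)); congr (_%:C); rewrite divfK.
have q1 : (1 + k / r)%:C = 1 + (k / r)%:C :> R[i] by apply: complex_eq; rewrite !cplxE ?addr0.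
rewrite /F /F' /c kq q1; set e := cispath t%:C in e1 *.
rewrite (_ : cis t = e)//.
have ie : conjc ('i * e) = - 'i * conjc e.
  by rewrite (rmorphM (@conjc R)); congr (_ * _); apply: complex_eq; rewrite /= ?oppr0.
rewrite ie.
set a := f (gam (r + k) t%:C); set b := f (gam r t%:C); set b' := f' (gam r t%:C).
move: e1 mulii; set ec := conjc e; set q := (k / r)%:C; set rr := r%:C; set i := (Complex (0 : R) 1) => e1 mulii.
have -> : a * ec - (1 + q) * (b * ec) -
  - (q * i) * (b' * (0 + rr * (i * e)) * ec + b * (- i * ec)) =
  a * ec - (1 + q) * (b * ec) + (i * i) * (q * rr * b' * (e * ec) - q * b * ec) by ring.
have -> : (a - b - b' * (q * rr * e)) * ec = a * ec - b * ec - b' * (q * rr) * (e * ec) by ring.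
by rewrite e1 mulii; ring.
Qed.

(** The term [f z0] of the expansion contributes nothing because the conjugate of [cis] has integral
    [0] over a period. *)
Let I_small r : 0 < r < R0 -> cabs ((r^-1)%:C * I r - T%:C * f' z0) <= 2 * (K * r) * T.
Proof.
move=> rR; have /andP[r0 rR0] := rR.
have [B FB] := F_hol rR; have cF := C11_clip FB.
have [B1 EB] := hol_conj_seg (hol_cispath 0 T).
have cE := C11_clip EB; have cE' := C11_deriv_clip EB.
have E'0 : cint 0 T (fun t => conjc (cispath t%:C)) = 0.
  have := cint_ftc T0 EB; rewrite !cispathE cis2pi subrr.
  rewrite (_ : (fun t => _) = (fun t => - 'i * conjc (cis t))); last first.
    by apply/funext => t; rewrite cispathE (rmorphM (@conjc R)); congr (_ * _);
      apply: complex_eq; rewrite /= ?oppr0.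
  rewrite (cintZ _ T0 cE) => /eqP; rewrite mulf_eq0 => /orP[|/eqP//].
  by rewrite oppr_eq0 => /eqP/(congr1 (@complex.Im R)) /= /eqP; rewrite oner_eq0.
have cZ c g : clip 0 T g -> clip 0 T (fun t => c * g t).
  move=> [L gL]; exists (cabs c * L) => s t sI tI.
  by rewrite -mulrBr cabsM -mulrA ler_wpM2l ?cabs_ge0// gL.
have cB g h : clip 0 T g -> clip 0 T h -> clip 0 T (fun t => g t - h t).
  move=> [L gL] [M hM]; exists (L + M) => s t sI tI.
  rewrite (_ : _ - _ = (g t - g s) - (h t - h s)); last by ring.
  by rewrite (le_trans (cabsB _ _))// mulrDl lerD ?gL ?hM.
have cC c : clip 0 T (fun=> c) by exists 0 => s t _ _; rewrite subrr cabs0 mul0r.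
have c1 := cZ (f z0) _ cE; have c2 := cB _ _ cF c1; have c3 := cC (f' z0 * r%:C).
have -> : (r^-1)%:C * I r - T%:C * f' z0 =
   (r^-1)%:C * cint 0 T (fun t => F r t%:C - f z0 * conjc (cispath t%:C) - f' z0 * r%:C).
  rewrite (cintB T0 c2 c3) (cintB T0 cF c1) (cintZ _ T0 cE) E'0 mulr0 subr0.
  rewrite (cint_cst _ T0) subr0 mulrBr; congr (_ - _).
  have rr : (r^-1)%:C * r%:C = 1 :> R[i].
    by rewrite -(rmorphM (real_complex R)) mulVf ?gt_eqF.
  move: rr; set u := (r^-1)%:C; set v := r%:C; set TT := T%:C => uv.
  have -> : u * (f' z0 * v * TT) = (u * v) * (TT * f' z0) by ring.
  by rewrite uv mul1r.
rewrite cabsM cabs_real gtr0_norm ?invr_gt0// ler_pdivrMl//.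
have -> : r * (2 * (K * r) * T) = 2 * (K * r ^+ 2) * (T - 0) by ring.
apply: (cint_le T0 (cB _ _ c2 c3)) => t _.
have d0 : disc z0 R0 z0 by rewrite /disc subrr cabs0 (lt_trans r0).
have [_ _ /(_ _ (gam_disc t%:C rR))] := fC d0.
have -> : gam r t%:C - z0 = r%:C * cis t by rewrite /gam /cispath /=; ring.
rewrite cabsM cabs_cis mulr1 cabs_real gtr0_norm// => H.
apply: le_trans H; rewrite -[leRHS]mulr1 -[X in _ <= _ * X](cabs_cis t) -[cabs (cis t)]cabs_conj -cabsM.
rewrite le_eqVlt; apply/orP; left; apply/eqP; congr cabs.
have := cis_conj t; rewrite /F !cispathE.
set a := f _; set ec := conjc (cis t); set e := cis t => e1.
have -> : (a - f z0 - f' z0 * (r%:C * e)) * ec = a * ec - f z0 * ec - f' z0 * r%:C * (e * ec) by ring.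
by rewrite e1; ring.
Qed.

(** By [I_step] the quotient [J r = I r / r] has increments of second order, so it is constant; its
    value is found at small radii and bounded at radius [rho]. The factor [2] is that of
    [cint_le]. *)
Lemma cauchy_deriv (B rho : R) : (forall z, disc z0 R0 z -> cabs (f z) <= B) ->
  0 < rho -> rho < R0 -> cabs (f' z0) <= 2 * B / rho.
Proof.
move=> fB rho0 rhoR.
have K0 : 0 <= K.
  by apply: (C11_ge0 fC (z := z0)); rewrite /disc subrr cabs0 (lt_trans rho0).
pose J r := (r^-1)%:C * I r.
have Tgt0 : 0 < T by rewrite mulrn_wgt0// pi_gt0.
have Jcst r : 0 < r -> r <= rho -> J rho = J r.
  move=> r0 rr; apply/eqP; rewrite -subr_eq0 -cabs0_eq0 eq_le cabs_ge0 andbT.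
  apply/ler_addgt0Pr => e e0; rewrite add0r.
  have rho_r : 0 <= rho - r by rewrite subr_ge0.
  have e1 : 0 < e / (1 + (rho - r)) by rewrite divr_gt0// ltr_pwDl.
  apply: (@le_trans _ _ (e / (1 + (rho - r)) * (rho - r))); last first.
    by rewrite -mulrA ler_piMr ?(ltW e0)// ler_pdivrMl ?ltr_pwDl// mulr1 lerDr.
  apply: local_lipschitz_le => // x /andP[rx xrho].
  have M0 : 0 < 1 + 2 * K * T / r by rewrite ltr_pwDl// divr_ge0 ?mulr_ge0// ltW.
  exists (e / (1 + (rho - r)) / (1 + 2 * K * T / r)); first by rewrite divr_gt0.
  move=> y /andP[ry yrho]; rewrite ltr_pdivlMr// => yx.
  have x0 : 0 < x by exact: lt_le_trans rx.
  have y0 : 0 < y by exact: lt_le_trans ry.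
  have xR : 0 < x < R0 by rewrite x0 (le_lt_trans xrho).
  have xy : x + (y - x) = y by ring.
  have yR : 0 < x + (y - x) < R0 by rewrite xy y0 (le_lt_trans yrho).
  have := I_step xR yR; rewrite xy => H.
  have -> : J y - J x = (y^-1)%:C * (I y - (1 + (y - x) / x)%:C * I x).
    rewrite /J mulrBr mulrA -(rmorphM (real_complex R)).
    by have -> : y^-1 * (1 + (y - x) / x) = x^-1 by field; rewrite !gt_eqF.
  rewrite cabsM cabs_real gtr0_norm ?invr_gt0// ler_pdivrMl//.
  apply: (le_trans H); rewrite -real_normK ?num_real//.
  have h1 : `|y - x| * (1 + 2 * K * T / r) * (r * `|y - x|) <= e / (1 + (rho - r)) * (r * `|y - x|).
    by rewrite ler_wpM2r ?(ltW yx)// mulr_ge0// ltW.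
  have h2 : e / (1 + (rho - r)) * (r * `|y - x|) <= e / (1 + (rho - r)) * (y * `|y - x|).
    by rewrite ler_wpM2l ?(ltW e1)// ler_wpM2r.
  have h3 : `|y - x| * (1 + 2 * K * T / r) * (r * `|y - x|) =
    r * `|y - x| ^+ 2 + 2 * (K * `|y - x| ^+ 2) * T by field; rewrite gt_eqF.
  have h4 : 0 <= r * `|y - x| ^+ 2 by rewrite mulr_ge0 ?sqr_ge0// ltW.
  by move: h1 h2; rewrite h3; lra.
have Jf' : J rho = T%:C * f' z0.
  apply/eqP; rewrite -subr_eq0 -cabs0_eq0 eq_le cabs_ge0 andbT.
  apply/ler_addgt0Pr => e e0; rewrite add0r.
  have M0 : 0 < 1 + 2 * K * T by rewrite ltr_pwDl// !mulr_ge0.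
  pose r := Num.min rho (e / (1 + 2 * K * T)).
  have r0 : 0 < r by rewrite lt_min rho0 divr_gt0.
  have rr : r <= rho by rewrite ge_min lexx.
  rewrite (Jcst r)//; apply: (le_trans (I_small _)); first by rewrite r0 (le_lt_trans rr).
  have : r <= e / (1 + 2 * K * T) by rewrite ge_min lexx orbT.
  by rewrite ler_pdivlMr//; lra.
have rhoRR : 0 < rho < R0 by rewrite rho0.
have : cabs (J rho) <= rho^-1 * (2 * B * T).
  rewrite cabsM cabs_real gtr0_norm ?invr_gt0// ler_wpM2l ?invr_ge0 ?(ltW rho0)//.
  rewrite -[T in leRHS]subr0; have [B1 FB] := F_hol rhoRR.
  apply: (cint_le T0 (C11_clip FB)) => t _.
  rewrite /F cabsM cabs_conj cabs_cis mulr1; apply: fB; exact: gam_disc.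
rewrite Jf' cabsM cabs_real gtr0_norm// => H.
rewrite -(ler_pM2l Tgt0) (le_trans H)// le_eqVlt; apply/orP; left; apply/eqP; ring.
Qed.
End circle_integral.
End cauchy.

(** * Bounds that depend only on the supremum of the function *)

Section estimates.
Variable R : realType.
Implicit Types (D : R[i] -> Prop) (z w c : R[i]).

(** With [c = 0] it yields Lipschitz bounds, with [c = f' z] second-order remainders. The constant
    [K] does not enter the conclusion, which is how qualitative smoothness is turned into explicit
    estimates. *)
Lemma mean_value D (K M : R) f f' z w c : C11 D K f f' ->
  (forall t : R, 0 <= t <= 1 -> D (z + t%:C * (w - z))) ->
  (forall t : R, 0 <= t <= 1 -> cabs (f' (z + t%:C * (w - z)) - c) <= M) ->
  cabs (f w - f z - c * (w - z)) <= M * cabs (w - z).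
Proof.
move=> fK zwD f'M.
have D0 : D (z + (0 : R)%:C * (w - z)) by apply: zwD; rewrite lexx ler01.
have K0 : 0 <= K by exact: (C11_ge0 fK D0).
pose g (t : R) := f (z + t%:C * (w - z)) - c * (t%:C * (w - z)).
have -> : f w - f z - c * (w - z) = g 1 - g 0.
  by rewrite /g mul0r !addr0 mul1r mulr0 subr0 (addrC z) subrK; ring.
apply/ler_addgt0Pr => e e0; rewrite -[leRHS]mulr1 -[X in _ * X](subr0 1).
apply: local_lipschitz_le => // x xI.
have M0 : 0 < 1 + K * cabs (w - z) ^+ 2 by rewrite ltr_pwDl// mulr_ge0 ?sqr_ge0.
exists (e / (1 + K * cabs (w - z) ^+ 2)); first by rewrite divr_gt0.
move=> y yI; rewrite ltr_pdivlMr// => yx.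
have [_ _ /(_ _ (zwD y yI))] := fK _ (zwD x xI).
have -> : z + y%:C * (w - z) - (z + x%:C * (w - z)) = (y - x)%:C * (w - z).
  by rewrite (rmorphB (real_complex R)); ring.
rewrite cabsM cabs_real exprMn => H.
have -> : g y - g x = (f (z + y%:C * (w - z)) - f (z + x%:C * (w - z)) -
    f' (z + x%:C * (w - z)) * ((y - x)%:C * (w - z))) +
    (f' (z + x%:C * (w - z)) - c) * ((y - x)%:C * (w - z)).
  by rewrite /g (rmorphB (real_complex R)); ring.
rewrite (le_trans (cabsD _ _))// !cabsM cabs_real.
have h1 : cabs (f' (z + x%:C * (w - z)) - c) * (`|y - x| * cabs (w - z)) <=
   M * (`|y - x| * cabs (w - z)) by rewrite ler_wpM2r ?mulr_ge0 ?cabs_ge0// f'M.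
have h2 : `|y - x| * (1 + K * cabs (w - z) ^+ 2) * `|y - x| <= e * `|y - x|.
  by rewrite ler_wpM2r// ltW.
have : 0 <= `|y - x| ^+ 2 by rewrite sqr_ge0.
by move: H h1 h2; lra.
Qed.

Lemma disc_convex z0 r z w (t : R) : disc z0 r z -> disc z0 r w -> 0 <= t <= 1 ->
  disc z0 r (z + t%:C * (w - z)).
Proof.
rewrite /disc => zr wr /andP[t0 t1].
have -> : z + t%:C * (w - z) - z0 = (1 - t)%:C * (z - z0) + t%:C * (w - z0).
  by rewrite (rmorphB (real_complex R)); ring.
rewrite (le_lt_trans (cabsD _ _))// !cabsM !cabs_real !ger0_norm ?subr_ge0//.
have [->|tn0] := eqVneq t 0; first by lra.
have h1 : t * cabs (w - z0) < t * r by rewrite ltr_pM2l// lt_def tn0.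
have h2 : (1 - t) * cabs (z - z0) <= (1 - t) * r by rewrite ler_wpM2l ?subr_ge0// ltW.
by lra.
Qed.

Lemma disc_sub z0 z1 r1 r0 z : cabs (z1 - z0) + r1 <= r0 -> disc z1 r1 z -> disc z0 r0 z.
Proof.
rewrite /disc => h zr; have -> : z - z0 = (z - z1) + (z1 - z0) by ring.
by rewrite (le_lt_trans (cabsD _ _))//; lra.
Qed.

(** The summands serve [f], [f'] and the remainder. [6 / r] is Cauchy's estimate with circles of
    radius [r / 3]; [108 / r ^+ 2] is [6 / r] times the factor [2 / (r / 9)] of a second application
    with radius [r / 9]. *)
Definition cauchy_cst (r : R) : R := 1 + 6 / r + 108 / r ^+ 2.

Section schwarz.
Variables (z0 : R[i]) (r K B : R) (f f' : R[i] -> R[i]).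
Hypotheses (r0 : 0 < r) (fK : C11 (disc z0 r) K f f')
  (fB : forall z, disc z0 r z -> cabs (f z) <= B).

Let B0 : 0 <= B.
Proof. by apply: le_trans (fB (z := z0) _); rewrite ?cabs_ge0 /disc ?subrr ?cabs0. Qed.

Lemma cauchy_deriv_half z : disc z0 (r / 2) z -> cabs (f' z) <= 6 * B / r.
Proof.
move=> zr; have sub w : disc z (r / 2) w -> disc z0 r w.
  by apply: disc_sub; move: r0 zr; rewrite /disc; lra.
have := @cauchy_deriv R z (r / 2) K f f' (C11_sub sub fK) B (r / 3).
have -> : 2 * B / (r / 3) = 6 * B / r by field; rewrite gt_eqF.
apply.
- by move=> w /sub; exact: fB.
- by rewrite divr_gt0.
- by move: r0; lra.
Qed.

Lemma cauchy_lip_half z w : disc z0 (r / 2) z -> disc z0 (r / 2) w ->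
  cabs (f w - f z) <= 6 * B / r * cabs (w - z).
Proof.
move=> zr wr; have := @mean_value (disc z0 (r / 2)) K (6 * B / r) f f' z w 0.
rewrite mul0r subr0; apply.
- by apply: C11_sub fK => u; apply: disc_sub; rewrite subrr cabs0; move: r0; lra.
- by move=> t; exact: disc_convex.
- by move=> t tI; rewrite subr0; apply: cauchy_deriv_half; exact: disc_convex.
Qed.

(** Cauchy's estimate for the translated difference [f (u + (w - z)) - f u], already small by
    [cauchy_lip_half]; second derivatives never appear. *)
Lemma cauchy_deriv_lip z w : disc z0 (r / 4) z -> disc z0 (r / 4) w ->
  cabs (f' w - f' z) <= 108 * B / r ^+ 2 * cabs (w - z).
Proof.
move=> zr wr.
have wz : cabs (w - z) < r / 2.
  move: r0 zr wr; rewrite /disc (_ : w - z = (w - z0) - (z - z0)); last by ring.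
  by have := cabsB (w - z0) (z - z0); lra.
have subz u : disc z (r / 8) u -> disc z0 (r / 2) u.
  by apply: disc_sub; move: r0 zr; rewrite /disc; lra.
have subw u : disc z (r / 8) u -> disc z0 (r / 2) (u + (w - z)).
  move=> uz; apply: (@disc_sub z0 w (r / 8)); first by move: r0 wr; rewrite /disc; lra.
  by rewrite /disc (_ : _ - w = u - z)//; ring.
have half u : disc z0 (r / 2) u -> disc z0 r u.
  by apply: disc_sub; rewrite subrr cabs0; move: r0; lra.
have gK : C11 (disc z (r / 8)) (K + K) (fun u => f (u + (w - z)) + - f u)
    (fun u => f' (u + (w - z)) + - f' u).
  apply: C11D.
  - move=> u /subw/half/fK[h1 h2 h3]; split => // v /subw/half/h3.
    by rewrite (_ : v + (w - z) - (u + (w - z)) = v - u)//; ring.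
  - move=> u /subz/half/fK[h1 h2 h3]; split; rewrite ?cabsN// => v /subz/half/h3.
    by rewrite -cabsN; congr (cabs _ <= _); ring.
have := @cauchy_deriv R z (r / 8) _ _ _ gK (6 * B / r * cabs (w - z)) (r / 9).
have zw : z + (w - z) = w by ring.
rewrite /= zw.
have -> : 2 * (6 * B / r * cabs (w - z)) / (r / 9) = 108 * B / r ^+ 2 * cabs (w - z).
  by field; rewrite gt_eqF.
apply.
- move=> u uz; have := cauchy_lip_half (subz u uz) (subw u uz).
  by rewrite (_ : u + (w - z) - u = w - z)//; ring.
- by rewrite divr_gt0.
- by move: r0; lra.
Qed.

Lemma cauchy_C11 : C11 (disc z0 (r / 4)) (B * cauchy_cst r) f f'.
Proof.
have p1 : 0 <= B * (6 / r) by rewrite mulr_ge0// divr_ge0// ltW.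
have p2 : 0 <= B * (108 / r ^+ 2) by rewrite mulr_ge0// divr_ge0// exprn_ge0// ltW.
have half z : disc z0 (r / 4) z -> disc z0 (r / 2) z.
  by apply: disc_sub; rewrite subrr cabs0; move: r0; lra.
have full z : disc z0 (r / 4) z -> disc z0 r z.
  by apply: disc_sub; rewrite subrr cabs0; move: r0; lra.
have E : B * cauchy_cst r = B + B * (6 / r) + B * (108 / r ^+ 2).
  by rewrite /cauchy_cst; ring.
have E1 : 6 * B / r = B * (6 / r) by ring.
have E2 : 108 * B / r ^+ 2 = B * (108 / r ^+ 2) by ring.
rewrite E; move=> z zr; split.
- by rewrite (le_trans (fB (full _ zr)))// -addrA lerDl addr_ge0.
- rewrite (le_trans (cauchy_deriv_half (half _ zr)))// E1 addrAC lerDr addr_ge0//.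
- move=> w wr; apply: (@le_trans _ _ (108 * B / r ^+ 2 * cabs (w - z) ^+ 2)); last first.
    by rewrite ler_wpM2r ?sqr_ge0// E2 lerDr addr_ge0.
  rewrite expr2 mulrA; apply: (mean_value fK).
    by move=> t tI; apply/full/disc_convex.
  move=> t tI; have tr := disc_convex zr wr tI.
  rewrite (le_trans (cauchy_deriv_lip zr tr))// ler_wpM2l ?E2//.
  rewrite (_ : z + t%:C * (w - z) - z = t%:C * (w - z)); last by ring.
  by case/andP: tI => t0 t1; rewrite cabsM cabs_real ger0_norm// ler_piMl ?cabs_ge0.
Qed.
End schwarz.

(** Points closer than [r / 4] are covered by [cauchy_C11]. For the others [cabs (w - z) / r] is at
    least [1 / 4], so the crude bounds on [f] and [f'] are already quadratic in it. *)
Lemma cauchy_C11_unif D (r B : R) f f' : 0 < r ->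
  (forall z, D z -> hol (disc z r) f f') ->
  (forall z w, D z -> disc z r w -> cabs (f w) <= B) ->
  C11 D (B * cauchy_cst r) f f'.
Proof.
move=> r0 fh fB z Dz; have [K fK] := fh z Dz.
have zz : disc z (r / 4) z by rewrite /disc subrr cabs0 divr_gt0.
have fBz w := fB z w Dz.
have [h1 h2 h3] := cauchy_C11 r0 fK fBz zz.
split => // w Dw.
have [wz|wz] := ltP (cabs (w - z)) (r / 4); first exact: h3.
have zB : cabs (f z) <= B by apply: (fB z) => //; rewrite /disc subrr cabs0.
have wB : cabs (f w) <= B by apply: (fB w) => //; rewrite /disc subrr cabs0.
have B0 : 0 <= B by rewrite (le_trans _ zB)// cabs_ge0.
have dB : cabs (f' z) <= 6 * B / r.
  by apply: (cauchy_deriv_half r0 fK fBz); rewrite /disc subrr cabs0 divr_gt0.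
rewrite (le_trans (cabsB _ _))// cabsM (le_trans (lerD (cabsB _ _) (lexx _)))//.
have e1 : cabs (f' z) * cabs (w - z) <= 6 * B / r * cabs (w - z) by rewrite ler_wpM2r ?cabs_ge0.
have q : 1 <= 4 / r * cabs (w - z) by rewrite mulrAC ler_pdivlMr// mul1r; lra.
have e2 : cabs (w - z) / r <= cabs (w - z) / r * (4 / r * cabs (w - z)).
  by rewrite ler_peMr// divr_ge0 ?cabs_ge0// ltW.
have e3 : 1 <= (4 / r * cabs (w - z)) ^+ 2 by rewrite expr_ge1// (le_trans ler01).
have e4 : B * (cabs (w - z) / r) <= B * (cabs (w - z) / r * (4 / r * cabs (w - z))) by rewrite ler_wpM2l.
have e5 : B * 1 <= B * (4 / r * cabs (w - z)) ^+ 2 by rewrite ler_wpM2l.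
set c := cabs (w - z) in e1 q e2 e3 e4 e5 *.
have -> : B * cauchy_cst r * c ^+ 2 = B * c ^+ 2 * (1 + 6 / r) + 108 * (B * (c / r) ^+ 2).
  by rewrite /cauchy_cst; field; rewrite gt_eqF.
have h4 : B * (c / r * (4 / r * c)) = 4 * (B * (c / r) ^+ 2) by field; rewrite gt_eqF.
have h6 : 6 * B / r * c = 6 * (B * (c / r)) by field; rewrite gt_eqF.
have p : 0 <= B * c ^+ 2 * (1 + 6 / r).
  by apply: mulr_ge0; [rewrite mulr_ge0 ?sqr_ge0|rewrite addr_ge0// divr_ge0// ltW].
have p2 : 0 <= B * (c / r) ^+ 2 by rewrite mulr_ge0 ?sqr_ge0.
move: e1 e4 e5; rewrite h4 h6 mulr1 (_ : B * (4 / r * c) ^+ 2 = 16 * (B * (c / r) ^+ 2)); last first.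
  by field; rewrite gt_eqF.
by lra.
Qed.

(** Each condition in [C11] is a non-strict inequality between finitely many values, so it survives
    a pointwise limit, derivative included. *)
Lemma C11_culim D (B : R) (f f' : nat -> R[i] -> R[i]) :
  (forall n, C11 D B (f n) (f' n)) ->
  C11 D B (fun z => culim (fun n => f n z)) (fun z => culim (fun n => f' n z)).
Proof.
move=> fB z Dz.
have fb w : D w -> cbounded (fun n => f n w) by move=> Dw; exists B, 0%N => n _; case: (fB n w Dw).
have fb' : cbounded (fun n => f' n z) by exists B, 0%N => n _; case: (fB n z Dz).
split; [apply: (@culim_le _ _ _ 0%N)|apply: (@culim_le _ _ _ 0%N)|] => //.
- exact: fb.
- by move=> n _; case: (fB n z Dz).
- by move=> n _; case: (fB n z Dz).
- move=> w Dw.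
  have -> : culim (fun n => f n w) - culim (fun n => f n z) - culim (fun n => f' n z) * (w - z) =
      culim (fun n => f n w - f n z - f' n z * (w - z)).
    rewrite culimB; last 2 first.
    - by apply: cboundedD; [exact: fb|apply: cboundedN; exact: fb].
    - by apply: cboundedM => //; exact: cbounded_cst.
    rewrite culimB; [|exact: fb|exact: fb].
    by rewrite culimM ?culim_cst//; exact: cbounded_cst.
  apply: (@culim_le _ _ _ 0%N).
    apply: cboundedD.
      by apply: cboundedD; [exact: fb|apply: cboundedN; exact: fb].
    by apply/cboundedN/cboundedM => //; exact: cbounded_cst.
  by move=> n _; case: (fB n z Dz) => _ _; exact.
Qed.
End estimates.

(** * Gluing across the real line *)

Section average.
Variable R : realType.
Local Notation mu := (@lebesgue_measure R).
Implicit Types (D E : R[i] -> Prop) (f g : R[i] -> R[i]) (z w : R[i]).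

(** Horizontal averaging commutes with holomorphy and has the derivative [(f (z + e) - f z) / e],
    which stays bounded up to the real line even where [f'] does not. *)
Definition avg (e : R) f z := (e^-1)%:C * cint 0 e (fun s => f (z + s%:C)).

Lemma clipB (a b : R) (g h : R -> R[i]) : clip a b g -> clip a b h -> clip a b (fun t => g t - h t).
Proof.
move=> [L gL] [M hM]; exists (L + M) => s t sI tI.
rewrite (_ : _ - _ = (g t - g s) - (h t - h s)); last by ring.
by rewrite (le_trans (cabsB _ _))// mulrDl lerD ?gL ?hM.
Qed.

Lemma clipZ (a b : R) c (g : R -> R[i]) : clip a b g -> clip a b (fun t => c * g t).
Proof.
move=> [L gL]; exists (cabs c * L) => s t sI tI.
by rewrite -mulrBr cabsM -mulrA ler_wpM2l ?cabs_ge0// gL.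
Qed.

Lemma clip_cst (a b : R) c : clip a b (fun=> c).
Proof. by exists 0 => s t _ _; rewrite subrr cabs0 mul0r. Qed.

Lemma avg_near (e M : R) f z c : 0 < e -> clip 0 e (fun s => f (z + s%:C)) ->
  (forall s, 0 <= s <= e -> cabs (f (z + s%:C) - c) <= M) -> cabs (avg e f z - c) <= 2 * M.
Proof.
move=> e0 fc fM; have e0' := ltW e0.
have -> : avg e f z - c = (e^-1)%:C * cint 0 e (fun s => f (z + s%:C) - c).
  rewrite (cintB e0' fc (clip_cst _ _ _)) cint_cst// subr0 mulrBr; congr (_ - _).
  by rewrite mulrCA -(rmorphM (real_complex R)) mulVf ?gt_eqF// mulr1.
rewrite cabsM cabs_real gtr0_norm ?invr_gt0// ler_pdivrMl//.
have -> : e * (2 * M) = 2 * M * (e - 0) by ring.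
by apply: cint_le => //; apply: clipB fc (clip_cst _ _ _).
Qed.

Lemma avg_le (e M : R) f z : 0 < e -> clip 0 e (fun s => f (z + s%:C)) ->
  (forall s, 0 <= s <= e -> cabs (f (z + s%:C)) <= M) -> cabs (avg e f z) <= 2 * M.
Proof.
move=> e0 fc fM; rewrite -[avg _ _ _]subr0; apply: avg_near => // s sI.
by rewrite subr0; exact: fM.
Qed.

Lemma avgB (e M : R) f z w : 0 < e -> clip 0 e (fun s => f (z + s%:C)) ->
  clip 0 e (fun s => f (w + s%:C)) ->
  (forall s, 0 <= s <= e -> cabs (f (w + s%:C) - f (z + s%:C)) <= M) ->
  cabs (avg e f w - avg e f z) <= 2 * M.
Proof.
move=> e0 fz fw fM; rewrite /avg -mulrBr -cintB ?(ltW e0)//.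
rewrite cabsM cabs_real gtr0_norm ?invr_gt0// ler_pdivrMl//.
have -> : e * (2 * M) = 2 * M * (e - 0) by ring.
by apply: cint_le; rewrite ?(ltW e0)//; exact: clipB.
Qed.

Lemma seg_shift (D : R[i] -> Prop) (e B : R) f f' z : (forall s : R, 0 <= s <= e -> D (z + s%:C)) ->
  C11 D B f f' -> C11 (seg 0 e) B (fun w => f (z + w)) (fun w => f' (z + w)).
Proof.
move=> zD fB w [w0 wI]; have wE : w = (Re w)%:C by apply: complex_eq.
have := zD _ wI; rewrite -wE => Dw; have [h1 h2 h3] := fB _ Dw; split => // v [v0 vI].
have vE : v = (Re v)%:C by apply: complex_eq.
have := zD _ vI; rewrite -vE => Dv; have := h3 _ Dv.
by rewrite (_ : z + v - (z + w) = v - w)//; ring.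
Qed.

(** The average of [f'] over the segment is the difference quotient of [f], by the fundamental
    theorem. *)
Lemma avg_hol D E (e : R) f f' : 0 < e -> (forall z s, D z -> 0 <= s <= e -> E (z + s%:C)) ->
  hol E f f' -> hol D (avg e f) (fun z => (e^-1)%:C * (f (z + e%:C) - f z)).
Proof.
move=> e0 DE [B fB]; exists (2 * B + 2 * B / e) => z Dz; have e0' := ltW e0.
have sz := seg_shift (fun s => DE z s Dz) fB.
have cz := C11_clip sz; have cz' := C11_deriv_clip sz.
have ze : E (z + e%:C) by apply: DE => //; rewrite lexx ltW.
have z0 : E z by rewrite -[z]addr0; apply: DE => //; rewrite lexx ltW.
have B0 := C11_ge0 fB z0.
have Be : 0 <= 2 * B / e by rewrite divr_ge0 ?mulr_ge0.
split.
- rewrite (@le_trans _ _ (2 * B))// ?lerDl//; apply: avg_le => // s sI.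
  by case: (fB _ (DE z s Dz sI)).
- rewrite cabsM cabs_real gtr0_norm ?invr_gt0// mulrC.
  have [h1 _ _] := fB _ ze; have [h2 _ _] := fB _ z0.
  rewrite (@le_trans _ _ (2 * B / e))// ?lerDr ?mulr_ge0//.
  rewrite ler_wpM2r ?invr_ge0// (le_trans (cabsB _ _))//; lra.
- move=> w Dw; have sw := seg_shift (fun s => DE w s Dw) fB; have cw := C11_clip sw.
  have -> : avg e f w - avg e f z - (e^-1)%:C * (f (z + e%:C) - f z) * (w - z) =
    (e^-1)%:C * cint 0 e (fun s => f (w + s%:C) - f (z + s%:C) - (w - z) * f' (z + s%:C)).
    rewrite (cintB e0' (clipB cw cz) (clipZ _ cz')) (cintB e0' cw cz) (cintZ _ e0' cz').
    by rewrite (cint_ftc e0' sz) addr0 /avg; ring.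
  rewrite cabsM cabs_real gtr0_norm ?invr_gt0// ler_pdivrMl//.
  apply: (@le_trans _ _ (2 * (B * cabs (w - z) ^+ 2) * (e - 0))).
    apply: cint_le => //; first exact: clipB (clipB cw cz) (clipZ _ cz').
    move=> s sI; have [_ _ /(_ _ (DE w s Dw sI))] := fB _ (DE z s Dz sI).
    by rewrite (_ : w + s%:C - (z + s%:C) = w - z) 1?(mulrC (w - z))//; ring.
  rewrite subr0 mulrC ler_wpM2l// mulrA ler_wpM2r ?sqr_ge0//.
  by rewrite lerDl.
Qed.

Lemma rint_dct (a b M : R) (h : nat -> R -> R) : a <= b ->
  (forall n, exists K, rlip a b K (h n)) ->
  (forall n t, a <= t <= b -> `|h n t| <= M) ->
  {ae mu, forall t, a <= t <= b -> forall e : R, 0 < e -> exists n0, forall n, (n0 <= n)%N -> `|h n t| <= e} ->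
  forall e : R, 0 < e -> exists n0, forall n, (n0 <= n)%N -> `|rint a b (h n)| <= e.
Proof.
move=> ab hK hM h0.
have hI n : mu.-integrable `]a, b] (EFin \o h n).
  by have [K] := hK n; exact: rlip_integrable.
have H1 n : measurable_fun `]a, b]%classic (EFin \o h n) by case/integrableP : (hI n).
have H2 : measurable_fun `]a, b]%classic (fun=> 0%E : \bar R) by exact: measurable_cst.
have H3 : {ae mu, forall t, `]a, b]%classic t -> (EFin \o h n) t @[n --> \oo] --> (0%E : \bar R)}.
  apply: (ae_imp _ h0) => t H /=; rewrite in_itv/= => /andP[at_ tb].
  apply: cvg_EFin; first by apply: nearW.
  apply/cvgrPdist_le => e e0; have [|n0 n0P] := H _ e e0; first by rewrite ltW.
  by exists n0 => // n /n0P; rewrite /= sub0r normrN.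
have H4 : mu.-integrable `]a, b]%classic (fun=> M%:E).
  exact: (rlip_integrable ab (@rlip_cst _ a b M)).
have H5 : {ae mu, forall t, forall n, `]a, b]%classic t -> (`|(EFin \o h n) t| <= M%:E)%E}.
  apply: ae_all => t n /=; rewrite in_itv/= => /andP[at_ tb].
  by rewrite lee_fin hM// tb ltW.
have [_ _] := @dominated_convergence _ _ R mu `]a, b]%classic (measurable_itv `]a, b])
  (fun n => EFin \o h n) (fun=> 0%E) (fun=> M%:E) H1 H2 H3 H4 H5.
rewrite integral0 => H.
have H' : (fun n => rint a b (h n)) @ \oo --> (0 : R) by exact: fine_cvg.
move=> e e0; move/cvgrPdist_le : H' => /(_ e e0)[n0 _ n0P].
by exists n0 => n /n0P; rewrite sub0r normrN.
Qed.

Lemma cint_dct (a b M : R) (g : nat -> R -> R[i]) : a <= b -> (forall n, clip a b (g n)) ->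
  (forall n t, a <= t <= b -> cabs (g n t) <= M) ->
  {ae mu, forall t, a <= t <= b -> forall e : R, 0 < e -> exists n0, forall n, (n0 <= n)%N -> cabs (g n t) <= e} ->
  forall e : R, 0 < e -> exists n0, forall n, (n0 <= n)%N -> cabs (cint a b (g n)) <= e.
Proof.
move=> ab gc gM g0 e e0; have e2 : 0 < e / 2 by rewrite divr_gt0.
have [|||n0 n0P] := @rint_dct a b M (fun n t => Re (g n t)) ab _ _ _ _ e2.
- by move=> n; have [K [? _]] := clip_rlip (gc n); exists K.
- by move=> n t tI; rewrite (le_trans (cabs_Re _))// gM.
- apply: (ae_imp _ g0) => t H tI e' e'0; have [n0 n0P] := H tI e' e'0.
  by exists n0 => n /n0P; apply: le_trans; exact: cabs_Re.
have [|||n1 n1P] := @rint_dct a b M (fun n t => Im (g n t)) ab _ _ _ _ e2.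
- by move=> n; have [K [_ ?]] := clip_rlip (gc n); exists K.
- by move=> n t tI; rewrite (le_trans (cabs_Im _))// gM.
- apply: (ae_imp _ g0) => t H tI e' e'0; have [n1 n1P] := H tI e' e'0.
  by exists n1 => n /n1P; apply: le_trans; exact: cabs_Im.
exists (maxn n0 n1) => n; rewrite geq_max => /andP[/n0P h0 /n1P h1].
by rewrite (le_trans (cabs_le _))// [leRHS]splitr lerD.
Qed.
End average.

Section extension.
Variable R : realType.
Implicit Types (f g h d : R[i] -> R[i]) (z w : R[i]).

Definition iinv (n : nat) : R[i] := 0 +i* (n.+1%:R)^-1.

(** The value on the line is taken from above, as a limit that always exists for bounded [g]. Once
    the jumps of [g] tend to [0] it is the boundary value from below as well. *)
Definition ext g z : R[i] := if Im z == 0 then culim (fun n => g (z + iinv n)) else g z.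

Lemma ext_off g z : Im z != 0 -> ext g z = g z.
Proof. by rewrite /ext => /negPf ->. Qed.

Lemma cabs_iinv n : cabs (iinv n) = (n.+1%:R)^-1.
Proof. by rewrite /cabs /= expr0n add0r sqrtr_sqr ger0_norm// invr_ge0. Qed.

Lemma invn_small (e : R) : 0 < e -> exists n0, forall n, (n0 <= n)%N -> (n.+1%:R : R)^-1 < e.
Proof.
move=> e0; exists (Num.truncn e^-1) => n n0n.
rewrite -[ltRHS]invrK ltf_pV2 ?posrE ?invr_gt0//.
by rewrite (lt_le_trans (truncnS_gt _))// ler_nat.
Qed.

Definition sg (b : bool) : R := if b then 1 else -1.

Definition half (b : bool) (t0 r delta : R) z := disc t0%:C r z /\ delta < sg b * Im z.

Lemma abs_sg b : `|sg b| = 1.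
Proof. by case: b; rewrite /sg /= ?normrN normr1. Qed.

Lemma sg_cases z : Im z != 0 -> exists b, 0 < sg b * Im z.
Proof.
rewrite neq_lt => /orP[z0|z0]; [exists false|exists true]; rewrite /sg ?mulN1r ?mul1r//.
by rewrite oppr_gt0.
Qed.

Lemma half_convex b t0 r delta z w t : half b t0 r delta z -> half b t0 r delta w -> 0 <= t <= 1 ->
  half b t0 r delta (z + t%:C * (w - z)).
Proof.
move=> [zd zi] [wd wi] tI; split; first exact: disc_convex.
rewrite !cplxE /= mul0r addr0.
have -> : sg b * (Im z + t * (Im w - Im z)) = (1 - t) * (sg b * Im z) + t * (sg b * Im w) by ring.
case/andP: tI => t0' t1; have [->|tn0] := eqVneq t 0; first by rewrite subr0 mul1r mul0r addr0.
have h1 : t * delta < t * (sg b * Im w) by rewrite ltr_pM2l// lt_def tn0.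
have h2 : (1 - t) * delta <= (1 - t) * (sg b * Im z) by rewrite ler_wpM2l ?subr_ge0// ltW.
by lra.
Qed.

Lemma crossing z w : Im z != 0 -> 0 <= - (Im z * Im w) -> exists2 t : R, 0 <= t <= 1 &
  Im (z + t%:C * (w - z)) = 0.
Proof.
move=> z0 zw; have D0 : Im z - Im w != 0.
  apply/eqP => /eqP; rewrite subr_eq0 => /eqP e; move: zw; rewrite -e oppr_ge0.
  by rewrite leNgt -expr2 lt_def sqr_ge0 sqrf_eq0 z0.
have zz : 0 < Im z ^+ 2 by rewrite lt_def sqr_ge0 sqrf_eq0 z0.
exists (Im z / (Im z - Im w)).
  have -> : Im z / (Im z - Im w) = Im z ^+ 2 / (Im z ^+ 2 - Im z * Im w).
    by rewrite expr2 -mulrBr invfM mulrACA divff// mul1r.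
  have p : 0 < Im z ^+ 2 - Im z * Im w by lra.
  by rewrite divr_ge0 ?(ltW zz) ?(ltW p)//= ler_pdivrMr// mul1r; lra.
by rewrite !cplxE /= mul0r addr0; field.
Qed.

Section lipschitz_extension.
Variables (t0 rho L : R) (g : R[i] -> R[i]).
Hypothesis rho0 : 0 < rho.
Hypothesis L0 : 0 <= L.
Hypothesis gL : forall b z w, half b t0 rho 0 z -> half b t0 rho 0 w ->
  cabs (g w - g z) <= L * cabs (w - z).
Hypothesis gx : forall t : R, `|t - t0| < rho -> forall e : R, 0 < e ->
  exists n0, forall n, (n0 <= n)%N -> cabs (g (t%:C + iinv n) - g (t%:C - iinv n)) <= e.

Let sgi b n : R[i] := (sg b)%:C * iinv n.

Let Im_sgi b n : Im (sgi b n) = sg b / n.+1%:R.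
Proof. by rewrite /sgi !cplxE /= mul0r addr0. Qed.

Let sg2 b : sg b * sg b = 1. Proof. by case: b; rewrite /sg ?mulr1// mulrNN mulr1. Qed.

Let cabs_sgi b n : cabs (sgi b n) = (n.+1%:R)^-1.
Proof. by rewrite /sgi cabsM cabs_iinv cabs_real abs_sg mul1r. Qed.

Let near_half b (t : R) : `|t - t0| < rho -> exists n0, forall n, (n0 <= n)%N ->
  half b t0 rho 0 (t%:C + sgi b n).
Proof.
move=> tr; have [|n0 n0P] := @invn_small (rho - `|t - t0|); first by rewrite subr_gt0.
exists n0 => n /n0P nr; split.
- rewrite /disc (_ : _ - _ = (t - t0)%:C + sgi b n); last by rewrite (rmorphB (real_complex R)); ring.
  by rewrite (le_lt_trans (cabsD _ _))// cabs_real cabs_sgi -ltrBrDl.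
- by rewrite ImD Im_sgi /= add0r mulrA sg2 mul1r invr_gt0.
Qed.

Let g_bounded b (t : R) : `|t - t0| < rho -> cbounded (fun n => g (t%:C + sgi b n)).
Proof.
move=> tr; have [n0 n0P] := near_half b tr.
exists (cabs (g (t%:C + sgi b n0)) + L * 2), n0 => n nn.
rewrite -[g _](subrK (g (t%:C + sgi b n0))) addrC (le_trans (cabsD _ _))// lerD2l.
rewrite (le_trans (gL (n0P _ (leqnn _)) (n0P _ nn)))// ler_wpM2l//.
rewrite (_ : _ - _ = sgi b n - sgi b n0); last by ring.
rewrite (le_trans (cabsB _ _))// !cabs_sgi.
have i1 m : (m.+1%:R : R)^-1 <= 1 by rewrite invf_le1// ler1n.
by rewrite (_ : 2 = 1 + 1 :> R) ?lerD//; ring.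
Qed.

Let ext_real b (t : R) : `|t - t0| < rho -> ext g t%:C = culim (fun n => g (t%:C + sgi b n)).
Proof.
move=> tr; have E : ext g t%:C = culim (fun n => g (t%:C + sgi true n)).
  by rewrite /ext /= eqxx; congr culim; apply/funext => n; rewrite /sgi /sg mul1r.
rewrite E; case: b => //.
apply/eqP; rewrite -subr_eq0 -culimB; [|exact: g_bounded|exact: g_bounded].
apply/eqP/culim_eq => e /(gx tr)[n0 n0P]; exists n0 => n /n0P.
rewrite subr0 /sgi /sg mul1r.
by have -> : (-1)%:C * iinv n = - iinv n by apply: complex_eq; rewrite !cplxE /=; ring.
Qed.

Let ext_lip_half b z (t : R) : half b t0 rho 0 z -> `|t - t0| < rho ->
  cabs (g z - ext g t%:C) <= L * cabs (z - t%:C).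
Proof.
move=> hz tr; rewrite (ext_real b tr).
have gb := g_bounded b tr.
rewrite -(culim_cst (g z)) -culimB//; last exact: cbounded_cst.
apply/ler_addgt0Pr => e e0; have [n0 n0P] := near_half b tr.
have [|n1 n1P] := @invn_small (e / (1 + L)); first by rewrite divr_gt0// ltr_pwDl.
apply: (@culim_le _ _ _ (maxn n0 n1)).
  by apply: cboundedD; [exact: cbounded_cst|exact: cboundedN].
move=> n; rewrite geq_max => /andP[/n0P hn /n1P].
rewrite ltr_pdivlMr ?ltr_pwDl// => ne.
rewrite (le_trans (gL hn hz))//; move: ne; rewrite -(cabs_sgi b n) => ne.
have : cabs (z - (t%:C + sgi b n)) <= cabs (z - t%:C) + cabs (sgi b n).
  by rewrite (_ : z - _ = (z - t%:C) - sgi b n) ?cabsB//; ring.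
move=> h; have : L * cabs (z - (t%:C + sgi b n)) <= L * (cabs (z - t%:C) + cabs (sgi b n)).
  by rewrite ler_wpM2l.
have := cabs_ge0 (sgi b n).
by lra.
Qed.

Let ext_lip_real (s t : R) : `|s - t0| < rho -> `|t - t0| < rho ->
  cabs (ext g s%:C - ext g t%:C) <= L * cabs (s%:C - t%:C).
Proof.
move=> sr tr; rewrite (ext_real true sr) (ext_real true tr) -culimB; [|exact: g_bounded..].
have [n0 n0P] := near_half true sr; have [n1 n1P] := near_half true tr.
apply: (@culim_le _ _ _ (maxn n0 n1)).
  by apply: cboundedD; [|apply: cboundedN]; exact: g_bounded.
move=> n; rewrite geq_max => /andP[/n0P hs /n1P ht].
by rewrite (le_trans (gL ht hs))// (_ : _ - _ = s%:C - t%:C)//; ring.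
Qed.

Let realE z : Im z = 0 -> z = (Re z)%:C. Proof. by move=> z0; apply: complex_eq. Qed.

Let disc_real z : disc t0%:C rho z -> Im z = 0 -> `|Re z - t0| < rho.
Proof.
by move=> zr z0; move: zr; rewrite /disc {1}(realE z0) -(rmorphB (real_complex R)) cabs_real.
Qed.

Let ext_lip_1 z w : disc t0%:C rho z -> disc t0%:C rho w -> Im w = 0 ->
  cabs (ext g z - ext g w) <= L * cabs (z - w).
Proof.
move=> zr wr w0; have [z0|z0] := eqVneq (Im z) 0.
  rewrite (realE z0) (realE w0); apply: ext_lip_real; exact: disc_real.
have [b bz] := sg_cases z0; rewrite (ext_off _ z0) (realE w0).
by apply: (@ext_lip_half b); [split|exact: disc_real].
Qed.

(** A segment that changes sides is cut at its real point. The two lengths add up to [cabs (w - z)],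
    so the constant is preserved. *)
Lemma ext_lip z w : disc t0%:C rho z -> disc t0%:C rho w ->
  cabs (ext g w - ext g z) <= L * cabs (w - z).
Proof.
move=> zr wr; have [z0|z0] := eqVneq (Im z) 0; first exact: ext_lip_1.
have [w0|w0] := eqVneq (Im w) 0.
  by rewrite cabs_distC (cabs_distC w); exact: ext_lip_1.
have [zw|zw] := leP 0 (- (Im z * Im w)); last first.
  have [b bz] := sg_cases z0; rewrite !ext_off//; apply: (@gL b); split => //.
  rewrite -(pmulr_rgt0 _ bz) mulrACA sg2 mul1r; lra.
have [t tI t0'] := crossing z0 zw.
set u := z + _ in t0'; have ur : disc t0%:C rho u by exact: disc_convex.
have -> : ext g w - ext g z = (ext g w - ext g u) - (ext g z - ext g u) by ring.
rewrite (le_trans (cabsB _ _))// (le_trans (lerD (ext_lip_1 wr ur t0') (ext_lip_1 zr ur t0')))//.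
rewrite -mulrDr ler_wpM2l// /u.
have -> : w - (z + t%:C * (w - z)) = (1 - t)%:C * (w - z).
  by rewrite (rmorphB (real_complex R)); ring.
have -> : z - (z + t%:C * (w - z)) = - (t%:C * (w - z)) by ring.
case/andP: tI => t1 t2.
by rewrite cabsN !cabsM !cabs_real !ger0_norm ?subr_ge0//; lra.
Qed.

Lemma ext_le (B : R) z : (forall w, disc t0%:C rho w -> Im w != 0 -> cabs (g w) <= B) ->
  disc t0%:C rho z -> cabs (ext g z) <= B.
Proof.
move=> gB zr; have [z0|z0] := eqVneq (Im z) 0; last by rewrite ext_off ?gB.
have zr' := disc_real zr z0; have [n0 n0P] := near_half true zr'.
rewrite (realE z0) (ext_real true zr'); apply: (@culim_le _ _ _ n0); first exact: g_bounded.
move=> n /n0P[h1 h2]; apply: gB => //; apply: contraTneq h2 => ->.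
by rewrite mulr0 ltxx.
Qed.
End lipschitz_extension.

Section C11_across.
Variables (t0 rho Lh M : R) (h d : R[i] -> R[i]).
Hypotheses (Lh0 : 0 <= Lh) (M0 : 0 <= M).
Hypothesis hL : forall z w, disc t0%:C rho z -> disc t0%:C rho w -> cabs (h w - h z) <= Lh * cabs (w - z).
Hypothesis dL : forall z w, disc t0%:C rho z -> disc t0%:C rho w -> cabs (d w - d z) <= M * cabs (w - z).
Hypothesis hd : forall b z w, half b t0 rho 0 z -> half b t0 rho 0 w ->
  cabs (h w - h z - d z * (w - z)) <= M * cabs (w - z) ^+ 2.

(** Both points are moved vertically by [a] into the open half disc, leaving [w - z] unchanged; the
    Lipschitz bounds on [h] and [d] let [a] tend to [0]. *)
Let hd_closed b z w : disc t0%:C rho z -> disc t0%:C rho w -> 0 <= sg b * Im z -> 0 <= sg b * Im w ->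
  cabs (h w - h z - d z * (w - z)) <= M * cabs (w - z) ^+ 2.
Proof.
move=> zr wr z0 w0; apply/ler_addgt0Pr => e e0.
set c := cabs (w - z); have c0 : 0 <= c by exact: cabs_ge0.
have K0 : 0 < 1 + 2 * Lh + M * c by rewrite -addrA ltr_pwDl// addr_ge0 ?mulr_ge0.
pose a := Num.min (e / (1 + 2 * Lh + M * c)) (Num.min ((rho - cabs (z - t0%:C)) / 2) ((rho - cabs (w - t0%:C)) / 2)).
have a0 : 0 < a by rewrite !lt_min !divr_gt0// subr_gt0.
pose p : R[i] := 0 +i* (sg b * a).
have pa : cabs p = a.
  by rewrite /cabs /p /= expr0n add0r sqrtr_sqr normrM abs_sg mul1r gtr0_norm.
have az : a <= (rho - cabs (z - t0%:C)) / 2 by rewrite !ge_min lexx orbT.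
have aw : a <= (rho - cabs (w - t0%:C)) / 2 by rewrite !ge_min lexx !orbT.
have ae : a <= e / (1 + 2 * Lh + M * c) by rewrite ge_min lexx.
have sb : sg b * (sg b * a) = a by case: (b); rewrite /sg; ring.
have hz : half b t0 rho 0 (z + p).
  split; first by rewrite /disc addrAC (le_lt_trans (cabsD _ _))// pa; move: zr; rewrite /disc; lra.
  by rewrite ImD mulrDr /= sb; lra.
have hw : half b t0 rho 0 (w + p).
  split; first by rewrite /disc addrAC (le_lt_trans (cabsD _ _))// pa; move: wr; rewrite /disc; lra.
  by rewrite ImD mulrDr /= sb; lra.
have := hd hz hw; have -> : w + p - (z + p) = w - z by ring.
move=> H; have -> : h w - h z - d z * (w - z) =
  (h (w + p) - h (z + p) - d (z + p) * (w - z)) -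
  ((h (w + p) - h w) - (h (z + p) - h z) - (d (z + p) - d z) * (w - z)) by ring.
rewrite (le_trans (cabsB _ _))// lerD// (le_trans (cabsB _ _))//.
rewrite (le_trans (lerD (cabsB _ _) (lexx _)))// cabsM.
have h1 := hL wr hw.1; have h2 := hL zr hz.1; have h3 := dL zr hz.1.
move: h1 h2 h3; rewrite !(addrC _ p) !addrK pa => h1 h2 h3.
have h4 : cabs (d (p + z) - d z) * c <= M * a * c by rewrite ler_wpM2r.
by move: ae; rewrite ler_pdivlMr// -/c; lra.
Qed.

(** With [u] the real point of the segment, the remainder is the sum of those from [z] to [u] and
    from [u] to [w] and of [(d u - d z) * (w - u)]. Each is at most [M * cabs (w - z) ^+ 2], hence
    [3 * M]. *)
Lemma C11_across B : (forall z, disc t0%:C rho z -> cabs (h z) <= B) ->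
  (forall z, disc t0%:C rho z -> cabs (d z) <= B) ->
  C11 (disc t0%:C rho) (Num.max B (3 * M)) h d.
Proof.
move=> hB dB z zr; split; [by rewrite le_max hB|by rewrite le_max dB|].
move=> w wr; apply: (@le_trans _ _ (3 * M * cabs (w - z) ^+ 2)); last first.
  by rewrite ler_wpM2r ?sqr_ge0// le_max lexx orbT.
have Mc : 0 <= M * cabs (w - z) ^+ 2 by rewrite mulr_ge0 ?sqr_ge0.
have same b : 0 <= sg b * Im z -> 0 <= sg b * Im w -> cabs (h w - h z - d z * (w - z)) <= 3 * M * cabs (w - z) ^+ 2.
  by move=> z0 w0; rewrite (le_trans (hd_closed zr wr z0 w0))//; lra.
have [z0|z0] := eqVneq (Im z) 0.
  have [w0|w0] := eqVneq (Im w) 0; first by apply: (same true); rewrite ?z0 ?w0 mulr0.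
  by have [b bw] := sg_cases w0; apply: (same b); rewrite ?z0 ?mulr0// ltW.
have [b bz] := sg_cases z0.
have [zw|zw] := ltP (- (Im z * Im w)) 0.
  apply: (same b); first exact: ltW.
  rewrite -(pmulr_rge0 _ bz) mulrACA (_ : sg b * sg b = 1); last by case: (b); rewrite /sg ?mulr1// mulrNN mulr1.
  by rewrite mul1r; lra.
have [t tI u0] := crossing z0 zw; set u := z + _ in u0.
have ur : disc t0%:C rho u by exact: disc_convex.
have uz : u - z = t%:C * (w - z) by rewrite /u; ring.
have wu : w - u = (1 - t)%:C * (w - z) by rewrite /u (rmorphB (real_complex R)); ring.
have r1 : cabs (h u - h z - d z * (u - z)) <= M * cabs (u - z) ^+ 2.
  by apply: (@hd_closed b) => //; rewrite ?u0 ?mulr0// ltW.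
have r2 : cabs (h w - h u - d u * (w - u)) <= M * cabs (w - u) ^+ 2.
  have [w0|w0] := eqVneq (Im w) 0.
    by apply: (@hd_closed true) => //; rewrite ?u0 ?w0 mulr0.
  by have [b' bw] := sg_cases w0; apply: (@hd_closed b') => //; rewrite ?u0 ?mulr0// ltW.
have r3 : cabs (d u - d z) <= M * cabs (u - z) by exact: dL.
have -> : h w - h z - d z * (w - z) = (h w - h u - d u * (w - u)) + (h u - h z - d z * (u - z))
   + (d u - d z) * (w - u) by ring.
rewrite (le_trans (cabsD _ _))// (le_trans (lerD (cabsD _ _) (lexx _)))// cabsM.
case/andP: tI => t1 t2.
move: r1 r2 r3; rewrite uz wu !cabsM !cabs_real !ger0_norm ?subr_ge0//.
set c := cabs (w - z) => r1 r2 r3; have c0 : 0 <= c by exact: cabs_ge0.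
have tc : t * c <= c by rewrite ler_piMl.
have tc' : (1 - t) * c <= c by rewrite ler_piMl//; lra.
have q1 : (t * c) ^+ 2 <= c ^+ 2 by rewrite lerXn2r ?nnegrE ?mulr_ge0.
have q2 : ((1 - t) * c) ^+ 2 <= c ^+ 2 by rewrite lerXn2r ?nnegrE ?mulr_ge0 ?subr_ge0.
have q3 : (t * c) * ((1 - t) * c) <= c ^+ 2 by rewrite expr2 ler_pM ?mulr_ge0 ?subr_ge0.
have q4 : cabs (d u - d z) * ((1 - t) * c) <= M * (t * c) * ((1 - t) * c).
  by rewrite ler_wpM2r ?mulr_ge0 ?subr_ge0.
have m1 : M * (t * c) ^+ 2 <= M * c ^+ 2 by rewrite ler_wpM2l.
have m2 : M * ((1 - t) * c) ^+ 2 <= M * c ^+ 2 by rewrite ler_wpM2l.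
have m3 : M * ((t * c) * ((1 - t) * c)) <= M * c ^+ 2 by rewrite ler_wpM2l.
by move: r1 r2 q4; lra.
Qed.
End C11_across.
End extension.

Section gluing.
Variable R : realType.
Local Notation mu := (@lebesgue_measure R).
Variables (t0 r B : R) (f f' : R[i] -> R[i]).
Hypothesis r0 : 0 < r.
Hypothesis fB : forall z, disc t0%:C r z -> Im z != 0 -> cabs (f z) <= B.
Hypothesis fh : forall b delta, 0 < delta -> hol (half b t0 r delta) f f'.
Hypothesis fm : {ae mu, forall t : R, `|t - t0| < r -> forall e : R, 0 < e ->
  exists n0, forall n, (n0 <= n)%N -> cabs (f (t%:C + iinv R n) - f (t%:C - iinv R n)) <= e}.

Let B0 : 0 <= B.
Proof.
apply: le_trans (fB (z := t0%:C + 0 +i* (r / 2)) _ _); first exact: cabs_ge0.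
- rewrite /disc addrC addKr /cabs /= expr0n add0r sqrtr_sqr gtr0_norm ?divr_gt0//.
  by move: r0; lra.
- by rewrite /= add0r gt_eqF// divr_gt0.
Qed.

Let half_off b rho delta z : 0 <= delta -> half b t0 rho delta z -> Im z != 0.
Proof. by move=> d0 [_]; apply: contraTneq => ->; rewrite mulr0 -leNgt. Qed.

Let half_sub b rho rho' delta z : rho <= rho' -> half b t0 rho delta z -> half b t0 rho' delta z.
Proof. by move=> h [zr zi]; split => //; exact: lt_le_trans zr h. Qed.

Let half_shift b rho rho' delta z (s : R) : 0 <= s -> rho + s <= rho' ->
  half b t0 rho delta z -> half b t0 rho' delta (z + s%:C).
Proof.
move=> s0 h [zr zi]; split; last by rewrite ImD /= addr0.
rewrite /disc addrAC (le_lt_trans (cabsD _ _))// cabs_real ger0_norm//.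
by move: zr; rewrite /disc; lra.
Qed.

Let half_min b rho z w : half b t0 rho 0 z -> half b t0 rho 0 w -> exists2 delta, 0 < delta &
  half b t0 rho delta z /\ half b t0 rho delta w.
Proof.
move=> [zr zi] [wr wi]; exists (Num.min (sg R b * Im z) (sg R b * Im w) / 2).
  by rewrite divr_gt0// lt_min zi.
have h : Num.min (sg R b * Im z) (sg R b * Im w) / 2 < Num.min (sg R b * Im z) (sg R b * Im w).
  by rewrite ltr_pdivrMr// mulr_natr mulr2n ltrDl lt_min zi.
by split; split => //; rewrite (lt_le_trans h)// ge_min lexx ?orbT.
Qed.

Section fixed_width.
Variable e : R.
Hypotheses (e0 : 0 < e) (er : e <= r / 4).

Let A := avg e f.
Let dA z := (e^-1)%:C * (f (z + e%:C) - f z).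
Let L := 2 * B / e.

Let L0 : 0 <= L. Proof. by rewrite divr_ge0 ?mulr_ge0// ltW. Qed.

Let A_hol b delta : 0 < delta -> hol (half b t0 (r - e) delta) A dA.
Proof.
move=> d0; apply: (@avg_hol R _ (half b t0 r delta) e f f') => //; last exact: fh.
by move=> z s zr /andP[s0 se]; apply: half_shift zr => //; lra.
Qed.

Let dA_le b z : half b t0 (r - e) 0 z -> cabs (dA z) <= L.
Proof.
move=> hz; rewrite cabsM cabs_real gtr0_norm ?invr_gt0// mulrC ler_wpM2r ?invr_ge0 ?(ltW e0)//.
have h1 : half b t0 r 0 (z + e%:C) by apply: half_shift hz; [exact: ltW|lra].
have h2 : half b t0 r 0 z by apply: half_sub hz; move: e0; lra.
rewrite (le_trans (cabsB _ _))//.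
have := fB h1.1 (half_off (lexx _) h1); have := fB h2.1 (half_off (lexx _) h2).
by lra.
Qed.

Let A_lip b z w : half b t0 (r - e) 0 z -> half b t0 (r - e) 0 w ->
  cabs (A w - A z) <= L * cabs (w - z).
Proof.
move=> hz hw; have [delta d0 [hz' hw']] := half_min hz hw.
have [K AK] := A_hol b d0.
have := @mean_value R _ K L A dA z w 0 AK; rewrite mul0r subr0; apply.
- by move=> t tI; exact: half_convex.
- by move=> t tI; rewrite subr0; apply: (@dA_le b); exact: half_convex.
Qed.

Let f_clip b z : half b t0 (r - e) 0 z -> clip 0 e (fun s => f (z + s%:C)).
Proof.
move=> hz; have [delta d0 [hz' _]] := half_min hz hz; have [K fK] := fh b d0.
apply: C11_clip (fun w => f (z + w)) (fun w => f' (z + w)) _.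
apply: seg_shift fK => s /andP[s0 se]; apply: half_shift hz' => //; lra.
Qed.

Let A_le z : disc t0%:C (r - e) z -> Im z != 0 -> cabs (A z) <= 2 * B.
Proof.
move=> zr z0; have [b bz] := sg_cases z0; have hz : half b t0 (r - e) 0 z by [].
apply: avg_le => //; first exact: f_clip hz.
move=> s /andP[s0 se]; have hs : half b t0 r 0 (z + s%:C) by apply: half_shift hz => //; lra.
by apply: fB; [exact: hs.1|exact: half_off (lexx _) hs].
Qed.

Let near_pt b (t : R) : `|t - t0| < r - e -> exists n0, forall n, (n0 <= n)%N ->
  half b t0 (r - e) 0 (t%:C + (sg R b)%:C * iinv R n).
Proof.
move=> tr; have [|n0 n0P] := @invn_small R (r - e - `|t - t0|); first by rewrite subr_gt0.
exists n0 => n /n0P nr; split.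
- rewrite /disc (_ : _ - _ = (t - t0)%:C + (sg R b)%:C * iinv R n); last first.
    by rewrite (rmorphB (real_complex R)); ring.
  rewrite (le_lt_trans (cabsD _ _))// cabsM !cabs_real cabs_iinv abs_sg mul1r.
  by rewrite -ltrBrDl.
- rewrite !cplxE /= mul0r !addr0 add0r mulrA.
  have -> : sg R b * sg R b = 1 by case: b; rewrite /sg ?mulr1// mulrNN mulr1.
  by rewrite mul1r invr_gt0.
Qed.

(** The jump of the average at [t] is the average of the jumps of [f] over [[t, t + e]]. These are
    bounded and tend to [0] almost everywhere, so dominated convergence removes the exceptional
    points. *)
Let A_cross (t : R) : `|t - t0| < r - e -> forall eta : R, 0 < eta ->
  exists n0, forall n, (n0 <= n)%N -> cabs (A (t%:C + iinv R n) - A (t%:C - iinv R n)) <= eta.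
Proof.
move=> tr; have [n0 n0P] := near_pt true tr; have [n1 n1P] := near_pt false tr.
have up n : (maxn n0 n1 <= n)%N -> half true t0 (r - e) 0 (t%:C + iinv R n).
  by rewrite geq_max => /andP[/n0P + _]; rewrite /sg mul1r.
have dn n : (maxn n0 n1 <= n)%N -> half false t0 (r - e) 0 (t%:C - iinv R n).
  rewrite geq_max => /andP[_ /n1P]; rewrite /sg (_ : (-1)%:C = -1 :> R[i]) ?mulN1r//.
  by apply: complex_eq; rewrite !cplxE /= ?oppr0.
pose n2 := maxn n0 n1.
(* The index is shifted by [n2] so that every member of the sequence, not only the late ones, is
   evaluated inside the half discs. *)
pose g n (s : R) := f (t%:C + iinv R (n + n2) + s%:C) - f (t%:C - iinv R (n + n2) + s%:C).
have gc n : clip 0 e (g n).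
  apply: clipB; first by apply: (@f_clip true); apply: up; rewrite leq_addl.
  by apply: (@f_clip false); apply: dn; rewrite leq_addl.
have gM n s : 0 <= s <= e -> cabs (g n s) <= 2 * B.
  move=> /andP[s0 se]; rewrite (le_trans (cabsB _ _))//.
  have h1 : half true t0 r 0 (t%:C + iinv R (n + n2) + s%:C).
    by apply: half_shift (up _ _) => //; [lra|rewrite leq_addl].
  have h2 : half false t0 r 0 (t%:C - iinv R (n + n2) + s%:C).
    by apply: half_shift (dn _ _) => //; [lra|rewrite leq_addl].
  have := fB h1.1 (half_off (lexx _) h1); have := fB h2.1 (half_off (lexx _) h2).
  by lra.
have g0 : {ae mu, forall s, 0 <= s <= e -> forall eta : R, 0 < eta ->
    exists n0, forall n, (n0 <= n)%N -> cabs (g n s) <= eta}.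
  have := @ae_preimage R (fun s => t + s) (fun s => s - t) _ _ _ _ _ _ fm.
  move=> H; apply: (ae_imp _ (H _ _ _ _ _)).
  - move=> s Hs /andP[s0 se] eta eta0; have [|n3 n3P] := Hs _ _ eta0.
      have -> : t + s - t0 = (t - t0) + s by ring.
      by rewrite (le_lt_trans (ler_normD _ _))// (ger0_norm s0); lra.
    exists n3 => n n3n; have := n3P (n + n2)%N (leq_trans n3n (leq_addr _ _)).
    by rewrite /g (rmorphD (real_complex R)) /= [t%:C + s%:C + _]addrAC [t%:C + s%:C - _]addrAC.
  - by move=> x y; rewrite ltrD2l.
  - by move=> x; ring.
  - by move=> x; ring.
  - by apply: lacD; [exact: lac_cst|exact: lac_id].
  - by apply: lacD; [exact: lac_id|exact: lac_cst].
move=> eta eta0; have ee : 0 < eta * e by rewrite mulr_gt0.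
have [n3 n3P] := cint_dct (ltW e0) gc gM g0 ee.
exists (n3 + n2)%N => n n3n.
have nE : (n - n2 + n2 = n)%N by rewrite subnK// (leq_trans _ n3n)// leq_addl.
have n3' : (n3 <= n - n2)%N by rewrite -(leq_add2r n2) nE.
have := n3P (n - n2)%N n3'.
have n2n : (n2 <= n)%N by rewrite (leq_trans _ n3n)// leq_addl.
rewrite /g nE (cintB (ltW e0) (f_clip (up n n2n)) (f_clip (dn n n2n))).
rewrite /A /avg -mulrBr cabsM cabs_real gtr0_norm ?invr_gt0// => H.
by rewrite ler_pdivrMl// mulrC.
Qed.

Let g := ext A.

Let rho0 : 0 < r - e. Proof. by move: r0 er; lra. Qed.

Let g_lip z w : disc t0%:C (r - e) z -> disc t0%:C (r - e) w -> cabs (g w - g z) <= L * cabs (w - z).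
Proof. exact: (ext_lip L0 A_lip A_cross). Qed.

Let g_le z : disc t0%:C (r - e) z -> cabs (g z) <= 2 * B.
Proof. exact: (ext_le L0 A_lip A_cross A_le). Qed.

Let shift_disc z (s : R) : disc t0%:C (r - 2 * e) z -> 0 <= s <= e -> disc t0%:C (r - e) (z + s%:C).
Proof.
rewrite /disc => zr /andP[s0 se]; rewrite addrAC (le_lt_trans (cabsD _ _))//.
by rewrite cabs_real ger0_norm//; lra.
Qed.

(** The glued first average is only Lipschitz across the line. A second average has a Lipschitz
    derivative, as [C11_across] asks. *)
Definition glue_approx := avg e g.
Definition glue_approx' z := (e^-1)%:C * (g (z + e%:C) - g z).

Let g_clip z : disc t0%:C (r - 2 * e) z -> clip 0 e (fun s => g (z + s%:C)).
Proof.
move=> zr; exists L => s t sI tI.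
rewrite (le_trans (g_lip (shift_disc zr sI) (shift_disc zr tI)))//.
by rewrite (_ : _ - _ = (t - s)%:C) ?cabs_real// (rmorphB (real_complex R)); ring.
Qed.

Let h_lip z w : disc t0%:C (r - 2 * e) z -> disc t0%:C (r - 2 * e) w ->
  cabs (glue_approx w - glue_approx z) <= 2 * L * cabs (w - z).
Proof.
move=> zr wr; rewrite -mulrA; apply: avgB => //; try exact: g_clip.
move=> s sI; rewrite (le_trans (g_lip (shift_disc zr sI) (shift_disc wr sI)))//.
by rewrite (_ : _ - _ = w - z)//; ring.
Qed.

Let d_lip z w : disc t0%:C (r - 2 * e) z -> disc t0%:C (r - 2 * e) w ->
  cabs (glue_approx' w - glue_approx' z) <= 2 * L / e * cabs (w - z).
Proof.
move=> zr wr; rewrite /glue_approx' -mulrBr cabsM cabs_real gtr0_norm ?invr_gt0//.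
rewrite mulrAC [leRHS]mulrC ler_wpM2l ?invr_ge0 ?(ltW e0)//.
have eI : 0 <= e <= e by rewrite lexx ltW.
have zI : 0 <= (0 : R) <= e by rewrite lexx ltW.
have h1 := g_lip (shift_disc zr eI) (shift_disc wr eI).
have h2 := g_lip (shift_disc zr zI) (shift_disc wr zI).
rewrite (_ : g (w + e%:C) - g w - _ = (g (w + e%:C) - g (z + e%:C)) - (g w - g z)); last by ring.
rewrite (le_trans (cabsB _ _))//.
move: h1 h2; rewrite !addr0 (_ : w + e%:C - (z + e%:C) = w - z); last by ring.
by lra.
Qed.

Let h_hol b delta : 0 < delta -> hol (half b t0 (r - 2 * e) delta) glue_approx glue_approx'.
Proof.
move=> d0; apply: (@avg_hol R _ (half b t0 (r - e) delta) e g dA) => //.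
  by move=> z s hz /andP[s0 se]; apply: half_shift hz => //; lra.
apply: hol_ext (A_hol b d0) => // z hz; rewrite /g ext_off//.
exact: half_off (ltW d0) hz.
Qed.

Let h_same b z w : half b t0 (r - 2 * e) 0 z -> half b t0 (r - 2 * e) 0 w ->
  cabs (glue_approx w - glue_approx z - glue_approx' z * (w - z)) <= 2 * L / e * cabs (w - z) ^+ 2.
Proof.
move=> hz hw; have [delta d0 [hz' hw']] := half_min hz hw; have [K hK] := h_hol b d0.
rewrite expr2 mulrA; apply: (mean_value hK).
- by move=> t tI; exact: half_convex.
- move=> t tI; have ht := half_convex hz' hw' tI.
  have p2 : 0 <= 2 * L / e by rewrite divr_ge0 ?(ltW e0)// mulr_ge0.
  rewrite (le_trans (d_lip hz'.1 ht.1))//; apply: ler_wpM2l => //.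
  rewrite (_ : z + t%:C * (w - z) - z = t%:C * (w - z)); last by ring.
  by case/andP: tI => t1 t2; rewrite cabsM cabs_real ger0_norm// ler_piMl ?cabs_ge0.
Qed.

Let h_le z : disc t0%:C (r - 2 * e) z -> cabs (glue_approx z) <= 4 * B.
Proof.
move=> zr; rewrite (_ : 4 * B = 2 * (2 * B)); last by ring.
apply: avg_le => //; first exact: g_clip.
by move=> s sI; apply: g_le; exact: shift_disc.
Qed.

(** [C11_across] gives constants that blow up with [1 / e]; Cauchy's estimates discard them. The two
    averages give the bound [4 * B]; [e <= r / 4] leaves the radius [r / 2], of which [cauchy_C11]
    keeps a quarter. *)
Lemma glue_approx_C11 :
  C11 (disc t0%:C (r / 8)) (4 * B * cauchy_cst (r / 2)) glue_approx glue_approx'.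
Proof.
have zI : 0 <= (0 : R) <= e by rewrite lexx ltW.
have eI : 0 <= e <= e by rewrite lexx ltW.
have p1 : 0 <= 2 * L by rewrite mulr_ge0.
have p2 : 0 <= 2 * L / e by rewrite divr_ge0// ltW.
have dB z : disc t0%:C (r - 2 * e) z -> cabs (glue_approx' z) <= Num.max (4 * B) (2 * L).
  move=> zr; rewrite le_max; apply/orP; right.
  rewrite cabsM cabs_real gtr0_norm ?invr_gt0// ler_pdivrMl//.
  have := g_le (shift_disc zr zI); rewrite addr0 => h1; have h2 := g_le (shift_disc zr eI).
  rewrite (le_trans (cabsB _ _))//.
  have -> : e * (2 * L) = 4 * B by rewrite /L; field; rewrite gt_eqF.
  by lra.
have hB z : disc t0%:C (r - 2 * e) z -> cabs (glue_approx z) <= Num.max (4 * B) (2 * L).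
  by move=> /h_le h; rewrite le_max h.
have hC := C11_across p1 p2 h_lip d_lip h_same hB dB.
have r2 : 0 < r / 2 by rewrite divr_gt0.
have sub z : disc t0%:C (r / 2) z -> disc t0%:C (r - 2 * e) z.
  by apply: disc_sub; rewrite subrr cabs0; move: er; lra.
have -> : r / 8 = (r / 2) / 4 by field.
apply: (cauchy_C11 r2 (C11_sub sub hC)).
by move=> z /sub; exact: h_le.
Qed.

Lemma glue_approx_near (K delta : R) b z : C11 (half b t0 r delta) K f f' -> 0 < delta ->
  half b t0 (r / 8) delta z -> cabs (glue_approx z - f z) <= 16 * K * e.
Proof.
move=> fK d0 hz.
have zr : disc t0%:C (r - 2 * e) z by apply: lt_le_trans hz.1 _; move: er r0; lra.
have hz0 : half b t0 r delta z by apply: half_sub hz; move: r0; lra.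
have K0 := C11_ge0 fK hz0.
rewrite (_ : 16 * K * e = 2 * (8 * K * e)); last by ring.
apply: avg_near => //; first exact: g_clip.
move=> s /andP[s0 se].
have hs : half b t0 (r - e) delta (z + s%:C) by apply: half_shift hz => //; move: er r0; lra.
rewrite /g ext_off; last exact: half_off (ltW d0) hs.
have hs0 : half b t0 (r - e) 0 (z + s%:C) by case: hs => ? ?; split => //; exact: lt_trans d0 _.
rewrite (_ : 8 * K * e = 2 * (4 * K * e)); last by ring.
apply: avg_near => //; first exact: f_clip hs0.
move=> s' /andP[s'0 s'e].
have hss : half b t0 r delta (z + s%:C + s'%:C) by apply: half_shift hs => //; lra.
rewrite (le_trans (C11_lip fK hz0 hss))//.
rewrite (_ : _ - _ = (s + s')%:C); last by rewrite (rmorphD (real_complex R)); ring.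
rewrite cabs_real ger0_norm ?addr_ge0// (_ : 4 * K * e = 2 * K * (2 * e)); last by ring.
by rewrite ler_wpM2l ?mulr_ge0//; lra.
Qed.
End fixed_width.

(* After averaging [f] twice over horizontal segments of length [e] the boundary values match everywhere and the glued function is [C11], with Cauchy estimates that do not depend on [e]; then [e] tends to [0]. *)
Theorem glue : exists F', C11 (disc t0%:C (r / 8)) (4 * B * cauchy_cst (r / 2)) (ext f) F'.
Proof.
pose e (n : nat) : R := r / 4 / n.+1%:R.
have e0 n : 0 < e n by rewrite !divr_gt0.
have er n : e n <= r / 4 by rewrite ler_piMr ?invf_le1 ?ler1n// divr_ge0// ltW.
have hC n := glue_approx_C11 (e0 n) (er n).
have FC := C11_culim hC; set F := (fun z => culim (fun n => glue_approx (e n) z)) in FC.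
set F' := (X in C11 _ _ _ X) in FC.
have Foff z : disc t0%:C (r / 8) z -> Im z != 0 -> F z = f z.
  move=> zr z0; have [b bz] := sg_cases z0.
  have hz : half b t0 (r / 8) 0 z by [].
  have [delta d0 [hz' _]] := half_min hz hz; have [K fK] := fh b d0.
  have K0 : 0 <= K by apply: (C11_ge0 fK (z := z)); apply: half_sub hz'; move: r0; lra.
  apply: culim_eq => eta eta0.
  have M0 : 0 < 1 + 4 * K * r by rewrite ltr_pwDl// !mulr_ge0// ltW.
  have [|n0 n0P] := @invn_small R (eta / (1 + 4 * K * r)); first by rewrite divr_gt0.
  exists n0 => n /n0P; rewrite ltr_pdivlMr// => /ltW nn.
  rewrite (le_trans (glue_approx_near (e0 n) (er n) fK d0 hz'))// (le_trans _ nn)// /e.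
  set q := n.+1%:R^-1; have q0 : 0 <= q by rewrite invr_ge0.
  by rewrite -/q; lra.
exists F'; move=> z zr; have K0 := C11_ge0 FC zr.
(* On the real line [ext f] is the limit of values of [f] from above, where [f] and [F] agree, and
   [F] is Lipschitz. *)
have extF w : disc t0%:C (r / 8) w -> ext f w = F w.
  move=> wr; have [w0|w0] := eqVneq (Im w) 0; last by rewrite ext_off// Foff.
  rewrite /ext w0 eqxx; apply: culim_eq => eta eta0.
  set K := 4 * B * _ in FC K0.
  have M0 : 0 < 1 + 2 * K by rewrite ltr_pwDl// mulr_ge0.
  have [|n0 n0P] := @invn_small R (eta / (1 + 2 * K)); first by rewrite divr_gt0.
  have [|n1 n1P] := @invn_small R (r / 8 - cabs (w - t0%:C)); first by rewrite subr_gt0.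
  exists (maxn n0 n1) => n; rewrite geq_max => /andP[/n0P + /n1P h1].
  rewrite ltr_pdivlMr// => /ltW nn.
  have wn : disc t0%:C (r / 8) (w + iinv R n).
    by rewrite /disc addrAC (le_lt_trans (cabsD _ _))// cabs_iinv -ltrBrDl.
  rewrite -Foff//; last by rewrite ImD w0 add0r /= invr_eq0.
  rewrite (le_trans (C11_lip FC wr wn))// addrC addKr cabs_iinv (le_trans _ nn)//.
  by rewrite mulrC ler_wpM2l ?invr_ge0// lerDr.
have [h1 h2 h3] := FC z zr; split; rewrite ?extF// => w wr; rewrite extF//; exact: h3.
Qed.
End gluing.

(** * Holomorphic functions with an unnamed derivative *)

Section holo.
Variable R : realType.
Implicit Types (D E : R[i] -> Prop) (f g : R[i] -> R[i]).

Definition holo D f := exists f', hol D f f'.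

(** A derivative given by a formula in [f], so that sequences of holomorphic functions get their
    derivatives without a choice. *)
Definition dc f (z : R[i]) : R[i] :=
  culim (fun n => (f (z + (n.+1%:R^-1)%:C) - f z) * (n.+1%:R)%:C).

Lemma hol_dc D f : (forall z, D z -> exists2 r, 0 < r & forall w, disc z r w -> D w) ->
  holo D f -> hol D f (dc f).
Proof.
move=> oD [f' fh]; have [B fB] := fh; apply: hol_ext fh => // z Dz.
have [r r0 zr] := oD z Dz; have B0 := C11_ge0 fB Dz.
apply/esym/culim_eq => e e0.
have [n0 n0P] := invn_small r0.
have [|n1 n1P] := @invn_small R (e / (1 + B)); first by rewrite divr_gt0// ltr_pwDl.
exists (maxn n0 n1) => n; rewrite geq_max => /andP[/n0P h0 /n1P].
set q := n.+1%:R^-1 in h0 * => h1; have q0 : 0 < q by rewrite invr_gt0.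
have qn : n.+1%:R = q^-1 by rewrite invrK.
have zq : D (z + q%:C).
  by apply: zr; rewrite /disc addrC addKr cabs_real gtr0_norm.
have [_ _ /(_ _ zq)] := fB z Dz.
rewrite (_ : z + q%:C - z = q%:C); last by ring.
rewrite cabs_real gtr0_norm// => H.
rewrite qn; have -> : (f (z + q%:C) - f z) * (q^-1)%:C - f' z =
   (q^-1)%:C * (f (z + q%:C) - f z - f' z * q%:C).
  have qq : (q^-1)%:C * q%:C = 1 :> R[i].
    by rewrite -(rmorphM (real_complex R)) mulVf ?gt_eqF.
  have -> : (q^-1)%:C * (f (z + q%:C) - f z - f' z * q%:C) =
    (q^-1)%:C * (f (z + q%:C) - f z) - ((q^-1)%:C * q%:C) * f' z by ring.
  by rewrite qq; ring.
rewrite cabsM cabs_real gtr0_norm ?invr_gt0// ler_pdivrMl// (le_trans H)//.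
rewrite expr2 mulrA mulrC ler_wpM2l ?(ltW q0)//.
move: h1; rewrite ltr_pdivlMr ?ltr_pwDl// => /ltW; apply: le_trans.
by rewrite mulrC ler_wpM2l ?(ltW q0)// lerDr.
Qed.

Lemma holo_cst D c : holo D (fun=> c). Proof. by exists (fun=> 0); exact: hol_cst. Qed.

Lemma holo_id D (M : R) : (forall z, D z -> cabs z <= M) -> holo D (fun z => z).
Proof. by move=> DM; exists (fun=> 1); exact: hol_id DM. Qed.

Lemma holoD D f g : holo D f -> holo D g -> holo D (fun z => f z + g z).
Proof. by move=> [f' F] [g' G]; eexists; exact: holD F G. Qed.

Lemma holoB D f g : holo D f -> holo D g -> holo D (fun z => f z - g z).
Proof. by move=> [f' F] [g' G]; eexists; exact: holB F G. Qed.

Lemma holoM D f g : holo D f -> holo D g -> holo D (fun z => f z * g z).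
Proof. by move=> [f' F] [g' G]; eexists; exact: holM F G. Qed.

Lemma holoX D f n : holo D f -> holo D (fun z => f z ^+ n).
Proof.
move=> F; elim: n => [|n IH].
  by rewrite (_ : (fun _ => _) = fun=> 1); [exact: holo_cst|apply/funext].
rewrite (_ : (fun _ => _) = fun z => f z * f z ^+ n); first exact: holoM.
by apply/funext => z; rewrite exprS.
Qed.

Lemma holo_div D f g (m : R) : 0 < m -> (forall z, D z -> m <= cabs (g z)) ->
  holo D f -> holo D g -> holo D (fun z => f z / g z).
Proof. by move=> m0 gm [f' F] [g' G]; eexists; exact: hol_div m0 gm F G. Qed.

Lemma holo_comp D E f g : (forall z, D z -> E (g z)) -> holo E f -> holo D g ->
  holo D (fun z => f (g z)).
Proof. by move=> DE [f' F] [g' G]; eexists; exact: hol_comp DE F G. Qed.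

Lemma holo_sub D E f : (forall z, E z -> D z) -> holo D f -> holo E f.
Proof. by move=> ED [f' F]; exists f'; exact: hol_sub ED F. Qed.

Lemma holo_ext D f g : (forall z, D z -> f z = g z) -> holo D f -> holo D g.
Proof. by move=> fg [f' F]; exists f'; exact: hol_ext fg _ F. Qed.

Lemma holo_sum D (F : nat -> R[i] -> R[i]) N : (forall n, holo D (F n)) ->
  holo D (fun z => \sum_(n < N) F n z).
Proof.
move=> FD; elim: N => [|N IH].
  by apply: holo_ext (holo_cst D 0) => z _; rewrite big_ord0.
by apply: holo_ext (holoD IH (FD N)) => z _; rewrite big_ord_recr.
Qed.

(* By the Cauchy estimates a common bound on the functions suffices for a common [C11] constant. *)
Lemma holo_culim D (r B : R) (f : nat -> R[i] -> R[i]) : 0 < r ->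
  (forall n z, D z -> holo (disc z r) (f n)) ->
  (forall n z w, D z -> disc z r w -> cabs (f n w) <= B) ->
  holo D (fun z => culim (fun n => f n z)).
Proof.
move=> r0 fh fB.
have oz z : forall w, disc z r w -> exists2 r', 0 < r' & forall u, disc w r' u -> disc z r u.
  move=> w wr; exists (r - cabs (w - z)); first by rewrite subr_gt0.
  by move=> u; apply: disc_sub; lra.
have fC n : C11 D (B * cauchy_cst r) (f n) (dc (f n)).
  apply: cauchy_C11_unif => // z; last exact: fB.
  by move=> Dz; apply: hol_dc (oz z) (fh n z Dz).
by eexists; exists (B * cauchy_cst r); exact: C11_culim fC.
Qed.
End holo.

(** * Linear systems depending on a parameter *)

Section real_lac.
Variable R : realType.
Local Notation mu := (@lebesgue_measure R).

Lemma derive_lac (f f' : R -> R) : (forall x, is_derive x (1 : R) f (f' x)) ->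
  (forall r : R, exists B, forall x, `|x| <= r -> `|f' x| <= B) -> loc_abs_cont f.
Proof.
move=> df bf; apply: loc_lipschitz_lac => r; have [B fB] := bf r; exists B.
suff H x y : `|x| <= r -> `|y| <= r -> x < y -> `|f y - f x| <= B * `|y - x|.
  move=> x y xr yr; have [xy|yx|->] := ltgtP x y; first exact: H.
    by rewrite distrC (distrC y); exact: H.
  by rewrite !subrr normr0 mulr0.
move=> xr yr xy; have cf : {within `[x, y], continuous f}.
  apply: continuous_subspaceT; apply/continuous_epsP => z e e0.
  exact: is_derive1_continuous (df z) e e0.
have [c cI ->] := MVT xy (fun z _ => df z) cf.
rewrite normrM ler_wpM2r// fB//; move: cI; rewrite in_itv/= => /andP[xc cy].
by move: xr yr; rewrite !ler_norml; lra.
Qed.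

Lemma is_derive_expZ (l x : R) : is_derive x (1 : R) (fun y => expR (l * y)) (l * expR (l * x)).
Proof.
have h : is_derive x (1 : R) (fun y => l * y) l.
  by apply/is_derive_eps => e e0; exists 1 => // y _; rewrite -mulrBr subrr normr0 mulr_ge0// ltW.
have := is_derive1_comp (is_derive_expR (l * x)) h.
by move=> H; apply: (is_derive_eq H); rewrite mulrC.
Qed.

Lemma lac_expZ (l : R) : loc_abs_cont (fun y => expR (l * y)).
Proof.
apply: (derive_lac (is_derive_expZ l)) => r; exists (`|l| * expR (`|l| * r)) => x xr.
rewrite normrM ler_wpM2l// gtr0_norm ?expR_gt0// ler_expR.
by rewrite (le_trans (ler_norm _))// normrM ler_wpM2l.
Qed.

(** In the weight [expR (l * |x|)] integration gains the factor [1 / l]; for [l] large compared with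
    the spectral parameter the Picard series is then dominated by a geometric one. *)
Lemma prim_exp_bound (h : R -> R) (K l x : R) : loc_bounded_meas h -> 0 < l -> 0 <= K ->
  (forall y, `|h y| <= K * expR (l * `|y|)) -> `|prim h x| <= K / l * expR (l * `|x|).
Proof.
move=> hb l0 K0 hK; have Kl : 0 <= K / l by rewrite divr_ge0// ltW.
have dh := prim_derive hb; have ch := prim_lac hb.
(* [s] is the sign of the half line; one monotonicity argument serves both. *)
have main (s : R) (a b : R) : a <= b -> (forall y, a <= y <= b -> s * y = `|y|) ->
   `|s| = 1 -> `|prim h b - prim h a| <= s * K / l * (expR (l * s * b) - expR (l * s * a)).
  move=> ab sy s1.
  pose G (y : R) := s * K / l * expR (l * s * y).
  have cG : loc_abs_cont G by apply: lacM (lac_cst _) (lac_expZ _).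
  have dG y : is_derive y (1 : R) G (K * expR (l * (s * y))).
    have H := is_deriveZ (s * K / l) (is_derive_expZ (l * s) y).
    apply: (is_derive_eq H); rewrite -[_ *: _]/(_ * _) (mulrA l s y).
    have ss : s * s = 1 by rewrite -expr2 -real_normK ?num_real// s1 expr1n.
    set E := expR _.
    have -> : s * K / l * (l * s * E) = (s * s) * K * (l / l) * E by ring.
    by rewrite ss mul1r divff ?gt_eqF// mulr1.
  rewrite mulrBr -/(G b) -/(G a) ler_norml; apply/andP; split.
  - suff : G a + prim h a <= G b + prim h b by lra.
    apply: lac_nondecreasing (lacD cG ch) ab _; apply: (ae_imp _ dh) => y dy yI.
    eexists; last exact: is_deriveD (dG y) dy.
    by have := hK y; rewrite sy// ler_norml; lra.
  - suff : G a - prim h a <= G b - prim h b by lra.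
    apply: lac_nondecreasing (lacB cG ch) ab _; apply: (ae_imp _ dh) => y dy yI.
    eexists; last exact: is_deriveB (dG y) dy.
    by have := hK y; rewrite sy// ler_norml; lra.
have [x0|/ltW x0] := leP 0 x.
- have h1 y : 0 <= y <= x -> 1 * y = `|y| by move=> /andP[y0 _]; rewrite mul1r ger0_norm.
  have := main 1 0 x x0 h1 (normr1 _).
  rewrite prim0 subr0 mul1r mulr1 mulr0 expR0 (ger0_norm x0) => H.
  by rewrite (le_trans H)// ler_wpM2l// lerBlDr lerDl.
- have h1 y : x <= y <= 0 -> -1 * y = `|y| by move=> /andP[_ y0]; rewrite mulN1r ler0_norm.
  have n1 : `|-1 : R| = 1 by rewrite normrN normr1.
  have := main (-1) x 0 x0 h1 n1.
  rewrite prim0 sub0r normrN mulr0 expR0 (ler0_norm x0) => H; rewrite (le_trans H)//.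
  rewrite (_ : l * -1 * x = l * - x); last by ring.
  set E := expR _; have : 0 <= K / l * E by rewrite mulr_ge0// ltW// expR_gt0.
  by lra.
Qed.
End real_lac.

Section linear_ode.
Variable R : realType.
Local Notation mu := (@lebesgue_measure R).

Definition cprim (h : R -> R[i]) (x : R) : R[i] :=
  prim (fun t => Re (h t)) x +i* prim (fun t => Im (h t)) x.

Lemma cprim_derive h : loc_bounded_meas (fun t => Re (h t)) -> loc_bounded_meas (fun t => Im (h t)) ->
  {ae mu, forall x, has_cderiv (cprim h) x (h x)}.
Proof.
by move=> h1 h2; apply: (ae_imp2 _ (prim_derive h1) (prim_derive h2)) => x d1 d2; split.
Qed.

Lemma cprim_cac h : loc_bounded_meas (fun t => Re (h t)) -> loc_bounded_meas (fun t => Im (h t)) ->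
  cac (cprim h).
Proof. by move=> h1 h2; split; exact: prim_lac. Qed.

Lemma cprim0 h : cprim h 0 = 0.
Proof. by rewrite /cprim !prim0. Qed.

Lemma loc_bounded_measD (f g : R -> R) : loc_bounded_meas f -> loc_bounded_meas g ->
  loc_bounded_meas (fun x => f x + g x).
Proof.
move=> [mf bf] [mg bg]; split; first exact: measurable_funD.
move=> r; have [B fB] := bf r; have [B' gB] := bg r; exists (B + B') => x xr.
by rewrite (le_trans (ler_normD _ _))// lerD ?fB ?gB.
Qed.

Lemma loc_bounded_measM (f g : R -> R) : loc_bounded_meas f -> loc_bounded_meas g ->
  loc_bounded_meas (fun x => f x * g x).
Proof.
move=> [mf bf] [mg bg]; split; first exact: measurable_funM.
move=> r; have [B fB] := bf r; have [B' gB] := bg r; exists (B * B') => x xr.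
by rewrite normrM ler_pM ?fB ?gB.
Qed.

Lemma loc_bounded_measZ k (f : R -> R) : loc_bounded_meas f -> loc_bounded_meas (fun x => k * f x).
Proof.
apply: loc_bounded_measM; split; first exact: measurable_cst.
by move=> r; exists `|k|.
Qed.

Lemma loc_bounded_lac (f : R -> R) : loc_abs_cont f -> loc_bounded_meas f.
Proof.
move=> /lac_cts cf; split; first exact: continuous_measurable_fun.
move=> r; have [B fB] := continuous_bounded (- r) r cf; exists B => x.
by rewrite ler_norml; exact: fB.
Qed.

Variable M : bool -> bool -> R -> R.
Hypothesis Mmeas : forall j k, measurable_fun setT (M j k).
Hypothesis M1 : forall j k x, `|M j k x| <= 1.
Variable v : bool -> R.

Let Mb j k : loc_bounded_meas (M j k).
Proof. by split=> // r; exists 1 => x _; exact: M1. Qed.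

(** Coefficient of [z ^+ n] in the Picard series of [u' = z M u]. Since [M] is real, these are real
    functions and the solution is a power series in [z]. *)
Fixpoint iterate n : bool -> R -> R := if n is n'.+1 then
  fun k => prim (fun x => M k true x * iterate n' true x + M k false x * iterate n' false x)
  else fun k _ => v k.

Let iterate_lac n k : loc_abs_cont (iterate n k).
Proof.
elim: n k => [|n IH] k; first exact: lac_cst.
by apply: prim_lac; apply: loc_bounded_measD; apply: loc_bounded_measM => //; exact: loc_bounded_lac.
Qed.

Let integrand_b n k : loc_bounded_meas (fun x => M k true x * iterate n true x + M k false x * iterate n false x).
Proof. by apply: loc_bounded_measD; apply: loc_bounded_measM => //; exact: loc_bounded_lac. Qed.

Let m : R := `|v true| + `|v false|.

Let m0 : 0 <= m. Proof. by rewrite addr_ge0. Qed.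

Let iterate_bound (l : R) n k x : 0 < l -> `|iterate n k x| <= m * (2 / l) ^+ n * expR (l * `|x|).
Proof.
move=> l0; elim: n k x => [|n IH] k x.
  rewrite expr0 mulr1 /=; apply: (@le_trans _ _ m); first by rewrite /m; case: k; rewrite ?lerDl ?lerDr.
  by rewrite ler_peMr// -expR0 ler_expR mulr_ge0// ltW.
have K0 : 0 <= 2 * (m * (2 / l) ^+ n) by rewrite !mulr_ge0// exprn_ge0// divr_ge0// ltW.
have := @prim_exp_bound R _ _ l x (integrand_b n k) l0 K0.
rewrite exprSr (_ : 2 * (m * (2 / l) ^+ n) / l = m * ((2 / l) ^+ n * (2 / l))); last by ring.
apply=> y; rewrite (le_trans (ler_normD _ _))// !normrM.
rewrite -[2 * _ * _]mulrA [leRHS]mulr_natl mulr2n.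
by rewrite lerD// -[leRHS]mul1r ler_pM.
Qed.

Definition psum k (z : R[i]) (x : R) N := \sum_(n < N) z ^+ n * (iterate n k x)%:C.

(** With the weight [l = 4 * rho] the factor [2 / l] per iteration is [1 / (2 * rho)], so for
    [cabs z <= rho] the n-th term is at most half of this constant times [2 ^- n]. *)
Let K (rho x : R) : R := 2 * m * expR (4 * rho * `|x|).

Let K0 rho x : 0 <= K rho x. Proof. by rewrite !mulr_ge0// ltW// expR_gt0. Qed.

Let psum_diff k z x rho N i : 0 < rho -> cabs z <= rho ->
  cabs (psum k z x (N + i) - psum k z x N) <= K rho x * ((2^-1) ^+ N - (2^-1) ^+ (N + i)).
Proof.
move=> r0 zr; elim: i => [|i IH]; first by rewrite addn0 !subrr mulr0 cabs0.
rewrite addnS /psum big_ord_recr /= -/(psum k z x _).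
rewrite addrAC (le_trans (cabsD _ _))//.
have h : cabs (z ^+ (N + i) * (iterate (N + i) k x)%:C) <= K rho x * (2^-1) ^+ (N + i).+1.
  rewrite cabsM cabsX cabs_real.
  have r4 : 0 < 4 * rho by rewrite mulr_gt0.
  have h1 := iterate_bound (N + i) k x r4.
  apply: (@le_trans _ _ (rho ^+ (N + i) * (m * (2 / (4 * rho)) ^+ (N + i) * expR (4 * rho * `|x|)))).
    by rewrite ler_pM ?exprn_ge0 ?cabs_ge0// lerXn2r ?nnegrE ?cabs_ge0// ltW.
  have -> : rho ^+ (N + i) * (m * (2 / (4 * rho)) ^+ (N + i) * expR (4 * rho * `|x|)) =
    m * expR (4 * rho * `|x|) * (rho * (2 / (4 * rho))) ^+ (N + i) by rewrite [(rho * _) ^+ _]exprMn; ring.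
  have -> : rho * (2 / (4 * rho)) = 2^-1 by field; rewrite gt_eqF.
  by rewrite exprS /K le_eqVlt; apply/orP; left; apply/eqP; field.
apply: (le_trans (lerD IH h)).
by rewrite le_eqVlt; apply/orP; left; apply/eqP; rewrite (exprS _ (N + i)); field.
Qed.

Let half_ge0 n : 0 <= (2^-1 : R) ^+ n. Proof. by rewrite exprn_ge0// invr_ge0. Qed.

Let psum_tail k z x rho N N' : 0 < rho -> cabs z <= rho -> (N <= N')%N ->
  cabs (psum k z x N' - psum k z x N) <= K rho x * (2^-1) ^+ N.
Proof.
move=> r0 zr NN; rewrite -(subnKC NN) (le_trans (psum_diff _ _ _ _ r0 zr))//.
by rewrite ler_wpM2l ?K0// lerBlDr lerDl half_ge0.
Qed.

Let psum_bound k z x rho N : 0 < rho -> cabs z <= rho -> cabs (psum k z x N) <= K rho x.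
Proof.
move=> r0 zr; have := psum_tail k x r0 zr (leq0n N).
by rewrite /psum big_ord0 subr0 expr0 mulr1.
Qed.

Definition lsol k (z : R[i]) (x : R) := culim (psum k z x).

Let rho z : R := 1 + cabs z.
Let rho0 z : 0 < rho z. Proof. by rewrite ltr_pwDl// cabs_ge0. Qed.
Let zrho z : cabs z <= rho z. Proof. by rewrite lerDr. Qed.

Let psum_cb k z x : cbounded (psum k z x).
Proof. by exists (K (rho z) x), 0%N => n _; exact: psum_bound. Qed.

Let lsol_tail k z x N : cabs (lsol k z x - psum k z x N) <= K (rho z) x * (2^-1) ^+ N.
Proof.
rewrite -(culim_cst (psum k z x N)) -culimB//; last exact: cbounded_cst.
apply: (@culim_le _ _ _ N); first by apply: cboundedD; [exact: psum_cb|exact/cboundedN/cbounded_cst].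
by move=> n; exact: psum_tail.
Qed.

Let lsol_bound k z x : cabs (lsol k z x) <= K (rho z) x.
Proof. by apply: (@culim_le _ _ _ 0%N) => // n _; exact: psum_bound. Qed.

Let psum_cac k z N : cac (fun x => psum k z x N).
Proof.
elim: N => [|N IH].
  by rewrite /psum (_ : (fun _ => _) = fun=> 0); [exact: cac_cst|apply/funext => x; rewrite big_ord0].
rewrite (_ : (fun _ => _) = fun x => psum k z x N + z ^+ N * (iterate N k x)%:C); last first.
  by apply/funext => x; rewrite /psum big_ord_recr.
by apply: cacD => //; apply: cacM (cac_cst _) _; exact: cac_real.
Qed.

Let rhs k (z : R[i]) (u : bool -> R[i]) x : R[i] := z * ((M k true x)%:C * u true + (M k false x)%:C * u false).

Let psum_deriv k z N : {ae mu, forall x, has_cderiv (fun x => psum k z x N.+1) x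
  (rhs k z (fun j => psum j z x N) x)}.
Proof.
elim: N => [|N IH].
  apply: ae_all => x; rewrite /rhs /psum !big_ord0 !mulr0 addr0 mulr0.
  rewrite (_ : (fun _ => _) = fun=> (v k)%:C); first exact: has_cderiv_cst.
  by apply/funext => t; rewrite big_ord1 expr0 mul1r.
rewrite (_ : (fun _ => _) = fun x => psum k z x N.+1 + z ^+ N.+1 * (iterate N.+1 k x)%:C); last first.
  by apply/funext => x; rewrite /psum big_ord_recr.
apply: (ae_imp2 _ IH (prim_derive (integrand_b N k))) => x d1 d2.
have d3 := has_cderivD d1 (has_cderivM (has_cderiv_cst (z ^+ N.+1) x) (has_cderiv_real d2)).
move: d3; congr has_cderiv.
rewrite /rhs /psum !big_ord_recr /= exprS mul0r add0r.
rewrite (rmorphD (real_complex R)) !(rmorphM (real_complex R)) /=; ring.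
Qed.

Let rhs_le k z u x C : (forall j, cabs (u j) <= C) -> cabs (rhs k z u x) <= cabs z * (2 * C).
Proof.
move=> uC; rewrite cabsM ler_wpM2l ?cabs_ge0// (le_trans (cabsD _ _))// !cabsM !cabs_real.
by rewrite mulr_natl mulr2n lerD// -[leRHS]mul1r ler_pM// cabs_ge0.
Qed.

Let K_mono z x r : `|x| <= r -> K (rho z) x <= K (rho z) r.
Proof.
move=> xr; rewrite ler_wpM2l ?mulr_ge0// ler_expR.
rewrite ler_wpM2l ?mulr_ge0 ?(ltW (rho0 z))// (le_trans xr)//; exact: ler_norm.
Qed.

Let lsol_lip k z r : exists L, forall x y, `|x| <= r -> `|y| <= r ->
  cabs (lsol k z y - lsol k z x) <= L * `|y - x|.
Proof.
exists (2 * (cabs z * (2 * K (rho z) r))).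
suff H x y : `|x| <= r -> `|y| <= r -> x <= y ->
    cabs (lsol k z y - lsol k z x) <= 2 * (cabs z * (2 * K (rho z) r)) * (y - x).
  move=> x y xr yr; have [xy|/ltW yx] := leP x y; first by rewrite ger0_norm ?subr_ge0//; exact: H.
  by rewrite cabs_distC distrC ger0_norm ?subr_ge0//; exact: H.
move=> xr yr xy; rewrite -culimB; [|exact: psum_cb..].
apply: (@culim_le _ _ _ 1%N).
  by apply: cboundedD; [|apply: cboundedN]; exact: psum_cb.
case=> // N _; have := cac_lipschitz (psum_cac k z N.+1) xy; apply.
apply: (ae_imp _ (psum_deriv k z N)) => t dt /andP[xt ty]; eexists; last exact: dt.
apply: rhs_le => j; rewrite (le_trans (psum_bound _ _ _ (rho0 z) (zrho z)))//.
by apply: K_mono; move: xr yr; rewrite !ler_norml; lra.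
Qed.

Lemma loc_lip_cac (f : R -> R[i]) : (forall r, exists L, forall x y, `|x| <= r -> `|y| <= r ->
  cabs (f y - f x) <= L * `|y - x|) -> cac f.
Proof.
move=> H; split; apply: loc_lipschitz_lac => r; have [L fL] := H r; exists L => x y xr yr.
- by rewrite (le_trans _ (fL _ _ xr yr))// -ReB cabs_Re.
- by rewrite (le_trans _ (fL _ _ xr yr))// -ImB cabs_Im.
Qed.

Lemma lsol_cac k z : cac (lsol k z).
Proof. by apply: loc_lip_cac => r; exact: lsol_lip. Qed.

Lemma loc_bounded_rhs k z (u : bool -> R -> R[i]) : (forall j, cac (u j)) ->
  loc_bounded_meas (fun x => Re (rhs k z (fun j => u j x) x)) /\
  loc_bounded_meas (fun x => Im (rhs k z (fun j => u j x) x)).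
Proof.
move=> uc.
have RM j x : Re ((M k j x)%:C * u j x) = M k j x * Re (u j x) by rewrite !cplxE /= mul0r subr0.
have IM j x : Im ((M k j x)%:C * u j x) = M k j x * Im (u j x) by rewrite !cplxE /= mul0r addr0.
have R1 j : loc_bounded_meas (fun x => M k j x * Re (u j x)).
  by apply: loc_bounded_measM => //; apply: loc_bounded_lac; case: (uc j).
have I1 j : loc_bounded_meas (fun x => M k j x * Im (u j x)).
  by apply: loc_bounded_measM => //; apply: loc_bounded_lac; case: (uc j).
have RR := loc_bounded_measD (R1 true) (R1 false); have II := loc_bounded_measD (I1 true) (I1 false).
split.
- have := loc_bounded_measD (loc_bounded_measZ (Re z) RR) (loc_bounded_measZ (- Im z) II).
  by congr loc_bounded_meas; apply/funext => x; rewrite /rhs ReM ReD ImD !RM !IM mulNr.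
- have := loc_bounded_measD (loc_bounded_measZ (Re z) II) (loc_bounded_measZ (Im z) RR).
  by congr loc_bounded_meas; apply/funext => x; rewrite /rhs ImM ReD ImD !RM !IM.
Qed.

Let W k z x : R[i] := (v k)%:C + cprim (fun x => rhs k z (fun j => lsol j z x) x) x.

Let psum0 k z N : psum k z 0 N.+1 = (v k)%:C.
Proof.
elim: N => [|N IH]; first by rewrite /psum big_ord1 expr0 mul1r.
by rewrite /psum big_ord_recr /= -/(psum k z 0 N.+1) IH prim0 mulr0 addr0.
Qed.

Let W_deriv k z : {ae mu, forall x, has_cderiv (W k z) x (rhs k z (fun j => lsol j z x) x)}.
Proof.
have [h1 h2] := loc_bounded_rhs k z (fun j => lsol_cac j z).
apply: (ae_imp _ (cprim_derive h1 h2)) => x dx.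
by have := has_cderivD (has_cderiv_cst (v k)%:C x) dx; rewrite add0r.
Qed.

Let W_cac k z : cac (W k z).
Proof.
have [h1 h2] := loc_bounded_rhs k z (fun j => lsol_cac j z).
by apply: cacD (cac_cst _) _; exact: cprim_cac.
Qed.

Lemma half_small (C e : R) : 0 <= C -> 0 < e -> exists n0, forall n, (n0 <= n)%N -> C * (2^-1) ^+ n <= e.
Proof.
move=> C0 e0; have [|n0 n0P] := @invn_small R (e / (1 + C)); first by rewrite divr_gt0// ltr_pwDl.
exists n0 => n /n0P; rewrite ltr_pdivlMr ?ltr_pwDl// => /ltW; apply: le_trans.
rewrite mulrC ler_pM//; last by rewrite lerDr.
rewrite exprVn lef_pV2 ?posrE ?exprn_gt0// -natrX ler_nat; exact: ltn_expl.
Qed.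

(** The integral equation for the limit: a partial sum minus [W] vanishes at [0], and its derivative
    involves the previous partial sum minus [lsol], which is of order [2 ^- N] by [lsol_tail]. *)
Lemma lsolE k z x : lsol k z x = W k z x.
Proof.
apply/culim_eq => e e0.
pose C := 2 * (cabs z * (2 * K (rho z) x)) * `|x|.
have C0 : 0 <= C by rewrite !mulr_ge0 ?cabs_ge0.
have [n0 n0P] := half_small C0 e0; exists n0.+1 => -[//|N]; rewrite ltnS => /n0P NP.
apply: le_trans NP.
pose D t := psum k z t N.+1 - W k z t.
have D0 : D 0 = 0 by rewrite /D psum0 /W cprim0 addr0 subrr.
have Dc : cac D by apply: cacB; [exact: psum_cac|exact: W_cac].
have Dd : {ae mu, forall t, `|t| <= `|x| -> exists2 u, cabs u <= cabs z * (2 * (K (rho z) x * (2^-1) ^+ N)) & has_cderiv D t u}.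
  apply: (ae_imp2 _ (psum_deriv k z N) (W_deriv k z)) => t d1 d2 tx.
  eexists; last exact: has_cderivB d1 d2.
  have -> : rhs k z (fun j => psum j z t N) t - rhs k z (fun j => lsol j z t) t =
     rhs k z (fun j => psum j z t N - lsol j z t) t by rewrite /rhs; ring.
  apply: rhs_le => j; rewrite cabs_distC (le_trans (lsol_tail _ _ _ _))//.
  rewrite ler_wpM2r ?half_ge0// (le_trans (K_mono _ tx))//.
  by rewrite /K normr_id.
have -> : C * 2^-1 ^+ N = 2 * (cabs z * (2 * (K (rho z) x * (2^-1) ^+ N))) * `|x| by rewrite /C; ring.
have [x0|/ltW x0] := leP 0 x.
- have := @cac_lipschitz R D 0 x _ Dc x0; rewrite D0 !subr0 (ger0_norm x0); apply.
  apply: (ae_imp _ Dd) => t Dt /andP[t0 tx]; apply: Dt.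
  by rewrite !ger0_norm// (le_trans t0).
- have := @cac_lipschitz R D x 0 _ Dc x0; rewrite D0 !sub0r cabsN (ler0_norm x0); apply.
  apply: (ae_imp _ Dd) => t Dt /andP[xt t0]; apply: Dt.
  by rewrite !ler0_norm// ?lerN2// (le_trans xt).
Qed.

Lemma lsol_deriv z : {ae mu, forall x, forall k, has_cderiv (lsol k z) x
  (z * ((M k true x)%:C * lsol true z x + (M k false x)%:C * lsol false z x))}.
Proof.
apply: (ae_imp2 _ (W_deriv true z) (W_deriv false z)) => x d1 d2 [].
- suff -> : has_cderiv (lsol true z) = has_cderiv (W true z) by [].
  by rewrite (funext (lsolE true z)).
- suff -> : has_cderiv (lsol false z) = has_cderiv (W false z) by [].
  by rewrite (funext (lsolE false z)).
Qed.

Lemma lsol0 k z : lsol k z 0 = (v k)%:C.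
Proof. by rewrite lsolE /W cprim0 addr0. Qed.

Lemma lsol_holo k x r : 0 < r -> holo (disc 0 r) (fun z => lsol k z x).
Proof.
move=> r0; have sub z w : disc 0 r z -> disc z r w -> cabs w <= 2 * r.
  rewrite /disc subr0 => zr wr; rewrite -[w](subrK z) (le_trans (cabsD _ _))//; lra.
apply: (@holo_culim R _ r (K (2 * r) x) (fun N z => psum k z x N)) => //.
- move=> N z zr; apply: (@holo_sum R _ (fun n w => w ^+ n * (iterate n k x)%:C)) => n; apply: holoM; last exact: holo_cst.
  by apply: holoX; apply: (@holo_id R _ (2 * r)) => w; exact: sub.
- move=> N z w zr wr; apply: psum_bound; [by rewrite mulr_gt0|exact: sub zr wr].
Qed.
End linear_ode.

(** * Weyl theory of canonical systems *)

Section quadratic_form.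
Variable R : realType.
Implicit Types (a b c p q r : R) (u v : R[i]).

Definition qform a b c u1 u2 : R :=
  a * cabs u1 ^+ 2 + 2 * b * Re (u1 * conjc u2) + c * cabs u2 ^+ 2.

(** Bilinear, without conjugation: for a pair [f], [g] of unit Wronskian these numbers are the
    coefficients of [H f] and [H g], rotated by [J], in the basis [f], [g]. *)
Definition bform a b c u1 u2 v1 v2 : R[i] :=
  a%:C * (u1 * v1) + b%:C * (u1 * v2 + u2 * v1) + c%:C * (u2 * v2).

Lemma psd_decomp a b c : 0 <= a -> 0 <= c -> b ^+ 2 <= a * c ->
  exists p q r, [/\ 0 <= p, 0 <= r, a = p, b = p * q & c = p * q ^+ 2 + r].
Proof.
move=> a0 c0 bac; have [aE|an0] := eqVneq a 0.
  move: bac; rewrite aE mul0r => bac; exists 0, 0, c; split => //.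
    by apply/eqP; rewrite mul0r -sqrf_eq0 eq_le bac sqr_ge0.
  by rewrite mul0r add0r.
have ap : 0 < a by rewrite lt_def an0.
exists a, (b / a), (c - b ^+ 2 / a); split => //.
- by rewrite subr_ge0 ler_pdivrMr// mulrC.
- by field.
- by field.
Qed.

Lemma qform_decomp p q r u1 u2 : qform p (p * q) (p * q ^+ 2 + r) u1 u2 =
  p * cabs (u1 + q%:C * u2) ^+ 2 + r * cabs u2 ^+ 2.
Proof. by rewrite /qform !cabs_sqr !cplxE /=; ring. Qed.

Lemma qform_ge0 a b c u1 u2 : 0 <= a -> 0 <= c -> b ^+ 2 <= a * c -> 0 <= qform a b c u1 u2.
Proof.
move=> a0 c0 /(psd_decomp a0 c0)[p [q [r [p0 r0 -> -> ->]]]].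
by rewrite qform_decomp; apply: addr_ge0; apply: mulr_ge0 => //; exact: sqr_ge0.
Qed.

(** After completing the square this is the inequality between the product and the mean of the
    squares, for each of the two terms. *)
Lemma bform_le a b c u1 u2 v1 v2 : 0 <= a -> 0 <= c -> b ^+ 2 <= a * c ->
  2 * cabs (bform a b c u1 u2 v1 v2) <= qform a b c u1 u2 + qform a b c v1 v2.
Proof.
move=> a0 c0 /(psd_decomp a0 c0)[p [q [r [p0 r0 -> -> ->]]]].
rewrite !qform_decomp.
have -> : bform p (p * q) (p * q ^+ 2 + r) u1 u2 v1 v2 =
    p%:C * ((u1 + q%:C * u2) * (v1 + q%:C * v2)) + r%:C * (u2 * v2).
  by apply: complex_eq; rewrite /bform !cplxE /=; ring.
have h := cabsD (p%:C * ((u1 + q%:C * u2) * (v1 + q%:C * v2))) (r%:C * (u2 * v2)).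
apply: le_trans (ler_wpM2l _ h) _ => //.
rewrite !cabsM !cabs_real (ger0_norm p0) (ger0_norm r0).
set A := cabs (u1 + _); set B := cabs (v1 + _); set C := cabs u2; set D := cabs v2.
have : 0 <= p * (A - B) ^+ 2 by rewrite mulr_ge0 ?sqr_ge0.
have : 0 <= r * (C - D) ^+ 2 by rewrite mulr_ge0 ?sqr_ge0.
by lra.
Qed.

Lemma qformZ a b c k u1 u2 : qform a b c (k * u1) (k * u2) = cabs k ^+ 2 * qform a b c u1 u2.
Proof. by rewrite /qform !cabs_sqr !cplxE; ring. Qed.

Lemma qformB a b c u1 u2 v1 v2 : 0 <= a -> 0 <= c -> b ^+ 2 <= a * c ->
  qform a b c (u1 - v1) (u2 - v2) <= 2 * (qform a b c u1 u2 + qform a b c v1 v2).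
Proof.
move=> a0 c0 bac; rewrite -subr_ge0.
have -> : 2 * (qform a b c u1 u2 + qform a b c v1 v2) - qform a b c (u1 - v1) (u2 - v2) =
  qform a b c (u1 + v1) (u2 + v2) by rewrite /qform !cabs_sqr !cplxE; ring.
exact: qform_ge0.
Qed.

(* With unit Wronskian, [(1, 0) = g2 f - f2 g] and [(0, 1) = f1 g - g1 f]. *)
Lemma qform_trace a b c f1 f2 g1 g2 : 0 <= a -> 0 <= c -> b ^+ 2 <= a * c ->
  f1 * g2 - f2 * g1 = 1 ->
  a + c <= 2 * (cabs f1 ^+ 2 + cabs f2 ^+ 2 + cabs g1 ^+ 2 + cabs g2 ^+ 2) *
    (qform a b c f1 f2 + qform a b c g1 g2).
Proof.
move=> a0 c0 bac W.
have aE : a = qform a b c (g2 * f1 - f2 * g1) (g2 * f2 - f2 * g2).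
  rewrite (mulrC g2 f1) W (mulrC g2) subrr /qform cabs1 cabs0 conjc0 mulr0 /=.
  by rewrite expr1n expr0n /= !mulr0 !addr0 mulr1.
have cE : c = qform a b c (g1 * f1 - f1 * g1) (g1 * f2 - f1 * g2).
  have -> : g1 * f2 - f1 * g2 = -1 by rewrite -W; ring.
  rewrite (mulrC g1) subrr /qform cabsN cabs1 cabs0 mul0r /=.
  by rewrite expr1n expr0n /= !mulr0 !add0r mulr1.
have := qformB (g2 * f1) (g2 * f2) (f2 * g1) (f2 * g2) a0 c0 bac.
have := qformB (g1 * f1) (g1 * f2) (f1 * g1) (f1 * g2) a0 c0 bac.
rewrite !qformZ -aE -cE.
have F0 := qform_ge0 f1 f2 a0 c0 bac; have G0 := qform_ge0 g1 g2 a0 c0 bac.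
set F := qform a b c f1 f2 in F0 *; set G := qform a b c g1 g2 in G0 *.
have h1 : 0 <= cabs f1 ^+ 2 * F by rewrite mulr_ge0 ?sqr_ge0.
have h2 : 0 <= cabs f2 ^+ 2 * F by rewrite mulr_ge0 ?sqr_ge0.
have h3 : 0 <= cabs g1 ^+ 2 * G by rewrite mulr_ge0 ?sqr_ge0.
have h4 : 0 <= cabs g2 ^+ 2 * G by rewrite mulr_ge0 ?sqr_ge0.
by lra.
Qed.

Lemma Re_le_cabs u : Re u <= cabs u.
Proof. by rewrite (le_trans (ler_norm _)) ?cabs_Re. Qed.

(** The left side is the derivative of the total square norm of two solutions. Through the expansion
    with coefficients [bform] its logarithmic growth is controlled by the energy density, which is
    integrable in [limit_point], and not merely by the trace. *)
Lemma growth_bound a b c z f1 f2 g1 g2 : 0 <= a -> 0 <= c -> b ^+ 2 <= a * c ->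
  f1 * g2 - f2 * g1 = 1 ->
  2 * Re (- z * (b%:C * f1 + c%:C * f2) * conjc f1) + 2 * Re (z * (a%:C * f1 + b%:C * f2) * conjc f2) +
  2 * Re (- z * (b%:C * g1 + c%:C * g2) * conjc g1) + 2 * Re (z * (a%:C * g1 + b%:C * g2) * conjc g2) <=
  4 * cabs z * (qform a b c f1 f2 + qform a b c g1 g2) *
   (cabs f1 ^+ 2 + cabs f2 ^+ 2 + cabs g1 ^+ 2 + cabs g2 ^+ 2).
Proof.
move=> a0 c0 bac W.
have F0 := qform_ge0 f1 f2 a0 c0 bac; have G0 := qform_ge0 g1 g2 a0 c0 bac.
have BB := bform_le f1 f2 f1 f2 a0 c0 bac; have BG := bform_le f1 f2 g1 g2 a0 c0 bac.
have GG := bform_le g1 g2 g1 g2 a0 c0 bac.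
set s := qform a b c f1 f2 + qform a b c g1 g2.
have s0 : 0 <= s by rewrite addr_ge0.
set Bff := bform a b c f1 f2 f1 f2 in BB; set Bfg := bform a b c f1 f2 g1 g2 in BG.
set Bgg := bform a b c g1 g2 g1 g2 in GG.
have e1 : a%:C * f1 + b%:C * f2 = g2 * Bff - f2 * Bfg.
  by rewrite -[LHS]mulr1 -W /Bff /Bfg /bform; ring.
have e2 : b%:C * f1 + c%:C * f2 = f1 * Bfg - g1 * Bff.
  by rewrite -[LHS]mulr1 -W /Bff /Bfg /bform; ring.
have e3 : a%:C * g1 + b%:C * g2 = g2 * Bfg - f2 * Bgg.
  by rewrite -[LHS]mulr1 -W /Bgg /Bfg /bform; ring.
have e4 : b%:C * g1 + c%:C * g2 = f1 * Bgg - g1 * Bfg.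
  by rewrite -[LHS]mulr1 -W /Bgg /Bfg /bform; ring.
have key k k' u u' w : cabs u <= s -> cabs u' <= s -> cabs k' = cabs z ->
    Re (k' * (k * u - w * u') * conjc w) <= cabs z * s * ((cabs k + cabs w) * cabs w) /\
    Re (k' * (k * u - w * u') * conjc k) <= cabs z * s * ((cabs k + cabs w) * cabs k).
  move=> us us' kz.
  have H : cabs (k * u - w * u') <= s * (cabs k + cabs w).
    rewrite (le_trans (cabsB _ _))// !cabsM mulrDr lerD// mulrC ler_wpM2r ?cabs_ge0//.
  by split; rewrite (le_trans (Re_le_cabs _))// !cabsM cabs_conj kz;
    rewrite [leRHS]mulrA ler_wpM2r ?cabs_ge0// -mulrA ler_wpM2l ?cabs_ge0.
have us1 : cabs Bff <= s by rewrite /s; lra.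
have us2 : cabs Bfg <= s by rewrite /s; lra.
have us3 : cabs Bgg <= s by rewrite /s; lra.
have cz : cabs (- z) = cabs z by rewrite cabsN.
rewrite e1 e2 e3 e4.
have [k1 _] := key g2 z Bff Bfg f2 us1 us2 erefl.
have [_ k2] := key f1 (- z) Bfg Bff g1 us2 us1 cz.
have [_ k3] := key g2 z Bfg Bgg f2 us2 us3 erefl.
have [k4 _] := key f1 (- z) Bgg Bfg g1 us3 us2 cz.
have zs : 0 <= cabs z * s by rewrite mulr_ge0 ?cabs_ge0.
have q1 : 0 <= cabs z * s * (cabs f1 - cabs g1) ^+ 2 by rewrite mulr_ge0 ?sqr_ge0.
have q2 : 0 <= cabs z * s * (cabs f2 - cabs g2) ^+ 2 by rewrite mulr_ge0 ?sqr_ge0.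
by move: k1 k2 k3 k4 q1 q2; lra.
Qed.
End quadratic_form.

(** * Transfer matrix, energy and the limit point property *)

Section canonical_sys.
Variable R : realType.
Local Notation mu := (@lebesgue_measure R).

(** The bounds hold everywhere, as the series for the transfer matrix wants them, while positivity
    is available only almost everywhere. *)
Record coefs (a b c : R -> R) : Prop := Coefs {
  coefs_meas : [/\ measurable_fun setT a, measurable_fun setT b & measurable_fun setT c];
  coefs_le1 : forall x, [/\ `|a x| <= 1, `|b x| <= 1 & `|c x| <= 1];
  coefs_psd : {ae mu, forall x, [/\ 0 <= a x, 0 <= c x, a x + c x = 1 & b x ^+ 2 <= a x * c x]} }.

Definition sol (a b c : R -> R) (z : R[i]) (u1 u2 : R -> R[i]) :=
  [/\ cac u1, cac u2 & {ae mu, forall x,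
    has_cderiv u1 x (- z * ((b x)%:C * u1 x + (c x)%:C * u2 x)) /\
    has_cderiv u2 x (z * ((a x)%:C * u1 x + (b x)%:C * u2 x))}].

Variables a b c : R -> R.
Hypothesis abc : coefs a b c.

Definition cmat (j k : bool) (x : R) : R :=
  if j then (if k then - b x else - c x) else (if k then a x else b x).

Let cmat_meas j k : measurable_fun setT (cmat j k).
Proof.
have [ma mb mc] := coefs_meas abc.
by case: j; case: k => //; exact: measurable_funN.
Qed.

Let cmat1 j k x : `|cmat j k x| <= 1.
Proof. by have [h1 h2 h3] := coefs_le1 abc x; case: j; case: k; rewrite /cmat ?normrN. Qed.

(* Transfer matrix: component [k] of the solution with initial value the unit vector [j]. *)
Definition tm (j k : bool) z x : R[i] := lsol cmat (fun i => (i == j)%:R) k z x.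

Lemma solD z u1 u2 v1 v2 : sol a b c z u1 u2 -> sol a b c z v1 v2 ->
  sol a b c z (fun x => u1 x + v1 x) (fun x => u2 x + v2 x).
Proof.
move=> [c1 c2 d] [c1' c2' d']; split; [exact: cacD|exact: cacD|].
apply: (ae_imp2 _ d d') => x [h1 h2] [h1' h2']; split.
- by have := has_cderivD h1 h1'; congr has_cderiv; ring.
- by have := has_cderivD h2 h2'; congr has_cderiv; ring.
Qed.

Lemma solZ z k u1 u2 : sol a b c z u1 u2 ->
  sol a b c z (fun x => k * u1 x) (fun x => k * u2 x).
Proof.
move=> [c1 c2 d]; split; [exact: cacM (cac_cst _) _|exact: cacM (cac_cst _) _|].
apply: (ae_imp _ d) => x [h1 h2]; split.
- by have := has_cderivM (has_cderiv_cst k x) h1; congr has_cderiv; ring.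
- by have := has_cderivM (has_cderiv_cst k x) h2; congr has_cderiv; ring.
Qed.

Lemma sol_conj z u1 u2 : sol a b c z u1 u2 ->
  sol a b c (conjc z) (fun x => conjc (u1 x)) (fun x => conjc (u2 x)).
Proof.
move=> [c1 c2 d]; split; [exact: cac_conj|exact: cac_conj|].
apply: (ae_imp _ d) => x [h1 h2]; split.
- have := has_cderiv_conj h1; congr has_cderiv.
  by apply: complex_eq; rewrite !cplxE /=; ring.
- have := has_cderiv_conj h2; congr has_cderiv.
  by apply: complex_eq; rewrite !cplxE /=; ring.
Qed.

Lemma tm_sol j z : sol a b c z (tm j true z) (tm j false z).
Proof.
split; [exact: lsol_cac|exact: lsol_cac|].
apply: (ae_imp _ (lsol_deriv cmat_meas cmat1 (fun i => (i == j)%:R) z)) => x d; split.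
- have := d true; congr has_cderiv; rewrite /cmat !(rmorphN (real_complex R)) /=.
  by rewrite -/(tm j true z x) -/(tm j false z x); ring.
- exact: d false.
Qed.

Lemma tm0 j k z : tm j k z 0 = (k == j)%:R.
Proof. by rewrite /tm lsol0//; case: (k == j). Qed.

Lemma tm_holo j k x r : 0 < r -> holo (disc 0 r) (fun z => tm j k z x).
Proof. exact: lsol_holo. Qed.

Lemma wronskian z u1 u2 v1 v2 x : sol a b c z u1 u2 -> sol a b c z v1 v2 ->
  u1 x * v2 x - u2 x * v1 x = u1 0 * v2 0 - u2 0 * v1 0.
Proof.
move=> [c1 c2 d] [c1' c2' d'].
apply: (@cac_const R (fun x => u1 x * v2 x - u2 x * v1 x)).
  by apply: cacB; exact: cacM.
apply: (ae_imp2 _ d d') => t [h1 h2] [h1' h2'].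
by have := has_cderivB (has_cderivM h1 h2') (has_cderivM h2 h1'); congr has_cderiv; ring.
Qed.

Lemma tm_det z x : tm true true z x * tm false false z x - tm true false z x * tm false true z x = 1.
Proof. by rewrite (wronskian x (tm_sol true z) (tm_sol false z)) !tm0 /= mulr1 mulr0 subr0. Qed.

Definition tsol k (w1 w2 : R[i]) z x := w1 * tm true k z x + w2 * tm false k z x.

Lemma tsol_sol w1 w2 z : sol a b c z (tsol true w1 w2 z) (tsol false w1 w2 z).
Proof. by apply: solD; apply: solZ; exact: tm_sol. Qed.

Lemma tsol0 k w1 w2 z : tsol k w1 w2 z 0 = if k then w1 else w2.
Proof. by rewrite /tsol !tm0; case: k; rewrite ?mulr1 ?mulr0 ?addr0 ?add0r. Qed.

(** The Wronskians of [u] with the two columns of the transfer matrix are constant, and by [tm_det]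
    they determine [u]. *)
Lemma sol_uniq z u1 u2 x : sol a b c z u1 u2 ->
  u1 x = tsol true (u1 0) (u2 0) z x /\ u2 x = tsol false (u1 0) (u2 0) z x.
Proof.
move=> us; have w1 := wronskian x us (tm_sol true z); have w2 := wronskian x us (tm_sol false z).
move: w1 w2; rewrite !tm0 /= mulr0 mulr1 sub0r mulr1 mulr0 subr0 => w1 w2.
have D := tm_det z x.
split; rewrite /tsol -[LHS]mulr1 -D -w2 -[u2 0]opprK -w1; ring.
Qed.

Definition qf (u1 u2 : R -> R[i]) x : R := qform (a x) (b x) (c x) (u1 x) (u2 x).

(** It is nonnegative exactly when [u1 / u2] lies in the closed upper half plane, and it decreases
    at the rate [Im z] times the energy density. *)
Definition nf (u1 u2 : R -> R[i]) (x : R) : R := Im (u1 x * conjc (u2 x)).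

Lemma nf_lac u1 u2 : cac u1 -> cac u2 -> loc_abs_cont (nf u1 u2).
Proof. by move=> c1 c2; have [_] := cacM c1 (cac_conj c2). Qed.

Lemma nf_derive z u1 u2 : sol a b c z u1 u2 ->
  {ae mu, forall x, is_derive x (1 : R) (nf u1 u2) (- Im z * qf u1 u2 x)}.
Proof.
move=> [c1 c2 d]; apply: (ae_imp _ d) => x [h1 h2].
have [_ H] := has_cderivM h1 (has_cderiv_conj h2).
by apply: (is_derive_eq H); rewrite /qf /qform !cabs_sqr !cplxE /=; ring.
Qed.

Lemma qf_ge0 u1 u2 : {ae mu, forall x, 0 <= qf u1 u2 x}.
Proof. by apply: (ae_imp _ (coefs_psd abc)) => x [? ? _ ?]; exact: qform_ge0. Qed.

Lemma nf_nonincreasing z u1 u2 x y : sol a b c z u1 u2 -> 0 <= Im z -> x <= y ->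
  nf u1 u2 y <= nf u1 u2 x.
Proof.
move=> us z0 xy; have [c1 c2 _] := us; rewrite -lerN2.
apply: (lac_nondecreasing (lacN (nf_lac c1 c2)) xy).
apply: (ae_imp2 _ (nf_derive us) (qf_ge0 u1 u2)) => t d q _.
eexists; last exact: is_deriveN d.
by rewrite mulNr opprK mulr_ge0.
Qed.

Lemma nf_const z u1 u2 x y : sol a b c z u1 u2 -> Im z = 0 -> nf u1 u2 y = nf u1 u2 x.
Proof.
move=> us z0; have [c1 c2 _] := us.
have [h _] : cac (fun t => (nf u1 u2 t)%:C) by apply/cac_real/nf_lac.
suff : (nf u1 u2 y)%:C = (nf u1 u2 x)%:C by case.
apply: (@cac_const R (fun t => (nf u1 u2 t)%:C)); first exact/cac_real/nf_lac.
apply: (ae_imp _ (nf_derive us)) => t d.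
by have := has_cderiv_real d; rewrite z0 oppr0 mul0r.
Qed.

(* Two linearly independent solutions of finite energy would be bounded, and then trace H = 1 would be integrable. *)
Lemma limit_point z f1 f2 g1 g2 (C : R) : 0 < Im z -> sol a b c z f1 f2 -> sol a b c z g1 g2 ->
  f1 0 * g2 0 - f2 0 * g1 0 = 1 ->
  (forall x, 0 <= x -> C <= nf f1 f2 x) -> (forall x, 0 <= x -> C <= nf g1 g2 x) -> False.
Proof.
move=> z0 fs gs W0 fC gC.
have [cf1 cf2 fd] := fs; have [cg1 cg2 gd] := gs.
have W x := wronskian x fs gs.
(* By [nf_derive] a primitive of the total energy density; the lower bounds on [nf] make it bounded
   above on the right half line. *)
pose S x := - (Im z)^-1 * (nf f1 f2 x + nf g1 g2 x).
have cS : loc_abs_cont S by apply: lacM (lac_cst _) _; apply: lacD; exact: nf_lac.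
have dS : {ae mu, forall x, is_derive x (1 : R) S (qf f1 f2 x + qf g1 g2 x)}.
  apply: (ae_imp2 _ (nf_derive fs) (nf_derive gs)) => x d1 d2.
  have H := is_deriveZ (- (Im z)^-1) (is_deriveD d1 d2); apply: (is_derive_eq H).
  by rewrite -[_ *: _]/(_ * _); field; rewrite gt_eqF.
have S_le x : 0 <= x -> S x <= - (Im z)^-1 * (2 * C).
  move=> x0; rewrite /S !mulNr lerN2 ler_wpM2l ?invr_ge0 ?(ltW z0)//.
  by have := fC x x0; have := gC x x0; lra.
pose Phi x := Re (f1 x * conjc (f1 x)) + Re (f2 x * conjc (f2 x)) +
  Re (g1 x * conjc (g1 x)) + Re (g2 x * conjc (g2 x)).
have PhiE x : Phi x = cabs (f1 x) ^+ 2 + cabs (f2 x) ^+ 2 + cabs (g1 x) ^+ 2 + cabs (g2 x) ^+ 2.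
  by rewrite /Phi !conj_mul.
have sqc (f : R -> R[i]) : cac f -> loc_abs_cont (fun x => Re (f x * conjc (f x))).
  by move=> cf; have [] := cacM cf (cac_conj cf).
have cPhi : loc_abs_cont Phi.
  by have := lacD (lacD (lacD (sqc _ cf1) (sqc _ cf2)) (sqc _ cg1)) (sqc _ cg2).
have dsq (f : R -> R[i]) x u : has_cderiv f x u -> is_derive x (1 : R) (fun x => Re (f x * conjc (f x))) (2 * Re (u * conjc (f x))).
  move=> du; have [H _] := has_cderivM du (has_cderiv_conj du).
  by apply: (is_derive_eq H); rewrite !cplxE; ring.
pose K := 4 * cabs z.
have K0 : 0 <= K by rewrite mulr_ge0 ?cabs_ge0.
(* Integrating factor: [growth_bound] makes [Phi * E] nonincreasing, so a bound on [S] bounds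
   [Phi]. *)
pose E x := expR (- K * S x).
have cE : loc_abs_cont E.
  apply: (@lip_comp_lac R S (fun y => expR (- K * y)) 0 cS) => p q pq.
  have [B SB] := continuous_bounded p q (lac_cts cS).
  have HL r : exists L, forall x y, `|x| <= r -> `|y| <= r -> `|expR (- K * y) - expR (- K * x)| <= L * `|y - x|.
    exists (`|- K| * expR (`|- K| * r)).
    suff H x y : `|x| <= r -> `|y| <= r -> x <= y ->
        `|expR (- K * y) - expR (- K * x)| <= `|- K| * expR (`|- K| * r) * (y - x).
      move=> x y xr yr; have [xy|/ltW yx] := leP x y; first by rewrite (ger0_norm (_ : 0 <= y - x)) ?subr_ge0//; exact: H.
      by rewrite distrC (distrC y) (ger0_norm (_ : 0 <= x - y)) ?subr_ge0//; exact: H.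
    move=> xr yr xy; apply: (lac_lipschitz (lac_expZ (- K)) xy).
    apply: ae_all => t /andP[xt ty]; eexists; last exact: is_derive_expZ.
    have tr : `|t| <= r by move: xr yr; rewrite !ler_norml; lra.
    rewrite normrM ler_wpM2l// gtr0_norm ?expR_gt0// ler_expR (le_trans (ler_norm _))//.
    by rewrite normrM ler_wpM2l.
  have [L HL'] := HL B; exists L => x y xI yI; apply: HL'; exact: SB.
have dE x s : is_derive x (1 : R) S s -> is_derive x (1 : R) E (- K * E x * s).
  move=> ds; have H := is_derive1_comp (is_derive_expZ (- K) (S x)) ds.
  exact: (is_derive_eq H).
have E0 x : 0 < E x by exact: expR_gt0.
have PE x : 0 <= x -> Phi x * E x <= Phi 0 * E 0.
  move=> x0; rewrite -lerN2.
  apply: (lac_nondecreasing (lacN (lacM cPhi cE)) x0).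
  have psd := coefs_psd abc.
  apply: (ae_imp3 _ (ae_imp2 (fun x p q => conj p q) fd gd) dS psd) => t [[d1 d2] [d3 d4]] ds [a0 c0 _ bac] _.
  have dP := is_deriveD (is_deriveD (is_deriveD (dsq _ _ _ d1) (dsq _ _ _ d2)) (dsq _ _ _ d3)) (dsq _ _ _ d4).
  have dPE := is_deriveN (is_deriveM dP (dE _ _ ds)).
  eexists; last exact: dPE.
  rewrite -![_ *: _]/(_ * _).
  have Wt : f1 t * g2 t - f2 t * g1 t = 1 by rewrite W W0.
  have := growth_bound z a0 c0 bac Wt; rewrite -PhiE -/(qf f1 f2 t) -/(qf g1 g2 t) -/K => H.
  move: H; set d := (X in X <= _) => H.
  have : E t * d <= E t * (K * (qf f1 f2 t + qf g1 g2 t) * Phi t) by rewrite ler_wpM2l// ltW.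
  rewrite oppr_ge0 => h; rewrite -[X in _ + E t * X]/d -[X in X * _ + _]/(Phi t).
  by move: h; lra.
have S0 x : 0 <= x -> Phi x <= Phi 0 * E 0 * expR (K * (- (Im z)^-1 * (2 * C))).
  move=> x0; have H := PE x x0.
  have -> : Phi x = Phi x * E x * expR (K * S x).
    by rewrite -mulrA /E -expRD -mulrDl addNr mul0r expR0 mulr1.
  have P0 : 0 <= Phi 0 * E 0.
    by rewrite mulr_ge0// ?(ltW (E0 _))// PhiE !addr_ge0 ?sqr_ge0.
  rewrite (le_trans (ler_wpM2r _ H)) ?(ltW (expR_gt0 _))//.
  by rewrite ler_wpM2l// ler_expR ler_wpM2l// S_le.
set B := Phi 0 * E 0 * _ in S0.
(* [qform_trace] bounds the trace, which is [1], by [2 * B] times the derivative of [S], so [x]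
   grows no faster than [2 * B * S], which is bounded above. *)
have lin x : 0 <= x -> x <= 2 * B * (- (Im z)^-1 * (2 * C)) - 2 * B * S 0.
  move=> x0; suff : 2 * B * S 0 - 0 <= 2 * B * S x - x.
    have B0 : 0 <= B by rewrite (le_trans _ (S0 0 (lexx _)))// PhiE !addr_ge0 ?sqr_ge0.
    have : 2 * B * S x <= 2 * B * (- (Im z)^-1 * (2 * C)) by apply: ler_wpM2l; [exact: mulr_ge0|exact: S_le].
    by lra.
  apply: (lac_nondecreasing (lacB (lacM (lac_cst (2 * B)) cS) (@lac_id R)) x0).
  apply: (ae_imp2 _ dS (coefs_psd abc)) => t ds [a0 c0 ac1 bac] /andP[t0 _].
  eexists; last exact: is_deriveB (is_deriveZ (2 * B) ds) (is_derive_id _ _).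
  rewrite -[_ *: _]/(_ * _) subr_ge0.
  apply: (@le_trans _ _ (a t + c t)); first by rewrite ac1.
  have Wt : f1 t * g2 t - f2 t * g1 t = 1 by rewrite W W0.
  apply: (le_trans (qform_trace a0 c0 bac Wt)); rewrite -PhiE.
  apply: ler_wpM2r; first by apply: addr_ge0; exact: qform_ge0.
  by apply: ler_wpM2l => //; exact: S0.
set Q := 2 * B * (- (Im z)^-1 * (2 * C)) - 2 * B * S 0 in lin.
have Q1 : 0 <= 1 + `|Q| by rewrite addr_ge0.
by have := lin _ Q1; have := ler_norm Q; lra.
Qed.
End canonical_sys.

(** * The Weyl solution in the Schur coordinate *)

Section weyl.
Variable R : realType.
Local Notation mu := (@lebesgue_measure R).
Variables a b c : R -> R.
Hypothesis abc : coefs a b c.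
Local Notation T := (tm a b c).

(* The Cayley transform [m = w1 s / w2 s] maps the disc [cabs s <= 1] onto the closed upper half plane. *)
Definition w1 (s : R[i]) : R[i] := 'i%C * (1 + s).
Definition w2 (s : R[i]) : R[i] := 1 - s.

(* The values at [0] of the solution that equals [('i, 1)] at [n]. *)
Definition back1 (n : nat) (z : R[i]) : R[i] := T false false z n%:R * 'i%C - T false true z n%:R.
Definition back2 (n : nat) (z : R[i]) : R[i] := T true true z n%:R - T true false z n%:R * 'i%C.

Definition sapprox n z := (back1 n z - 'i%C * back2 n z) / (back1 n z + 'i%C * back2 n z).

(** The ultralimit selects a point of the limiting Weyl disc; [splus_unique] shows afterwards that
    for [0 < Im z] there is no other. *)
Definition splus z := culim (fun n => sapprox n z).

Lemma mulii : ('i%C : R[i]) * 'i%C = -1. Proof. by rewrite -expr2 sqr_i. Qed.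

Lemma back_end n z : tsol a b c true (back1 n z) (back2 n z) z n%:R = 'i%C /\
  tsol a b c false (back1 n z) (back2 n z) z n%:R = 1.
Proof.
have D := tm_det abc z n%:R; split.
- rewrite -[RHS]mulr1 -D /tsol /back1 /back2; ring.
- rewrite -D /tsol /back1 /back2; ring.
Qed.

Lemma cabs_pair (v1 v2 : R[i]) : cabs (v1 + 'i%C * v2) ^+ 2 - cabs (v1 - 'i%C * v2) ^+ 2 = 4 * Im (v1 * conjc v2).
Proof. by rewrite !cabs_sqr !cplxE /=; ring. Qed.

Lemma nfZ k (u1 u2 : R -> R[i]) x : nf (fun x => k * u1 x) (fun x => k * u2 x) x = cabs k ^+ 2 * nf u1 u2 x.
Proof. by rewrite /nf cabs_sqr !cplxE; ring. Qed.

Lemma cayley_pair (v1 v2 : R[i]) : v1 + 'i%C * v2 != 0 ->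
  let s := (v1 - 'i%C * v2) / (v1 + 'i%C * v2) in
  w1 s = (2 * 'i%C / (v1 + 'i%C * v2)) * v1 /\ w2 s = (2 * 'i%C / (v1 + 'i%C * v2)) * v2.
Proof. by move=> d0 s; rewrite /w1 /w2 /s; split; field. Qed.

Lemma tsolZ d k v1 v2 z x : tsol a b c k (d * v1) (d * v2) z x = d * tsol a b c k v1 v2 z x.
Proof. by rewrite /tsol; ring. Qed.

Lemma back_nf n z x : 0 <= Im z -> x <= n%:R ->
  1 <= nf (tsol a b c true (back1 n z) (back2 n z) z) (tsol a b c false (back1 n z) (back2 n z) z) x.
Proof.
move=> z0 xn; apply: le_trans (nf_nonincreasing abc (tsol_sol abc _ _ z) z0 xn).
by have [e1 e2] := back_end n z; rewrite /nf e1 e2 conjc1 mulr1.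
Qed.

(** By [cabs_pair] the squares differ by [4 * nf], and [nf >= 1] at [0] since [nf] is [1] at [n] and
    nonincreasing. The lower bound [2] is independent of [n] and [z]. *)
Lemma back_den n z : 0 <= Im z -> 2 <= cabs (back1 n z + 'i%C * back2 n z) /\
  cabs (back1 n z - 'i%C * back2 n z) <= cabs (back1 n z + 'i%C * back2 n z).
Proof.
move=> z0; have := back_nf z0 (ler0n R n); rewrite /nf !tsol0// => H.
have E := cabs_pair (back1 n z) (back2 n z).
have q := sqr_ge0 (cabs (back1 n z - 'i%C * back2 n z)).
move: H E q; set N := Im _; set P := cabs _ ^+ 2; set Q := cabs _ ^+ 2 => H E q.
by split; rewrite -(ler_pXn2r (n := 2)) ?nnegrE ?cabs_ge0// -/P -/Q; lra.
Qed.

Lemma sapprox_le n z : 0 <= Im z -> cabs (sapprox n z) <= 1.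
Proof.
move=> z0; have [d2 dn] := back_den n z0.
have d0 : 0 < cabs (back1 n z + 'i%C * back2 n z) by apply: lt_le_trans d2.
by rewrite /sapprox cabsM cabsV ler_pdivrMr// mul1r.
Qed.

Lemma sapprox_cb z : 0 <= Im z -> cbounded (fun n => sapprox n z).
Proof. by move=> z0; exists 1, 0%N => n _; exact: sapprox_le. Qed.

Lemma splus_le z : 0 <= Im z -> cabs (splus z) <= 1.
Proof. by move=> z0; apply: (@culim_le _ _ _ 0%N) => [|n _]; [exact: sapprox_cb|exact: sapprox_le]. Qed.

Lemma sapprox_nf n z x : 0 <= Im z -> x <= n%:R ->
  0 <= nf (tsol a b c true (w1 (sapprox n z)) (w2 (sapprox n z)) z)
          (tsol a b c false (w1 (sapprox n z)) (w2 (sapprox n z)) z) x.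
Proof.
move=> z0 xn; have [d2 _] := back_den n z0.
have d0 : back1 n z + 'i%C * back2 n z != 0 by rewrite -cabs_gt0; apply: lt_le_trans d2.
have [-> ->] := cayley_pair d0.
set d := 2 * 'i%C / _.
rewrite (_ : nf _ _ x = cabs d ^+ 2 * nf (tsol a b c true (back1 n z) (back2 n z) z)
  (tsol a b c false (back1 n z) (back2 n z) z) x); last by rewrite -nfZ /nf !tsolZ.
by rewrite mulr_ge0 ?sqr_ge0// (le_trans _ (back_nf z0 xn)).
Qed.

Lemma culim_tsol k (s : nat -> R[i]) z x : cbounded s ->
  tsol a b c k (w1 (culim s)) (w2 (culim s)) z x = culim (fun n => tsol a b c k (w1 (s n)) (w2 (s n)) z x).
Proof.
move=> sb; have c1 := @cbounded_cst R.
rewrite /tsol /w1 /w2.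
have b1 : cbounded (fun n => 'i%C * (1 + s n)) by apply: cboundedM => //; apply: cboundedD.
have b2 : cbounded (fun n => 1 - s n) by apply: cboundedD => //; exact: cboundedN.
rewrite culimD; [|exact: cboundedM..].
rewrite !culimM//; last exact: cboundedD.
by rewrite culimB// culimD// !culim_cst.
Qed.

(** For fixed [x] of either sign the approximants satisfy this once [n >= x], and the limit keeps
    it. *)
Lemma splus_nf z x : 0 <= Im z ->
  0 <= nf (tsol a b c true (w1 (splus z)) (w2 (splus z)) z)
          (tsol a b c false (w1 (splus z)) (w2 (splus z)) z) x.
Proof.
move=> z0; have sb := sapprox_cb z0.
rewrite /nf /splus !culim_tsol//.
have c1 := @cbounded_cst R.
have b1 : cbounded (fun n => 'i%C * (1 + sapprox n z)) by apply: cboundedM => //; apply: cboundedD.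
have b2 : cbounded (fun n => 1 - sapprox n z) by apply: cboundedD => //; exact: cboundedN.
have tb k : cbounded (fun n => tsol a b c k (w1 (sapprox n z)) (w2 (sapprox n z)) z x).
  by apply: cboundedD; exact: cboundedM.
rewrite -culim_conj// -culimM//; last exact: cbounded_conj.
set u := fun n => _ * _.
have ub : cbounded u by apply: cboundedM => //; exact: cbounded_conj.
have ImE (w : R[i]) : Im w = Re (- 'i%C * w) by case: w => x1 y1 /=; ring.
rewrite ImE -culimZ//; apply: (@culim_Re_ge _ _ _ (Num.truncn x).+1); first exact: cboundedM.
move=> n xn; rewrite -ImE; apply: sapprox_nf => //.
by rewrite ltW// (lt_le_trans (truncnS_gt _))// ler_nat.
Qed.

Definition upper_half (delta : R) (z : R[i]) := delta < Im z.

Lemma splus_holo delta : 0 < delta -> holo (upper_half delta) splus.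
Proof.
move=> d0; have up z w : upper_half delta z -> disc z delta w -> 0 <= Im w.
  rewrite /upper_half /disc => zd wd; have := cabs_Im (w - z); rewrite ImB.
  by rewrite ler_norml => /andP[h _]; move: wd; lra.
apply: (@holo_culim R _ delta 1) => // [n z zd|n z w zd wd].
- apply: (@holo_sub R (fun w => 0 <= Im w /\ disc 0 (cabs z + delta) w)).
    move=> w wd; split; first exact: up wd.
    by apply: disc_sub wd; rewrite subr0.
  have sub2 (w : R[i]) : 0 <= Im w /\ disc 0 (cabs z + delta) w -> disc 0 (cabs z + delta) w by case.
  have r0 : 0 < cabs z + delta by rewrite ltr_pwDr// cabs_ge0.
  have th j k : holo (fun w => 0 <= Im w /\ disc 0 (cabs z + delta) w) (fun w => T j k w n%:R).
    by apply: holo_sub sub2 _; exact: tm_holo.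
  have h1 : holo (fun w => 0 <= Im w /\ disc 0 (cabs z + delta) w) (back1 n).
    by apply: holoB => //; apply: holoM => //; exact: holo_cst.
  have h2 : holo (fun w => 0 <= Im w /\ disc 0 (cabs z + delta) w) (back2 n).
    by apply: holoB => //; apply: holoM => //; exact: holo_cst.
  have h3 : holo (fun w => 0 <= Im w /\ disc 0 (cabs z + delta) w) (fun w => 'i%C * back2 n w).
    by apply: holoM => //; exact: holo_cst.
  apply: (@holo_div R _ (fun w => back1 n w - 'i%C * back2 n w) _ 2) => //.
  + by move=> w [w0 _]; case: (back_den n w0).
  + exact: holoB.
  + exact: holoD.
- by apply: sapprox_le; exact: up wd.
Qed.

(** Otherwise, scaled to unit Wronskian, the two solutions would contradict [limit_point]. *)
Lemma splus_unique z u1 u2 (C : R) : 0 < Im z -> sol a b c z u1 u2 ->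
  (forall x, 0 <= x -> C <= nf u1 u2 x) -> u1 0 * w2 (splus z) = u2 0 * w1 (splus z).
Proof.
move=> z0 us uC; apply/eqP; rewrite -subr_eq0; apply/negPn/negP => k0.
set k := _ - _ in k0.
have vs := tsol_sol abc (w1 (splus z)) (w2 (splus z)) z.
have us' := solZ k^-1 us.
apply: (@limit_point R a b c abc z _ _ _ _ (Num.min (cabs k^-1 ^+ 2 * C) 0) z0 us' vs).
- by rewrite !tsol0// -!mulrA -mulrBr -/k mulVf.
- move=> x x0; rewrite nfZ ge_min; apply/orP; left.
  by rewrite ler_wpM2l ?sqr_ge0// uC.
- by move=> x _; rewrite ge_min (splus_nf _ (ltW z0)) orbT.
Qed.
End weyl.

(** * Exchange of the two half lines *)

Section reflection.
Variable R : realType.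
Local Notation mu := (@lebesgue_measure R).

Lemma lac_opp (f : R -> R) : loc_abs_cont f -> loc_abs_cont (fun x => f (- x)).
Proof.
move=> cf a b ab e e0; have [|d d0 H] := cf (- b) (- a) _ e e0; first by rewrite ltrN2.
exists d => // n l r lr dis sd.
rewrite (eq_bigr (fun i => `|f (- l i) - f (- r i)|)); last by move=> i _; rewrite distrC.
apply: (H n (fun i => - r i) (fun i => - l i)).
- by move=> i; have /and3P[? ? ?] := lr i; apply/and3P; split; rewrite ?lerN2 ?ltrN2.
- by move=> i j /dis[?|?]; [right|left]; rewrite lerN2.
- by rewrite (eq_bigr (fun i => r i - l i))// => i _; rewrite opprK addrC.
Qed.

Lemma cac_opp (f : R -> R[i]) : cac f -> cac (fun x => f (- x)).
Proof. by move=> [f1 f2]; split; [exact: (lac_opp f1)|exact: (lac_opp f2)]. Qed.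

Lemma is_derive_opp (f : R -> R) x v : is_derive (- x) (1 : R) f v ->
  is_derive x (1 : R) (fun x => f (- x)) (- v).
Proof.
move=> /is_derive_eps H; apply/is_derive_eps => e /H[d d0 dH]; exists d => // y yx.
have yE : - y - - x = - (y - x) by ring.
have yx' : `|- y - - x| < d by rewrite yE normrN.
by have := dH _ yx'; rewrite yE normrN mulrN mulNr.
Qed.

Lemma has_cderiv_opp (f : R -> R[i]) x v : has_cderiv f (- x) v ->
  has_cderiv (fun x => f (- x)) x (- v).
Proof. by move=> [h1 h2]; split; rewrite ?ReN ?ImN; exact: is_derive_opp. Qed.

Variables a b c : R -> R.
Local Notation a' := (fun x => a (- x)).
Local Notation b' := (fun x => - b (- x)).
Local Notation c' := (fun x => c (- x)).

Lemma coefs_reflect : coefs a b c -> coefs a' b' c'.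
Proof.
move=> abc; have [ma mb mc] := coefs_meas abc.
have mopp : measurable_fun setT (-%R : R -> R).
  by apply: continuous_measurable_fun => x; exact: opp_continuous.
split.
- split; [exact: measurableT_comp ma mopp| |exact: measurableT_comp mc mopp].
  by apply: measurable_funN; exact: measurableT_comp mb mopp.
- by move=> x; rewrite normrN; exact: coefs_le1 abc (- x).
- by apply: (ae_imp _ (ae_opp (coefs_psd abc))) => x; rewrite sqrrN.
Qed.

(** The sign change of [u2] and [b] compensates the reversal of the derivative at the same [z], so
    the left half line is handled by the theory of the right one. *)
Lemma sol_reflect z u1 u2 : sol a b c z u1 u2 ->
  sol a' b' c' z (fun x => u1 (- x)) (fun x => - u2 (- x)).
Proof.
move=> [c1 c2 d]; split; [exact: cac_opp|exact/cacN/cac_opp|].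
apply: (ae_imp _ (ae_opp d)) => x [h1 h2]; split.
- have := has_cderiv_opp h1; congr has_cderiv.
  by rewrite (rmorphN (real_complex R)) /=; ring.
- have := has_cderivN (has_cderiv_opp h2); congr has_cderiv.
  by rewrite (rmorphN (real_complex R)) /=; ring.
Qed.
End reflection.

Section reflectK.
Variable R : realType.
Variables a b c : R -> R.
Local Notation a' := (fun x => a (- x)).
Local Notation b' := (fun x => - b (- x)).
Local Notation c' := (fun x => c (- x)).

Lemma sol_unreflect z u1 u2 : sol a' b' c' z u1 u2 ->
  sol a b c z (fun x => u1 (- x)) (fun x => - u2 (- x)).
Proof.
move=> /sol_reflect; have E (f : R -> R) : (fun x => f (- - x)) = f by apply/funext => x; rewrite opprK.
have -> : (fun x => a (- - x)) = a by exact: E.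
have -> : (fun x => c (- - x)) = c by exact: E.
by have -> : (fun x => - - b (- - x)) = b by apply/funext => x; rewrite !opprK.
Qed.
End reflectK.

Section schur.
Variable R : realType.
Variables a b c : R -> R.
Hypothesis abc : coefs a b c.

Definition sminus (z : R[i]) := splus (fun x => a (- x)) (fun x => - b (- x)) (fun x => c (- x)) z.

(** The Schur coordinate of [m_+] above the real axis and of [- conj (m_- (conj z))] below it: the
    two branches whose boundary values agree for a reflectionless system. *)
Definition szero (z : R[i]) : R[i] :=
  if 0 < Im z then splus a b c z else conjc (sminus (conjc z)).

Lemma szero_le z : cabs (szero z) <= 1.
Proof.
rewrite /szero; case: ifPn => [z0|]; first by apply: (splus_le abc); exact: ltW.
rewrite -leNgt cabs_conj => z0; apply: (splus_le (coefs_reflect abc)).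
by rewrite Im_conj oppr_ge0.
Qed.

Lemma hol_conjconj (D : R[i] -> Prop) f : holo D f ->
  holo (fun z => D (conjc z)) (fun z => conjc (f (conjc z))).
Proof.
move=> [f' [B fB]]; exists (fun z => conjc (f' (conjc z))), B => z Dz.
have [h1 h2 h3] := fB _ Dz; split; rewrite ?cabs_conj// => w Dw.
have E : conjc (f (conjc w)) - conjc (f (conjc z)) - conjc (f' (conjc z)) * (w - z) =
    conjc (f (conjc w) - f (conjc z) - f' (conjc z) * (conjc w - conjc z)).
  by apply: complex_eq; rewrite !cplxE /=; ring.
have E2 : cabs (conjc w - conjc z) = cabs (w - z).
  by rewrite -[RHS]cabs_conj; congr cabs; apply: complex_eq; rewrite !cplxE; ring.
by rewrite E cabs_conj -E2; exact: h3.
Qed.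

Lemma szero_holo (s : bool) (delta : R) : 0 < delta ->
  holo (fun z => delta < sg R s * Im z) szero.
Proof.
move=> d0; case: s; rewrite /sg /=.
- apply: holo_ext (holo_sub _ (splus_holo abc d0)); last by move=> z; rewrite mul1r.
  by move=> z; rewrite mul1r /szero => /(lt_trans d0) ->.
- have := hol_conjconj (splus_holo (coefs_reflect abc) d0).
  move=> H; apply: holo_ext (holo_sub _ H).
    move=> z; rewrite mulN1r /szero /sminus => zd.
    by rewrite ltNge (_ : Im z <= 0)//; move: zd; lra.
  by move=> z; rewrite mulN1r /upper_half Im_conj.
Qed.

(** Below the axis the solution is, up to sign, the conjugate of the Weyl solution of the left half
    line. In both cases it stays in the closed upper half plane along the whole line, which makes
    the Schur function at every [x] bounded by [1]. *)
Lemma szero_nf z x : Im z != 0 ->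
  0 <= nf (tsol a b c true (w1 (szero z)) (w2 (szero z)) z)
          (tsol a b c false (w1 (szero z)) (w2 (szero z)) z) x.
Proof.
move=> zn0; rewrite /szero; case: ifPn => [z0|]; first by apply: (splus_nf abc); exact: ltW.
rewrite -leNgt le_eqVlt (negPf zn0)/= => z0.
have abc' := coefs_reflect abc.
have z'0 : 0 <= Im (conjc z) by rewrite Im_conj oppr_ge0 ltW.
set s := sminus (conjc z).
have us := sol_conj (sol_unreflect (tsol_sol abc' (w1 s) (w2 s) (conjc z))).
rewrite conjcK in us.
have [E1 E2] := sol_uniq abc x us.
rewrite oppr0 !tsol0// in E1 E2.
have F1 : conjc (w1 s) = - w1 (conjc s) by apply: complex_eq; rewrite /w1 !cplxE /=; ring.
have F2 : conjc (- w2 s) = - w2 (conjc s) by apply: complex_eq; rewrite /w2 !cplxE /=; ring.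
rewrite F1 F2 -[- w1 _]mulN1r -[- w2 _]mulN1r !tsolZ in E1 E2.
have := splus_nf abc' (- x) z'0; rewrite -/(sminus (conjc z)) -/s /nf => H.
have -> : forall u v : R[i], Im (u * conjc v) = Im ((-1 * u) * conjc (-1 * v)).
  by move=> u v; rewrite !cplxE /=; ring.
rewrite -E1 -E2; apply: le_trans H _; rewrite le_eqVlt; apply/orP; left; apply/eqP.
set A := tsol _ _ _ true _ _ _ _; set B := tsol _ _ _ false _ _ _ _; clearbody A B.
by rewrite !cplxE; ring.
Qed.
End schur.

(** * From matrices to coefficient functions, and integrals over half lines *)

Section entries.
Variable R : realType.
Local Notation mu := (@lebesgue_measure R).

Lemma mul2E (K : pzRingType) m n (A : 'M[K]_(m, 2)) (B : 'M[K]_(2, n)) i j :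
  (A *m B) i j = A i 0 * B 0 j + A i 1 * B 1 j.
Proof.
rewrite mxE big_ord_recl big_ord1; congr (_ + A i _ * B _ j); exact: val_inj.
Qed.

Lemma scalemx_entry (K : pzRingType) m n (k : K) (A : 'M[K]_(m, n)) i j : (k *: A) i j = k * A i j.
Proof. by rewrite mxE. Qed.

Lemma ord2P (P : 'I_2 -> Prop) : P 0 -> P 1 -> forall i, P i.
Proof.
move=> h0 h1 [[|[|//]] p].
- by rewrite (_ : Ordinal p = 0)//; exact: val_inj.
- by rewrite (_ : Ordinal p = 1)//; exact: val_inj.
Qed.

Lemma col2P (K : pzRingType) (A B : 'cV[K]_2) : A 0 0 = B 0 0 -> A 1 0 = B 1 0 -> A = B.
Proof. by move=> h0 h1; apply/matrixP => i j; rewrite (ord1 j); move: i; exact: ord2P. Qed.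

Definition col2 (K : pzRingType) (p q : K) : 'cV[K]_2 := \col_i (if i == 0 then p else q).

Lemma col2_0 (K : pzRingType) (p q : K) : col2 p q 0 0 = p. Proof. by rewrite mxE. Qed.
Lemma col2_1 (K : pzRingType) (p q : K) : col2 p q 1 0 = q. Proof. by rewrite mxE. Qed.

Lemma prim_unique (h f : R -> R) x : loc_bounded_meas h -> loc_abs_cont f ->
  {ae mu, forall x, is_derive x (1 : R) f (h x)} -> f x = f 0 + prim h x.
Proof.
move=> hb cf df; have cp := prim_lac hb.
suff : (f x - prim h x)%:C = (f 0 - prim h 0)%:C.
  by case; rewrite prim0 subr0 => <-; rewrite subrK.
apply: (@cac_const R (fun t => (f t - prim h t)%:C)); first exact/cac_real/lacB.
apply: (ae_imp2 _ df (prim_derive hb)) => t d1 d2.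
by have := has_cderiv_real (is_deriveB d1 d2); rewrite subrr.
Qed.

Lemma EFin_lty (x : \bar R) K : (x <= K%:E)%E -> (x < +oo)%E.
Proof. by move=> h; apply: le_lt_trans h _; exact: ltry. Qed.

Lemma prim_integral_oc (h : R -> R) x y : loc_bounded_meas h -> x <= y ->
  (\int[mu]_(t in `]x, y]) (h t)%:E = (prim h y - prim h x)%:E)%E.
Proof.
move=> hb xy; rewrite primB// /Rintegral fineK//.
exact: integrable_fin_num (loc_bounded_integrable x y hb).
Qed.

Lemma bigcup_oc : \bigcup_n [set` `]0, n%:R]] = `]0, +oo[%classic :> set R.
Proof.
apply/seteqP; split => x /=.
- by move=> [n _] /=; rewrite !in_itv/= andbT => /andP[].
- rewrite in_itv/= andbT => x0; exists (Num.truncn x).+1 => //=.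
  by rewrite in_itv/= x0 ltW// truncnS_gt.
Qed.

Lemma bigcup_oc_opp : \bigcup_n [set` `](- n%:R), 0]] = `]-oo, 0]%classic :> set R.
Proof.
apply/seteqP; split => x /=.
- by move=> [n _] /=; rewrite !in_itv/= => /andP[].
- rewrite in_itv/= => x0; exists (Num.truncn (- x)).+1 => //=.
  by rewrite in_itv/= x0 andbT ltrNl truncnS_gt.
Qed.

Lemma integral_bigcup_lty (h : R -> R) (F : (set (measurableTypeR R))^nat) (D : set (measurableTypeR R)) : \bigcup_n F n = D ->
  nondecreasing_seq F -> (forall n, measurable (F n)) ->
  measurable_fun setT h -> (forall x, 0 <= h x) ->
  ((\int[mu]_(t in D) (h t)%:E < +oo) <->
   exists K, forall n, \int[mu]_(t in F n) (h t)%:E <= K%:E)%E.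
Proof.
move=> FD nF mF mh h0.
have mD : measurable D by rewrite -FD; exact: bigcup_measurable.
have mhE (A : set R) : measurable_fun A (EFin \o h).
  by apply/measurable_EFinP; exact: measurable_funTS.
have h0' x : (0 <= (h x)%:E)%E by rewrite lee_fin.
split => [H|[K HK]].
- exists (fine (\int[mu]_(t in D) (h t)%:E)) => n.
  rewrite fineK; last by rewrite ge0_fin_numE ?integral_ge0.
  have FnD : F n `<=` D by rewrite -FD; exact: bigcup_sup.
  by apply: ge0_subset_integral => //; exact: mhE.
- apply: (@EFin_lty _ K).
  have mFh n : measurable_fun (F n) (EFin \o h) by exact: mhE.
  have hF n x : F n x -> (0 <= (EFin \o h) x)%E by move=> _; exact: h0'.
  have := @ge0_nondecreasing_set_cvg_integral _ (measurableTypeR R) R F (EFin \o h) mu nF mF mFh hF.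
  rewrite FD => /cvg_lim <- //; apply: lime_le; last exact: nearW.
  apply: ereal_nondecreasing_is_cvgn.
  exact: (@ge0_nondecreasing_set_nondecreasing_integral _ (measurableTypeR R) R F (EFin \o h) mu nF mF mFh hF).
Qed.

Lemma prim_le (h : R -> R) x y : loc_bounded_meas h -> (forall x, 0 <= h x) -> x <= y ->
  prim h x <= prim h y.
Proof.
move=> hb h0 xy; rewrite -subr_ge0 primB//; exact: Rintegral_ge0.
Qed.

Lemma integral_plus_lty (h : R -> R) : loc_bounded_meas h -> (forall x, 0 <= h x) ->
  (\int[mu]_(t in `[0%R, +oo[) (h t)%:E < +oo)%E <-> exists K, forall x, 0 <= x -> prim h x <= K.
Proof.
move=> hb h0; have mh := hb.1.
rewrite -integral_itv_obnd_cbnd; last by apply/measurable_EFinP; exact: measurable_funTS.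
rewrite (@integral_bigcup_lty h _ _ bigcup_oc)//; last first.
  move=> m n mn; apply/subsetPset => x /=; rewrite !in_itv/= => /andP[-> xm].
  by rewrite (le_trans xm)// ler_nat.
split=> -[K HK]; exists K.
- move=> x x0; have := HK (Num.truncn x).+1.
  rewrite prim_integral_oc// prim0 subr0 lee_fin; apply: le_trans; apply: prim_le => //.
  by rewrite ltW// truncnS_gt.
- by move=> n; rewrite prim_integral_oc// prim0 subr0 lee_fin HK.
Qed.

Lemma integral_minus_lty (h : R -> R) : loc_bounded_meas h -> (forall x, 0 <= h x) ->
  (\int[mu]_(t in `]-oo, 0%R]) (h t)%:E < +oo)%E <-> exists K, forall x, x <= 0 -> K <= prim h x.
Proof.
move=> hb h0; have mh := hb.1.
rewrite (@integral_bigcup_lty h _ _ bigcup_oc_opp)//; last first.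
  move=> m n mn; apply/subsetPset => x /=; rewrite !in_itv/= => /andP[xm ->].
  by rewrite andbT (le_lt_trans _ xm)// lerN2 ler_nat.
split=> -[K HK]; exists (- K).
- move=> x x0; have := HK (Num.truncn (- x)).+1.
  rewrite prim_integral_oc ?oppr_le0// prim0 sub0r lee_fin lerNl => H.
  apply: le_trans H _; apply: prim_le => //.
  by rewrite lerNl ltW// truncnS_gt.
- by move=> n; rewrite prim_integral_oc ?oppr_le0// prim0 sub0r lee_fin lerN2 HK// oppr_le0.
Qed.

Variable H : R -> 'M[R]_2.
Hypothesis cH : canonical_system H.

(** The entries of a positive semidefinite matrix of trace [1] lie in [[-1, 1]]; clamping alters
    them only on a null set and secures the everywhere bounds of [coefs]. *)
Definition ca (x : R) := clamp (-1) 1 (H x 0 0).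
Definition cb (x : R) := clamp (-1) 1 (H x 0 1).
Definition cc (x : R) := clamp (-1) 1 (H x 1 1).

Lemma psd_entries (A : 'M[R]_2) : A^T = A -> (forall v : 'cV[R]_2, 0 <= (v^T *m A *m v) 0 0) ->
  \tr A = 1 -> [/\ A 1 0 = A 0 1, 0 <= A 0 0, 0 <= A 1 1, A 0 0 + A 1 1 = 1 & A 0 1 ^+ 2 <= A 0 0 * A 1 1].
Proof.
move=> sA psd trA.
have s01 : A 1 0 = A 0 1 by rewrite -[in LHS]sA mxE.
have Q p q : 0 <= p ^+ 2 * A 0 0 + 2 * p * q * A 0 1 + q ^+ 2 * A 1 1.
  have := psd (col2 p q); rewrite !mul2E !mxE /= s01.
  by congr (_ <= _); ring.
have t1 : A 0 0 + A 1 1 = 1.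
  move: trA; rewrite /mxtrace big_ord_recl big_ord1 => <-; congr (_ + A _ _); exact: val_inj.
have a0 : 0 <= A 0 0 by have := Q 1 0; rewrite expr1n expr0n /=; lra.
have c0 : 0 <= A 1 1 by have := Q 0 1; rewrite expr1n expr0n /=; lra.
split => //.
(* The two values are [det A] times [A 0 0] and times [A 1 1]; their sum is the determinant because
   the trace is [1], and no entry has to be inverted. *)
have q1 := Q (- A 0 1) (A 0 0); have q2 := Q (A 1 1) (- A 0 1).
have : 0 <= (A 0 0 + A 1 1) * (A 0 0 * A 1 1 - A 0 1 ^+ 2).
  by apply: le_trans (addr_ge0 q1 q2) _; rewrite le_eqVlt; apply/orP; left; apply/eqP; ring.
by rewrite t1 mul1r subr_ge0.
Qed.

Lemma entries_ae : {ae mu, forall x, [/\ H x 0 0 = ca x, H x 0 1 = cb x, H x 1 0 = cb x & H x 1 1 = cc x] /\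
  [/\ 0 <= ca x, 0 <= cc x, ca x + cc x = 1 & cb x ^+ 2 <= ca x * cc x]}.
Proof.
apply: (ae_imp _ cH.2) => x [s psd t]; have [e a0 c0 ac bac] := psd_entries s psd t.
have b1 : -1 <= H x 0 1 <= 1.
  rewrite -ler_norml -(ler_pXn2r (n := 2)) ?nnegrE// expr1n real_normK ?num_real//.
  by apply: le_trans bac _; have := sqr_ge0 (H x 0 0 - H x 1 1); rewrite -ac; nra.
rewrite /ca /cb /cc !clamp_id ?e//; lra.
Qed.

Lemma clamp_meas (f : R -> R) : measurable_fun setT f -> measurable_fun setT (fun x : R => clamp (-1) 1 (f x)).
Proof. by move=> mf; apply: measurable_maxr => //; exact: measurable_minr. Qed.

Lemma entries_coefs : coefs ca cb cc.
Proof.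
have m i j : measurable_fun setT (fun x => H x i j) by case: (cH.1 i j).
have cl y : `|clamp (-1) 1 y| <= 1 :> R by rewrite ler_norml clamp_bound// (le_trans lerN10).
split; [by split; apply: clamp_meas| |].
- by move=> x; split; exact: cl.
- by apply: (ae_imp _ entries_ae) => x [].
Qed.

Lemma cs_solP z u : cs_solution H z u <-> sol ca cb cc z (fun t => u t 0 0) (fun t => u t 1 0).
Proof.
split=> [[c d]|[c1 c2 d]].
- split; [exact: c|exact: c|].
  apply: (ae_imp2 _ entries_ae d) => x [[e1 e2 e3 e4] _] [v [dv /matrixP E]].
  have := E 0 0; have := E 1 0; rewrite !scalemx_entry !mul2E !mxE /= e1 e2 e3 e4 => E1 E2.
  split.
  + have := dv 0; congr has_cderiv; move: E1; rewrite subr0 subrr !mul1r mul0r addr0 => ->; ring.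
  + have := dv 1; congr has_cderiv; apply: oppr_inj.
    by move: E2; rewrite subrr sub0r mul0r add0r mulN1r => ->; ring.
- split; first by apply: ord2P; [exact: c1|exact: c2].
  apply: (ae_imp2 _ entries_ae d) => x [[e1 e2 e3 e4] _] [d1 d2].
  exists (col2 (- z * ((cb x)%:C * u x 0 0 + (cc x)%:C * u x 1 0))
    (z * ((ca x)%:C * u x 0 0 + (cb x)%:C * u x 1 0))); split.
    by apply: ord2P; rewrite mxE.
  by apply: col2P; rewrite !scalemx_entry !mul2E !mxE /= ?e1 ?e2 ?e3 ?e4; ring.
Qed.
End entries.

(** * The Cayley transform on the sphere *)

Section cayley.
Variable R : realType.
Implicit Types (s u v : R[i]).

Definition icayley s : sphere R := sdiv (w1 s) (w2 s).

Lemma sdiv_eq u1 u2 v1 v2 : (u1, u2) != 0 :> R[i] * R[i] -> (v1, v2) != 0 :> R[i] * R[i] ->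
  u1 * v2 = u2 * v1 -> sdiv u1 u2 = sdiv v1 v2.
Proof.
rewrite !xpair_eqE /sdiv => u0 v0 E; case: ifPn => u20; case: ifPn => v20 //.
- move: E u0; rewrite (eqP u20) mul0r eqxx andbT => /eqP; rewrite mulf_eq0 (negPf v20) orbF.
  by move=> ->.
- move: E v0; rewrite (eqP v20) mulr0 eqxx andbT => /esym/eqP; rewrite mulf_eq0 (negPf u20)/=.
  by move=> ->.
- congr Some; apply: (@mulIf _ (u2 * v2)); first by rewrite mulf_neq0.
  by rewrite mulrA divfK// (mulrC u2) mulrA divfK// E mulrC.
Qed.

Lemma two_neq0 : (2 : R[i]) != 0. Proof. by rewrite pnatr_eq0. Qed.

Lemma w_neq0 s : (w1 s, w2 s) != 0 :> R[i] * R[i].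
Proof.
rewrite xpair_eqE /w1 /w2; apply/negP => /andP[h1]; rewrite subr_eq0 => /eqP h2.
by move: h1; rewrite -h2 -cabs0_eq0 cabsM cabs_i mul1r cabs0_eq0 -mulr2n pnatr_eq0.
Qed.

Lemma sopp_sdiv u v : sopp (sdiv u v) = sdiv u (- v).
Proof. by rewrite /sdiv oppr_eq0; case: ifP => //= _; rewrite invrN mulrN. Qed.

Lemma conj_eq0 v : (conjc v == 0) = (v == 0).
Proof. by rewrite -(cabs0_eq0 (conjc v)) cabs_conj cabs0_eq0. Qed.

Lemma sconj_sdiv u v : sconj (sdiv u v) = sdiv (conjc u) (conjc v).
Proof.
rewrite /sdiv conj_eq0; case: ifP => //= _.
by rewrite (rmorphM (@conjc R)) (fmorphV (@conjc R)).
Qed.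

(** In the Schur coordinate the reflection [- conj m] is complex conjugation, so being
    reflectionless becomes equality of the two boundary values of [szero]. *)
Lemma icayley_reflect s : sopp (sconj (icayley s)) = icayley (conjc s).
Proof.
rewrite sconj_sdiv sopp_sdiv; apply: sdiv_eq; [|exact: w_neq0|].
- have := w_neq0 s; rewrite !xpair_eqE oppr_eq0.
  by rewrite !conj_eq0.
- by apply: complex_eq; rewrite /w1 /w2 !cplxE /=; ring.
Qed.
End cayley.

(** * The m functions in terms of the Schur functions *)

Section m_functions.
Variable R : realType.
Local Notation mu := (@lebesgue_measure R).
Variable H : R -> 'M[R]_2.
Hypothesis cH : canonical_system H.
Local Notation a := (ca H).
Local Notation b := (cb H).
Local Notation c := (cc H).
Local Notation abc := (entries_coefs cH).

Let ent_meas i j : measurable_fun setT (fun x => H x i j).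
Proof. by case: (cH.1 i j). Qed.

Lemma lac_meas (f : R -> R) : loc_abs_cont f -> measurable_fun setT f.
Proof. by move=> /lac_cts cf; exact: continuous_measurable_fun. Qed.

Lemma energyE (u : R -> 'cV[R[i]]_2) x : energy H u x =
  H x 0 0 * Re (u x 0 0 * conjc (u x 0 0)) + (H x 0 1 + H x 1 0) * Re (u x 0 0 * conjc (u x 1 0)) +
  H x 1 1 * Re (u x 1 0 * conjc (u x 1 0)) .
Proof.
rewrite /energy !mul2E !mxE; set p := u x 0 0; set q := u x 1 0; clearbody p q.
by rewrite !cplxE /=; ring.
Qed.

Lemma energy_meas (u : R -> 'cV[R[i]]_2) : cac (fun x => u x 0 0) -> cac (fun x => u x 1 0) ->
  measurable_fun setT (energy H u).
Proof.
move=> c0 c1; rewrite (_ : energy H u = (fun x : R =>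
  H x 0 0 * Re (u x 0 0 * conjc (u x 0 0)) + (H x 0 1 + H x 1 0) * Re (u x 0 0 * conjc (u x 1 0)) +
  H x 1 1 * Re (u x 1 0 * conjc (u x 1 0)))); last by apply/funext => x; exact: energyE.
have m (f g : R -> R[i]) : cac f -> cac g -> measurable_fun setT (fun x => Re (f x * conjc (g x))).
  by move=> cf cg; have [h _] := cacM cf (cac_conj cg); exact: lac_meas.
apply: measurable_funD; first apply: measurable_funD.
- by apply: measurable_funM; [exact: ent_meas|exact: m].
- by apply: measurable_funM; [apply: measurable_funD; exact: ent_meas|exact: m].
- by apply: measurable_funM; [exact: ent_meas|exact: m].
Qed.

(** The absolute value makes the integrand nonnegative everywhere instead of almost everywhere, the
    form [integral_plus_lty] asks for. *)
Lemma energy_ae (u : R -> 'cV[R[i]]_2) :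
  {ae mu, forall x, energy H u x = `|qf a b c (fun x => u x 0 0) (fun x => u x 1 0) x|}.
Proof.
apply: (ae_imp2 _ (entries_ae cH) (qf_ge0 abc (fun x => u x 0 0) (fun x => u x 1 0))).
move=> x [[e1 e2 e3 e4] _] q0; rewrite ger0_norm// energyE e1 e2 e3 e4 /qf /qform.
by rewrite !conj_mul /=; ring.
Qed.

Lemma qf_loc (u1 u2 : R -> R[i]) : cac u1 -> cac u2 -> loc_bounded_meas (fun x => `|qf a b c u1 u2 x|).
Proof.
move=> c1 c2; suff [m B] : loc_bounded_meas (qf a b c u1 u2).
  split; first by apply: measurableT_comp.
  by move=> r; have [B' HB] := B r; exists B' => x xr; rewrite normr_id HB.
have m (f g : R -> R[i]) : cac f -> cac g -> loc_bounded_meas (fun x => Re (f x * conjc (g x))).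
  by move=> cf cg; have [h _] := cacM cf (cac_conj cg); exact: loc_bounded_lac.
have [ma mb mc] := coefs_meas abc.
have la : loc_bounded_meas a by split => // r; exists 1 => x _; case: (coefs_le1 abc x).
have lb : loc_bounded_meas b by split => // r; exists 1 => x _; case: (coefs_le1 abc x).
have lc : loc_bounded_meas c by split => // r; exists 1 => x _; case: (coefs_le1 abc x).
rewrite (_ : qf a b c u1 u2 = fun x => a x * Re (u1 x * conjc (u1 x)) +
   2 * (b x * Re (u1 x * conjc (u2 x))) + c x * Re (u2 x * conjc (u2 x))).
  apply: loc_bounded_measD; first apply: loc_bounded_measD.
  - by apply: loc_bounded_measM => //; exact: m.
  - by apply: loc_bounded_measZ; apply: loc_bounded_measM => //; exact: m.
  - by apply: loc_bounded_measM => //; exact: m.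
by apply/funext => x; rewrite /qf /qform !conj_mul /= mulrA.
Qed.

Lemma energy_integral (I : set R) (u : R -> 'cV[R[i]]_2) : measurable I ->
  cac (fun x => u x 0 0) -> cac (fun x => u x 1 0) ->
  (\int[mu]_(x in I) (energy H u x)%:E =
   \int[mu]_(x in I) (`|qf a b c (fun x => u x 0 0) (fun x => u x 1 0) x|)%:E)%E.
Proof.
move=> mI c0 c1; apply: ae_eq_integral => //.
- by apply/measurable_EFinP/measurable_funTS; exact: energy_meas.
- by apply/measurable_EFinP/measurable_funTS; case: (qf_loc c0 c1).
- by apply: (ae_imp _ (energy_ae u)) => x e _; congr EFin.
Qed.

Lemma nf_prim z u1 u2 x : sol a b c z u1 u2 ->
  nf u1 u2 x = nf u1 u2 0 - Im z * prim (fun x => `|qf a b c u1 u2 x|) x.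
Proof.
move=> us; have [c1 c2 _] := us; have ql := qf_loc c1 c2.
have := @prim_unique R (fun x => - Im z * `|qf a b c u1 u2 x|) (nf u1 u2) x.
move=> ->; last 3 first.
- exact: loc_bounded_measZ.
- exact: nf_lac.
- apply: (ae_imp2 _ (nf_derive us) (qf_ge0 abc u1 u2)) => t d q0.
  by rewrite ger0_norm.
congr (_ + _); rewrite -mulNr.
have := @prim_unique R (fun x => - Im z * `|qf a b c u1 u2 x|)
   (fun x => - Im z * prim (fun x => `|qf a b c u1 u2 x|) x) x.
rewrite prim0 mulr0 add0r => -> //; first exact: loc_bounded_measZ.
- by apply: lacM (lac_cst _) _; exact: prim_lac.
- by apply: (ae_imp _ (prim_derive ql)) => t d; exact: is_deriveZ.
Qed.

(** The energy over [[0, x]] is [(nf 0 - nf x) / Im z]. *)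
Lemma weyl_plusP z (u : R -> 'cV[R[i]]_2) : 0 < Im z -> sol a b c z (fun x => u x 0 0) (fun x => u x 1 0) ->
  (\int[mu]_(x in `[0%R, +oo[) (energy H u x)%:E < +oo)%E <->
  exists C, forall x, 0 <= x -> C <= nf (fun x => u x 0 0) (fun x => u x 1 0) x.
Proof.
move=> z0 us; have [c0 c1 _] := us; rewrite energy_integral//.
rewrite integral_plus_lty//; last exact: qf_loc.
split=> -[K HK].
- exists (nf (fun x => u x 0 0) (fun x => u x 1 0) 0 - Im z * K) => x x0.
  by rewrite (nf_prim x us) lerD2l lerN2 ler_wpM2l ?(ltW z0)// HK.
- exists ((nf (fun x => u x 0 0) (fun x => u x 1 0) 0 - K) / Im z) => x x0.
  have := HK x x0; rewrite (nf_prim x us) ler_pdivlMr// (mulrC _ (Im z)); lra.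
Qed.

Lemma weyl_minusP z (u : R -> 'cV[R[i]]_2) : 0 < Im z -> sol a b c z (fun x => u x 0 0) (fun x => u x 1 0) ->
  (\int[mu]_(x in `]-oo, 0%R]) (energy H u x)%:E < +oo)%E <->
  exists C, forall x, x <= 0 -> nf (fun x => u x 0 0) (fun x => u x 1 0) x <= C.
Proof.
move=> z0 us; have [c0 c1 _] := us; rewrite energy_integral//.
rewrite integral_minus_lty//; last exact: qf_loc.
split=> -[K HK].
- exists (nf (fun x => u x 0 0) (fun x => u x 1 0) 0 - Im z * K) => x x0.
  by rewrite (nf_prim x us) lerD2l lerN2 ler_wpM2l ?(ltW z0)// HK.
- exists ((nf (fun x => u x 0 0) (fun x => u x 1 0) 0 - K) / Im z) => x x0.
  have := HK x x0; rewrite (nf_prim x us) ler_pdivrMr// (mulrC _ (Im z)); lra.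
Qed.

Lemma sol_neq0 z u1 u2 x : sol a b c z u1 u2 -> (u1 x, u2 x) != 0 :> R[i] * R[i] ->
  (u1 0, u2 0) != 0 :> R[i] * R[i].
Proof.
move=> us; apply: contraNneq => -[e1 e2]; have [] := sol_uniq abc x us.
by rewrite e1 e2 /tsol !mul0r addr0 => -> ->.
Qed.

Lemma col_neq0 (v : 'cV[R[i]]_2) : (v != 0) = ((v 0 0, v 1 0) != 0 :> R[i] * R[i]).
Proof.
congr negb; apply/eqP/eqP => [->|[e1 e2]]; first by rewrite !mxE.
by apply: col2P; rewrite mxE.
Qed.

Lemma ratioE (v : 'cV[R[i]]_2) : Defs.ratio v = sdiv (v 0 0) (v 1 0). Proof. by []. Qed.

(** The [xget] is resolved by the solution with initial value [(w1 s, w2 s)], and by [splus_unique]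
    for any other Weyl solution. *)
Lemma m_plusE z : 0 < Im z -> m_plus H z = icayley (splus a b c z).
Proof.
move=> z0; set s := splus a b c z.
apply: xget_unique.
  have us := tsol_sol abc (w1 s) (w2 s) z.
  pose u x := col2 (tsol a b c true (w1 s) (w2 s) z x) (tsol a b c false (w1 s) (w2 s) z x).
  have e1 : (fun x => u x 0 0) = tsol a b c true (w1 s) (w2 s) z by apply/funext => x; rewrite mxE.
  have e2 : (fun x => u x 1 0) = tsol a b c false (w1 s) (w2 s) z by apply/funext => x; rewrite mxE.
  have us' : sol a b c z (fun x => u x 0 0) (fun x => u x 1 0) by rewrite e1 e2.
  exists u; last by rewrite ratioE /u col2_0 col2_1 !tsol0 //; exact: abc.
  split; first exact/(cs_solP cH).
  - exists 0; rewrite col_neq0 /u col2_0 col2_1 !tsol0; [exact: w_neq0|exact: abc..].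
  - apply/(weyl_plusP z0 us'); exists 0 => x _; rewrite e1 e2.
    by apply: (splus_nf abc); exact: ltW.
move=> w [f [fs [x fx] fi] ->].
have us := (cs_solP cH z f).1 fs.
have [C HC] := (weyl_plusP z0 us).1 fi.
apply: sdiv_eq; last exact: (splus_unique abc z0 us HC).
- by apply: (sol_neq0 us (x := x)); rewrite -col_neq0.
- exact: w_neq0.
Qed.

Lemma m_minusE z : 0 < Im z -> m_minus H z = icayley (sminus a b c z).
Proof.
move=> z0; set s := sminus a b c z.
have abc' := coefs_reflect abc.
have nfo (u1 u2 : R -> R[i]) x : nf (fun x => u1 (- x)) (fun x => - u2 (- x)) x = - nf u1 u2 (- x).
  by rewrite /nf !cplxE; ring.
apply: xget_unique.
  have us := sol_unreflect (tsol_sol abc' (w1 s) (w2 s) z).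
  set A := tsol _ _ _ true _ _ _ in us; set B := tsol _ _ _ false _ _ _ in us.
  pose u x := col2 (A (- x)) (- B (- x)).
  have e1 : (fun x => u x 0 0) = (fun x => A (- x)) by apply/funext => x; rewrite mxE.
  have e2 : (fun x => u x 1 0) = (fun x => - B (- x)) by apply/funext => x; rewrite mxE.
  have us' : sol a b c z (fun x => u x 0 0) (fun x => u x 1 0) by rewrite e1 e2.
  have A0 : A 0 = w1 s by rewrite /A tsol0//; exact: abc'.
  have B0 : B 0 = w2 s by rewrite /B tsol0//; exact: abc'.
  exists u; last by rewrite ratioE /u col2_0 col2_1 oppr0 A0 B0 sopp_sdiv opprK.
  split; first exact/(cs_solP cH).
  - exists 0; rewrite col_neq0 /u col2_0 col2_1 oppr0 A0 B0.
    by have := w_neq0 s; rewrite !xpair_eqE oppr_eq0.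
  - apply/(weyl_minusP z0 us'); exists 0 => x _; rewrite e1 e2 nfo oppr_le0.
    by apply: (splus_nf abc'); exact: ltW.
move=> w [f [fs [x fx] fi] ->].
have us := (cs_solP cH z f).1 fs.
have [C HC] := (weyl_minusP z0 us).1 fi.
have us' := sol_reflect us.
have HC' x' : 0 <= x' -> - C <= nf (fun x => f (- x) 0 0) (fun x => - f (- x) 1 0) x'.
  by move=> x0; rewrite (nfo (fun x => f x 0 0) (fun x => f x 1 0)) lerN2 HC// oppr_le0.
have := splus_unique abc' z0 us' HC'; rewrite oppr0 -/(sminus a b c z) -/s => E.
have n0 : (f 0 0 0, f 0 1 0) != 0 :> R[i] * R[i] by apply: (sol_neq0 us (x := x)); rewrite -col_neq0.
rewrite ratioE sopp_sdiv; apply: sdiv_eq => //; last exact: w_neq0.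
by move: n0; rewrite !xpair_eqE oppr_eq0.
Qed.

Definition schur0 := szero a b c.

Lemma m_szero_plus z : 0 < Im z -> m_plus H z = icayley (schur0 z).
Proof. by move=> z0; rewrite m_plusE// /schur0 /szero z0. Qed.

Lemma m_szero_minus z : Im z < 0 -> sopp (sconj (m_minus H (conjc z))) = icayley (schur0 z).
Proof.
move=> z0; rewrite m_minusE; last by rewrite Im_conj oppr_gt0.
by rewrite icayley_reflect /schur0 /szero ltNge ltW.
Qed.
End m_functions.

(** * Analytic continuation of the m functions *)

Section sphere_topology.
Variable R : realType.
Implicit Types (z w s : R[i]).

Lemma gt0_real (e : R[i]) : 0 < e -> e = (Re e)%:C /\ 0 < Re e.
Proof. by case: e => x y; rewrite ltcE /= => /andP[/eqP -> ]. Qed.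

Lemma nbhs_discP (z : R[i]^o) (P : set (R[i]^o)) :
  nbhs z P <-> exists2 d : R, 0 < d & forall w, cabs (w - z) < d -> P w.
Proof.
split=> [/nbhs_ballP[e /= /gt0_real[eE e0] H]|[d d0 H]].
- exists (Re e) => // w wz; apply: H; rewrite -ball_normE /= eE.
  by rewrite cabsE ltcR cabs_distC.
- apply/nbhs_ballP; exists d%:C; first by rewrite /= ltcR.
  by move=> w; rewrite -ball_normE /= cabsE ltcR cabs_distC; exact: H.
Qed.

Lemma at_rightP (P : set R) : nbhs (0 : R)^'+ P -> exists2 d : R, 0 < d & forall y, 0 < y < d -> P y.
Proof.
rewrite /at_right /within /= => /nbhs_ballP[d /= d0 H]; exists d => // y /andP[y0 yd].
by apply: H => //=; rewrite /ball /= sub0r normrN gtr0_norm.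
Qed.

Lemma sphere_cvg_some (G : R -> sphere R) (v : R[i]) : G y @[y --> (0 : R)^'+] --> (Some v : sphere R) ->
  forall e, 0 < e -> exists2 d : R, 0 < d & forall y, 0 < y < d -> exists2 g, G y = Some g & cabs (g - v) < e.
Proof.
move=> Gv e e0.
have nv : nbhs (v : R[i]^o) [set w | cabs (w - v) < e] by apply/nbhs_discP; exists e.
have := Gv _ (one_point_compactification_some_nbhs _ _ nv).
by move=> /at_rightP[d d0 H]; exists d => // y /H[g gv <-]; exists g.
Qed.

(** Neighbourhoods of infinity in the one-point compactification are complements of closed compact
    sets; a square is the image of a product of segments. *)
Lemma square_compact (K : R) : exists2 C : set (R[i]^o), (compact `&` closed) C & forall z, cabs z <= K -> C z.
Proof.
pose f (p : R * R) : R[i]^o := p.1 +i* p.2.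
have cf : continuous f.
  move=> p; apply/cvgrPdist_lt => e /gt0_real[eE e0].
  apply/(@nbhs_ballP R (R * R)%type); exists (Re e / 2); first by rewrite /= divr_gt0.
  move=> q [h1 h2]; have {}h1 : `|p.1 - q.1| < Re e / 2 by exact: h1.
  have {}h2 : `|p.2 - q.2| < Re e / 2 by exact: h2.
  rewrite eE cabsE ltcR.
  have -> : f p - f q = (p.1 - q.1)%:C + 'i%C * (p.2 - q.2)%:C.
    by apply: complex_eq; rewrite /f !cplxE /=; ring.
  apply: (le_lt_trans (cabsD _ _)); rewrite cabsM cabs_i !cabs_real mul1r; lra.
have cK : compact (f @` (`[- K, K] `*` `[- K, K])).
  apply: continuous_compact; first exact: continuous_subspaceT.
  by apply: compact_setX; exact: segment_compact.
exists (f @` (`[- K, K] `*` `[- K, K])).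
  split => //; apply: compact_closed => //; exact: norm_hausdorff.
move=> z zK; exists (Re z, Im z); last by case: z {zK}.
have := cabs_Re z; have := cabs_Im z; rewrite !ler_norml => h1 h2.
by split => /=; rewrite in_itv/=; lra.
Qed.

Lemma sphere_cvg_infty (G : R -> sphere R) : G y @[y --> (0 : R)^'+] --> (infty : sphere R) ->
  forall K, exists2 d : R, 0 < d & forall y, 0 < y < d -> forall g, G y = Some g -> K < cabs g.
Proof.
move=> Gv K; have [C CC CK] := square_compact K.
have nC : nbhs (infty : sphere R) (Some @` (~` C) `|` [set None]) by exists C.
have := Gv _ nC => /at_rightP[d d0 H]; exists d => // y /H + g Gg.
rewrite /= Gg => -[[g' nCg [<-]]|//]; rewrite ltNge; apply/negP => /CK; exact: nCg.
Qed.

Lemma icayley_some s (g : R[i]) : icayley s = Some g -> w2 s != 0 /\ w1 s = g * w2 s.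
Proof.
rewrite /icayley /sdiv; case: ifPn => // s0 [<-]; split => //.
by rewrite divfK.
Qed.

Lemma icayley_infty s : icayley s = infty -> s = 1.
Proof. by rewrite /icayley /sdiv; case: ifPn => //; rewrite /w2 subr_eq0 => /eqP <-. Qed.

Lemma cabs_nat n : cabs (n%:R : R[i]) = n%:R.
Proof. by rewrite -(rmorph_nat (real_complex R)) cabs_real normr_nat. Qed.

Lemma i_neq0 : ('i%C : R[i]) != 0. Proof. by rewrite -cabs_gt0 cabs_i. Qed.

Lemma icayley_inv s g : w1 s = g * w2 s -> s * (g + 'i%C) = g - 'i%C.
Proof.
rewrite /w1 /w2 => E; apply: subr0_eq.
have -> : s * (g + 'i%C) - (g - 'i%C) = 'i%C * (1 + s) - g * (1 - s) by ring.
by rewrite E subrr.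
Qed.

Lemma icayley_Im s g : cabs s <= 1 -> icayley s = Some g -> 0 <= Im g.
Proof.
move=> s1 /icayley_some[w0 E].
have : Im (w1 s * conjc (w2 s)) = Im g * cabs (w2 s) ^+ 2.
  by rewrite E -mulrA conj_mul !cplxE /=; ring.
have -> : Im (w1 s * conjc (w2 s)) = 1 - cabs s ^+ 2.
  by rewrite cabs_sqr /w1 /w2 !cplxE /=; ring.
move=> F; have p : 0 < cabs (w2 s) ^+ 2 by rewrite exprn_gt0// cabs_gt0.
rewrite -(pmulr_lge0 _ p) -F subr_ge0 expr_le1//; exact: cabs_ge0.
Qed.

Lemma icayley_inj s s' : icayley s = icayley s' -> s = s'.
Proof.
case E : (icayley s) => [g|] => /esym E'; last by rewrite (icayley_infty E) (icayley_infty E').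
have [w0 h] := icayley_some E; have [w0' h'] := icayley_some E'.
have : 2 * 'i%C * (s - s') = w1 s * w2 s' - w2 s * w1 s' by rewrite /w1 /w2; ring.
have -> : w1 s * w2 s' - w2 s * w1 s' = 0 by rewrite h h'; ring.
move/eqP; rewrite !mulf_eq0 (negPf i_neq0) (negPf (two_neq0 R)) subr_eq0 => /eqP //.
Qed.

(** Convergence on the sphere, also to infinity, becomes convergence of bounded complex numbers. *)
Lemma icayley_lim (s : R -> R[i]) (w : sphere R) : (forall y, 0 < y -> cabs (s y) <= 1) ->
  icayley (s y) @[y --> (0 : R)^'+] --> w ->
  exists2 t, w = icayley t &
    forall e, 0 < e -> exists2 d : R, 0 < d & forall y, 0 < y < d -> cabs (s y - t) <= e.
Proof.
(* The pole [- 'i] of the map from [m] to [s] has distance at least [1] from the closed upper half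
   plane, so this map is Lipschitz there. *)
move=> s1; have den (g : R[i]) : 0 <= Im g -> 1 <= cabs (g + 'i%C).
  move=> g0; apply: le_trans (cabs_Im _); rewrite !cplxE /= ger0_norm; lra.
case: w => [v|] sw.
- have Hs := sphere_cvg_some sw.
  have v0 : 0 <= Im v.
    rewrite leNgt; apply/negP => v0; have [|d d0 H] := Hs (- Im v); first by rewrite oppr_gt0.
    have [|g sg gv] := H (d / 2); first lra.
    have d20 : 0 < d / 2 by lra.
    have := icayley_Im (s1 _ d20) sg.
    have := cabs_Im (g - v); rewrite ImB ler_norml; lra.
  have vi : v + 'i%C != 0 by rewrite -cabs_gt0; apply: lt_le_trans (den _ v0).
  have e1 : w1 ((v - 'i%C) / (v + 'i%C)) = 2 * 'i%C / (v + 'i%C) * v by rewrite /w1; field.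
  have e2 : w2 ((v - 'i%C) / (v + 'i%C)) = 2 * 'i%C / (v + 'i%C) by rewrite /w2; field.
  have k0 : 2 * 'i%C / (v + 'i%C) != 0 by rewrite !mulf_neq0 ?invr_neq0 ?i_neq0 ?two_neq0.
  exists ((v - 'i%C) / (v + 'i%C)).
    by rewrite /icayley e1 e2 /sdiv (negPf k0) mulrAC divff// mul1r.
  move=> e e0; have [|d d0 H] := Hs (e / 2); first lra.
  exists d => // y yd; have [g sg gv] := H y yd.
  have y0 : 0 < y by case/andP: yd.
  have g1 := den _ (icayley_Im (s1 y y0) sg).
  have [_ E] := icayley_some sg.
  have gi : g + 'i%C != 0 by rewrite -cabs_gt0; apply: lt_le_trans g1.
  have -> : s y = (g - 'i%C) / (g + 'i%C) by rewrite -(icayley_inv E) mulfK.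
  have -> : (g - 'i%C) / (g + 'i%C) - (v - 'i%C) / (v + 'i%C) = 2 * 'i%C * (g - v) / ((g + 'i%C) * (v + 'i%C)).
    by field; rewrite vi gi.
  have v1 := den _ v0.
  rewrite cabsM cabsV !cabsM cabs_i cabs_nat mulr1 ler_pdivrMr; last first.
    by rewrite mulr_gt0//; [apply: lt_le_trans g1|apply: lt_le_trans v1].
  have : e * 1 <= e * (cabs (g + 'i%C) * cabs (v + 'i%C)).
    rewrite ler_wpM2l ?(ltW e0)//; apply: le_trans (ler_wpM2r (cabs_ge0 _) g1).
    by rewrite mul1r.
  by move: gv; lra.
- have Hs := sphere_cvg_infty sw.
  exists 1; first by rewrite /icayley /sdiv /w2 subrr eqxx.
  (* [cabs (s - 1)] equals [2 / cabs (g + 'i)], and [cabs (g + 'i) >= cabs g - 1 > 2 / e]. *)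
  move=> e e0; have [d d0 H] := Hs (2 / e + 1).
  exists d => // y yd; have y0 : 0 < y by case/andP: yd.
  case sg : (icayley (s y)) => [g|]; last by rewrite (icayley_infty sg) subrr cabs0 ltW.
  have gK := H y yd g sg.
  have [_ E] := icayley_some sg.
  have gi0 := den _ (icayley_Im (s1 y y0) sg).
  have gi : g + 'i%C != 0 by rewrite -cabs_gt0; apply: lt_le_trans gi0.
  have -> : s y - 1 = - (2 * 'i%C) / (g + 'i%C).
    rewrite -[s y](mulfK gi) (icayley_inv E); field.
    exact: gi.
  rewrite cabsM cabsV cabsN cabsM cabs_i cabs_nat mulr1 ler_pdivrMr; last exact: lt_le_trans gi0.
  have h : cabs g <= cabs (g + 'i%C) + 1.
    have := cabsB (g + 'i%C) 'i%C; by rewrite addrK cabs_i.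
  have : 2 / e < cabs (g + 'i%C) by lra.
  by rewrite ltr_pdivrMr// => /ltW; rewrite mulrC.
Qed.
End sphere_topology.

(** * Continuation of bounded functions across [U] and through infinity *)

Section continuation.
Variable R : realType.
Local Notation mu := (@lebesgue_measure R).
Implicit Types (z w : R[i]).

Lemma UsetP (t : R) : Uset t <-> 1 < `|t|.
Proof.
rewrite /Uset /= !in_itv/= andbT ltr_normr; split => [[h|h]|/orP[h|h]].
- by apply/orP; right; lra.
- by apply/orP; left.
- by right.
- by left; lra.
Qed.

Lemma Im_inv z : Im z^-1 = - Im z / cabs z ^+ 2.
Proof.
have [->|z0] := eqVneq z 0; first by rewrite invr0 /= oppr0 mul0r.
have c0 : cabs z ^+ 2 != 0 by rewrite expf_neq0// cabs0_eq0.
apply: (@mulIf _ (cabs z ^+ 2)) => //; rewrite divfK// -Im_conj.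
have -> : conjc z = z^-1 * (cabs z ^+ 2)%:C by rewrite -conj_mul mulrA mulVf// mul1r.
by rewrite !cplxE /= mulr0 add0r.
Qed.

Lemma half_plane_open (s : bool) (delta : R) z : delta < sg R s * Im z ->
  exists2 r, 0 < r & forall w, disc z r w -> delta < sg R s * Im w.
Proof.
move=> zd; exists (sg R s * Im z - delta); first by rewrite subr_gt0.
move=> w; rewrite /disc => wz; have : `|sg R s * Im (w - z)| < sg R s * Im z - delta.
  by rewrite normrM abs_sg mul1r (le_lt_trans _ wz)// cabs_Im.
by rewrite ImB ltr_norml mulrBr; lra.
Qed.

Lemma half_open b (t0 r delta : R) z : half b t0 r delta z ->
  exists2 q, 0 < q & forall w, disc z q w -> half b t0 r delta w.
Proof.
move=> [zr zd]; have [q q0 qH] := half_plane_open zd.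
exists (Num.min q (r - cabs (z - t0%:C))); first by rewrite lt_min q0 subr_gt0.
move=> w; rewrite /disc lt_min => /andP[w1 w2]; split; last exact: qH.
by rewrite /disc (le_lt_trans (_ : _ <= cabs (w - z) + cabs (z - t0%:C)))//; [rewrite -[w - _](subrKA z) cabsD|lra].
Qed.

Lemma inv_iinv (t : R) (s : bool) n : t != 0 ->
  cabs ((t%:C + (sg R s)%:C * iinv R n)^-1 - (t^-1)%:C) <= (n.+1%:R)^-1 / t ^+ 2.
Proof.
move=> t0; set h := _ * iinv R n.
have t2 : 0 < t ^+ 2 by rewrite lt_def sqr_ge0 sqrf_eq0 t0.
have tc : t%:C != 0 :> R[i] by rewrite -cabs_gt0 cabs_real normr_gt0.
have hRe : Re h = 0 by rewrite /h !cplxE /=; ring.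
have th : `|t| <= cabs (t%:C + h).
  by have := cabs_Re (t%:C + h); rewrite ReD hRe addr0.
have th0 : t%:C + h != 0 by rewrite -cabs_gt0 (lt_le_trans _ th)// normr_gt0.
rewrite (fmorphV (real_complex R)) /=.
have -> : (t%:C + h)^-1 - (t%:C)^-1 = - h / ((t%:C + h) * t%:C) by field; rewrite th0 tc.
have hE : cabs h = (n.+1%:R)^-1 by rewrite /h cabsM cabs_real abs_sg mul1r cabs_iinv.
have den : t ^+ 2 <= cabs (t%:C + h) * `|t|.
  by rewrite -real_normK ?num_real// expr2 ler_wpM2r.
rewrite cabsM cabsN hE cabsV cabsM cabs_real ler_wpM2l ?invr_ge0//.
by rewrite lef_pV2 ?posrE// (lt_le_trans t2).
Qed.

Lemma ae_neq (x : R) : {ae mu, forall t, t != x}.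
Proof.
exists [set x]; split => //; first exact: lebesgue_measure_set1.
by move=> t /= /negP; rewrite negbK => /eqP.
Qed.

Lemma iinvT (t : R) n : t%:C + iinv R n = t%:C + (sg R true)%:C * iinv R n.
Proof. by rewrite /sg mul1r. Qed.

Lemma iinvF (t : R) n : t%:C - iinv R n = t%:C + (sg R false)%:C * iinv R n.
Proof. by rewrite /sg (rmorphN (real_complex R)) mulN1r. Qed.

Lemma half_inv b (delta : R) z : 0 < delta -> half b 0 1 delta z -> delta < sg R (~~ b) * Im z^-1.
Proof.
move=> d0 [zr zd]; rewrite Im_inv.
have z1 : cabs z < 1 by move: zr; rewrite /disc subr0.
have z0 : 0 < cabs z by rewrite (lt_le_trans _ (cabs_Im z))// normr_gt0; apply: contraTneq zd => ->; rewrite mulr0 -leNgt ltW.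
have -> : sg R (~~ b) * (- Im z / cabs z ^+ 2) = sg R b * Im z / cabs z ^+ 2 by case: b {zd}; rewrite /sg /=; ring.
rewrite ltr_pdivlMr ?exprn_gt0// (le_lt_trans _ zd)// ler_piMr ?(ltW d0)//; apply: exprn_ile1; exact: ltW.
Qed.

Lemma half_le_cabs b (t0 r delta : R) z : half b t0 r delta z -> delta <= cabs z.
Proof. by move=> [_ zd]; rewrite ltW// (lt_le_trans zd)// (le_trans (ler_norm _))// normrM abs_sg mul1r cabs_Im. Qed.

Lemma half_inv_holo b (delta : R) : 0 < delta -> holo (half b 0 1 delta) (fun z : R[i] => z^-1).
Proof.
move=> d0; apply: (@holo_ext R _ (fun z => 1 / z)); first by move=> z _; rewrite div1r.
apply: (@holo_div _ _ _ _ delta) => //; [by move=> z /half_le_cabs|exact: holo_cst|].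
by apply: (@holo_id _ _ 1) => z [+ _]; rewrite /disc subr0 => /ltW.
Qed.

(** The class is stable under transport along the line. The disc in the second clause is there
    because [hol] asks for uniform bounds, and those on the transfer matrix hold on bounded sets of
    [z]. *)
Definition regular (F : R[i] -> R[i]) := [/\ forall z, cabs (F z) <= 1,
  forall b delta r, 0 < delta -> 0 < r -> holo (fun z => delta < sg R b * Im z /\ disc 0 r z) F &
  forall t : R, 1 < `|t| -> exists2 r, 0 < r & holo (disc t%:C r) F].

(** The limit along [(iinv n)^-1 = - (n + 1) * 'i], thus along the negative imaginary axis. *)
Definition at_inf (F : R[i] -> R[i]) : R[i] := ext (fun z => F z^-1) 0.

Lemma inv_lim (F : R[i] -> R[i]) (t r : R) (s : bool) : t != 0 -> 0 < r -> holo (disc (t^-1)%:C r) F ->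
  forall e, 0 < e -> exists n0, forall n, (n0 <= n)%N ->
    cabs (F (t%:C + (sg R s)%:C * iinv R n)^-1 - F (t^-1)%:C) <= e.
Proof.
move=> t0 r0 [F' [B FB]] e e0.
have t2 : 0 < t ^+ 2 by rewrite lt_def sqr_ge0 sqrf_eq0 t0.
have c0 : disc (t^-1)%:C r (t^-1)%:C by rewrite /disc subrr cabs0.
have B0 := C11_ge0 FB c0.
have b1 : 0 < 2 * B + 1 by move: B0; lra.
have [|n0 n0P] := @invn_small R (Num.min (r * t ^+ 2) (e / (2 * B + 1) * t ^+ 2)).
  by rewrite lt_min; apply/andP; split; apply: mulr_gt0 => //; apply: divr_gt0.
exists n0 => n /n0P; rewrite lt_min -(ltr_pdivrMr _ _ t2) -(ltr_pdivrMr _ _ t2) => /andP[n1 n2].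
have hh := @inv_iinv t s n t0.
apply: (le_trans (C11_lip FB c0 _)); first by rewrite /disc (le_lt_trans hh).
have : cabs ((t%:C + (sg R s)%:C * iinv R n)^-1 - (t^-1)%:C) <= e / (2 * B + 1) by rewrite (le_trans hh)// ltW.
rewrite ler_pdivlMr//; have := cabs_ge0 ((t%:C + (sg R s)%:C * iinv R n)^-1 - (t^-1)%:C); lra.
Qed.

Lemma inv_norm_gt1 (t : R) : t != 0 -> `|t| < 1 -> 1 < `|t^-1|.
Proof. by move=> t0 t1; rewrite normfV invf_gt1 ?normr_gt0. Qed.

(** What [glue] yields for the bound [1] and the radius [1]. No function enters, so it is the same
    for all points of the line. *)
Definition glue_cst : R := 4 * 1 * cauchy_cst (1 / 2).

(** Near [0] the jumps of [F z^-1] vanish at every real point except [0] itself, which stands for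
    infinity. A single point is a null set, so [glue] also removes this singularity. *)
Lemma regular_glue F : regular F -> exists F', C11 (disc 0 (1 / 8)) glue_cst (ext (fun z => F z^-1)) F'.
Proof.
move=> [F1 Fh Fr]; apply: (@glue R 0 1 1 (fun z => F z^-1) (dc (fun z => F z^-1))) => //.
- move=> b delta d0; apply: hol_dc; first by move=> z; exact: half_open.
  apply: (@holo_comp _ _ (fun z => delta < sg R (~~ b) * Im z /\ disc 0 (delta^-1 + 1) z)).
  + move=> z hz; split; first exact: half_inv.
    rewrite /disc subr0 cabsV; have h := half_le_cabs hz.
    rewrite (le_lt_trans (_ : _ <= delta^-1)) ?ltrDl// lef_pV2// posrE//; exact: lt_le_trans h.
  + by apply: Fh => //; rewrite ltr_wpDl// invr_ge0 ltW.
  + exact: half_inv_holo.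
- apply: (ae_imp _ (ae_neq 0)) => t t0; rewrite subr0 => t1 e e0.
  have e20 : 0 < e / 2 by lra.
  have [r r0 hF] := Fr _ (inv_norm_gt1 t0 t1).
  have [n1 h1] := inv_lim true t0 r0 hF e20; have [n2 h2] := inv_lim false t0 r0 hF e20.
  exists (maxn n1 n2) => n; rewrite geq_max => /andP[/h1 k1 /h2 k2].
  rewrite iinvT iinvF; set p := F _ in k1 *; set q := F _ in k2 *; set v := F _ in k1 k2.
  clearbody p q v; have -> : p - q = (p - v) - (q - v) by ring.
  by apply: (le_trans (cabsB _ _)); lra.
Qed.

Lemma regular_ext F z : regular F -> z != 0 -> cabs z < 1 -> ext (fun z => F z^-1) z = F z^-1.
Proof.
move=> [_ _ Fr] z0 z1; have [zi|zi] := eqVneq (Im z) 0; last exact: (ext_off (fun z => F z^-1) zi).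
have zE : z = (Re z)%:C by apply: complex_eq.
have t0 : Re z != 0 by apply: contraNneq z0 => e; rewrite zE e.
have t1 : `|Re z| < 1 by rewrite (le_lt_trans (cabs_Re z)).
rewrite /ext zi eqxx; apply: culim_eq => e e0.
have [r r0 hF] := Fr _ (inv_norm_gt1 t0 t1).
have [n0 h] := inv_lim true t0 r0 hF e0; exists n0 => n /h.
by rewrite [in X in _ -> X]zE iinvT (fmorphV (real_complex R)).
Qed.

Lemma at_infE (F : R[i] -> R[i]) : at_inf F = culim (fun n => F (iinv R n)^-1).
Proof. by rewrite /at_inf /ext eqxx; congr culim; apply/funext => n; rewrite add0r. Qed.

Lemma regular_cb F : regular F -> cbounded (fun n => F (iinv R n)^-1).
Proof. by move=> [F1 _ _]; exists 1, 0%N. Qed.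

Lemma at_inf_le F : regular F -> cabs (at_inf F) <= 1.
Proof.
by move=> Fr; rewrite at_infE; apply: (@culim_le _ _ _ 0%N) => [|n _]; [exact: regular_cb|case: Fr].
Qed.

Lemma at_inf_lip F z : regular F -> z != 0 -> cabs z < 1 / 8 ->
  cabs (F z^-1 - at_inf F) <= 2 * glue_cst * cabs z.
Proof.
move=> Fr z0 z8; have [F' HF] := regular_glue Fr.
have h0 : disc 0 (1 / 8) (0 : R[i]) by rewrite /disc subrr cabs0; lra.
have hz : disc 0 (1 / 8) z by rewrite /disc subr0.
have := C11_lip HF h0 hz; rewrite subr0 (regular_ext Fr z0)//.
by apply: lt_trans z8 _; lra.
Qed.

Lemma glue_cst_ge0 : 0 <= glue_cst.
Proof.
have r0 : regular (fun=> 0) by split=> *; rewrite ?cabs0//; [exact: holo_cst|exists 1 => //; exact: holo_cst].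
have [F' HF] := regular_glue r0; apply: (C11_ge0 HF (z := 0)).
by rewrite /disc subrr cabs0; lra.
Qed.

(* Schwarz's lemma at infinity for the Blaschke transform of [th * F]; the limit [th -> 1] also covers [cabs (at_inf F) = 1]. *)
Lemma at_inf_schwarz F z : regular F -> z != 0 -> cabs z < 1 / 8 -> 2 * glue_cst * cabs z <= 1 / 2 ->
  cabs (F z^-1 - at_inf F) <= 4 * glue_cst * (1 - cabs (at_inf F) ^+ 2) * cabs z.
Proof.
move=> Fr z0 z8 zC; have [F1 Fh Frr] := Fr; set s := at_inf F.
have s1 : cabs s <= 1 by exact: at_inf_le.
have C0 := glue_cst_ge0.
have key th : 0 < th < 1 -> th * cabs (F z^-1 - s) <= 4 * glue_cst * (1 - (th * cabs s) ^+ 2) * cabs z.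
  move=> /andP[th0 th1].
  pose num w := th%:C * (F w - s); pose den w := 1 - (th ^+ 2)%:C * conjc s * F w.
  pose h w := num w / den w.
  have thth : th ^+ 2 < 1 by rewrite expr_lt1 ?ltW.
  have d0 : 0 < 1 - th ^+ 2 by rewrite subr_gt0.
  have denm w : 1 - th ^+ 2 <= cabs (den w).
    have hh := cabsD (den w) ((th ^+ 2)%:C * conjc s * F w); rewrite subrK cabs1 in hh.
    have : cabs ((th ^+ 2)%:C * conjc s * F w) <= th ^+ 2 * (1 * 1).
      rewrite !cabsM cabs_real cabs_conj ger0_norm ?sqr_ge0// -mulrA ler_wpM2l ?sqr_ge0//.
      by apply: ler_pM; rewrite ?cabs_ge0.
    rewrite !mulr1 => hh'; lra.
  have den_gt w : 0 < cabs (den w) by exact: lt_le_trans (denm w).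
  have den0 w : den w != 0 by rewrite -cabs_gt0.
  have num_le w : cabs (num w) <= cabs (den w).
    rewrite -(ler_pXn2r (n := 2)) ?nnegrE ?cabs_ge0// -subr_ge0.
    have -> : cabs (den w) ^+ 2 - cabs (num w) ^+ 2 =
        (1 - th ^+ 2 * cabs s ^+ 2) * (1 - th ^+ 2 * cabs (F w) ^+ 2).
      by rewrite !cabs_sqr /den /num !cplxE /=; ring.
    have q u : cabs u <= 1 -> 0 <= 1 - th ^+ 2 * cabs u ^+ 2.
      by move=> u1; rewrite subr_ge0 mulr_ile1 ?sqr_ge0 ?(ltW thth)// exprn_ile1 ?cabs_ge0.
    by rewrite mulr_ge0 ?q.
  have hh D : holo D F -> holo D h.
    move=> hF; apply: (@holo_div _ _ _ _ (1 - th ^+ 2)) => //.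
    - by apply: holoM; [exact: holo_cst|apply: holoB => //; exact: holo_cst].
    - by apply: holoB; [exact: holo_cst|apply: holoM => //; exact: holo_cst].
  have hr : regular h.
    split.
    - by move=> w; rewrite /h cabsM cabsV ler_pdivrMr// mul1r.
    - by move=> b delta r b0 r0; apply: hh; exact: Fh.
    - by move=> t t1; have [r r0 ?] := Frr t t1; exists r => //; exact: hh.
  have Fcb := regular_cb Fr; have c1 := @cbounded_cst R.
  have h0 : at_inf h = 0.
    have E1 : culim (fun n => h (iinv R n)^-1 * den (iinv R n)^-1) = 0.
      rewrite (_ : (fun n => _) = fun n => th%:C * (F (iinv R n)^-1 - s)); last first.
        by apply/funext => n; rewrite /h divfK.
      rewrite culimZ ?culimB ?culim_cst -?at_infE ?subrr ?mulr0//.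
      by apply: cboundedD => //.
    have E2 : culim (fun n => den (iinv R n)^-1) = 1 - (th ^+ 2)%:C * conjc s * s.
      by rewrite culimB ?culimZ ?culim_cst -?at_infE//; exact: cboundedM.
    have : at_inf h * (1 - (th ^+ 2)%:C * conjc s * s) = 0.
      rewrite -E2 at_infE -culimM//; first exact: regular_cb.
      by apply: cboundedD => //; apply: cboundedN; exact: cboundedM.
    move/eqP; rewrite mulf_eq0 => /orP[/eqP //|/eqP e0].
    exfalso; have : Re (1 - (th ^+ 2)%:C * conjc s * s) = 0 by rewrite e0.
    have -> : Re (1 - (th ^+ 2)%:C * conjc s * s) = 1 - th ^+ 2 * cabs s ^+ 2.
      by rewrite cabs_sqr !cplxE /=; ring.
    have : th ^+ 2 * cabs s ^+ 2 <= th ^+ 2 by rewrite ler_piMr ?sqr_ge0// exprn_ile1 ?cabs_ge0.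
    by clear e0 E1 E2; move: thth; lra.
  have := at_inf_lip hr z0 z8; rewrite h0 subr0 => hl.
  have hl2 : cabs (h z^-1) <= 1 / 2 by exact: le_trans zC.
  set n := th * cabs (F z^-1 - s).
  have nE : n = cabs (h z^-1) * cabs (den z^-1).
    by rewrite -cabsM /h divfK// cabsM cabs_real gtr0_norm.
  have ts : th * cabs s <= 1 by rewrite mulr_ile1 ?cabs_ge0 ?(ltW th0) ?(ltW th1).
  have rho0 : 0 <= 1 - (th * cabs s) ^+ 2.
    by rewrite subr_ge0 exprn_ile1// mulr_ge0 ?cabs_ge0// ltW.
  have denle : cabs (den z^-1) <= 1 - (th * cabs s) ^+ 2 + n.
    have -> : den z^-1 = (1 - (th * cabs s) ^+ 2)%:C - (th ^+ 2)%:C * conjc s * (F z^-1 - s).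
      by rewrite exprMn cabs_sqr /den; apply: complex_eq; rewrite !cplxE /=; ring.
    rewrite (le_trans (cabsB _ _))// cabs_real ger0_norm// lerD2l !cabsM cabs_real cabs_conj.
    rewrite ger0_norm ?sqr_ge0// /n ler_wpM2r ?cabs_ge0//.
    by rewrite (_ : th ^+ 2 * cabs s = th * (th * cabs s)) ?ler_piMr ?(ltW th0)//; ring.
  have n0 : 0 <= n by rewrite mulr_ge0 ?cabs_ge0 ?(ltW th0).
  (* [n] is [cabs h * cabs den] with [cabs h <= 1 / 2], and [denle] contains [n] again. Absorbing
     half of it doubles the constant [2 * glue_cst]. *)
  have k1 : n <= cabs (h z^-1) * (1 - (th * cabs s) ^+ 2) + 1 / 2 * n.
    rewrite {1}nE (le_trans (ler_wpM2l (cabs_ge0 _) denle))// mulrDr lerD2l.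
    exact: ler_wpM2r.
  have k2 : cabs (h z^-1) * (1 - (th * cabs s) ^+ 2) <= 2 * glue_cst * cabs z * (1 - (th * cabs s) ^+ 2).
    exact: ler_wpM2r.
  move: k1 k2; lra.
set X := cabs (F z^-1 - s) in key *; set A := 4 * glue_cst * cabs z.
have A0 : 0 <= A by apply: mulr_ge0 (cabs_ge0 _); exact: mulr_ge0.
have X0 : 0 <= X by exact: cabs_ge0.
set q := cabs s in key s1 *; have q0 : 0 <= q by exact: cabs_ge0.
apply/ler_addgt0Pr => e e0.
have B0 : 0 < X + 2 * A + 1 by lra.
(* [th] is [1 - d]; passing to [th = 1] costs at most [d * (X + 2 * A)]. *)
pose d := Num.min (1 / 2) (e / (X + 2 * A + 1)).
have d0 : 0 < d by rewrite lt_min; apply/andP; split; [lra|exact: divr_gt0].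
have d2 : d <= 1 / 2 by rewrite ge_min lexx.
have de : d * (X + 2 * A + 1) <= e by rewrite -ler_pdivlMr// ge_min lexx orbT.
have k : (1 - d) * X <= A * (1 - ((1 - d) * q) ^+ 2).
  have dI : 0 < 1 - d < 1 by apply/andP; split; lra.
  by have := key _ dI; rewrite /A; lra.
have q2 : q ^+ 2 <= 1 by rewrite exprn_ile1.
have : A * (1 - ((1 - d) * q) ^+ 2) <= A * (1 - q ^+ 2 + 2 * d).
  apply: ler_wpM2l => //; rewrite exprMn.
  have : 0 <= d * (1 - q ^+ 2) by rewrite mulr_ge0 ?subr_ge0// ltW.
  have : 0 <= d ^+ 2 * q ^+ 2 by rewrite mulr_ge0 ?sqr_ge0.
  move=> h1 h2; have -> : (1 - d) ^+ 2 * q ^+ 2 = q ^+ 2 - 2 * (d * q ^+ 2) + d ^+ 2 * q ^+ 2 by ring.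
  lra.
have -> : 4 * glue_cst * (1 - q ^+ 2) * cabs z = A * (1 - q ^+ 2) by rewrite /A; ring.
move: k de; lra.
Qed.

Variable H : R -> 'M[R]_2.
Hypothesis hH : Rclass (@Uset R) H.
Let cH : canonical_system H := hH.1.
Local Notation S := (schur0 H).

Lemma S_le z : cabs (S z) <= 1.
Proof. exact: szero_le (entries_coefs cH) z. Qed.

(** By [icayley_lim] the two sphere-valued limits exist in the Schur coordinate, and injectivity of
    [icayley] makes them conjugate to each other. *)
Lemma S_match : {ae mu, forall t : R, Uset t -> forall e : R, 0 < e ->
  exists n0, forall n, (n0 <= n)%N -> cabs (S (t%:C + iinv R n) - S (t%:C - iinv R n)) <= e}.
Proof.
apply: (ae_imp _ hH.2) => t HU /HU[wp [wm [hp hm wE]]].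
have tI y : Im (t +i* y) = y by [].
have [||sp spE sp_lim] := @icayley_lim R (fun y => splus (ca H) (cb H) (cc H) (t +i* y)) wp.
- by move=> y y0; apply: (splus_le (entries_coefs cH)); exact: ltW.
- apply: cvg_trans hp; apply: near_eq_cvg; near=> y.
  by rewrite m_plusE//= tI; near: y; exact: nbhs_right_gt.
have [||sm smE sm_lim] := @icayley_lim R (fun y => sminus (ca H) (cb H) (cc H) (t +i* y)) wm.
- by move=> y y0; apply: (splus_le (coefs_reflect (entries_coefs cH))); exact: ltW.
- apply: cvg_trans hm; apply: near_eq_cvg; near=> y.
  by rewrite m_minusE//= tI; near: y; exact: nbhs_right_gt.
have sE : sp = conjc sm.
  by apply: icayley_inj; rewrite -spE wE smE icayley_reflect.
move=> e e0; have e20 : 0 < e / 2 by lra.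
have [d1 d10 H1] := sp_lim _ e20; have [d2 d20 H2] := sm_lim _ e20.
have [|n0 n0P] := @invn_small R (Num.min d1 d2); first by rewrite lt_min d10.
exists n0 => n /(n0P _); rewrite lt_min => /andP[nd1 nd2].
have p0 : 0 < (n.+1%:R : R)^-1 by rewrite invr_gt0.
have E1 : t%:C + iinv R n = t +i* (n.+1%:R)^-1 by apply: complex_eq; rewrite !cplxE /=; ring.
have E2 : conjc (t%:C - iinv R n) = t +i* (n.+1%:R)^-1 by apply: complex_eq; rewrite !cplxE /=; ring.
rewrite {1}/schur0 /szero E1 tI p0.
rewrite /schur0 /szero E2.
have -> : (0 < Im (t%:C - iinv R n)) = false.
  by rewrite ImB /= sub0r oppr_gt0 ltNge ltW.
have h1 : cabs (splus (ca H) (cb H) (cc H) (t +i* (n.+1%:R)^-1) - sp) <= e / 2 by apply: H1; rewrite p0.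
have h2 : cabs (sminus (ca H) (cb H) (cc H) (t +i* (n.+1%:R)^-1) - sm) <= e / 2 by apply: H2; rewrite p0.
move: h1 h2; set A := splus _ _ _ _; set B := sminus _ _ _ _ => h1 h2.
have -> : A - conjc B = (A - sp) - conjc (B - sm) by rewrite sE (rmorphB (@conjc R)); ring.
apply: (le_trans (cabsB _ _)); rewrite cabs_conj; lra.
Unshelve. all: by end_near. Qed.

Lemma S_holo (s : bool) (delta : R) : 0 < delta -> hol (fun z => delta < sg R s * Im z) S (dc S).
Proof.
move=> d0; apply: hol_dc; first by move=> z; exact: half_plane_open.
exact: szero_holo (entries_coefs cH) _ _ d0.
Qed.

Lemma extS_real (t : R) : 1 < `|t| -> exists2 r, 0 < r & holo (disc t%:C r) (ext S).
Proof.
move=> t1; have r0 : 0 < `|t| - 1 by rewrite subr_gt0.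
have [||F' HF] := @glue R t (`|t| - 1) 1 S (dc S) r0 (fun z _ _ => S_le z).
- move=> b delta d0; apply: hol_sub (S_holo b d0); by move=> z [].
- apply: (ae_imp _ S_match) => s Hs st; apply: Hs; apply/UsetP.
  have := lerB_dist t s; rewrite distrC; have := lerB_normD; move: st; lra.
by exists ((`|t| - 1) / 8); [lra|exists F'; eexists; exact: HF].
Qed.

Lemma extS_off z : Im z != 0 -> exists2 r, 0 < r & holo (disc z r) (ext S).
Proof.
move=> z0; have [b bz] := sg_cases z0.
have [|r r0 rH] := @half_plane_open b (sg R b * Im z / 2) z; first lra.
exists r => //; apply: (@holo_ext _ _ S); first last.
  by exists (dc S); apply: hol_sub (S_holo b _); [exact: rH|lra].
move=> w /rH h; rewrite ext_off//; apply: contraTneq h => ->; rewrite mulr0 -leNgt; lra.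
Qed.

Lemma extS_holo z : (Im z = 0 -> 1 < `|Re z|) -> exists2 r, 0 < r & holo (disc z r) (ext S).
Proof.
have [z0 /(_ z0) h|z0 _] := eqVneq (Im z) 0; last exact: extS_off.
have -> : z = (Re z)%:C by apply: complex_eq.
exact: extS_real.
Qed.

Lemma extS_le z : cabs (ext S z) <= 1.
Proof.
rewrite /ext; case: ifP => _; last exact: S_le.
by apply: (@culim_le _ _ _ 0%N) => [|n _]; [exists 1, 0%N => n _|]; exact: S_le.
Qed.

Lemma extS_regular : regular (ext S).
Proof.
split; [exact: extS_le| |exact: extS_real].
move=> b delta r d0 _; apply: (@holo_sub _ (fun z => delta < sg R b * Im z)); first by move=> z [].
apply: (@holo_ext _ _ S); last by exists (dc S); exact: S_holo.
by move=> z zd; rewrite ext_off//; apply: contraTneq zd => ->; rewrite mulr0 -leNgt ltW.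
Qed.

Definition Sinv (z : R[i]) := ext S z^-1.

Definition sinf := at_inf (ext S).
End continuation.

(** * The function [M] and its value at infinity *)

Section m_continuation.
Variable R : realType.
Implicit Types (z w s : R[i]).

Lemma holo_derivable (z : R[i]^o) r (f : R[i] -> R[i]) (g : R[i]^o -> R[i]^o) : 0 < r -> holo (disc z r) f ->
  (forall w, disc z r w -> g w = f w) -> derivable g z 1.
Proof.
move=> r0 [f' [B fB]] gf; have z0 : disc z r z by rewrite /disc subrr cabs0.
have B0 := C11_ge0 fB z0; have [_ _ H] := fB _ z0.
apply/cvg_ex; exists (f' z); apply/cvgrPdist_le => e /gt0_real[eE e0].
rewrite -nbhs_nearE; apply/nbhs_discP.
have b1 : 0 < B + 1 by rewrite ltr_wpDl.
exists (Num.min r (Re e / (B + 1))); first by rewrite lt_min r0 divr_gt0.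
move=> h; rewrite subr0 lt_min => /andP[h1 h2] hn0.
have hd : disc z r (h + z) by rewrite /disc addrK.
rewrite -[(g \o shift z) _]/(g (h * 1 + z)) mulr1 gf// gf// eE cabsE lecR.
have := H _ hd; rewrite addrK => hh.
have ch : 0 < cabs h by rewrite cabs_gt0.
rewrite -[_ *: _]/(h^-1 * (f (h + z) - f z)).
have -> : f' z - h^-1 * (f (h + z) - f z) = - (h^-1 * (f (h + z) - f z - f' z * h)).
  by field.
rewrite cabsN cabsM cabsV mulrC ler_pdivrMr//.
apply: (le_trans hh); rewrite expr2 mulrA ler_wpM2r ?(ltW ch)//.
move: h2; rewrite ltr_pdivlMr// => /ltW; apply: le_trans; rewrite mulrC ler_wpM2l ?(ltW ch)//; lra.
Qed.

Lemma derivable_eps (g : R[i]^o -> R[i]^o) (z : R[i]^o) : derivable g z 1 -> forall e, 0 < e ->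
  exists2 d, 0 < d & forall w, cabs (w - z) < d -> cabs (g w - g z) < e.
Proof.
move=> /derivable1_diffP/differentiable_continuous gc e e0.
have ng : nbhs (g z) [set w | cabs (w - g z) < e] by apply/nbhs_discP; exists e.
by have /nbhs_discP[d d0 H] := gc _ ng; exists d.
Qed.

Lemma holo_near z r (f : R[i] -> R[i]) : 0 < r -> holo (disc z r) f -> forall e, 0 < e ->
  exists2 d, 0 < d <= r & forall w, disc z d w -> cabs (f w - f z) <= e.
Proof.
move=> r0 [f' [B fB]] e e0; have z0 : disc z r z by rewrite /disc subrr cabs0.
have B0 := C11_ge0 fB z0; have b1 : 0 < 2 * B + 1 by move: B0; lra.
exists (Num.min r (e / (2 * B + 1))).
  by rewrite lt_min r0 divr_gt0//= ge_min lexx.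
move=> w; rewrite /disc lt_min => /andP[w1' w2']; apply: (le_trans (C11_lip fB z0 w1')).
move: w2'; rewrite ltr_pdivlMr//; have := cabs_ge0 (w - z); lra.
Qed.

Lemma w1w2_holo (D : R[i] -> Prop) (f : R[i] -> R[i]) : holo D f ->
  holo D (fun z => w1 (f z)) /\ holo D (fun z => w2 (f z)).
Proof.
move=> hf; split; last by apply: holoB => //; exact: holo_cst.
by apply: holoM; [exact: holo_cst|apply: holoD => //; exact: holo_cst].
Qed.

Lemma sinv_sdiv (u v : R[i]) : u != 0 -> sinv (sdiv u v) = sdiv v u.
Proof.
move=> u0; rewrite /sdiv; case: (eqVneq v 0) => [->|v0] /=.
  by rewrite (negPf u0) mul0r.
rewrite /sdiv mulf_eq0 invr_eq0 (negPf u0) (negPf v0)/=; congr Some.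
by rewrite invf_div mul1r.
Qed.

Lemma sinv0 : sinv (Some 0 : sphere R) = infty.
Proof. by rewrite /sinv /sdiv eqxx. Qed.

Lemma sinv_some z : z != 0 -> sinv (Some z) = Some z^-1.
Proof. by move=> z0; rewrite /sinv /sdiv (negPf z0) div1r. Qed.

Lemma sdiff_quotient (z : R[i]^o) r (f g : R[i] -> R[i]) (G : R[i]^o -> sphere R) : 0 < r ->
  holo (disc z r) f -> holo (disc z r) g -> g z != 0 ->
  (forall w, disc z r w -> g w != 0 -> G w = sdiv (f w) (g w)) ->
  (\forall w \near z, G w <> infty) /\ derivable (fun w : R[i]^o => Defs.affine (G w) : R[i]^o) (z : R[i]^o) 1.
Proof.
move=> r0 hf hg gz0 GE; have c0 : 0 < cabs (g z) by rewrite cabs_gt0.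
have [|d /andP[d0 dr] dH] := holo_near r0 hg (e := cabs (g z) / 2); first lra.
have gm w : disc z d w -> cabs (g z) / 2 <= cabs (g w).
  move=> /dH h; have := cabsB (g w) (g w - g z); rewrite opprB addrC subrK; lra.
have gn0 w : disc z d w -> g w != 0.
  by move=> /gm h; rewrite -cabs_gt0 (lt_le_trans _ h)//; lra.
have sub w : disc z d w -> disc z r w by rewrite /disc => /lt_le_trans; apply.
have Gd w : disc z d w -> G w = Some (f w / g w).
  by move=> wd; rewrite GE ?gn0//; [rewrite /sdiv (negPf (gn0 _ wd))|exact: sub].
split.
- rewrite -nbhs_nearE; apply/nbhs_discP; exists d => // w wd; by rewrite Gd.
- apply: (@holo_derivable z d (fun w => f w / g w)) => //; last by move=> w wd; rewrite Gd.
  apply: (@holo_div _ _ _ _ (cabs (g z) / 2)) => //; [lra|exact: holo_sub hf|exact: holo_sub hg].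
Qed.

Lemma sdiff_icayley (z : R[i]^o) r (F : R[i] -> R[i]) (G : R[i]^o -> sphere R) : 0 < r -> holo (disc z r) F ->
  (forall w, disc z r w -> G w = icayley (F w)) -> sdifferentiable G z.
Proof.
move=> r0 hF GE; have [h1 h2] := w1w2_holo hF.
have [w20|w20] := eqVneq (w2 (F z)) 0.
- right; have w10 : w1 (F z) != 0.
    by have := w_neq0 (F z); rewrite xpair_eqE w20 eqxx andbT.
  apply: (@sdiff_quotient z r (fun w => w2 (F w)) (fun w => w1 (F w))) => // w wr w0.
  by rewrite GE// /icayley sinv_sdiv.
- left; apply: (@sdiff_quotient z r (fun w => w1 (F w)) (fun w => w2 (F w))) => // w wr w0.
  exact: GE.
Qed.

Lemma icayley_upper s : cabs s <= 1 -> closed_upper (icayley s).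
Proof. by move=> s1; rewrite /closed_upper /=; case E : (icayley s) => [g|//]; exact: icayley_Im E. Qed.

Variable H : R -> 'M[R]_2.
Hypothesis hH : Rclass (@Uset R) H.
Let cH : canonical_system H := hH.1.
Local Notation S := (schur0 H).

Definition Mcont (p : sphere R) : sphere R :=
  if p is Some z then icayley (ext S z) else icayley (sinf H).

Lemma Omega_some z : Omega (Some z : sphere R) -> Im z = 0 -> 1 < `|Re z|.
Proof.
move=> Oz z0; rewrite ltNge; apply/negP => z1; apply: Oz; exists (Re z).
  by move: z1; rewrite /= in_itv/= ler_norml.
by congr Some; apply: complex_eq.
Qed.

Lemma Mcont_is_M : is_M_function H Mcont.
Proof.
split.
- move=> [z|] Oz.
  + have [r r0 hS] := extS_holo hH (Omega_some Oz).
    by apply: (sdiff_icayley r0 hS).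
  + have [F' HF] := regular_glue (extS_regular hH).
    apply: (@sdiff_icayley _ (1 / 8) (ext (Sinv H))); first lra.
      by exists F'; eexists; exact: HF.
    move=> w; rewrite /disc subr0 => w8.
    have [->|w0] := eqVneq w 0; first by rewrite sinv0.
    have w1' : cabs w < 1 by lra.
    by rewrite (sinv_some w0) (regular_ext (extS_regular hH) w0 w1').
- move=> [z|] _ /=; first exact/icayley_upper/extS_le.
  by apply: icayley_upper; exact: at_inf_le (extS_regular hH).
- by move=> z z0; rewrite /Mcont (m_szero_plus cH z0) (ext_off S)// gt_eqF.
- by move=> z z0; rewrite /Mcont (m_szero_minus cH z0) (ext_off S)// lt_eqF.
Qed.
Lemma iinv_neq0 n : iinv R n != 0.
Proof. by rewrite -cabs_gt0 cabs_iinv invr_gt0. Qed.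

Lemma iinv_Im n : Im (iinv R n)^-1 != 0.
Proof. by rewrite Im_inv mulf_neq0 ?oppr_eq0 ?invr_neq0 ?expf_neq0 ?cabs0_eq0 ?iinv_neq0//= invr_neq0. Qed.

Lemma M_function_iinv (M : sphere R -> sphere R) n : is_M_function H M ->
  M (sinv (Some (iinv R n))) = icayley (Sinv H (iinv R n)).
Proof.
move=> [_ _ Mp Mm]; rewrite (sinv_some (iinv_neq0 n)).
have := iinv_Im n; rewrite neq_lt => /orP[z0|z0].
- by rewrite Mm// (m_szero_minus cH z0) /Sinv (ext_off S)// lt_eqF.
- by rewrite Mp// (m_szero_plus cH z0) /Sinv (ext_off S)// gt_eqF.
Qed.

Lemma sinfE : sinf H = culim (fun n => Sinv H (iinv R n)).
Proof. exact: at_infE. Qed.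

Lemma Sinv_cb : cbounded (fun n => Sinv H (iinv R n)).
Proof. exact: regular_cb (extS_regular hH). Qed.

Lemma culim_near (g : R[i]^o -> R[i]^o) : derivable g (0 : R[i]^o) 1 ->
  cbounded (fun n => g (iinv R n)) /\ culim (fun n => g (iinv R n)) = g 0.
Proof.
move=> /derivable_eps dg.
have near e : 0 < e -> exists n0, forall n, (n0 <= n)%N -> cabs (g (iinv R n) - g 0) <= e.
  move=> /dg[d d0 H0]; have [n0 n0P] := invn_small d0; exists n0 => n /n0P nd.
  by apply/ltW/H0; rewrite subr0 cabs_iinv.
split; last by apply: culim_eq.
have [n0 n0P] := near 1 ltr01; exists (1 + cabs (g 0)), n0 => n /n0P h.
by have := cabsD (g (iinv R n) - g 0) (g 0); rewrite subrK; lra.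
Qed.

Lemma near_iinv (P : set (R[i]^o)) : (\forall w \near (0 : R[i]^o), P w) ->
  P 0 /\ exists n0, forall n, (n0 <= n)%N -> P (iinv R n).
Proof.
rewrite -nbhs_nearE => /nbhs_discP[d d0 H0]; split; first by apply: H0; rewrite subrr cabs0.
by have [n0 n0P] := invn_small d0; exists n0 => n /n0P nd; apply: H0; rewrite subr0 cabs_iinv.
Qed.

Lemma culim_ext (u v : nat -> R[i]) n0 : cbounded v -> (forall n, (n0 <= n)%N -> u n = v n) -> culim u = culim v.
Proof.
move=> vb uv; have ub : cbounded u.
  have [B [n1 vB]] := vb; exists B, (maxn n0 n1) => n; rewrite geq_max => /andP[h1 h2].
  by rewrite uv// vB.
apply/eqP; rewrite -subr_eq0 -culimB//; apply/eqP/culim_eq => e e0; exists n0 => n /uv ->.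
by rewrite subr0 subrr cabs0 ltW.
Qed.

(** [Mfun] is some continuation, so its value at infinity has to be determined by [H]. Along
    [(iinv n)^-1] it agrees with the Schur function, and the relation between [w1] and [w2] passes
    to the limit in whichever chart [M] is differentiable. *)
Lemma M_function_infty (M : sphere R -> sphere R) : is_M_function H M -> M infty = icayley (sinf H).
Proof.
move=> hM; have [hol _ _ _] := hM.
have Oi : Omega (infty : sphere R) by case.
have Sb := Sinv_cb; have c1 := @cbounded_cst R.
have w1b : cbounded (fun n => w1 (Sinv H (iinv R n))) by apply: cboundedM => //; exact: cboundedD.
have w2b : cbounded (fun n => w2 (Sinv H (iinv R n))) by apply: cboundedD => //; exact: cboundedN.
have w1l : culim (fun n => w1 (Sinv H (iinv R n))) = w1 (sinf H).
  by rewrite /w1 culimZ ?culimD ?culim_cst ?sinfE//; exact: cboundedD.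
have w2l : culim (fun n => w2 (Sinv H (iinv R n))) = w2 (sinf H).
  by rewrite /w2 culimB ?culim_cst ?sinfE.
have M0 : M (sinv (Some 0)) = M infty by rewrite sinv0.
have wn0 := w_neq0 (sinf H); rewrite xpair_eqE in wn0.
have := hol infty Oi; case=> [[/near_iinv[Mi [n0 n0P]] /culim_near[ab al]]|[/near_iinv[Mi [n0 n0P]] /culim_near[ab al]]].
- move: Mi al; rewrite M0; case: (M infty) => [m _ al|//].
  have E : w1 (sinf H) = m * w2 (sinf H).
    rewrite -w1l -w2l -[m]al -culimM//; apply: (@culim_ext _ _ n0); first exact: cboundedM.
    move=> n /n0P; rewrite (M_function_iinv n hM).
    by case G : (icayley _) => [g|//] _; have [_ ->] := icayley_some G.
  have w20 : w2 (sinf H) != 0.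
    by apply: contraNneq wn0 => e; rewrite E e mulr0 eqxx.
  by rewrite /icayley /sdiv (negPf w20) E mulfK.
- move: Mi al; rewrite M0.
  case si : (sinv (M infty)) => [k|//] _ al.
  have E : w2 (sinf H) = k * w1 (sinf H).
    rewrite -w1l -w2l -[k]al -culimM//; apply: (@culim_ext _ _ n0); first exact: cboundedM.
    move=> n /n0P; rewrite (M_function_iinv n hM).
    rewrite /icayley; have [w10|w10] := eqVneq (w1 (Sinv H (iinv R n))) 0.
      rewrite /sdiv; case: ifPn => [/eqP w20 _|w20].
        by have := w_neq0 (Sinv H (iinv R n)); rewrite w10 w20 eqxx.
      by rewrite w10 mul0r /sinv /sdiv eqxx.
    by rewrite sinv_sdiv// /sdiv (negPf w10) => _; rewrite /= divfK.
  have w10 : w1 (sinf H) != 0.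
    by apply: contraNneq wn0 => e; rewrite E e mulr0 eqxx.
  move: si; rewrite /icayley /sdiv; case: (M infty) => [m|] /=.
    rewrite /sdiv; case: ifPn => // m0 [kE].
    have k0 : k != 0 by rewrite -kE div1r invr_neq0.
    by rewrite E mulf_eq0 (negPf k0) (negPf w10)/= invfM mulrCA divff// mulr1 -kE div1r invrK.
  by case=> k0; rewrite E -k0 mul0r eqxx.
Qed.

Lemma phi_i : phi ('i%C : R[i]) = infty.
Proof. by rewrite /phi /sdiv sqr_i addNr eqxx. Qed.

Lemma icayley_eq_i s : icayley s = Some 'i%C <-> s = 0.
Proof.
split=> [/icayley_some[_]|->]; last by rewrite /icayley /sdiv /w1 /w2 subr0 addr0 oner_eq0 mulr1 divr1.
rewrite /w1 /w2 => /(mulfI (i_neq0 R)) /eqP; rewrite -subr_eq0 => /eqP E.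
apply/eqP; have : 2 * s == 0 by rewrite -E; apply/eqP; ring.
by rewrite mulf_eq0 (negPf (two_neq0 R)).
Qed.

Lemma Ffun_i : Ffun 'i%C H = Some 'i%C <-> sinf H = 0.
Proof.
rewrite /Ffun phi_i /Mfun; set A := [set M | _].
have : A (xget (fun=> Some 0) A) by apply: xgetPex; exists Mcont; exact: Mcont_is_M.
by move=> /M_function_infty ->; exact: icayley_eq_i.
Qed.
End m_continuation.

(** * The Schur function along the line *)

Section transport.
Variable R : realType.
Local Notation mu := (@lebesgue_measure R).
Variables a b c : R -> R.
Hypothesis abc : coefs a b c.
Local Notation T := (tm a b c).
Variable S : R[i] -> R[i].
Hypothesis hS : regular S.
Hypothesis S_nf : forall z x, Im z != 0 ->
  0 <= nf (tsol a b c true (w1 (S z)) (w2 (S z)) z) (tsol a b c false (w1 (S z)) (w2 (S z)) z) x.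

(** For [S = ext (schur0 H)] a multiple of the right Weyl solution above the real axis, and of the
    conjugate of the left one below it. *)
Definition V1 x z := tsol a b c true (w1 (S z)) (w2 (S z)) z x.
Definition V2 x z := tsol a b c false (w1 (S z)) (w2 (S z)) z x.
Definition alpha x z := V1 x z - 'i%C * V2 x z.
Definition beta x z := V1 x z + 'i%C * V2 x z.
(* The Schur function of the half line starting at [x]. *)
Definition Sx x z := alpha x z / beta x z.

Lemma V_sol z : sol a b c z (V1^~ z) (V2^~ z).
Proof. exact: tsol_sol. Qed.

Lemma V1_0 z : V1 0 z = w1 (S z). Proof. by rewrite /V1 tsol0. Qed.
Lemma V2_0 z : V2 0 z = w2 (S z). Proof. by rewrite /V2 tsol0. Qed.

(** For real [z] the form is constant in [x], and at [0] it equals [1 - cabs (S z) ^+ 2]. *)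
Lemma V_nf x z : 0 <= Im (V1 x z * conjc (V2 x z)).
Proof.
have [z0|z0] := eqVneq (Im z) 0; last exact: S_nf.
have := nf_const 0 x (V_sol z) z0; rewrite /nf => ->.
rewrite V1_0 V2_0 (_ : Im _ = 1 - cabs (S z) ^+ 2); last first.
  by rewrite cabs_sqr /w1 /w2; set s := S z; clearbody s; rewrite !cplxE /=; ring.
by rewrite subr_ge0 exprn_ile1 ?cabs_ge0//; case: hS.
Qed.

Lemma alpha_le_beta x z : cabs (alpha x z) <= cabs (beta x z).
Proof.
rewrite -(ler_pXn2r (n := 2)) ?nnegrE ?cabs_ge0// -subr_ge0 cabs_pair.
by rewrite mulr_ge0// V_nf.
Qed.

Lemma V_le_beta x z : cabs (V1 x z) <= cabs (beta x z) /\ cabs (V2 x z) <= cabs (beta x z).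
Proof.
have h := alpha_le_beta x z.
have e1 : 2 * V1 x z = alpha x z + beta x z by rewrite /alpha /beta; ring.
have e2 : 2 * 'i%C * V2 x z = beta x z - alpha x z by rewrite /alpha /beta; ring.
have h1 : 2 * cabs (V1 x z) <= cabs (alpha x z) + cabs (beta x z).
  by rewrite -(cabs_nat R 2) -cabsM e1 cabsD.
have h2 : 2 * cabs (V2 x z) <= cabs (beta x z) + cabs (alpha x z).
  have -> : 2 * cabs (V2 x z) = cabs (2 * 'i%C * V2 x z) by rewrite !cabsM cabs_i cabs_nat mulr1.
  by rewrite e2 cabsB.
by split; lra.
Qed.

(* Transporting back to [x = 0], where [w1 + 'i w2 = 2 'i]. *)
Lemma beta_lower x r : 0 < r -> exists2 m, 0 < m & forall z, disc 0 r z -> m <= cabs (beta x z).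
Proof.
move=> r0; have tB j k : exists2 B, 0 < B & forall z, disc 0 r z -> cabs (T j k z x) <= B.
  have [f' [B fB]] := tm_holo abc j k x r0; exists (`|B| + 1); first by rewrite ltr_wpDl.
  by move=> z /fB[h _ _]; rewrite (le_trans h)// (le_trans (ler_norm _))// lerDl.
have [B1 B10 H1] := tB true true; have [B2 B20 H2] := tB true false.
have [B3 B30 H3] := tB false true; have [B4 B40 H4] := tB false false.
exists (2 / (B1 + B2 + B3 + B4)); first by rewrite divr_gt0// !addr_gt0.
move=> z zr; rewrite ler_pdivrMr ?addr_gt0//.
have D := tm_det abc z x.
have E : 2 * 'i%C = V1 x z * (T false false z x - 'i%C * T true false z x) +
    V2 x z * ('i%C * T true true z x - T false true z x).
  rewrite -[LHS]mulr1 -[X in _ * X = _]D /V1 /V2 /tsol /w1 /w2.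
  move: (S z) (T true true z x) (T true false z x) (T false true z x) (T false false z x) => s t11 t12 t21 t22.
  ring.
have [v1 v2] := V_le_beta x z.
rewrite (_ : 2 = cabs (2 * 'i%C : R[i])); last by rewrite cabsM cabs_i cabs_nat mulr1.
rewrite E (le_trans (cabsD _ _))// !cabsM.
have h1 := cabsB (T false false z x) ('i%C * T true false z x).
have h2 := cabsB ('i%C * T true true z x) (T false true z x).
rewrite cabsM cabs_i mul1r in h1; rewrite cabsM cabs_i mul1r in h2.
have k1 := H1 z zr; have k2 := H2 z zr; have k3 := H3 z zr; have k4 := H4 z zr.
have -> : cabs (beta x z) * (B1 + B2 + B3 + B4) = cabs (beta x z) * (B4 + B2) + cabs (beta x z) * (B1 + B3) by ring.
by apply: lerD; apply: ler_pM; rewrite ?cabs_ge0//; [move: h1|move: h2]; lra.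
Qed.

Lemma beta_neq0 x z : beta x z != 0.
Proof.
have r0 : 0 < cabs z + 1 by rewrite ltr_wpDl ?cabs_ge0.
have [m m0 mH] := beta_lower x r0; rewrite -cabs_gt0 (lt_le_trans m0)// mH//.
by rewrite /disc subr0 ltrDl.
Qed.

Lemma V_holo D x r : 0 < r -> (forall z, D z -> disc 0 r z) -> holo D S ->
  holo D (V1 x) /\ holo D (V2 x).
Proof.
move=> r0 Dr hD; have [h1 h2] := w1w2_holo hD.
have hT j k : holo D (fun z => T j k z x) by apply: holo_sub Dr _; exact: tm_holo.
by split; apply: holoD; apply: holoM.
Qed.

Lemma Sx_holo D x r : 0 < r -> (forall z, D z -> disc 0 r z) -> holo D S -> holo D (Sx x).
Proof.
move=> r0 Dr hD; have [h1 h2] := V_holo x r0 Dr hD.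
have [m m0 mH] := beta_lower x r0.
have h3 : holo D (fun z => 'i%C * V2 x z) by apply: holoM => //; exact: holo_cst.
apply: (@holo_div _ _ _ _ m) => //; [by move=> z /Dr; exact: mH|exact: holoB|exact: holoD].
Qed.

(** The transfer matrix is entire in [z] and [beta] is bounded below on discs, so the domain of
    holomorphy of [S] is inherited at every [x]. *)
Lemma Sx_regular x : regular (Sx x).
Proof.
have [S1 Sh Sr] := hS; split.
- move=> z; rewrite /Sx cabsM cabsV ler_pdivrMr ?mul1r ?alpha_le_beta//.
  by rewrite cabs_gt0 beta_neq0.
- by move=> s delta r d0 r0; apply: (Sx_holo x r0); [move=> z []|exact: Sh].
- move=> t t1; have [r r0 hr] := Sr t t1; exists r => //.
  apply: (@Sx_holo _ x (`|t| + r)) => //; first by rewrite ltr_wpDl.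
  move=> z; rewrite /disc subr0 => zr.
  by have := cabsD (z - t%:C) t%:C; rewrite subrK cabs_real; lra.
Qed.

Definition sigma x := at_inf (Sx x).
Definition rho x := 1 - cabs (sigma x) ^+ 2.

Lemma sigma0 : sigma 0 = at_inf S.
Proof.
rewrite /sigma; congr at_inf; apply/funext => z; rewrite /Sx /alpha /beta V1_0 V2_0.
have -> : w1 (S z) - 'i%C * w2 (S z) = 2 * 'i%C * S z by rewrite /w1 /w2; ring.
have -> : w1 (S z) + 'i%C * w2 (S z) = 2 * 'i%C by rewrite /w1 /w2; ring.
by rewrite mulrAC divff ?mul1r// mulf_neq0 ?two_neq0 ?i_neq0.
Qed.

Lemma sigma_le x : cabs (sigma x) <= 1.
Proof. exact: at_inf_le (Sx_regular x). Qed.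

Lemma rho_ge0 x : 0 <= rho x.
Proof. by rewrite subr_ge0 exprn_ile1 ?cabs_ge0 ?sigma_le. Qed.

Definition kappa x : R[i] := ((c x - a x) / 2) +i* b x.

Definition riccati x (s : R[i]) : R[i] := conjc (kappa x) * s ^+ 2 - s + kappa x.

(** [(c - a)^2 / 4 + b^2 <= (a + c)^2 / 4]. *)
Lemma kappa_ae : {ae mu, forall x, cabs (kappa x) <= 1 / 2}.
Proof.
apply: (ae_imp _ (coefs_psd abc)) => x [a0 c0 ac bac].
rewrite -(ler_pXn2r (n := 2)) ?nnegrE ?cabs_ge0// cabs_sqr /kappa /=.
have : (a x + c x) ^+ 2 = 1 by rewrite ac expr1n.
move: bac; lra.
Qed.

Local Notation z_ m := ('i%C * m%:C).

Lemma beta_cac z : cac (alpha^~ z) /\ cac (beta^~ z).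
Proof.
have [c1 c2 _] := V_sol z; have c3 : cac (fun x => 'i%C * V2 x z) by exact: cacM (cac_cst _) c2.
by split; [exact: cacB|exact: cacD].
Qed.
End transport.

(** * Quotients of absolutely continuous complex functions *)

Section cquotient.
Variable R : realType.
Local Notation mu := (@lebesgue_measure R).

Lemma has_cderiv_unique (f : R -> R[i]) x u v : has_cderiv f x u -> has_cderiv f x v -> u = v.
Proof.
move=> [f1 f2] [g1 g2]; apply: complex_eq.
- by rewrite -(@derive_val _ _ _ _ _ _ _ f1) -(@derive_val _ _ _ _ _ _ _ g1).
- by rewrite -(@derive_val _ _ _ _ _ _ _ f2) -(@derive_val _ _ _ _ _ _ _ g2).
Qed.

Lemma cinv_conj (f : R -> R[i]) : (fun x => (f x)^-1) = (fun x => conjc (f x) * ((Re (f x * conjc (f x)))^-1)%:C).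
Proof.
apply/funext => x; have [->|f0] := eqVneq (f x) 0; first by rewrite invr0 conjc0 mul0r.
rewrite conj_mul /= (fmorphV (real_complex R)) /= -conj_mul invfM mulrCA divff ?mulr1//.
by rewrite conj_eq0.
Qed.

Lemma sqr_lac (f : R -> R[i]) : cac f -> loc_abs_cont (fun x => Re (f x * conjc (f x))).
Proof. by move=> cf; have [] := cacM cf (cac_conj cf). Qed.

Lemma cacV (f : R -> R[i]) : cac f -> (forall x, f x != 0) -> cac (fun x => (f x)^-1).
Proof.
move=> cf f0; rewrite cinv_conj; apply: cacM; first exact: cac_conj.
apply: cac_real; apply: lac_inv; first exact: sqr_lac.
by move=> x; rewrite conj_mul exprn_gt0// cabs_gt0.
Qed.

Lemma has_cderivV (f : R -> R[i]) x u : f x != 0 -> has_cderiv f x u ->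
  exists v, has_cderiv (fun x => (f x)^-1) x v.
Proof.
move=> f0 fu; have [du _] := has_cderivM fu (has_cderiv_conj fu).
have n0 : Re (f x * conjc (f x)) != 0 by rewrite conj_mul /= expf_neq0// cabs0_eq0.
rewrite cinv_conj; eexists; apply: has_cderivM; first exact: has_cderiv_conj fu.
exact: has_cderiv_real (is_deriveV n0 du).
Qed.

(** For the inverse of [g] only the existence of a derivative is used; its value follows from
    uniqueness of the derivative of [f / g * g]. *)
Lemma has_cderiv_div (f g : R -> R[i]) x u v : (forall x, g x != 0) ->
  has_cderiv f x u -> has_cderiv g x v ->
  has_cderiv (fun x => f x / g x) x ((u * g x - f x * v) / g x ^+ 2).
Proof.
move=> g0 fu gv; have [w gw] := has_cderivV (g0 x) gv.
have H := has_cderivM fu gw.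
have := has_cderivM H gv.
rewrite (_ : (fun x => f x / g x * g x) = f); last by apply/funext => y; rewrite divfK.
move=> /(has_cderiv_unique fu) E; congr (has_cderiv _ x _): H.
have E' : (u * (g x)^-1 + f x * w) * g x = u - f x / g x * v.
  by apply/esym/eqP; rewrite subr_eq; apply/eqP.
apply: (@mulIf _ (g x)) => //; rewrite E'.
by move: (g0 x) => gx0; field.
Qed.

Definition clocb (h : R -> R[i]) := loc_bounded_meas (fun t => Re (h t)) /\ loc_bounded_meas (fun t => Im (h t)).

Lemma clocbD f g : clocb f -> clocb g -> clocb (fun x => f x + g x).
Proof.
by move=> [f1 f2] [g1 g2]; split; [rewrite (funext (fun t => ReD (f t) (g t)))|rewrite (funext (fun t => ImD (f t) (g t)))];
  exact: loc_bounded_measD.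
Qed.

Lemma loc_bounded_measN (f : R -> R) : loc_bounded_meas f -> loc_bounded_meas (fun x => - f x).
Proof. by move=> /(loc_bounded_measZ (-1)); congr loc_bounded_meas; apply/funext => x; rewrite mulN1r. Qed.

Lemma clocbN f : clocb f -> clocb (fun x => - f x).
Proof.
by move=> [f1 f2]; split; [rewrite (funext (fun t => ReN (f t)))|rewrite (funext (fun t => ImN (f t)))];
  exact: loc_bounded_measN.
Qed.

Lemma clocb_conj f : clocb f -> clocb (fun x => conjc (f x)).
Proof.
move=> [f1 f2]; split; [rewrite (funext (fun t => Re_conj (f t)))|rewrite (funext (fun t => Im_conj (f t)))] => //.
exact: loc_bounded_measN.
Qed.

Lemma clocbM f g : clocb f -> clocb g -> clocb (fun x => f x * g x).
Proof.
move=> [f1 f2] [g1 g2]; split; [rewrite (funext (fun t => ReM (f t) (g t)))|rewrite (funext (fun t => ImM (f t) (g t)))].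
- by apply: loc_bounded_measD; [|apply: loc_bounded_measN]; exact: loc_bounded_measM.
- by apply: loc_bounded_measD; exact: loc_bounded_measM.
Qed.
End cquotient.

(** * The Riccati equation and its limit at infinity *)

Section dynamics.
Variable R : realType.
Local Notation mu := (@lebesgue_measure R).
Variables a b c : R -> R.
Hypothesis abc : coefs a b c.
Variable S : R[i] -> R[i].
Hypothesis hS : regular S.
Hypothesis S_nf : forall z x, Im z != 0 ->
  0 <= nf (tsol a b c true (w1 (S z)) (w2 (S z)) z) (tsol a b c false (w1 (S z)) (w2 (S z)) z) x.
Local Notation Sx := (Sx a b c S).
Local Notation al := (alpha a b c S).
Local Notation be := (beta a b c S).
Local Notation sigma := (sigma a b c S).
Local Notation rho := (rho a b c S).
Local Notation kappa := (kappa a b c).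
Local Notation riccati := (riccati a b c).
Local Notation z_ m := ('i%C * m%:C).
Local Notation C0 := (glue_cst R).

Lemma Sx_cac z : cac (Sx^~ z).
Proof.
have [c1 c2] := beta_cac abc S z.
by apply: cacM => //; apply: cacV => // x; exact: (beta_neq0 abc hS S_nf).
Qed.

(** The linear term comes with the coefficient [a + c]; the trace normalization enters here. *)
Lemma Sx_deriv z : {ae mu, forall x, has_cderiv (Sx^~ z) x ('i%C * z * riccati x (Sx x z))}.
Proof.
have [_ _ d] := V_sol abc S z.
apply: (ae_imp2 _ d (coefs_psd abc)) => x [d1 d2] [_ _ ac _].
have d2i := has_cderivM (has_cderiv_cst 'i%C x) d2.
have da := has_cderivB d1 d2i; have db := has_cderivD d1 d2i.
have bn0 : forall x, be x z != 0 by move=> y; exact: (beta_neq0 abc hS S_nf).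
have := has_cderiv_div bn0 da db; congr has_cderiv.
have b0 := bn0 x; rewrite /Sx.
apply: (@mulIf _ (be x z ^+ 2)); first exact: expf_neq0.
rewrite divfK ?expf_neq0//.
have -> : 'i%C * z * riccati x (al x z / be x z) * be x z ^+ 2 =
  'i%C * z * (conjc (kappa x) * al x z ^+ 2 - al x z * be x z + kappa x * be x z ^+ 2).
  by rewrite /riccati; field.
rewrite /alpha /beta; move: (V1 a b c S x z) (V2 a b c S x z) => v1 v2.
have k1 : kappa x = ((c x)%:C - (a x)%:C) / 2 + 'i%C * (b x)%:C.
  by apply: (@mulIf _ 2); rewrite ?two_neq0// mulrDl divfK ?two_neq0//; apply: complex_eq; rewrite /kappa !cplxE /=; field.
have k2 : conjc (kappa x) = ((c x)%:C - (a x)%:C) / 2 - 'i%C * (b x)%:C.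
  by apply: (@mulIf _ 2); rewrite ?two_neq0// mulrBl divfK ?two_neq0//; apply: complex_eq; rewrite /kappa !cplxE /=; field.
have ac1 : (a x)%:C + (c x)%:C = 1 by rewrite -(rmorphD (real_complex R)) ac.
rewrite k2 k1; move: ac1 (mulii R); move: ((a x)%:C) ((b x)%:C) ((c x)%:C) ('i%C) => A B C j AC jj.
have e1 : (v1 - j * v2) ^+ 2 = v1 ^+ 2 - 2 * j * v1 * v2 - v2 ^+ 2.
  by rewrite -[v2 ^+ 2]mul1r -[X in X * v2 ^+ 2]opprK -jj; ring.
have e2 : (v1 + j * v2) ^+ 2 = v1 ^+ 2 + 2 * j * v1 * v2 - v2 ^+ 2.
  by rewrite -[v2 ^+ 2]mul1r -[X in X * v2 ^+ 2]opprK -jj; ring.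
have e3 : (v1 - j * v2) * (v1 + j * v2) = (A + C) * (v1 ^+ 2 + v2 ^+ 2).
  by rewrite AC mul1r -[v2 ^+ 2]mul1r -[X in X * v2 ^+ 2]opprK -jj; ring.
rewrite e1 e2 e3; set q := (X in _ = j * z * X).
have -> : q = - 2 * (A * v1 ^+ 2 + C * v2 ^+ 2) + j * j * (4 * B * v1 * v2) by rewrite /q; field.
rewrite jj; ring.
Qed.

Lemma riccati_lip x s t : cabs (kappa x) <= 1 / 2 -> cabs s <= 1 -> cabs t <= 1 ->
  cabs (riccati x s - riccati x t) <= 2 * cabs (s - t).
Proof.
move=> k1 s1 t1.
have -> : riccati x s - riccati x t = (conjc (kappa x) * (s + t) - 1) * (s - t) by rewrite /riccati; ring.
rewrite cabsM ler_wpM2r ?cabs_ge0// (le_trans (cabsB _ _))// cabs1 cabsM cabs_conj.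
have : cabs (kappa x) * cabs (s + t) <= 1 / 2 * 2.
  by apply: ler_pM; rewrite ?cabs_ge0// (le_trans (cabsD _ _))//; lra.
lra.
Qed.

Lemma Sx_le x z : cabs (Sx x z) <= 1.
Proof. by case: (Sx_regular abc hS S_nf x). Qed.

Lemma cabs_z (m : R) : 0 < m -> cabs (z_ m) = m.
Proof. by move=> m0; rewrite cabsM cabs_i mul1r cabs_real gtr0_norm. Qed.

Lemma zV_spec (m : R) : 8 < m -> [/\ ((z_ m : R[i])^-1)^-1 = z_ m, (z_ m : R[i])^-1 != 0,
  cabs (z_ m)^-1 = m^-1 & cabs (z_ m)^-1 < 1 / 8].
Proof.
move=> m8; have m0 : 0 < m by lra.
have e : cabs (z_ m)^-1 = m^-1 by rewrite cabsV cabs_z.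
have i0 : 0 < m^-1 by rewrite invr_gt0.
split; rewrite ?invrK//; first by rewrite -cabs_gt0 e.
by rewrite e div1r ltf_pV2 ?posrE//; lra.
Qed.

Lemma sigma_near x (m : R) : 8 < m -> cabs (Sx x (z_ m) - sigma x) <= 2 * C0 / m.
Proof.
move=> m8; have [zK z0 zE z8] := zV_spec m8.
by have := at_inf_lip (Sx_regular abc hS S_nf x) z0 z8; rewrite zK zE.
Qed.

Lemma sigma_schwarz x (m : R) : 8 < m -> 4 * C0 <= m ->
  cabs (Sx x (z_ m) - sigma x) <= 4 * C0 * rho x / m.
Proof.
move=> m8 mC; have [zK z0 zE z8] := zV_spec m8.
have := at_inf_schwarz (Sx_regular abc hS S_nf x) z0 z8; rewrite zK zE => -> //.
rewrite ler_pdivrMr; lra.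
Qed.

Lemma le_div_all (x K : R) : 0 <= K -> (forall m, 8 < m -> x <= K / m) -> x <= 0.
Proof.
move=> K0 H; apply/ler_addgt0Pr => e e0; rewrite add0r.
have k : 0 <= K / e by rewrite divr_ge0// ltW.
have m8 : 8 < 9 + K / e by lra.
apply: (le_trans (H _ m8)); rewrite ler_pdivrMr; last by lra.
have : K / e * e = K by rewrite divfK// gt_eqF.
lra.
Qed.

Lemma sigma_lip_aux x y (m : R) : 8 < m ->
  cabs (sigma y - sigma x) <= cabs (Sx y (z_ m) - Sx x (z_ m)) + 4 * C0 / m.
Proof.
move=> m8; have h1 := sigma_near x m8; have h2 := sigma_near y m8.
have -> : sigma y - sigma x = (Sx y (z_ m) - Sx x (z_ m)) + ((Sx x (z_ m) - sigma x) - (Sx y (z_ m) - sigma y)) by ring.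
have h3 := cabsD (Sx y (z_ m) - Sx x (z_ m)) ((Sx x (z_ m) - sigma x) - (Sx y (z_ m) - sigma y)).
have h4 := cabsB (Sx x (z_ m) - sigma x) (Sx y (z_ m) - sigma y).
move: h1 h2 h3 h4; lra.
Qed.

Lemma cac_eps (f : R -> R[i]) x e : cac f -> 0 < e ->
  exists2 d, 0 < d & forall y, `|y - x| < d -> cabs (f y - f x) < e.
Proof.
move=> [f1 f2] e0; have e20 : 0 < e / 2 by lra.
have [d1 d10 H1] := lac_continuous f1 x e20; have [d2 d20 H2] := lac_continuous f2 x e20.
exists (Num.min d1 d2); first by rewrite lt_min d10.
move=> y; rewrite lt_min => /andP[/H1 h1 /H2 h2].
by rewrite (le_lt_trans (cabs_le _))// !cplxE; lra.
Qed.

(** [sigma] is a uniform limit of the continuous functions [Sx x (z_ m)]. Its measurability is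
    wanted before the Riccati expression in [sigma] can be integrated, hence ahead of the Lipschitz
    bound. *)
Lemma sigma_clocb : clocb sigma.
Proof.
have ce x e : 0 < e -> exists2 d, 0 < d & forall y, `|y - x| < d -> cabs (sigma y - sigma x) < e.
  move=> e0; have Cg := glue_cst_ge0 R.
  (* With this [m] the error [4 * C0 / m] of [sigma_lip_aux] is at most [e / 2]. *)
  have m8 : 8 < 9 + 8 * C0 / e by rewrite ltr_wpDr//; [apply: divr_ge0 (ltW e0); exact: mulr_ge0|lra].
  have e20 : 0 < e / 2 by lra.
  have [d d0 H] := cac_eps x (Sx_cac (z_ (9 + 8 * C0 / e))) e20.
  exists d => // y /H h; apply: (le_lt_trans (sigma_lip_aux x y m8)).
  have : 4 * C0 / (9 + 8 * C0 / e) <= e / 2.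
    rewrite ler_pdivrMr; last by lra.
    have -> : e / 2 * (9 + 8 * C0 / e) = e * 9 / 2 + 4 * C0.
      by field; rewrite gt_eqF.
    by move: e0; lra.
  lra.
have b1 (f : R[i] -> R) : (forall z, `|f z| <= cabs z) -> (forall z w, f z - f w = f (z - w)) ->
    loc_bounded_meas (fun x => f (sigma x)).
  move=> fle fB; split; last first.
    by move=> r; exists 1 => x _; rewrite (le_trans (fle _))// (sigma_le abc hS S_nf).
  apply: continuous_measurable_fun; apply/continuous_epsP => x e /(ce x)[d d0 H].
  by exists d => // y /H; apply: le_lt_trans; rewrite fB.
split; apply: b1 => *; [exact: cabs_Re|by rewrite ReB|exact: cabs_Im|by rewrite ImB].
Qed.

Lemma kappa_clocb : clocb kappa.
Proof.
have [ma mb mc] := coefs_meas abc.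
have la : loc_bounded_meas a by split => // r; exists 1 => x _; case: (coefs_le1 abc x).
have lb : loc_bounded_meas b by split => // r; exists 1 => x _; case: (coefs_le1 abc x).
have lc : loc_bounded_meas c by split => // r; exists 1 => x _; case: (coefs_le1 abc x).
split => //=; rewrite (_ : (fun t => _) = fun t => 2^-1 * (c t + - a t)); last by apply/funext => t; rewrite mulrC.
by apply: loc_bounded_measZ; apply: loc_bounded_measD => //; exact: loc_bounded_measN.
Qed.

Lemma riccati_clocb : clocb (fun x => riccati x (sigma x)).
Proof.
have hs := sigma_clocb; have hk := kappa_clocb.
rewrite (_ : (fun x => _) = fun x => conjc (kappa x) * (sigma x * sigma x) + - sigma x + kappa x); last first.
  by apply/funext => x; rewrite /riccati expr2.
apply: clocbD => //; apply: clocbD; last exact: clocbN.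
by apply: clocbM; [exact: clocb_conj|exact: clocbM].
Qed.

Lemma Sx_imag_deriv (m : R) : {ae mu, forall x, has_cderiv (Sx^~ (z_ m)) x (- (m%:C * riccati x (Sx x (z_ m))))}.
Proof.
apply: (ae_imp _ (Sx_deriv (z_ m))) => x; congr has_cderiv.
by rewrite mulrA mulii; ring.
Qed.

(** The equation for [Sx] at [z = i m] is integrated and divided by [m]: the boundary terms are at
    most [2 / m], and replacing [Sx] by [sigma] costs another multiple of [1 / m]. *)
Lemma riccati_prim x : cprim (fun x => riccati x (sigma x)) x = 0.
Proof.
set h := fun x => riccati x (sigma x); have [h1 h2] := riccati_clocb.
have Cg := glue_cst_ge0 R.
suff H p q : p <= q -> cprim h q - cprim h p = 0.
  have [x0|/ltW x0] := leP 0 x; first by have := H _ _ x0; rewrite cprim0 subr0.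
  by have := H _ _ x0; rewrite cprim0 sub0r => /eqP; rewrite oppr_eq0 => /eqP.
clear x; move=> pq; apply/eqP; rewrite -cabs0_eq0 eq_le cabs_ge0 andbT.
have qp : 0 <= q - p by rewrite subr_ge0.
apply: (@le_div_all _ (2 + 2 * (4 * C0) * (q - p))).
  apply: addr_ge0 => //; apply: mulr_ge0 => //; apply: mulr_ge0 => //; exact: mulr_ge0.
move=> m m8; have m0 : 0 < m by lra.
have mi : 0 < m^-1 by rewrite invr_gt0.
pose Q x := (m^-1)%:C * Sx x (z_ m) + cprim h x.
have cQ : cac Q by apply: cacD; [exact: cacM (cac_cst _) (Sx_cac _)|exact: cprim_cac].
have := cac_lipschitz cQ pq (L := 4 * C0 / m) _.
have /[swap] /[apply] : {ae mu, forall x, p <= x <= q -> exists2 v, cabs v <= 4 * C0 / m & has_cderiv Q x v}.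
  apply: (ae_imp3 _ (Sx_imag_deriv m) (cprim_derive h1 h2) (kappa_ae abc)) => x d1 d2 k1 _.
  eexists; last exact: has_cderivD (has_cderivM (has_cderiv_cst _ x) d1) d2.
  have -> : 0 * Sx x (z_ m) + (m^-1)%:C * - (m%:C * riccati x (Sx x (z_ m))) + h x =
     riccati x (sigma x) - riccati x (Sx x (z_ m)).
    rewrite mul0r add0r mulrN mulrA -(rmorphM (real_complex R)) mulVf ?gt_eqF// mul1r addrC.
    by [].
  apply: (le_trans (riccati_lip k1 (sigma_le abc hS S_nf x) (Sx_le x _))).
  by rewrite cabs_distC; have := sigma_near x m8; lra.
move=> HQ; have s1 := Sx_le p (z_ m); have s2 := Sx_le q (z_ m).
have -> : cprim h q - cprim h p = (Q q - Q p) - (m^-1)%:C * (Sx q (z_ m) - Sx p (z_ m)) by rewrite /Q; ring.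
apply: (le_trans (cabsB _ _)); rewrite cabsM cabs_real gtr0_norm//.
have h3 : m^-1 * cabs (Sx q (z_ m) - Sx p (z_ m)) <= m^-1 * 2.
  by apply: ler_wpM2l; [exact: ltW|rewrite (le_trans (cabsB _ _))//; lra].
move: HQ h3; lra.
Qed.

Lemma riccati_sigma : {ae mu, forall x, riccati x (sigma x) = 0}.
Proof.
have [h1 h2] := riccati_clocb.
apply: (ae_imp _ (cprim_derive h1 h2)) => x; rewrite (funext riccati_prim) => d.
exact: has_cderiv_unique d (has_cderiv_cst 0 x).
Qed.
End dynamics.

(** * Lipschitz bounds for [sigma] and the lower bound for [rho] *)

Section dynamics2.
Variable R : realType.
Local Notation mu := (@lebesgue_measure R).
Variables a b c : R -> R.
Hypothesis abc : coefs a b c.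
Variable S : R[i] -> R[i].
Hypothesis hS : regular S.
Hypothesis S_nf : forall z x, Im z != 0 ->
  0 <= nf (tsol a b c true (w1 (S z)) (w2 (S z)) z) (tsol a b c false (w1 (S z)) (w2 (S z)) z) x.
Local Notation Sx := (Sx a b c S).
Local Notation sigma := (sigma a b c S).
Local Notation rho := (rho a b c S).
Local Notation kappa := (kappa a b c).
Local Notation riccati := (riccati a b c).
Local Notation z_ m := ('i%C * m%:C).
Local Notation C0 := (glue_cst R).

(** Since the Riccati expression vanishes at [sigma], at [Sx] it is at most [4 * C0 / m], which
    cancels the factor [m] in the derivative. The bound is uniform in [m] and passes to [sigma]. *)
Lemma Sx_lip (m x y : R) : 8 < m -> x <= y ->
  cabs (Sx y (z_ m) - Sx x (z_ m)) <= 8 * C0 * (y - x).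
Proof.
move=> m8 xy; have m0 : 0 < m by lra.
have -> : 8 * C0 * (y - x) = 2 * (4 * C0) * (y - x) by ring.
apply: (cac_lipschitz (Sx_cac abc hS S_nf (z_ m)) xy).
apply: (ae_imp3 _ (Sx_imag_deriv abc hS S_nf m) (riccati_sigma abc hS S_nf) (kappa_ae abc)) => t d E k1 _.
eexists; last exact: d.
rewrite cabsN cabsM cabs_real gtr0_norm// -[riccati t _]subr0 -E.
apply: (le_trans (ler_wpM2l (ltW m0) (riccati_lip k1 (Sx_le abc hS S_nf t _) (sigma_le abc hS S_nf t)))).
have := ler_wpM2l (ltW m0) (sigma_near abc hS S_nf t m8).
rewrite mulrCA divff ?gt_eqF// mulr1; lra.
Qed.

Lemma sigma_lip x y : cabs (sigma y - sigma x) <= 8 * C0 * `|y - x|.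
Proof.
wlog xy : x y / x <= y.
  move=> W; have [/W //|/ltW/W] := leP x y.
  by rewrite cabs_distC distrC.
rewrite ger0_norm ?subr_ge0// -subr_le0; apply: (@le_div_all _ _ (4 * C0)).
  by rewrite mulr_ge0// glue_cst_ge0.
move=> m m8; have := sigma_lip_aux abc hS S_nf x y m8; have := Sx_lip m8 xy; lra.
Qed.

(** Subtracting [s ^+ 2] times the conjugate equation eliminates [conjc k] and leaves a multiple of
    [1 - cabs s ^+ 2], which is nonzero. *)
Lemma riccati_solve (k s : R[i]) : conjc k * s ^+ 2 - s + k = 0 -> cabs s < 1 ->
  k * (1 + cabs s ^+ 2)%:C = s.
Proof.
move=> E s1; set q := cabs s ^+ 2.
have qE : s * conjc s = q%:C by exact: conj_mul.
have q1 : 1 - q != 0.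
  by rewrite subr_eq0 eq_sym lt_eqF// /q exprn_ilt1 ?cabs_ge0.
have E' : k * conjc s ^+ 2 - conjc s + conjc k = 0.
  have -> : k * conjc s ^+ 2 - conjc s + conjc k = conjc (conjc k * s ^+ 2 - s + k).
    by apply: complex_eq; rewrite !expr2 !cplxE /=; ring.
  by rewrite E conjc0.
apply: (@mulIf _ (1 - q)%:C); first by rewrite -cabs_gt0 cabs_real normr_gt0.
have e1 : (1 - q)%:C = 1 - s * conjc s by rewrite qE; apply: complex_eq; rewrite !cplxE /=; ring.
have e2 : (1 + q)%:C = 1 + s * conjc s by rewrite qE; apply: complex_eq; rewrite !cplxE /=; ring.
apply: subr0_eq; rewrite e1 e2.
have -> : k * (1 + s * conjc s) * (1 - s * conjc s) - s * (1 - s * conjc s) =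
  (conjc k * s ^+ 2 - s + k) - s ^+ 2 * (k * conjc s ^+ 2 - conjc s + conjc k) by ring.
by rewrite E E' mulr0 subrr.
Qed.

Lemma kappaE : {ae mu, forall x, 0 < rho x -> kappa x * (1 + cabs (sigma x) ^+ 2)%:C = sigma x}.
Proof.
apply: (ae_imp _ (riccati_sigma abc hS S_nf)) => x E r0; apply: riccati_solve => //.
by rewrite -(@expr_lt1 _ 2) ?cabs_ge0// -subr_gt0.
Qed.

(** The derivative of the quadratic at its root is [2 * conjc kappa * sigma - 1 = - rho / (1 + cabs
    sigma ^+ 2)], and Schwarz's lemma bounds the increment [e] by [4 * C0 * rho / m]. The product
    has the second factor [rho]. *)
Lemma riccati_near x (m : R) : 8 < m -> 16 * C0 <= m -> cabs (kappa x) <= 1 / 2 ->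
  riccati x (sigma x) = 0 -> (0 < rho x -> kappa x * (1 + cabs (sigma x) ^+ 2)%:C = sigma x) ->
  m * cabs (riccati x (Sx x (z_ m))) <= 8 * C0 * rho x ^+ 2.
Proof.
move=> m8 mC k1 E kE; have m0 : 0 < m by lra.
have Cg := glue_cst_ge0 R; have r0 := rho_ge0 abc hS S_nf x.
have sch := sigma_schwarz abc hS S_nf x m8 _; have {}sch : cabs (Sx x (z_ m) - sigma x) <= 4 * C0 * rho x / m by apply: sch; lra.
set e := Sx x (z_ m) - sigma x in sch.
have SE : Sx x (z_ m) = sigma x + e by rewrite /e; ring.
have -> : riccati x (Sx x (z_ m)) = e * (2 * conjc (kappa x) * sigma x - 1 + conjc (kappa x) * e).
  by rewrite -[LHS]subr0 -E SE /riccati; ring.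
(* At [rho x = 0], where [kappa] is not determined by [sigma], the Schwarz bound forces [e = 0]. *)
have [re0|rn0] := eqVneq (rho x) 0.
  move: sch; rewrite re0 mulr0 mul0r => e0.
  have -> : e = 0 by apply/eqP; rewrite -cabs0_eq0 eq_le e0 cabs_ge0.
  by rewrite mul0r cabs0 mulr0 expr0n /= mulr0.
have rp : 0 < rho x by rewrite lt_def rn0.
have q0 : 0 <= cabs (sigma x) ^+ 2 by exact: sqr_ge0.
set q := cabs (sigma x) ^+ 2 in q0 kE.
have p1 : 1 + q != 0 by rewrite gt_eqF//; lra.
have h1 : cabs (2 * conjc (kappa x) * sigma x - 1) <= rho x.
  have -> : 2 * conjc (kappa x) * sigma x - 1 = (- rho x / (1 + q))%:C.
    apply: (@mulIf _ (1 + q)%:C); first by rewrite -cabs_gt0 cabs_real normr_gt0.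
    rewrite -(rmorphM (real_complex R)) divfK//.
    have ck : conjc (kappa x) * (1 + q)%:C = conjc (sigma x).
      by rewrite -(kE rp) (rmorphM (@conjc R)) /=; congr (_ * _); apply: complex_eq; rewrite /= ?oppr0.
    have -> : (2 * conjc (kappa x) * sigma x - 1) * (1 + q)%:C = 2 * (sigma x * (conjc (kappa x) * (1 + q)%:C)) - (1 + q)%:C by ring.
    rewrite ck conj_mul -/q /rho -/q; apply: complex_eq; rewrite !cplxE /=; ring.
  rewrite cabs_real normrM normrN normfV (ger0_norm r0) ger0_norm; last by lra.
  by rewrite ler_pdivrMr; [rewrite ler_peMr//; lra|lra].
have h2 : cabs (2 * conjc (kappa x) * sigma x - 1 + conjc (kappa x) * e) <= 2 * rho x.
  apply: (le_trans (cabsD _ _)); rewrite cabsM cabs_conj.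
  have : cabs e <= rho x.
    apply: (le_trans sch); rewrite ler_pdivrMr// mulrC ler_wpM2l//; lra.
  have : cabs (kappa x) * cabs e <= 1 * cabs e by rewrite ler_wpM2r ?cabs_ge0//; lra.
  move: h1; lra.
rewrite cabsM mulrA.
have h3 : m * cabs e <= 4 * C0 * rho x by rewrite mulrC -ler_pdivlMr.
have -> : 8 * C0 * rho x ^+ 2 = (4 * C0 * rho x) * (2 * rho x) by ring.
by apply: ler_pM; rewrite ?cabs_ge0// mulr_ge0 ?cabs_ge0// ltW.
Qed.

(* For large fixed [m] the function [1 - cabs S_m ^+ 2] is comparable to [rho], and its reciprocal is Lipschitz by [riccati_near]. *)
Lemma rho_lower x : sigma 0 = 0 -> 1 <= 2 * rho x * (2 + 128 * C0 * `|x|).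
Proof.
move=> s0; have Cg := glue_cst_ge0 R.
pose m := 9 + 16 * C0; have m8 : 8 < m by rewrite /m; lra.
have mC : 16 * C0 <= m by rewrite /m; lra.
have m0 : 0 < m by lra.
pose s t := Sx t (z_ m); pose r t := 1 - Re (s t * conjc (s t)).
have rE t : r t = 1 - cabs (s t) ^+ 2 by rewrite /r conj_mul.
(* [m >= 16 * C0] turns the Schwarz bound into [rho t / 4]; the difference of the squares costs a
   factor [2]. *)
have cmp t : `|rho t - r t| <= rho t / 2.
  have sch := sigma_schwarz abc hS S_nf t m8 _; have {}sch : cabs (s t - sigma t) <= 4 * C0 * rho t / m by apply: sch; lra.
  have r0 := rho_ge0 abc hS S_nf t.
  have h1 : 4 * C0 * rho t / m <= rho t / 4.
    rewrite ler_pdivrMr//; have := ler_wpM2r r0 mC; lra.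
  have -> : rho t - r t = (cabs (s t) - cabs (sigma t)) * (cabs (s t) + cabs (sigma t)).
    by rewrite rE /rho; ring.
  have h2 := Sx_le abc hS S_nf t (z_ m); have h3 := sigma_le abc hS S_nf t.
  have h4 := cabs_ge0 (s t); have h5 := cabs_ge0 (sigma t).
  have h6 : `|cabs (s t) - cabs (sigma t)| <= cabs (s t - sigma t).
    have k1 := cabsD (s t - sigma t) (sigma t); rewrite subrK in k1.
    have k2 := cabsD (sigma t - s t) (s t); rewrite subrK cabs_distC in k2.
    by rewrite ler_norml; lra.
  rewrite normrM (ger0_norm (addr_ge0 h4 h5)).
  have : `|cabs (s t) - cabs (sigma t)| * (cabs (s t) + cabs (sigma t)) <= (rho t / 4) * 2.
    apply: ler_pM; rewrite ?addr_ge0//; first by rewrite (le_trans h6)// (le_trans sch).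
    by move: h2; rewrite -/(s t); lra.
  lra.
have r_ge0 t : 0 <= r t by rewrite rE subr_ge0 exprn_ile1 ?cabs_ge0 ?(Sx_le abc hS S_nf).
have rho2 t : rho t <= 2 * r t by have := cmp t; rewrite ler_norml; lra.
have r2 t : r t <= 2 * rho t by have := cmp t; have := rho_ge0 abc hS S_nf t; rewrite ler_norml; lra.
have rc : loc_abs_cont r by apply: lacB (lac_cst _) _; exact: sqr_lac (Sx_cac abc hS S_nf (z_ m)).
have r01 : 1 / 2 <= r 0 by have := rho2 0; rewrite /rho s0 cabs0 expr0n /=; lra.
(* At this stage [r] might vanish, so its reciprocal is regularized by [e], which tends to [0] at
   the end. *)
have key e : 0 < e -> (r x + e)^-1 <= 2 + 128 * C0 * `|x|.
  move=> e0; pose u t := (r t + e)^-1.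
  have p t : 0 < r t + e by rewrite ltr_wpDl.
  have uc : loc_abs_cont u by apply: lac_inv => //; exact: lacD rc (lac_cst _).
  have uL y z : y <= z -> `|u z - u y| <= 128 * C0 * (z - y).
    move=> yz; apply: (lac_lipschitz uc yz).
    have ae4 := ae_imp2 (fun t p q => conj p q) (riccati_sigma abc hS S_nf) kappaE.
    apply: (ae_imp3 _ (Sx_imag_deriv abc hS S_nf m) ae4 (kappa_ae abc)) => t d [E kE] k1 _.
    have [dr _] := has_cderivM d (has_cderiv_conj d).
    set w := - (m%:C * riccati t (Sx t (z_ m))) in dr *.
    have dr' : is_derive t (1 : R) (fun t => r t + e) (- Re (w * conjc (Sx t (z_ m)) + Sx t (z_ m) * conjc w)).
      have h := is_deriveD (is_deriveB (is_derive_cst (1 : R) t 1) dr) (is_derive_cst e t 1).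
      by apply: (is_derive_eq h); rewrite sub0r addr0.
    have pn0 : r t + e != 0 by rewrite gt_eqF.
    eexists; last exact: (@is_deriveV R (fun t => r t + e) t _ 1 pn0 dr').
    rewrite -[_ *: _]/(_ * _) normrM !normrN normfV.
    have h1 := riccati_near m8 mC k1 E kE.
    have wle : cabs w <= 32 * C0 * r t ^+ 2.
      rewrite /w cabsN cabsM cabs_real gtr0_norm//; apply: (le_trans h1).
      have rr : rho t ^+ 2 <= (2 * r t) ^+ 2.
        by rewrite ler_pXn2r ?nnegrE ?mulr_ge0 ?(rho_ge0 abc hS S_nf).
      have := ler_wpM2l Cg rr; rewrite exprMn; lra.
    rewrite [`|(_ ^+ 2)|]ger0_norm ?sqr_ge0//.
    have dle : `|Re (w * conjc (Sx t (z_ m)) + Sx t (z_ m) * conjc w)| <= 64 * C0 * r t ^+ 2.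
      rewrite (le_trans (cabs_Re _))// (le_trans (cabsD _ _))//.
      have := Sx_le abc hS S_nf t (z_ m); move: (Sx t (z_ m)) => v v1.
      rewrite !cabsM !cabs_conj [X in _ + X <= _]mulrC.
      have : cabs w * cabs v <= cabs w * 1 by rewrite ler_wpM2l ?cabs_ge0.
      by move: wle; lra.
    rewrite mulrC ler_pdivrMr ?exprn_gt0//; apply: (le_trans dle).
    have rr : r t ^+ 2 <= (r t + e) ^+ 2 by rewrite ler_pXn2r ?nnegrE ?(ltW (p _))// lerDl ltW.
    have := ler_wpM2l Cg rr; have := ler_wpM2l Cg (sqr_ge0 (r t)); rewrite mulr0; lra.
  have u0 : u 0 <= 2.
    rewrite /u (le_trans (_ : _ <= (1 / 2)^-1)) ?lef_pV2 ?posrE//; [lra|].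
    by rewrite div1r invrK.
  have : `|u x - u 0| <= 128 * C0 * `|x|.
    have [x0|/ltW x0] := leP 0 x; first by have := uL _ _ x0; rewrite subr0 (ger0_norm x0).
    by have := uL _ _ x0; rewrite sub0r (ler0_norm x0) distrC.
  by rewrite ler_norml -/(u x); lra.
have K0 : 0 < 2 + 128 * C0 * `|x|.
  have : 0 <= C0 * `|x| by rewrite mulr_ge0.
  lra.
set K := 2 + _ in K0 key *.
apply/ler_addgt0Pr => e e0.
have eK : 0 < e / K by rewrite divr_gt0.
have pe : 0 < r x + e / K by rewrite ltr_wpDl.
have := key _ eK; rewrite -(ler_pM2l pe) divff ?gt_eqF// => h.
apply: (le_trans h); rewrite mulrDl divfK ?gt_eqF// lerD2r ler_wpM2r ?(ltW K0)//.
Qed.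
End dynamics2.

(** * The determinant normalization *)

Section inverse.
Variable R : realType.
Local Notation mu := (@lebesgue_measure R).

Lemma ae_exists (P : R -> Prop) (d : R) : 0 < d -> {ae mu, forall x, P x} -> exists2 y, `|y| < d & P y.
Proof.
move=> d0 [N [mN N0 NP]]; apply: contrapT => nex.
pose I : set R := `](- d), d[%classic.
have sub : I `<=` N.
  move=> y; rewrite /I /= in_itv/= -ltr_norml => yd; apply: NP => /= Py; apply: nex.
  by exists y.
have mI : measurable I by exact: measurable_itv.
have : (mu I <= mu N)%E by apply: le_measure => //; rewrite inE.
rewrite N0 /I lebesgue_measure_itv/= lte_fin ifT; last by lra.
rewrite -EFinB lee_fin; lra.
Qed.

Variables (g : R -> R) (K : R).
Hypothesis K0 : 0 < K.
Hypothesis gb : loc_bounded_meas g.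
Hypothesis glow : forall x, (K * (1 + `|x|))^-1 <= g x.

Let q := prim g.

Lemma prim_expand (r x y : R) : x <= y -> (forall t, x <= t <= y -> `|t| <= r) -> 0 <= r ->
  (K * (1 + r))^-1 * (y - x) <= q y - q x.
Proof.
move=> xy tr r0; set m := (K * (1 + r))^-1.
suff : q x - m * x <= q y - m * y by rewrite mulrBr; lra.
have cq : loc_abs_cont (fun t => q t - m * t) by apply: lacB; [exact: prim_lac|exact: lacM (lac_cst _) (@lac_id R)].
apply: (lac_nondecreasing cq xy); apply: (ae_imp _ (prim_derive gb)) => t d txy.
exists (g t - m * 1); last exact: is_deriveB d (is_deriveZ m (is_derive_id _ _)).
rewrite mulr1 subr_ge0; apply: le_trans (glow t).
rewrite /m lef_pV2 ?posrE ?mulr_gt0 ?ltr_wpDr//.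
by rewrite ler_wpM2l ?(ltW K0)// lerD2l tr.
Qed.

Lemma prim_mono : {homo q : x y / x < y}.
Proof.
move=> x y xy; have h := @prim_expand (`|x| + `|y|) x y (ltW xy) _ _.
rewrite -subr_gt0; apply: lt_le_trans (h _ _).
- by rewrite mulr_gt0 ?subr_gt0// invr_gt0 mulr_gt0// ltr_wpDr// addr_ge0.
- move=> t /andP[xt ty]; have := ler_norm y; have := ler_norm (- x); rewrite normrN => h1 h2.
  by have := normr_ge0 x; have := normr_ge0 y; rewrite ler_norml; lra.
- by rewrite addr_ge0.
Qed.

(* Each dyadic block contributes at least [1 / (3 K)]. *)
Lemma prim_dyadic (n : nat) : (3 * K)^-1 * n%:R <= q (2 ^+ n) /\ q (- 2 ^+ n) <= - ((3 * K)^-1 * n%:R).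
Proof.
elim: n => [|n [IH1 IH2]].
  rewrite mulr0 oppr0 expr0; have q0 : q 0 = 0 by exact: prim0.
  by rewrite -q0; split; apply/ltW/prim_mono; lra.
have p2 : 1 <= 2 ^+ n :> R by rewrite exprn_ege1// ler1n.
have E : 2 ^+ n.+1 = 2 * 2 ^+ n :> R by rewrite exprS.
set p := 2 ^+ n in IH1 IH2 p2 E.
have k : (3 * K)^-1 <= (K * (1 + 2 * p))^-1 * p.
  rewrite [leRHS]mulrC ler_pdivlMr ?mulr_gt0//; last by lra.
  rewrite ler_pdivrMl ?mulr_gt0//; have : 0 <= K * (p - 1) by rewrite mulr_ge0 ?subr_ge0// ltW.
  lra.
have p0 : 0 <= 2 * p by lra.
have h1 : (K * (1 + 2 * p))^-1 * (2 * p - p) <= q (2 * p) - q p.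
  by apply: prim_expand => //; [lra|move=> t h; rewrite ler_norml; lra].
have h2 : (K * (1 + 2 * p))^-1 * (- p - - (2 * p)) <= q (- p) - q (- (2 * p)).
  by apply: prim_expand => //; [lra|move=> t h; rewrite ler_norml; lra].
rewrite E -[n.+1%:R]natr1 mulrDr mulr1; split.
- have -> : (3 * K)^-1 * n%:R + (3 * K)^-1 <= q (2 * p); last by [].
  apply: le_trans (_ : q p + (K * (1 + 2 * p))^-1 * p <= _); first by rewrite lerD.
  by move: h1; rewrite (_ : 2 * p - p = p); [lra|ring].
- move: h2; rewrite (_ : - p - - (2 * p) = p); [lra|ring].
Qed.

Lemma prim_cts : continuous q.
Proof. exact/lac_cts/prim_lac. Qed.

Lemma prim_surj y : exists x, q x = y.
Proof.
pose n := (Num.truncn (3 * K * `|y|)).+1.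
have ny : `|y| <= (3 * K)^-1 * n%:R.
  rewrite [leRHS]mulrC ler_pdivlMr ?mulr_gt0// mulrC; apply/ltW/truncnS_gt.
have [h1 h2] := prim_dyadic n.
have p2 : 0 < 2 ^+ n :> R by rewrite exprn_gt0.
have [|||x _ <-] := @IVT R q (- 2 ^+ n) (2 ^+ n) y; [lra| | |by exists x].
- exact/continuous_subspaceT/prim_cts.
- have qq : q (- 2 ^+ n) <= q (2 ^+ n) by apply/ltW/prim_mono; lra.
  rewrite min_l// max_r//; have := ler_norm y; have := ler_norm (- y); rewrite normrN => ? ?.
  by apply/andP; split; lra.
Qed.

Definition prim_inv (y : R) : R := xget 0 [set x | q x = y].
Let p := prim_inv.

Lemma prim_invK : cancel p q.
Proof. by move=> y; have [x xy] := prim_surj y; exact: (xgetPex 0 (P := [set x | q x = y]) (ex_intro _ x xy)). Qed.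

Lemma prim_inj : injective q.
Proof.
move=> x y E; case: (ltgtP x y) => // /prim_mono; by rewrite E ltxx.
Qed.

Lemma primK : cancel q p.
Proof. by move=> x; apply: prim_inj; rewrite prim_invK. Qed.

Lemma prim_inv_mono : {homo p : x y / x < y}.
Proof.
move=> x y xy; rewrite ltNge; apply/negP; rewrite le_eqVlt => /predU1P[E|/prim_mono].
- by move: xy; rewrite -(prim_invK x) -(prim_invK y) E ltxx.
- by rewrite !prim_invK ltNge ltW.
Qed.

(** On the bounded interval that [p] reaches from [[-r, r]] the density [g] is bounded below, and
    the reciprocal of that bound is a Lipschitz constant. *)
Lemma prim_inv_lip (r : R) : exists2 L, 0 <= L & forall x y, `|x| <= r -> `|y| <= r -> `|p y - p x| <= L * `|y - x|.
Proof.
pose s := `|p (- r)| + `|p r|; have s0 : 0 <= s by rewrite addr_ge0.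
have pk : 0 < K * (1 + s) by rewrite mulr_gt0// ltr_wpDr.
have ps x : `|x| <= r -> `|p x| <= s.
  move=> xr; have [h1 h2] : - r <= x /\ x <= r by move: xr; rewrite ler_norml => /andP.
  have pm : {homo p : x y / x <= y} by apply: ltW_homo; exact: prim_inv_mono.
  have := pm _ _ h1; have := pm _ _ h2; have := ler_norm (p r); have := ler_norm (- p (- r)).
  rewrite normrN /s => a1 a2 a3 a4; have := normr_ge0 (p r); have := normr_ge0 (p (- r)).
  by rewrite ler_norml; lra.
exists (K * (1 + s)); first exact: ltW.
suff H x y : `|x| <= r -> `|y| <= r -> x <= y -> `|p y - p x| <= K * (1 + s) * (y - x).
  move=> x y xr yr; have [xy|/ltW xy] := leP x y; first by rewrite (ger0_norm (_ : 0 <= y - x)) ?subr_ge0 ?H.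
  by rewrite distrC (distrC y) (ger0_norm (_ : 0 <= x - y)) ?subr_ge0 ?H.
move=> xr yr xy; have pm : p x <= p y by apply: (ltW_homo prim_inv_mono).
rewrite ger0_norm ?subr_ge0// -ler_pdivrMl//.
rewrite -[X in _ <= X - _]prim_invK -[X in _ <= _ - X]prim_invK; apply: prim_expand => //.
move=> t; have := ps x xr; have := ps y yr; rewrite !ler_norml; lra.
Qed.

Lemma prim_inv_lac : loc_abs_cont p.
Proof. by apply: loc_lipschitz_lac => r; have [L _ HL] := prim_inv_lip r; exists L. Qed.

Lemma prim_inv0 : p 0 = 0.
Proof. by rewrite -{1}(prim0 g) primK. Qed.

Lemma prim_inv_derive y : is_derive (p y) (1 : R) q (g (p y)) -> is_derive y (1 : R) p (g (p y))^-1.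
Proof.
move=> dq; have g0 : 0 < g (p y) by apply: lt_le_trans (glow _); rewrite invr_gt0 mulr_gt0// ltr_wpDr.
rewrite -[y in is_derive y](prim_invK y); apply: (@is_derive_inverse R q) => //.
- by near=> x; exact: primK.
- by near=> x; exact: prim_cts.
- by rewrite gt_eqF.
Unshelve. all: by end_near. Qed.

Lemma prim_change_of_variable : change_of_variable p.
Proof.
split; [exact: prim_inv_mono|exact: prim_inv0|exact: prim_inv_lac|].
by exists q; split; [exact: prim_invK|exact: primK|exact: prim_lac].
Qed.
End inverse.

(** * The two implications *)

Section dirac.
Variable R : realType.
Local Notation mu := (@lebesgue_measure R).
Variable H : R -> 'M[R]_2.
Hypothesis hH : Rclass (@Uset R) H.
Let cH : canonical_system H := hH.1.
Local Notation a := (ca H).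
Local Notation b := (cb H).
Local Notation c := (cc H).
Let abc : coefs a b c := entries_coefs cH.
Local Notation S := (ext (schur0 H)).
Let hS : regular S := extS_regular hH.

Lemma extS_nf z x : Im z != 0 ->
  0 <= nf (tsol a b c true (w1 (S z)) (w2 (S z)) z) (tsol a b c false (w1 (S z)) (w2 (S z)) z) x.
Proof. by move=> z0; rewrite (ext_off (schur0 H) z0); exact: szero_nf. Qed.

Local Notation sigma := (sigma a b c S).
Local Notation rho := (rho a b c S).
Local Notation kappa := (kappa a b c).
Local Notation C0 := (glue_cst R).

Lemma Ffun_sigma : Ffun 'i%C H = Some 'i%C <-> sigma 0 = 0.
Proof. by rewrite (Ffun_i hH) (sigma0 abc). Qed.

Definition nsq x : R := cabs (sigma x) ^+ 2.
Definition mat2 (p q r s : R) : 'M[R]_2 :=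
  \matrix_(i, j) if i == 0 then (if j == 0 then p else q) else (if j == 0 then r else s).

Lemma mat2P (A B : 'M[R]_2) : A 0 0 = B 0 0 -> A 0 1 = B 0 1 -> A 1 0 = B 1 0 -> A 1 1 = B 1 1 -> A = B.
Proof. by move=> h00 h01 h10 h11; apply/matrixP; apply: ord2P; apply: ord2P. Qed.

Lemma det2 (A : 'M[R]_2) : \det A = A 0 0 * A 1 1 - A 0 1 * A 1 0.
Proof.
rewrite (expand_det_row _ 0) big_ord_recl big_ord1 /cofactor !det_mx11 !mxE /=.
have -> : lift ord0 ord0 = 1 :> 'I_2 by exact: val_inj.
have -> : lift 1 (0 : 'I_1) = 0 :> 'I_2 by exact: val_inj.
by rewrite /= expr0 expr1; ring.
Qed.

(* By [kappaE] a continuous representative of [H]. *)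
Definition Hc x : 'M[R]_2 :=
  let p := Re (sigma x) / (1 + nsq x) in let q := Im (sigma x) / (1 + nsq x) in
  mat2 (1 / 2 - p) q q (1 / 2 + p).

Definition gc x : R := rho x / (2 * (1 + nsq x)).

Lemma nsq1 x : 0 < 1 + nsq x. Proof. by rewrite ltr_wpDr// sqr_ge0. Qed.

Lemma Hc_det x : \det (Hc x) = gc x ^+ 2.
Proof.
rewrite det2 !mxE /= /gc /rho -/(nsq x).
have := nsq1 x; have : nsq x = Re (sigma x) ^+ 2 + Im (sigma x) ^+ 2 by exact: cabs_sqr.
move: (nsq x) (Re _) (Im _) => n p q -> n1; field.
by rewrite gt_eqF.
Qed.

Section zero.
Hypothesis s0 : sigma 0 = 0.

Lemma rho_gt0 x : 0 < rho x.
Proof.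
rewrite lt_def (rho_ge0 abc hS extS_nf) andbT; apply/eqP => e.
by have := rho_lower abc hS extS_nf x s0; rewrite e mulr0 mul0r ler10.
Qed.

Lemma Hc_ae : {ae mu, forall x, H x = Hc x}.
Proof.
apply: (ae_imp2 _ (entries_ae cH) (kappaE abc hS extS_nf)) => x [[e1 e2 e3 e4] [_ _ ac _]] /(_ (rho_gt0 x)) k.
have n1 := nsq1 x; rewrite -/(nsq x) in k.
have kr : (c x - a x) / 2 = Re (sigma x) / (1 + nsq x).
  by rewrite -k; apply: (@mulIf _ (1 + nsq x)); rewrite ?gt_eqF// divfK ?gt_eqF// !cplxE /=; ring.
have ki : b x = Im (sigma x) / (1 + nsq x).
  by rewrite -k; apply: (@mulIf _ (1 + nsq x)); rewrite ?gt_eqF// divfK ?gt_eqF// !cplxE /=; ring.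
by apply: mat2P; rewrite /Hc !mxE /= ?e1 ?e2 ?e3 ?e4 -?kr -?ki//; lra.
Qed.

Lemma sigma_lac : loc_abs_cont (fun x => Re (sigma x)) /\ loc_abs_cont (fun x => Im (sigma x)).
Proof.
split; apply: loc_lipschitz_lac => r; exists (8 * C0) => x y _ _.
- by rewrite -ReB (le_trans (cabs_Re _))// (sigma_lip abc hS extS_nf).
- by rewrite -ImB (le_trans (cabs_Im _))// (sigma_lip abc hS extS_nf).
Qed.

Lemma gc_gt0 x : 0 < gc x.
Proof. by rewrite divr_gt0 ?rho_gt0// mulr_gt0// nsq1. Qed.

Lemma gc_loc : loc_bounded_meas gc.
Proof.
have [l1 l2] := sigma_lac; apply: loc_bounded_lac.
have nl : loc_abs_cont nsq.
  rewrite (_ : nsq = fun x => Re (sigma x) * Re (sigma x) + Im (sigma x) * Im (sigma x)).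
    by apply: lacD; exact: lacM.
  by apply/funext => x; rewrite /nsq cabs_sqr !expr2.
apply: lacM; first exact: lacB (lac_cst _) nl.
apply: lac_inv; last by move=> x; rewrite mulr_gt0// nsq1.
by apply: lacM (lac_cst _) _; exact: lacD (lac_cst _) nl.
Qed.

(** [gc >= rho / 4] costs a factor [4] and [rho_lower] a factor [2]; the remaining bracket dominates
    [2 + 128 * C0 * |x|] after multiplication by [1 + |x|]. *)
Let K := 8 * (2 + 128 * C0).

Lemma K_gt0 : 0 < K.
Proof. by rewrite mulr_gt0// ltr_wpDr// mulr_ge0// glue_cst_ge0. Qed.

Lemma gc_low x : (K * (1 + `|x|))^-1 <= gc x.
Proof.
have C := glue_cst_ge0 R; have r0 := rho_gt0 x; have n1 := nsq1 x.
have nle : nsq x <= 1 by have := rho_gt0 x; rewrite subr_gt0 => /ltW.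
have g4 : rho x / 4 <= gc x.
  by rewrite /gc ler_wpM2l ?(ltW r0)// lef_pV2 ?posrE ?mulr_gt0//; lra.
apply: le_trans g4; have p : 0 < K * (1 + `|x|) by rewrite mulr_gt0 ?K_gt0// ltr_wpDr.
rewrite -[leLHS]mul1r ler_pdivrMr//; apply: (le_trans (rho_lower abc hS extS_nf x s0)).
have xx : 0 <= `|x| by [].
have h : 0 <= rho x * (2 * `|x| + 128 * C0) by apply: mulr_ge0 (ltW r0) _; apply: addr_ge0; exact: mulr_ge0.
have -> : rho x / 4 * (K * (1 + `|x|)) = 2 * rho x * (2 + 128 * C0 * `|x|) + 2 * (rho x * (2 * `|x| + 128 * C0)).
  by rewrite /K; field.
lra.
Qed.

Lemma sigma_dirac : Dirac H.
Proof.
split; first exact: cH.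
have K0 := K_gt0; have gl := gc_loc.
pose p := prim_inv gc.
have pcv : change_of_variable p := prim_change_of_variable K0 gl gc_low.
have pl : loc_abs_cont p := prim_inv_lac K0 gl gc_low.
exists (fun y => (gc (p y))^-1 *: Hc (p y)); split.
- exists p => //.
  (* These facts hold for almost every [x], while the version asks for almost every [y] with
     [x = p y]; [ae_preimage] carries null sets back along [p]. *)
  have := ae_imp2 (fun x h d => conj h d) Hc_ae (prim_derive gl).
  move=> /(ae_preimage (prim_inv_mono K0 gl gc_low) (prim_invK K0 gl gc_low) (primK K0 gl gc_low) pl (prim_lac gl)).
  apply: ae_imp => y [HE d]; exists (gc (p y))^-1; last by rewrite -HE.
  exact: (prim_inv_derive K0 gl gc_low).
- have lip (h : R[i] -> R) : (forall z, `|h z| <= cabs z) -> (forall z w, h (z - w) = h z - h w) ->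
      loc_abs_cont (fun y => h (sigma (p y))).
    move=> hle hB; apply: (@lip_comp_lac R p (fun x => h (sigma x)) 0 pl) => u v _.
    exists (8 * C0) => x y _ _; rewrite -hB (le_trans (hle _))//.
    exact: (sigma_lip abc hS extS_nf).
  have l1 : loc_abs_cont (fun y => Re (sigma (p y))) by apply: lip => *; [exact: cabs_Re|exact: ReB].
  have l2 : loc_abs_cont (fun y => Im (sigma (p y))) by apply: lip => *; [exact: cabs_Im|exact: ImB].
  have nl : loc_abs_cont (fun y => nsq (p y)).
    rewrite (_ : (fun y => _) = fun y => Re (sigma (p y)) * Re (sigma (p y)) + Im (sigma (p y)) * Im (sigma (p y))).
      by apply: lacD; exact: lacM.
    by apply/funext => x; rewrite /nsq cabs_sqr !expr2.
  have n1l : loc_abs_cont (fun y => 1 + nsq (p y)) by exact: lacD (lac_cst _) nl.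
  have nil : loc_abs_cont (fun y => (1 + nsq (p y))^-1) by apply: lac_inv => // y; exact: nsq1.
  have gil : loc_abs_cont (fun y => (gc (p y))^-1).
    apply: lac_inv; last by move=> y; exact: gc_gt0.
    apply: lacM; first exact: lacB (lac_cst _) nl.
    apply: lac_inv; last by move=> x; rewrite mulr_gt0// nsq1.
    exact: lacM (lac_cst _) n1l.
  have e (h : R -> R) : loc_abs_cont (fun y => h (p y)) -> loc_abs_cont (fun y => (gc (p y))^-1 * h (p y)).
    by move=> hl; exact: lacM.
  apply: ord2P; apply: ord2P.
  + rewrite (_ : (fun y => _) = fun y => (gc (p y))^-1 * (1 / 2 - Re (sigma (p y)) * (1 + nsq (p y))^-1)).
      by apply: lacM => //; apply: lacB (lac_cst _) _; exact: lacM.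
    by apply/funext => y; rewrite !mxE.
  + rewrite (_ : (fun y => _) = fun y => (gc (p y))^-1 * (Im (sigma (p y)) * (1 + nsq (p y))^-1)).
      by apply: lacM => //; exact: lacM.
    by apply/funext => y; rewrite !mxE.
  + rewrite (_ : (fun y => _) = fun y => (gc (p y))^-1 * (Im (sigma (p y)) * (1 + nsq (p y))^-1)).
      by apply: lacM => //; exact: lacM.
    by apply/funext => y; rewrite !mxE.
  + rewrite (_ : (fun y => _) = fun y => (gc (p y))^-1 * (1 / 2 + Re (sigma (p y)) * (1 + nsq (p y))^-1)).
      by apply: lacM => //; apply: lacD (lac_cst _) _; exact: lacM.
    by apply/funext => y; rewrite !mxE.
- rewrite /p (prim_inv0 K0 gl gc_low).
  have n0 : nsq 0 = 0 by rewrite /nsq s0 cabs0 expr0n.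
  have g0 : (gc 0)^-1 = 2 by rewrite /gc /rho -/(nsq 0) n0 subr0 addr0 mulr1 div1r invrK.
  by apply: mat2P; rewrite g0 !mxE /= s0 n0 /=; field.
- by move=> y; rewrite detZ Hc_det exprVn mulVf// expf_neq0// (gt_eqF (gc_gt0 _)).
Qed.
End zero.

Lemma dirac_sigma : Dirac H -> sigma 0 = 0.
Proof.
move=> [_ [G [[p [pm p0 pl [q [pq qp ql]]] GH] Gl G0 _]]].
apply/eqP; rewrite -cabs0_eq0; apply/negPn/negP => d0'.
set d := cabs (sigma 0) in d0'; have d0 : 0 < d by rewrite lt_def d0' cabs_ge0.
have C := glue_cst_ge0 R.
have := ae_imp2 (fun x h d => conj h d) (entries_ae cH) (riccati_sigma abc hS extS_nf).
move=> /(ae_preimage pm pq qp pl ql) ae1.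
(* The tolerances give [cabs kappa <= d / 8] at [p y], hence [cabs sigma <= d / 4] there by the
   quadratic equation. The Lipschitz bound moves [sigma] by at most [d / 2] back to [0], where its
   modulus [d] would be at most [3 * d / 4]. *)
have [e1 e10 H1] := lac_continuous (Gl 0 0) 0 (e := Num.min (1 / 2) (d / 16)) ltac:(by rewrite lt_min; apply/andP; split; lra).
have [e2 e20 H2] := lac_continuous (Gl 1 1) 0 (e := Num.min (1 / 2) (d / 16)) ltac:(by rewrite lt_min; apply/andP; split; lra).
have [e3 e30 H3] := lac_continuous (Gl 0 1) 0 (e := d / 16) ltac:(by lra).
have [e4 e40 H4] := lac_continuous pl 0 (e := d / (2 * (8 * C0 + 1))) ltac:(by rewrite divr_gt0//; lra).
have [y yd [[p' dp GE] [[[h1 h2 h3 h4] [_ _ ac _]] ric]]] :=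
  ae_exists (d := Num.min (Num.min e1 e2) (Num.min e3 e4)) ltac:(by rewrite !lt_min e10 e20 e30 e40)
   (ae_imp2 (fun x h d => conj h d) GH ae1).
move: yd; rewrite !lt_min -[y]subr0 => /andP[/andP[/H1 + /H2 +] /andP[/H3 k3 /H4 k4]]; rewrite !lt_min => /andP[k1 k1'] /andP[k2 k2'].
rewrite G0 !mxE /= ?subr0 in k1 k1' k2 k2' k3; rewrite p0 subr0 in k4.
rewrite GE !mxE h1 h4 in k1 k1' k2 k2'; rewrite GE !mxE h2 in k3.
set A := a (p y) in ac k1 k1' *; set B := b (p y) in k3 *; set D := c (p y) in ac k2 k2' *.
(* Both diagonal entries of [G y] exceed [1 / 2], and their sum is [p'] because [H] has trace [1].
   So passing from [G y] to [H (p y)] only shrinks [b] and [c - a]. *)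
have p1 : 1 < p'.
  have : p' * A + p' * D = p' by rewrite -mulrDr ac mulr1.
  by move: k1 k2; rewrite !ltr_norml; lra.
have kle : cabs (kappa (p y)) <= d / 8.
  apply: (le_trans (cabs_le _)); rewrite /kappa /= -/A -/B -/D.
  have q1 : `|(D - A) / 2| <= p' * `|(D - A) / 2| by rewrite ler_peMl// ltW.
  have q2 : `|B| <= p' * `|B| by rewrite ler_peMl// ltW.
  have pp : 0 <= p' by lra.
  have e1' : p' * `|(D - A) / 2| = `|(p' * D - 1) - (p' * A - 1)| / 2.
    rewrite -{1}(ger0_norm pp) -normrM -{2}(ger0_norm (_ : 0 <= 2 :> R))// -normf_div.
    by congr `|_|; ring.
  have e2' : p' * `|B| = `|p' * B| by rewrite normrM (ger0_norm pp).
  have := ler_normB (p' * D - 1) (p' * A - 1); lra.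
have s1 := sigma_le abc hS extS_nf (p y).
have sle : cabs (sigma (p y)) <= 2 * cabs (kappa (p y)).
  have -> : sigma (p y) = conjc (kappa (p y)) * sigma (p y) ^+ 2 + kappa (p y).
    by apply/eqP; rewrite eq_sym -subr_eq0 -ric /riccati; apply/eqP; ring.
  rewrite (le_trans (cabsD _ _))// cabsM cabs_conj cabsX.
  have : cabs (kappa (p y)) * cabs (sigma (p y)) ^+ 2 <= cabs (kappa (p y)) * 1.
    by rewrite ler_wpM2l ?cabs_ge0// exprn_ile1 ?cabs_ge0.
  lra.
have sl := sigma_lip abc hS extS_nf (p y) 0; rewrite sub0r normrN in sl.
have : 8 * C0 * `|p y| <= d / 2.
  have : (8 * C0 + 1) * `|p y| <= (8 * C0 + 1) * (d / (2 * (8 * C0 + 1))) by rewrite ler_wpM2l ?(ltW k4)//; lra.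
  have -> : (8 * C0 + 1) * (d / (2 * (8 * C0 + 1))) = d / 2 by field; rewrite gt_eqF//; lra.
  by have := normr_ge0 (p y); lra.
have := cabsD (sigma 0 - sigma (p y)) (sigma (p y)); rewrite subrK -/d; lra.
Qed.

Lemma dirac_iff : Dirac H <-> Ffun 'i%C H = Some 'i%C.
Proof. by rewrite Ffun_sigma; split; [exact: dirac_sigma|exact: sigma_dirac]. Qed.
End dirac.

Theorem theorem3p2 (R : realType) (H : R -> 'M[R]_2)
    (hH : Rclass (@Uset R) H) :
  Dirac H <-> Ffun 'i H = Some 'i.
Proof. exact: dirac_iff hH. Qed.
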